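(* Let $X=\operatorname{Proj}(A)\subset\mathbb{P}^n$ be a standard determinantal scheme of codimension $c$ associated to a homogeneous $t\times(t+c-1)$ matrix $\mathcal{A}$, $t\ge2$, with $I=I(X)=I_t(\mathcal{A})$, $A=R/I$ and $J=I_{t-1}(\mathcal{A})$. Let $K_A$ be the canonical module of $A$ and let $i\ge1$ be an integer. If $\operatorname{depth}_JA\ge4+i$, then $$H^k_{\mathfrak{m}}(I/I^2)=0\quad\text{for }\dim X-i<k\le\dim X,$$ or, equivalently, $$\operatorname{Ext}^j_A(I/I^2,K_A)=0\quad\text{for }1\le j\le i.$$
   Context: $K$ is an algebraically closed field of characteristic $0$, $R=K[x_0,\dots,x_n]$ with its standard grading, $\mathfrak{m}=(x_0,\dots,x_n)$, $\mathbb{P}^n=\operatorname{Proj}(R)$; $H^k_{\mathfrak{m}}$ is local cohomology. $I(X)$ is the saturated homogeneous ideal of $X$. For a homogeneous matrix $\mathcal{A}$, $I_j(\mathcal{A})$ is the ideal of $R$ generated by its $j\times j$ minors. A codimension $c$ subscheme $X\subset\mathbb{P}^n$ is standard determinantal if $I(X)=I_t(\mathcal{A})$ for some $t\times(t+c-1)$ homogeneous matrix $\mathcal{A}$. $K_A=\operatorname{Ext}^c_R(A,R)(-n-1)$. $\operatorname{depth}_JA$ is the length of a maximal $A$-regular sequence in $J$. *)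

(* Defs.v *)
From HB Require Import structures.
From mathcomp Require Import all_boot all_order all_algebra.
From mathcomp Require Import boolp classical_sets functions.
From mathcomp.multinomials Require Import mpoly freeg.

Set Implicit Arguments.
Unset Strict Implicit.
Unset Printing Implicit Defensive.

Import GRing.Theory Quotient.
Local Open Scope ring_scope.
Local Open Scope quotient_scope.
Local Open Scope classical_set_scope.

Record submodule (R : comNzRingType) (V : lmodType R) := Submodule {
  submod_mem :> {pred V};
  submod_memP : submod_closed submod_mem }.

HB.instance Definition _ (R : comNzRingType) (V : lmodType R) (S : submodule V) :=
  GRing.isSubmodClosed.Build R V (submod_mem S) (submod_memP S).

Section SubmoduleType.
Variables (R : comNzRingType) (V : lmodType R) (S : submodule V).

Record submod := Submod { submod_val : V; submod_valP : submod_val \in submod_mem S }.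

HB.instance Definition _ := [isSub for submod_val].
HB.instance Definition _ := [Choice of submod by <:].
HB.instance Definition _ := [SubChoice_isSubLmodule of submod by <:].
End SubmoduleType.

Section QuotientModule.
Variables (R : comNzRingType) (V : lmodType R) (N : submodule V).

Definition quotm := Quotient.quot (submod_mem N).
HB.instance Definition _ := GRing.Zmodule.on quotm.
HB.instance Definition _ := EqQuotient.on quotm.

Definition quotm_scale (a : R) (x : quotm) : quotm := \pi_quotm (a *: repr x).

Lemma quotm_eqP (x y : V) : reflect (\pi_quotm x = \pi_quotm y) (x - y \in N).
Proof. by rewrite (idealrBE N); exact: eqP. Qed.

Lemma quotm_piD (x y : V) : \pi_quotm (x + y) = \pi_quotm x + \pi_quotm y.
Proof. by rewrite /quotm !piE. Qed.

Lemma quotm_piZ a (x : V) : quotm_scale a (\pi_quotm x) = \pi_quotm (a *: x).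
Proof.
apply/quotm_eqP; rewrite -scalerBr rpredZ //.
by apply/quotm_eqP; rewrite reprK.
Qed.

Lemma quotm_ind (P : quotm -> Prop) :
  (forall x : V, P (\pi_quotm x)) -> forall x, P x.
Proof. by move=> h x; rewrite -[x]reprK; exact: h. Qed.

Fact quotm_scaleA a b (x : quotm) :
  quotm_scale a (quotm_scale b x) = quotm_scale (a * b) x.
Proof. by elim/quotm_ind: x => x; rewrite !quotm_piZ scalerA. Qed.
Fact quotm_scale1 : left_id 1 quotm_scale.
Proof. by elim/quotm_ind => x; rewrite quotm_piZ scale1r. Qed.
Fact quotm_scaleDr : right_distributive quotm_scale +%R.
Proof.
move=> a; elim/quotm_ind => x; elim/quotm_ind => y.
by rewrite -quotm_piD !quotm_piZ scalerDr quotm_piD.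
Qed.
Fact quotm_scaleDl (x : quotm) :
  {morph quotm_scale^~ x : a b / a + b >-> a + b}.
Proof. by move=> a b; elim/quotm_ind: x => x; rewrite !quotm_piZ scalerDl quotm_piD. Qed.

HB.instance Definition _ := GRing.Zmodule_isLmodule.Build R quotm
  quotm_scaleA quotm_scale1 quotm_scaleDr quotm_scaleDl.
End QuotientModule.

Section Ideals.
Variable R : comNzRingType.

Definition span (V : lmodType R) (S : set V) : set V :=
  [set x | exists s : seq (R * V),
     (forall p, p \in s -> S p.2) /\ x = \sum_(p <- s) p.1 *: p.2].

Lemma span0 (V : lmodType R) S : @span V S 0.
Proof. by exists [::]; rewrite big_nil. Qed.

Lemma spanD (V : lmodType R) S a x y : @span V S x -> span S y -> span S (a *: x + y).
Proof.
move=> [s [hs ->]] [t [ht ->]].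
exists ([seq (a * p.1, p.2) | p <- s] ++ t); split.
  by move=> p; rewrite mem_cat => /orP[/mapP[q /hs ? ->]|/ht].
rewrite big_cat big_map scaler_sumr; congr (_ + _).
by apply: eq_bigr => p _; rewrite scalerA.
Qed.

Lemma span_gen (V : lmodType R) (S : set V) (x : V) : S x -> span S x.
Proof.
move=> Sx; exists [:: (1, x)]; split; last by rewrite big_seq1 scale1r.
by move=> p; rewrite inE => /eqP ->.
Qed.

Lemma span_sub (V : lmodType R) (S T : set V) :
  T 0 -> (forall a x y, T x -> T y -> T (a *: x + y)) ->
  S `<=` T -> span S `<=` T.
Proof.
move=> T0 TD ST x [s [hs ->]]; elim: s hs => [|p s IHs] hs; rewrite ?big_nil ?big_cons //.
apply: TD; first by apply/ST/hs; rewrite inE eqxx.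
by apply: IHs => q qs; apply: hs; rewrite inE qs orbT.
Qed.

Definition ideal_gen (S : set R) : set R := span (V := R^o) S.

Lemma ideal_gen0 S : ideal_gen S 0. Proof. exact: (@span0 R^o). Qed.

Lemma ideal_genD S a x y : ideal_gen S x -> ideal_gen S y -> ideal_gen S (a * x + y).
Proof. exact: (@spanD R^o). Qed.

Lemma ideal_gen_in S x : S x -> ideal_gen S x.
Proof. exact: (@span_gen R^o). Qed.

Lemma ideal_gen_sub (S T : set R) :
  T 0 -> (forall a x y, T x -> T y -> T (a * x + y)) ->
  S `<=` T -> ideal_gen S `<=` T.
Proof. exact: (@span_sub R^o). Qed.

Definition ideal_mul (I J : set R) : set R :=
  ideal_gen [set z | exists a b, [/\ I a, J b & z = a * b]].

Definition ideal_exp (I : set R) (t : nat) : set R :=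
  iter t (ideal_mul I) setT.

Lemma ideal_exp0 I k : ideal_exp I k 0.
Proof. by case: k => [//|k]; exact: ideal_gen0. Qed.

Lemma ideal_expD I k a x y :
  ideal_exp I k x -> ideal_exp I k y -> ideal_exp I k (a * x + y).
Proof. by case: k => [//|k]; exact: ideal_genD. Qed.

Lemma ideal_exp_le I s t : (s <= t)%N -> ideal_exp I t `<=` ideal_exp I s.
Proof.
elim: t => [|t IHt]; first by rewrite leqn0 => /eqP ->.
rewrite leq_eqVlt => /orP[/eqP -> //|/IHt {}IHt].
apply: subset_trans IHt; apply: ideal_gen_sub.
- exact: ideal_exp0.
- exact: ideal_expD.
- move=> _ [a [b [_ hb ->]]]; rewrite -[a * b]addr0.
  exact/ideal_expD/ideal_exp0.
Qed.

Definition ideal_set (I : idealr R) : set R := [set x | x \in (I : {pred R})].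

Definition ideal_mem_pred (I : idealr R) : {pred R^o} := fun x => (x : R) \in I.

Fact ideal_mem_closed I : submod_closed (ideal_mem_pred I).
Proof.
split=> [|a x y Ix Iy]; first exact: rpred0.
by apply: rpredD Iy; exact: idealMr.
Qed.
Definition ideal_mem I : submodule R^o := Submodule (ideal_mem_closed I).

(* [R / I] as an [R]-module; the quotient ring is [{ideal_quot I}]. *)
Definition cyclic_mod (I : idealr R) : lmodType R := quotm (ideal_mem I).

Definition square_mem_pred (I : idealr R) : {pred submod (ideal_mem I)} :=
  fun z => `[< ideal_exp (ideal_set I) 2 (val z) >].

Fact square_mem_closed (I : idealr R) : submod_closed (@square_mem_pred I).
Proof.
split=> [|a x y /asboolP hx /asboolP hy]; apply/asboolP; first exact: ideal_gen0.
exact: ideal_genD.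
Qed.
Definition square_mem (I : idealr R) : submodule (submod (ideal_mem I)) :=
  Submodule (square_mem_closed I).

(* [I / I ^ 2] *)
Definition conormal (I : idealr R) : lmodType R := quotm (square_mem I).

Lemma cyclic_mod_ann I a (x : cyclic_mod I) : a \in (I : {pred R}) -> a *: x = 0.
Proof.
move=> Ia; elim/quotm_ind: x => x; rewrite [LHS]quotm_piZ.
rewrite -[RHS](_ : \pi_(quotm (ideal_mem I)) 0 = 0); last by rewrite /quotm piE.
by apply/quotm_eqP; rewrite subr0; rewrite -[_ \in _]/((a * x : R) \in I) mulrC idealMr.
Qed.

Lemma conormal_ann I a (x : conormal I) : a \in (I : {pred R}) -> a *: x = 0.
Proof.
move=> Ia; elim/quotm_ind: x => x; rewrite [LHS]quotm_piZ.
rewrite -[RHS](_ : \pi_(quotm (square_mem I)) 0 = 0); last by rewrite /quotm piE.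
apply/quotm_eqP; rewrite subr0; apply/asboolP.
apply: ideal_gen_in; exists a, (val x); split=> //.
apply: ideal_gen_in; exists (val x), 1; split=> //; last by rewrite mulr1.
exact: (valP x).
Qed.
End Ideals.

Section Descent.
Variables (R : comNzRingType) (I : idealr R) (M : lmodType R).
Hypothesis annM : forall a (m : M), a \in (I : {pred R}) -> a *: m = 0.

(* An [R]-module killed by [I], as a module over [R / I]. *)
Definition descend of (forall a (m : M), a \in (I : {pred R}) -> a *: m = 0) : Type := M.
Local Notation D := (descend annM).
HB.instance Definition _ := GRing.Zmodule.on D.

Definition descend_scale (a : {ideal_quot I}) (m : D) : D := repr a *: (m : M).

Lemma descend_piE (r : R) (m : M) : descend_scale (\pi r) m = r *: m.
Proof.
apply/eqP; rewrite -subr_eq0 -scalerBl annM //.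
by rewrite (idealrBE I) reprK.
Qed.

Fact descend_scaleA a b (x : D) :
  descend_scale a (descend_scale b x) = descend_scale (a * b) x.
Proof. by rewrite -[a]reprK -[b]reprK -rmorphM !descend_piE scalerA. Qed.
Fact descend_scale1 : left_id 1 descend_scale.
Proof. by move=> x; rewrite -(rmorph1 \pi_({ideal_quot I})) descend_piE scale1r. Qed.
Fact descend_scaleDr : right_distributive descend_scale +%R.
Proof. by move=> a x y; exact: scalerDr. Qed.
Fact descend_scaleDl (x : D) : {morph descend_scale^~ x : a b / a + b >-> a + b}.
Proof. by move=> a b; rewrite -[a]reprK -[b]reprK -rmorphD !descend_piE scalerDl. Qed.

HB.instance Definition _ := GRing.Zmodule_isLmodule.Build {ideal_quot I} D
  descend_scaleA descend_scale1 descend_scaleDr descend_scaleDl.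
End Descent.

Definition mklinear (R : comNzRingType) (U V : lmodType R) (f : U -> V)
    (hf : linear f) : {linear U -> V} :=
  HB.pack_for {linear U -> V} f (GRing.isLinear.Build R U V _ f hf).

Section Cohomology.
Variable R : comNzRingType.

Record cochain := Cochain {
  cterm :> nat -> lmodType R;
  cdiff : forall k, {linear cterm k -> cterm k.+1};
  cdiffK : forall k x, cdiff k.+1 (cdiff k x) = 0 }.

Variable C : cochain.

Definition cocycle_pred k : {pred C k} := fun x => cdiff C k x == 0.
Fact cocycle_closed k : submod_closed (@cocycle_pred k).
Proof.
split=> [|a x y /eqP dx /eqP dy]; apply/eqP; first exact: linear0.
by rewrite linearP dx dy scaler0 addr0.
Qed.
Definition cocycle k : submodule (C k) := Submodule (@cocycle_closed k).

Definition is_coboundary k : C k -> Prop :=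
  match k with
  | 0 => fun x => x = 0
  | k'.+1 => fun x => exists y : C k', x = cdiff C k' y
  end.
Definition coboundary_pred k : {pred submod (cocycle k)} :=
  fun z => `[< is_coboundary (val z) >].
Fact coboundary_closed k : submod_closed (@coboundary_pred k).
Proof.
case: k => [|k]; split=> [|a x y /asboolP hx /asboolP hy]; apply/asboolP => //=.
- by rewrite hx hy scaler0 addr0.
- by exists 0; rewrite linear0.
- move: hx hy => [x' ->] [y' ->]; exists (a *: x' + y').
  by rewrite linearP.
Qed.
Definition coboundary k : submodule (submod (cocycle k)) :=
  Submodule (@coboundary_closed k).

Definition cohomology k : lmodType R := quotm (coboundary k).
End Cohomology.

Section Hom.
Variables (R : comNzRingType) (M N : lmodType R).

Definition hom_pred : {pred M -> N} := fun f => `[< linear f >].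
Fact hom_closed : submod_closed hom_pred.
Proof.
split=> [|a f g /asboolP hf /asboolP hg]; apply/asboolP => b x y /=.
  by rewrite scaler0 addr0.
rewrite -[LHS]/(a *: f (b *: x + y) + g (b *: x + y)).
rewrite -[RHS]/(b *: (a *: f x + g x) + (a *: f y + g y)).
rewrite hf hg !scalerDr !scalerA [a * b]mulrC -!addrA; congr (_ + _).
by rewrite addrCA.
Qed.
Definition hom_sub : submodule (M -> N) := Submodule hom_closed.
Definition hom : lmodType R := submod hom_sub.

Lemma hom_linear (f : hom) : linear (val f).
Proof. exact/asboolP/(valP f). Qed.

Definition mkhom (f : M -> N) (hf : linear f) : hom :=
  Submod (introT (asboolP _) hf : f \in submod_mem hom_sub).
End Hom.

Section HomComp.
Variables (R : comNzRingType) (M M' N : lmodType R) (d : {linear M' -> M}).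

Fact hom_comp_subproof (f : hom M N) : linear (val f \o d).
Proof. by move=> a x y /=; rewrite linearP hom_linear. Qed.
Definition hom_comp (f : hom M N) : hom M' N := mkhom (hom_comp_subproof f).
Fact hom_comp_linear : linear hom_comp.
Proof. by move=> a f g; apply: val_inj. Qed.
HB.instance Definition _ := GRing.isLinear.Build R _ _ _ hom_comp hom_comp_linear.
End HomComp.

Section FreeModule.
Variables (R : comNzRingType) (T : choiceType) (M : lmodType R) (f : T -> M).

Fact fglift_linear : linear (fglift f : {freeg T / R} -> M).
Proof.
have fgD : zmod_morphism (fglift f : {freeg T / R} -> M) by exact: lift_is_additive.
pose fgA := GRing.isZmodMorphism.Build {freeg T / R} M (fglift f) fgD.
pose g : {additive {freeg T / R} -> M} := HB.pack (fglift f) fgA.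
have gZ c D : g (c *: D) = c *: g D.
  rewrite -{2}[D]freeg_sumE -[c *: D]/(fgscale c D) /fgscale !raddf_sum.
  by apply: eq_bigr => x _; rewrite /= !(@liftU R M T f) scalerA.
by move=> c D D'; rewrite -[LHS]/(g (c *: D + D')) raddfD gZ.
Qed.
HB.instance Definition _ :=
  GRing.isLinear.Build R {freeg T / R} M _ (fglift f) fglift_linear.

Lemma fgliftU (x : T) : fglift f << x >> = f x.
Proof. by rewrite liftU scale1r. Qed.

Lemma freeg_linear_ext (g h : {linear {freeg T / R} -> M}) :
  (forall x, g << x >> = h << x >>) -> g =1 h.
Proof.
move=> gh D; rewrite -[D]freeg_sumE !raddf_sum; apply: eq_bigr => x _.
suff -> : << coeff x D *g x >> = coeff x D *: << x >> :> {freeg T / R}.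
  exact: (etrans (linearZ_LR g _ _) (etrans (congr1 ( *:%R _) (gh x)) (esym (linearZ_LR h _ _)))).
by apply/eqP/freeg_eqP => y; rewrite coeffZ !coeffU mul1r.
Qed.
End FreeModule.

Section Ext.
Variable R : comNzRingType.

Definition free_cover (M : lmodType R) : {linear {freeg M / R} -> M} :=
  fglift (fun m : M => m).

Definition syzygy_pred (M : lmodType R) : {pred {freeg M / R}} :=
  fun p => free_cover M p == 0.
Fact syzygy_closed M : submod_closed (@syzygy_pred M).
Proof.
split=> [|a x y /eqP dx /eqP dy]; apply/eqP; first exact: linear0.
by rewrite linearP dx dy scaler0 addr0.
Qed.
Definition syzygy M : lmodType R := submod (Submodule (@syzygy_closed M)).

Fixpoint iter_syzygy (M : lmodType R) (k : nat) : lmodType R :=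
  if k is k'.+1 then syzygy (iter_syzygy M k') else M.

(* The standard free resolution of [M]: its term in degree [k] is free on the
   elements of the [k]-th syzygy module, and its differential is the composite
   of the canonical surjection and the inclusion of syzygies. *)
Definition free_res (M : lmodType R) (k : nat) : lmodType R :=
  {freeg (iter_syzygy M k) / R}.

Definition free_res_diff (M : lmodType R) k (p : free_res M k.+1) : free_res M k :=
  val (free_cover (iter_syzygy M k.+1) p).
Fact free_res_diff_linear M k : linear (@free_res_diff M k).
Proof. by move=> a x y; rewrite /free_res_diff linearP. Qed.
HB.instance Definition _ M k :=
  GRing.isLinear.Build R _ _ _ (@free_res_diff M k) (@free_res_diff_linear M k).

Lemma free_res_diffK M k (p : free_res M k.+2) :
  free_res_diff (free_res_diff p) = 0.
Proof.
rewrite {1}/free_res_diff.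
suff -> : free_cover (iter_syzygy M k.+1) (free_res_diff p) = 0 by exact: raddf0.
exact/eqP/(valP (free_cover (iter_syzygy M k.+2) p)).
Qed.

Definition hom_res_diff (M N : lmodType R) k :
    {linear hom (free_res M k) N -> hom (free_res M k.+1) N} :=
  hom_comp (@free_res_diff M k).
Fact hom_res_diffK M N k x : @hom_res_diff M N k.+1 (hom_res_diff M N k x) = 0.
Proof.
apply: val_inj; apply/funext => p /=.
by rewrite free_res_diffK; exact: (linear0 (mklinear (hom_linear x))).
Qed.
Definition hom_res (M N : lmodType R) : cochain R := Cochain (@hom_res_diffK M N).

Definition Ext (k : nat) (M N : lmodType R) : lmodType R :=
  cohomology (hom_res M N) k.
End Ext.

(* If [r] kills [M] then it kills [Ext k M N]: multiplication by [r] on the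
   standard resolution of [M] is null-homotopic. *)
Section ExtAnnihilator.
Variables (R : comNzRingType) (r : R).

Lemma homotopy_step (X : lmodType R) (phi : {linear X -> {freeg X / R}}) :
    (forall x, free_cover X (phi x) = r *: x) ->
  exists s : {linear {freeg X / R} -> {freeg (syzygy X) / R}},
    forall p, val (free_cover (syzygy X) (s p)) = r *: p - phi (free_cover X p).
Proof.
move=> phiK.
have in_syz (x : X) :
    r *: (<< x >> : {freeg X / R}) - phi x \in submod_mem (Submodule (@syzygy_closed R X)).
  rewrite -[_ \in _]/(free_cover X (r *: << x >> - phi x) == 0).
  have -> : free_cover X (r *: << x >> - phi x) = r *: x - r *: x; last by rewrite subrr.
  have fx : free_cover X << x >> = x := fgliftU _ x.
  transitivity (r *: free_cover X << x >> - free_cover X (phi x)); last by rewrite fx phiK.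
  rewrite (raddfB (free_cover X)); congr (_ - _); exact: (linearZ_LR (free_cover X)).
pose u (x : X) : {freeg (syzygy X) / R} := << (Submod (in_syz x) : syzygy X) >>.
pose s : {linear {freeg X / R} -> {freeg (syzygy X) / R}} := fglift u.
exists s.
have lin1 : linear (fun p => val (free_cover (syzygy X) (s p)) : {freeg X / R}).
  by move=> a x y /=; rewrite !linearP.
have lin2 : linear (fun p : {freeg X / R} => r *: p - phi (free_cover X p)).
  move=> a x y; rewrite (linearP (free_cover X)) (linearP phi) scalerDr opprD addrACA.
  by rewrite scalerBr !scalerA [r * a]mulrC.
apply: (freeg_linear_ext (g := mklinear lin1) (h := mklinear lin2)) => x /=.
by rewrite /s [fglift u _]fgliftU [free_cover (syzygy X) _]fgliftU [free_cover X _]fgliftU.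
Qed.

Variables (M N : lmodType R).
Hypothesis annM : forall m : M, r *: m = 0.

Lemma homotopy_exists k :
  exists phi : {linear iter_syzygy M k -> free_res M k},
    (forall x, free_cover (iter_syzygy M k) (phi x) = r *: x) /\
    match k return {linear iter_syzygy M k -> free_res M k} -> Prop with
    | 0 => fun phi => forall x, phi x = 0
    | k'.+1 => fun phi => exists s : {linear free_res M k' -> free_res M k'.+1},
                 forall x, phi x = s (val x)
    end phi.
Proof.
elim: k => [|k [phi [phiK _]]].
  exists \0%R; split=> [x|//]; by rewrite annM [LHS]raddf0.
have [s hs] := homotopy_step phiK.
have lin : linear (fun x : iter_syzygy M k.+1 => s (val x)).
  by move=> a x y /=; rewrite !linearP.
exists (mklinear lin); split=> [x /=|]; last by exists s.
apply: val_inj; rewrite /= hs.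
have /eqP -> : free_cover (iter_syzygy M k) (val x) == 0 by exact: (valP x).
by rewrite [phi 0]raddf0 subr0.
Qed.

Lemma hom_res_ann k (f : hom (free_res M k) N) : hom_res_diff M N k f = 0 ->
  @is_coboundary R (hom_res M N) k (r *: f).
Proof.
move=> df0; have [phi [phiK hphi]] := homotopy_exists k.
have fr (p : free_res M k) : r *: val f p = val f (phi (free_cover _ p)).
  have [s hs] := homotopy_step phiK.
  pose fl : {linear free_res M k -> N} := mklinear (hom_linear f).
  have f0 : fl (free_res_diff (s p)) = 0 := congr1 (fun g => val g (s p)) df0.
  rewrite -[val f _]/(fl _) -[X in _ *: X = _]/(fl p).
  apply/eqP; rewrite -subr_eq0 -f0 /free_res_diff [X in _ == fl X]hs.
  rewrite (raddfB fl); apply/eqP; congr (_ - _); exact/esym/(linearZ_LR fl).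
case: k f {df0} phi {phiK} hphi fr => [|k] f phi hphi fr /=.
  apply: val_inj; apply/funext => p; rewrite -[LHS]/(r *: val f p) fr hphi.
  exact: (linear0 (mklinear (hom_linear f))).
have [s hs] := hphi.
have lin : linear (val f \o s) by move=> a x y /=; rewrite linearP hom_linear.
exists (mkhom lin); apply: val_inj; apply/funext => p.
by rewrite -[LHS]/(r *: val f p) fr hs.
Qed.

Lemma Ext_ann k (x : Ext k M N) : r *: x = 0.
Proof.
elim/quotm_ind: x => z; rewrite [LHS]quotm_piZ.
rewrite -[RHS](_ : \pi_(quotm (coboundary (hom_res M N) k)) 0 = 0); last by rewrite /quotm piE.
apply/quotm_eqP; rewrite subr0; apply/asboolP.
by apply: hom_res_ann; apply/eqP; exact: (valP z).
Qed.
End ExtAnnihilator.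

Section QuotientRingModules.
Variables (R : comNzRingType) (I : idealr R).

Definition conormal_quot : lmodType {ideal_quot I} :=
  descend (@conormal_ann R I).

Fact Ext_cyclic_ann c a (x : Ext c (cyclic_mod I) R^o) :
  a \in (I : {pred R}) -> a *: x = 0.
Proof. by move=> Ia; apply: Ext_ann => m; exact: cyclic_mod_ann. Qed.

(* [Ext^c_R(R / I, R)] as an [R / I]-module. Gradings are not carried along, so
   the degree shift of the canonical module does not appear. *)
Definition canonical_quot (c : nat) : lmodType {ideal_quot I} :=
  descend (@Ext_cyclic_ann c).
End QuotientRingModules.

Section LocalCohomology.
Variables (R : comNzRingType).

Definition injective_module (E : lmodType R) : Prop :=
  forall (U V : lmodType R) (i : {linear U -> V}) (f : {linear U -> E}),
    injective i -> exists g : {linear V -> E}, forall u, g (i u) = f u.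

Record injective_resolution (M : lmodType R) := InjectiveResolution {
  inj_cochain :> cochain R;
  inj_aug : {linear M -> inj_cochain 0%N};
  inj_term : forall k, injective_module (inj_cochain k);
  inj_aug_inj : injective inj_aug;
  inj_aug_exact : forall x,
    cdiff inj_cochain 0 x = 0 <-> exists m, x = inj_aug m;
  inj_exact : forall k x,
    cdiff inj_cochain k.+1 x = 0 -> exists y, x = cdiff inj_cochain k y }.

Variable J : set R.

Definition torsion_pred (E : lmodType R) : {pred E} := fun x =>
  `[< exists t, forall a, ideal_exp J t a -> a *: x = 0 >].
Fact torsion_closed E : submod_closed (@torsion_pred E).
Proof.
split=> [|b x y /asboolP[s hs] /asboolP[t ht]]; apply/asboolP.
  by exists 0%N => a _; rewrite scaler0.
exists (maxn s t) => a ha.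
rewrite scalerDr scalerA mulrC -scalerA hs ?ht ?scaler0 ?addr0 //.
  exact: ideal_exp_le (leq_maxr s t) _ ha.
exact: ideal_exp_le (leq_maxl s t) _ ha.
Qed.
Definition torsion (E : lmodType R) : submodule E := Submodule (@torsion_closed E).

Section TorsionComplex.
Variable C : cochain R.

Fact torsion_diff_subproof k (x : submod (torsion (C k))) :
  cdiff C k (val x) \in submod_mem (torsion (C k.+1)).
Proof.
have /asboolP[t ht] := valP x; apply/asboolP; exists t => a /ht ax0.
by rewrite -(linearZ_LR (cdiff C k)) [a *: _]ax0 linear0.
Qed.
Definition torsion_diff k (x : submod (torsion (C k))) : submod (torsion (C k.+1)) :=
  Submod (torsion_diff_subproof x).
Fact torsion_diff_linear k : linear (@torsion_diff k).
Proof. by move=> a x y; apply: val_inj; rewrite /= linearP. Qed.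
Fact torsion_diffK k x :
  mklinear (@torsion_diff_linear k.+1) (mklinear (@torsion_diff_linear k) x) = 0.
Proof. by apply: val_inj; rewrite /= cdiffK. Qed.
Definition torsion_complex : cochain R := Cochain torsion_diffK.
End TorsionComplex.

(* [H^k_J(M)] as the [k]-th right derived functor of [J]-torsion, computed with
   the injective resolution [E] of [M]; it depends on [E] up to isomorphism only. *)
Definition local_cohomology (M : lmodType R) (E : injective_resolution M) (k : nat) :
    lmodType R :=
  cohomology (torsion_complex E) k.
End LocalCohomology.

Section Depth.
Variables (R : comNzRingType) (M : lmodType R).

Definition seq_submod (s : seq R) : set M :=
  span [set y | exists a m, a \in s /\ y = a *: m].

Definition regular_seq (s : seq R) : Prop :=
  (forall k m, (k < size s)%N ->
     seq_submod (take k s) (s`_k *: m) -> seq_submod (take k s) m) /\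
  (exists m, ~ seq_submod s m).

Definition is_depth (J : set R) (e : nat) : Prop :=
  exists s : seq R,
    [/\ size s = e, forall a, a \in s -> J a, regular_seq s
      & forall a, J a -> ~ regular_seq (rcons s a)].
End Depth.

Section Projective.
Variables (K : fieldType) (n : nat).
Local Notation R := {mpoly K[n.+1]}.

Definition irrelevant_ideal : set R := ideal_gen [set f | exists i, f = 'X_i].

Definition homogeneous_ideal (I : idealr R) : Prop :=
  forall f d, f \in (I : {pred R}) -> pihomog mdeg d f \in (I : {pred R}).

Definition saturated (I : idealr R) : Prop :=
  forall (f : R) t,
    (forall g, ideal_exp irrelevant_ideal t g -> g * f \in (I : {pred R})) ->
    f \in (I : {pred R}).

(* Points of [Proj (R / I)] are the homogeneous primes that contain [I] and not
   the irrelevant ideal; [P i] matters for [i <= d] only. *)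
Definition proj_chain (I : idealr R) (d : nat) (P : nat -> prime_idealr R) : Prop :=
  (forall i, (i <= d)%N ->
     [/\ homogeneous_ideal (P i), ideal_set I `<=` ideal_set (P i)
       & ~ irrelevant_ideal `<=` ideal_set (P i)]) /\
  (forall i, (i < d)%N -> ideal_set (P i) `<` ideal_set (P i.+1)).

Definition proj_dim (I : idealr R) (d : nat) : Prop :=
  (exists P, proj_chain I d P) /\ ~ (exists P, proj_chain I d.+1 P).

Definition proj_codim (I : idealr R) (c : nat) : Prop :=
  exists2 d, proj_dim I d & (c + d)%N = n.

(* [M] is the matrix of a degree [0] map of graded free modules. *)
Definition homogeneous_mx p q (M : 'M[R]_(p, q)) : Prop :=
  exists (a : 'I_p -> int) (b : 'I_q -> int), forall i j, M i j != 0 ->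
    exists2 d : nat, d%:Z = b j - a i & M i j \is d.-homog.

Definition minor_ideal p q (M : 'M[R]_(p, q)) (k : nat) : set R :=
  ideal_gen [set x | exists (f : 'I_k -> 'I_p) (g : 'I_k -> 'I_q),
    [/\ {homo f : i j / (i < j)%N}, {homo g : i j / (i < j)%N}
      & x = \det (mxsub f g M)]].

(* The closed subscheme with saturated homogeneous ideal [I] is standard
   determinantal of codimension [c], associated to [M]. Closed subschemes of
   projective space are represented by their saturated homogeneous ideals; the
   type [idealr] of proper ideals excludes the empty scheme. *)
Definition standard_determinantal (I : idealr R) (t c : nat)
    (M : 'M[R]_(t, t + c - 1)) : Prop :=
  [/\ homogeneous_ideal I, saturated I, proj_codim I c, homogeneous_mx M
    & ideal_set I = minor_ideal M t].
End Projective.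

Arguments standard_determinantal {K n} I t c M.

(* Main.v *)
(** Write [F] and [G] for the free modules of ranks [m = t + c - 1] and [t], and let [L] be the
    cokernel of [/\^t F (x) G -> /\^(t-1) F]. Contracting with the rows of the matrix gives a complex
    [0 -> I/I^2 -> F (x) L -> G (x) L -> A -> 0] whose homology is killed by the [(t-1)]-minors.
    Since [grade I = c], the modules [L] and [A] are resolved by strands of length at most [c] of the
    Koszul complex of the linear forms [sum_i M i j * y_i] (the characteristic is 0, so
    divided powers are polynomials and a Weyl algebra homotopy makes the cycles torsion). As
    [depth_J A >= 4 + i], the grade of [J] in [R] is at least [c + 4 + i], so modules killed by [J]
    have no [Ext^p(-, R)] for [p < c + 4 + i], and a diagram chase gives
    [Ext^p_R(I/I^2, R) = 0] for [c < p <= c + i].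

    For the grade of [J], the homogeneous regular sequence in [I] is extended one element at a time:
    otherwise some associated prime of [R/(a_1, .., a_e)] contains [J], the rows of [M] are dependent
    modulo it, and a power of the dependency gives a nonzero class in an [Ext] group that the depth
    hypothesis kills. Homogeneous regular sequences in [I] come from chains of homogeneous primes.

    The two conclusions follow by duality in vanishing form. For local cohomology, the colimit of the
    Koszul cohomology of [x_0^s, .., x_n^s] is compared with [Ext(-, R)], using Artin-Rees and the
    perfect pairing on [R/(x_0^s, .., x_n^s)]. For [Ext_A(-, K_A)], Rees' isomorphism identifies
    [K_A] with the elements of [R/(a_1, .., a_c)] killed by [I], which reduces extension problems over
    [A] into [K_A] to extension problems over [R]. *)

Require Import Defs.
From HB Require Import structures.
From mathcomp Require Import all_boot all_order all_algebra.
From mathcomp Require Import boolp classical_sets functions.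
From mathcomp.multinomials Require Import mpoly freeg.
From mathcomp Require Import zify ring.

Set Implicit Arguments.
Unset Strict Implicit.
Unset Printing Implicit Defensive.
Import GRing.Theory Quotient.
Local Open Scope ring_scope.
Local Open Scope quotient_scope.
Local Notation lift := fintype.lift.

(** * Modules and vanishing of Ext *)

(** No [Ext] group is computed. Everything runs on vanishing statements, phrased as extension
    properties ([ext1], [extn]) or as cocycles being coboundaries ([hv]), so that long exact
    sequences become implications and no isomorphism of derived functors has to be constructed,
    apart from the description of [K_A]. Mind the shift: [extn q] is about [Ext] of degree [q + 1].
    The constant 4 counts the places of the four-term complex where homology may survive. Each costs
    one degree, so [extn q] for [I/I^2] needs the torsion homology modules up to [Ext] of degree
    [q + 4]; with [q < c + i] this stays below [c + 4 + i], the length of the regular sequence found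
    in [J]. That the grade of [J] over [R] is at least [c] plus the depth over [A] is usually read
    off from heights after localizing. Here everything stays graded over [R]: the strand that
    resolves the ideal has length [c - 1], and walking along it turns a class with values in its
    last term into one with values in [A], exactly [c] degrees lower. *)

Section LinearMaps.
Variable R : comNzRingType.
Implicit Types U V W C N T P Q : lmodType R.

Lemma ex_linear U V (f : U -> V) : linear f ->
  exists g : {linear U -> V}, forall x, g x = f x.
Proof. by move=> hf; exists (mklinear hf). Qed.

Lemma ex_choice (X Y : Type) (P : X -> Y -> Prop) :
  (forall x, exists y, P x y) -> exists f : X -> Y, forall x, P x (f x).
Proof. by move=> /choice[f hf]; exists f. Qed.

Section Operations.
Variables (U V W : lmodType R) (k : {linear V -> W}) (f g : {linear U -> V}) (b : R).
Variables (h : {linear U -> W}).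
Fact lcomp_linear : linear (fun x => k (f x)).
Proof. by move=> a x y; rewrite !linearP. Qed.
Fact lsub_linear : linear (fun x => f x - g x).
Proof.
by move=> a x y; rewrite (linearP f) (linearP g) scalerBr opprD addrACA.
Qed.
Fact ladd_linear : linear (fun x => f x + g x).
Proof. by move=> a x y; rewrite (linearP f) (linearP g) scalerDr addrACA. Qed.
Fact lscale_linear : linear (fun x => b *: f x).
Proof. by move=> a x y; rewrite (linearP f) scalerDr !scalerA mulrC. Qed.
Fact lpair_linear : linear (fun x => (f x, h x)).
Proof. by move=> a x y; rewrite (linearP f) (linearP h). Qed.
Fact lid_linear : linear (fun x : U => x). Proof. by []. Qed.
Fact lzero_linear : linear (fun x : U => 0 : V).
Proof. by move=> a x y; rewrite scaler0 addr0. Qed.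
Fact lfst_linear : linear (fst : U * V -> U). Proof. by []. Qed.
Fact lsnd_linear : linear (snd : U * V -> V). Proof. by []. Qed.
Definition lfst : {linear (U * V)%type -> U} := mklinear lfst_linear.
Definition lsnd : {linear (U * V)%type -> V} := mklinear lsnd_linear.
Definition lcomp : {linear U -> W} := mklinear lcomp_linear.
Definition lsub : {linear U -> V} := mklinear lsub_linear.
Definition ladd : {linear U -> V} := mklinear ladd_linear.
Definition lscale : {linear U -> V} := mklinear lscale_linear.
Definition lpair : {linear U -> (V * W)%type} := mklinear lpair_linear.
Definition lid : {linear U -> U} := mklinear lid_linear.
Definition lzero : {linear U -> V} := mklinear lzero_linear.
End Operations.

Definition lval V (S : submodule V) : {linear submod S -> V} := \val.

(** Submodules are carried as [Prop]-valued predicates so that they can be given by existential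
    statements; [psub] turns one into a module only where a type is needed. *)
Definition subclosed V (S : V -> Prop) :=
  S 0 /\ forall (a : R) x y, S x -> S y -> S (a *: x + y).

Fact psub_closed V (S : V -> Prop) (h : subclosed S) :
  submod_closed ((fun x => `[< S x >]) : {pred V}).
Proof.
split=> [|a x y /asboolP hx /asboolP hy]; apply/asboolP; first exact: h.1.
exact: h.2.
Qed.
Definition psub V (S : V -> Prop) (h : subclosed S) : lmodType R :=
  submod (Submodule (psub_closed h)).

Lemma psubP V (S : V -> Prop) (h : subclosed S) (x : psub h) : S (val x).
Proof. exact/asboolP/(valP x). Qed.

Definition mkpsub V (S : V -> Prop) (h : subclosed S) (x : V) (Sx : S x) : psub h :=
  Submod (introT (asboolP _) Sx : x \in submod_mem (Submodule (psub_closed h))).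

Definition onto U V (p : {linear U -> V}) := forall v, exists u, p u = v.

Definition ses U V C (i : {linear U -> V}) (p : {linear V -> C}) :=
  [/\ injective i, onto p & forall v, p v = 0 <-> exists u, v = i u].

Lemma lker_inj U V (i : {linear U -> V}) : (forall u, i u = 0 -> u = 0) -> injective i.
Proof.
by move=> h x y e; apply/eqP; rewrite -subr_eq0; apply/eqP/h; rewrite linearB e subrr.
Qed.

Lemma factor_surj V C N (p : {linear V -> C}) (f : {linear V -> N}) :
  onto p -> (forall v, p v = 0 -> f v = 0) ->
  exists g : {linear C -> N}, forall v, g (p v) = f v.
Proof.
move=> sp kf; have [s hs] := choice sp.
have E v v' : p v = p v' -> f v = f v'.
  move=> e; apply/eqP; rewrite -subr_eq0 -linearB; apply/eqP/kf.
  by rewrite linearB e subrr.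
have [g hg] : exists g : {linear C -> N}, forall c, g c = f (s c).
  by apply: ex_linear => a x y; rewrite -linearP; apply: E; rewrite linearP !hs.
by exists g => v; rewrite hg; apply: E; rewrite hs.
Qed.

Lemma factor_inj U V T (i : {linear U -> V}) (f : {linear T -> V}) :
  injective i -> (forall t, exists u, f t = i u) ->
  exists g : {linear T -> U}, forall t, i (g t) = f t.
Proof.
move=> ii /choice[g hg].
have [h hh] : exists h : {linear T -> U}, forall t, h t = g t.
  by apply: ex_linear => a x y; apply: ii; rewrite linearP -!hg linearP.
by exists h => t; rewrite hh hg.
Qed.

Lemma ker_closed V C (p : {linear V -> C}) : subclosed (fun v => p v = 0).
Proof. by split=> [|a x y hx hy]; rewrite ?linear0 // linearP hx hy scaler0 addr0. Qed.
Definition kerm V C (p : {linear V -> C}) := psub (ker_closed p).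

Lemma kerm_ses V C (p : {linear V -> C}) : onto p ->
  ses (\val : {linear kerm p -> V}) p.
Proof.
move=> sp; split=> [||v]; [exact: val_inj|by []|].
split=> [h|[u ->]]; last exact: (psubP u).
by exists (mkpsub (ker_closed p) h).
Qed.

Lemma im_closed U V (f : {linear U -> V}) : subclosed (fun v => exists u, v = f u).
Proof.
split=> [|a _ _ [x ->] [y ->]]; first by exists 0; rewrite linear0.
by exists (a *: x + y); rewrite linearP.
Qed.

(** Quotients are used through a surjection with prescribed kernel; most later statements take any
    such map as a parameter. *)
Lemma quot_ex V (S : V -> Prop) (h : subclosed S) :
  exists (Q : lmodType R) (p : {linear V -> Q}), onto p /\ forall v, p v = 0 <-> S v.
Proof.
pose N := Submodule (psub_closed h); exists (quotm N).
have lin : linear (fun v => \pi_(quotm N) v).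
  by move=> a x y; rewrite quotm_piD; congr (_ + _); rewrite -quotm_piZ.
have [p hp] := ex_linear lin; exists p; split=> [q|v].
  by exists (repr q); rewrite hp reprK.
have -> : (p v = 0) = (\pi_(quotm N) v = \pi_(quotm N) 0).
  by rewrite -!hp linear0.
split=> [/quotm_eqP|Sv]; first by rewrite subr0 => /asboolP.
by apply/quotm_eqP; rewrite subr0; apply/asboolP.
Qed.

Lemma pullback_closed V W C (p : {linear V -> C}) (q : {linear W -> C}) :
  subclosed (fun x : V * W => p x.1 = q x.2).
Proof. by split=> [|a x y hx hy] /=; rewrite ?linear0 // !linearP hx hy. Qed.

Lemma pullback_ex V W C (p : {linear V -> C}) (q : {linear W -> C}) :
  exists (P : lmodType R) (p1 : {linear P -> V}) (p2 : {linear P -> W}),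
    [/\ forall x, p (p1 x) = q (p2 x),
        forall v w, p v = q w -> exists x, p1 x = v /\ p2 x = w,
        forall x y, p1 x = p1 y -> p2 x = p2 y -> x = y
      & forall T (f : {linear T -> V}) (g : {linear T -> W}),
          (forall t, p (f t) = q (g t)) ->
          exists h : {linear T -> P}, forall t, p1 (h t) = f t /\ p2 (h t) = g t].
Proof.
pose P := psub (pullback_closed p q).
have [p1 h1] : exists p1 : {linear P -> V}, forall x, p1 x = (val x).1.
  by apply: ex_linear => a x y.
have [p2 h2] : exists p2 : {linear P -> W}, forall x, p2 x = (val x).2.
  by apply: ex_linear => a x y.
exists P, p1, p2; split=> [x|v w e|x y|T f g fg].
- by rewrite h1 h2; exact: (psubP x).
- by exists (mkpsub (pullback_closed p q) (x := (v, w)) e); rewrite h1 h2.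
- rewrite !h1 !h2 => e1 e2; apply: val_inj.
  by case: (val x) e1 e2 => a b; case: (val y) => c d /= -> ->.
- have [h hh] : exists h : {linear T -> P}, forall t, val (h t) = (f t, g t).
    apply: (factor_inj (i := (\val : {linear P -> _})) (f := lpair f g)); first exact: val_inj.
    by move=> t; exists (mkpsub (pullback_closed p q) (x := (f t, g t)) (fg t)).
  by exists h => t; rewrite h1 h2 hh.
Qed.

Definition projective (P : lmodType R) :=
  forall V C (p : {linear V -> C}) (f : {linear P -> C}),
    onto p -> exists g : {linear P -> V}, forall x, p (g x) = f x.

Lemma freeg_projective (T : choiceType) : projective {freeg T / R}.
Proof.
move=> V C p f sp; have [g hg] := choice (fun t => sp (f << t >>)).
exists (fglift g : {linear {freeg T / R} -> V}).
have lin : linear (fun x => p (fglift g x : V)) by move=> a x y /=; rewrite !linearP.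
by apply: (freeg_linear_ext (g := mklinear lin) (h := f)) => t /=; rewrite [fglift g _]fgliftU hg.
Qed.

Lemma retract_projective P Q (s : {linear Q -> P}) (r : {linear P -> Q}) :
  (forall x, r (s x) = x) -> projective P -> projective Q.
Proof.
move=> rs hP V C p f sp.
have [h hh] := hP _ _ p (lcomp f r) sp.
by exists (lcomp h s) => x /=; rewrite hh /= rs.
Qed.

Lemma prod_projective P Q : projective P -> projective Q -> projective (P * Q)%type.
Proof.
move=> hP hQ V C p f sp.
have [f1 hf1] : exists g : {linear P -> C}, forall x, g x = f (x, 0).
  apply: ex_linear => a x y /=; rewrite -linearP; congr (f _).
  by congr pair; rewrite /= scaler0 addr0.
have [f2 hf2] : exists g : {linear Q -> C}, forall x, g x = f (0, x).
  apply: ex_linear => a x y /=; rewrite -linearP; congr (f _).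
  by congr pair; rewrite /= scaler0 addr0.
have [g1 hg1] := hP _ _ p f1 sp; have [g2 hg2] := hQ _ _ p f2 sp.
have [g hg] : exists g : {linear (P * Q)%type -> V}, forall x, g x = g1 x.1 + g2 x.2.
  by apply: ex_linear => a x y /=; rewrite !linearP scalerDr addrACA.
exists g => -[x y]; rewrite hg linearD hg1 hg2 hf1 hf2 -linearD; congr (f _).
by congr pair; rewrite /= ?addr0 ?add0r.
Qed.

Lemma ses_split U V C (i : {linear U -> V}) (p : {linear V -> C}) :
  ses i p -> projective C ->
  exists r : {linear V -> U}, forall u, r (i u) = u.
Proof.
move=> [ii sp ex] hC.
have [s hs] := hC _ _ p (lid C) sp.
pose f := lsub (lid V) (lcomp s p).
have [|r hr] := factor_inj (i := i) (f := f) ii.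
  by move=> v; apply/ex; rewrite /= linearB hs subrr.
exists r => u; apply: ii; rewrite hr /=.
by have /ex -> : exists u', i u = i u' by [exists u]; rewrite linear0 subr0.
Qed.

End LinearMaps.

Section ExtVanishing.
Variables (R : comNzRingType) (N : lmodType R).
Implicit Types U V W A B C P M Y Z F : lmodType R.

(* [ext1 C] says [Ext^1(C, N) = 0] and [extn q C] says [Ext^(q+1)(C, N) = 0]. *)
Definition ext1 C := forall U V (i : {linear U -> V}) (p : {linear V -> C}),
  ses i p -> forall f : {linear U -> N}, exists g : {linear V -> N}, forall u, g (i u) = f u.

Lemma ext1_proj C : projective C -> ext1 C.
Proof.
move=> hC U V i p h f; have [r hr] := ses_split h hC.
by exists (lcomp f r) => u /=; rewrite hr.
Qed.

(** One extension [V] on which all maps extend is enough. For another extension [V'], the pullback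
    [W] is an extension of [V] by [U'], so [f'] extends to [W]; subtracting an extension to [V] of
    its restriction to [U] makes it descend to [V']. *)
Lemma ext1_cover U V C (i : {linear U -> V}) (p : {linear V -> C}) :
  ses i p -> ext1 V ->
  (forall f : {linear U -> N}, exists g : {linear V -> N}, forall u, g (i u) = f u) ->
  ext1 C.
Proof.
move=> [ii sp ex] eV hf U' V' i' p' [ii' sp' ex'] f'.
have [W [w1 [w2 [Wc We W0 Wu]]]] := pullback_ex p p'.
have pi' u : p' (i' u) = 0 by apply/ex'; exists u.
have pi u : p (i u) = 0 by apply/ex; exists u.
have [|j hj] := Wu _ (lzero U' V) i'; first by move=> u /=; rewrite linear0 pi'.
have [|k hk] := Wu _ i (lzero U V'); first by move=> u /=; rewrite linear0 pi.
have sesW : ses j w1.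
  split=> [x y e|v|x].
  - by apply: ii'; rewrite -!(hj _).2 e.
  - by have [v' /esym e] := sp' (p v); have [x [<- _]] := We _ _ e; exists x.
  - split=> [e|[u ->]]; last exact: (hj u).1.
    have /ex'[u hu] : p' (w2 x) = 0 by rewrite -Wc e linear0.
    by exists u; apply: W0; rewrite ?(hj u).1 ?(hj u).2.
have [g hg] := eV _ _ _ _ sesW f'.
have [h hh] := hf (lcomp g k).
have [| |g' hg'] := factor_surj (p := w2) (f := lsub g (lcomp h w1)).
- by move=> v'; have [v ev] := sp (p' v'); have [x [_ <-]] := We _ _ ev; exists x.
- move=> x x0; have /ex[u hu] : p (w1 x) = 0 by rewrite Wc x0 linear0.
  have -> : x = k u by apply: W0; rewrite ?(hk u).1 ?(hk u).2.
  by rewrite /= (hk u).1 hh subrr.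
exists g' => u; rewrite -(hj u).2 hg' /= hg.
by rewrite (hj u).1 linear0 subr0.
Qed.

Lemma ext1_retract A W (s : {linear A -> W}) (r : {linear W -> A}) :
  (forall a, r (s a) = a) -> ext1 W -> ext1 A.
Proof.
move=> rs hW U V i p [ii sp ex] f.
have [P [w1 [w2 [Wc We W0 Wu]]]] := pullback_ex p r.
have [|k hk] := Wu _ (lid V) (lcomp s p); first by move=> v /=; rewrite rs.
have pi u : p (i u) = 0 by apply/ex; exists u.
have sesP : ses (lcomp k i) w2.
  split=> [x y /= e|w|x].
  - by apply: ii; rewrite -[i x](hk (i x)).1 -[i y](hk (i y)).1 e.
  - by have [v e] := sp (r w); have [x [_ <-]] := We _ _ e; exists x.
  - split=> [e|[u ->]] /=; last by rewrite (hk _).2 /= pi linear0.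
    have /ex[u hu] : p (w1 x) = 0 by rewrite Wc e linear0.
    by exists u; apply: W0; rewrite ?(hk _).1 ?(hk _).2 //= pi linear0.
have [g hg] := hW _ _ _ _ sesP f.
by exists (lcomp g k) => u; rewrite -hg.
Qed.

(** A map is extended in two steps: to the preimage of [A], which is an extension of [A] by [U], and
    from there to [V], the quotient being [C]. *)
Lemma ext1_ses A B C (i : {linear A -> B}) (p : {linear B -> C}) :
  ses i p -> ext1 A -> ext1 C -> ext1 B.
Proof.
move=> [ii sp ex] eA eC U V i' p' [ii' sp' ex'] f.
pose q := lcomp p p'; have hq x : q x = p (p' x) by [].
have sq : onto q.
  by move=> c; have [b <-] := sp c; have [v <-] := sp' b; exists v; rewrite hq.
have sesq := kerm_ses sq.
pose p0 := lcomp p' (\val : {linear kerm q -> V}); have hp0 x : p0 x = p' (val x) by [].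
have [|p1 hp1] := factor_inj (i := i) (f := p0) ii.
  by move=> x; apply/ex; rewrite hp0 -hq; exact: (psubP x).
have ki u : q (i' u) = 0.
  by rewrite hq; have -> : p' (i' u) = 0 by [apply/ex'; exists u]; rewrite linear0.
have [j hj] : exists j : {linear U -> kerm q}, forall u, val (j u) = i' u.
  apply: (factor_inj (i := (\val : {linear kerm q -> V})) (f := i')); first exact: val_inj.
  by move=> u; exists (mkpsub (ker_closed q) (ki u)).
have ses1 : ses j p1.
  split=> [x y e|a|x].
  - by apply: ii'; rewrite -!hj e.
  - have [v hv] := sp' (i a).
    have qv : q v = 0 by rewrite hq hv; apply/ex; exists a.
    by exists (mkpsub (ker_closed q) qv); apply: ii; rewrite hp1 hp0 hv.
  - split=> [e|[u ->]].
      have /ex'[u hu] : p' (val x) = 0 by rewrite -hp0 -hp1 e linear0.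
      by exists u; apply: val_inj; rewrite hj.
    by apply: ii; rewrite hp1 hp0 hj linear0; apply/ex'; exists u.
have [g1 hg1] := eA _ _ _ _ ses1 f.
have [g hg] := eC _ _ _ _ sesq g1.
by exists g => u; rewrite -hj hg hg1.
Qed.

Definition extn q C := ext1 (iter_syzygy C q).

Lemma iter_syzygyS C q : iter_syzygy C q.+1 = iter_syzygy (syzygy C) q.
Proof. by elim: q => // q IH; rewrite -[LHS]/(syzygy (iter_syzygy C q.+1)) IH. Qed.

Lemma extnS q C : extn q.+1 C = extn q (syzygy C).
Proof. by rewrite /extn iter_syzygyS. Qed.

Definition fgmap (S T : choiceType) (s : S -> T) : {linear {freeg S / R} -> {freeg T / R}} :=
  fglift (fun x => << s x >>).

Lemma fgmapU (S T : choiceType) (s : S -> T) x : fgmap s << x >> = << s x >>.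
Proof. exact: fgliftU. Qed.

Lemma free_coverU M (x : M) : free_cover M << x >> = x.
Proof. exact: fgliftU. Qed.

Lemma free_cover_surj M : onto (free_cover M).
Proof. by move=> x; exists << x >>; rewrite free_coverU. Qed.

Lemma syzygy_cover0 M (u : syzygy M) : free_cover M (val u) = 0.
Proof. exact/eqP/(valP u). Qed.

Lemma syzygy_ses M : ses (\val : {linear syzygy M -> {freeg M / R}}) (free_cover M).
Proof.
split=> [||v]; [exact: val_inj|exact: free_cover_surj|].
split=> [/eqP h|[u ->]]; last exact/eqP/(valP u).
by exists (Submod (h : v \in submod_mem (Submodule (@syzygy_closed R M)))).
Qed.

Lemma cover_map A B (s : {linear A -> B}) x : free_cover B (fgmap s x) = s (free_cover A x).
Proof.
apply: (freeg_linear_ext (g := lcomp (free_cover B) (fgmap s)) (h := lcomp s (free_cover A))).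
by move=> y /=; rewrite fgmapU !free_coverU.
Qed.

Fact syz_map_subproof A B (s : {linear A -> B}) (x : syzygy A) :
  fgmap s (val x) \in submod_mem (Submodule (@syzygy_closed R B)).
Proof.
rewrite -[_ \in _]/(free_cover B (fgmap s (val x)) == 0) cover_map.
by have /eqP -> : free_cover A (val x) == 0 := valP x; rewrite linear0.
Qed.
Definition syz_map0 A B (s : {linear A -> B}) (x : syzygy A) : syzygy B :=
  Submod (syz_map_subproof s x).
Fact syz_map_linear A B (s : {linear A -> B}) : linear (syz_map0 s).
Proof. by move=> a x y; apply: val_inj; rewrite /= linearP. Qed.
Definition syz_map A B (s : {linear A -> B}) : {linear syzygy A -> syzygy B} :=
  mklinear (syz_map_linear s).

Lemma fgmap_comp (S T X : choiceType) (s : S -> T) (r : T -> X) x :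
  fgmap r (fgmap s x) = fgmap (r \o s) x.
Proof.
apply: (freeg_linear_ext (g := lcomp (fgmap r) (fgmap s)) (h := fgmap (r \o s))) => y /=.
by rewrite !fgmapU.
Qed.

Lemma fgmap_id (S : choiceType) (s : S -> S) x : s =1 id -> fgmap s x = x.
Proof.
move=> sid; apply: (freeg_linear_ext (g := fgmap s) (h := lid _)) => y /=.
by rewrite fgmapU sid.
Qed.

(** The free cover on all elements of a module is strictly functorial, so a retraction passes to
    syzygies without any choice. *)
Lemma extn_retract q A W (s : {linear A -> W}) (r : {linear W -> A}) :
  (forall a, r (s a) = a) -> extn q W -> extn q A.
Proof.
elim: q A W s r => [|q IH] A W s r rs; first exact: ext1_retract rs.
rewrite !extnS; apply: (IH _ _ (syz_map s) (syz_map r)) => x.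
by apply: val_inj; rewrite /= fgmap_comp fgmap_id.
Qed.

Lemma syzygy_projective P : projective P -> projective (syzygy P).
Proof.
move=> hP; have [r hr] := ses_split (syzygy_ses P) hP.
exact: retract_projective hr (freeg_projective (T := P)).
Qed.

Lemma extn_proj q P : projective P -> extn q P.
Proof.
move=> hP; suff : projective (iter_syzygy P q) by exact: ext1_proj.
by elim: q => // q IH; exact: syzygy_projective.
Qed.

(** Named because the two inductions are intertwined: [cover_indep0] at [q] assumes it, and
    [extn_mid] at [q.+1] uses [cover_indep0] at [q]. *)
Definition mid_exact q := forall A B C (i : {linear A -> B}) (p : {linear B -> C}),
  ses i p -> extn q A -> extn q C -> extn q B.

(** Schanuel's argument: the pullback of the two covers is an extension of [F] by [Y] and also of
    [P] by [Z]. The second splits, so [Z] is a retract of it. *)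
Lemma cover_indep0 q : mid_exact q ->
  forall B Y P (i : {linear Y -> P}) (p : {linear P -> B})
    Z F (j : {linear Z -> F}) (r : {linear F -> B}),
  ses i p -> ses j r -> projective P -> projective F -> extn q Y -> extn q Z.
Proof.
move=> mid B Y P i p Z F j r [ii sp ex] [ij sr ex'] hP hF eY.
have [W [w1 [w2 [Wc We W0 Wu]]]] := pullback_ex p r.
have pi u : p (i u) = 0 by apply/ex; exists u.
have rj u : r (j u) = 0 by apply/ex'; exists u.
have [|a ha] := Wu _ i (lzero Y F); first by move=> u /=; rewrite linear0 pi.
have [|b hb] := Wu _ (lzero Z P) j; first by move=> u /=; rewrite linear0 rj.
have sa : ses a w2.
  split=> [x y e|v|x].
  - by apply: ii; rewrite -!(ha _).1 e.
  - by have [w e] := sp (r v); have [x [_ <-]] := We _ _ e; exists x.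
  - split=> [e|[u ->]]; last exact: (ha u).2.
    have /ex[u hu] : p (w1 x) = 0 by rewrite Wc e linear0.
    by exists u; apply: W0; rewrite ?(ha u).1 ?(ha u).2.
have sb : ses b w1.
  split=> [x y e|v|x].
  - by apply: ij; rewrite -!(hb _).2 e.
  - by have [w /esym e] := sr (p v); have [x [<- _]] := We _ _ e; exists x.
  - split=> [e|[u ->]]; last exact: (hb u).1.
    have /ex'[u hu] : r (w2 x) = 0 by rewrite -Wc e linear0.
    by exists u; apply: W0; rewrite ?(hb u).1 ?(hb u).2.
have [s hs] := ses_split sb hP.
apply: (extn_retract (s := b) (r := s)) => //.
apply: mid sa eY _; exact: extn_proj.
Qed.

Lemma horseshoe A B C (i : {linear A -> B}) (p : {linear B -> C}) (SA FA SC FC : lmodType R)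
    (ja : {linear SA -> FA}) (ra : {linear FA -> A})
    (jc : {linear SC -> FC}) (rc : {linear FC -> C}) :
  ses i p -> ses ja ra -> ses jc rc -> projective FA -> projective FC ->
  exists Y P (j : {linear Y -> P}) (r : {linear P -> B})
    (k : {linear SA -> Y}) (l : {linear Y -> SC}),
    [/\ ses j r, projective P & ses k l].
Proof.
move=> [ii sp ex] [ia sa ea] [ic sc ec] hA hC.
have [g hg] := hC _ _ p rc sp.
pose r := ladd (lcomp (lcomp i ra) (lfst FA FC)) (lcomp g (lsnd FA FC)).
have hr x : r x = i (ra x.1) + g x.2 by [].
have pi u : p (i u) = 0 by apply/ex; exists u.
have ra0 u : ra (ja u) = 0 by apply/ea; exists u.
have rc0 u : rc (jc u) = 0 by apply/ec; exists u.
have pr x : p (r x) = rc x.2 by rewrite hr linearD pi add0r hg.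
have sr : onto r.
  move=> b; have [y hy] := sc (p b).
  have /ex[a ha] : p (b - g y) = 0 by rewrite linearB hg hy subrr.
  have [x hx] := sa a; exists (x, y).
  by rewrite hr /= hx -ha subrK.
pose vr : {linear kerm r -> (FA * FC)%type} := lval _.
have vr0 x : r (vr x) = 0 := psubP x.
have vrE x y : vr x = vr y -> x = y by exact: val_inj.
have vr_ex x : r x = 0 -> exists y, vr y = x by move=> h; exists (mkpsub (ker_closed r) h).
move: (kerm r) vr vr0 vrE vr_ex (kerm_ses sr : ses vr r) => Y vr vr0 vrE vr_ex sY.
have [|k hk] := factor_inj (i := vr) (f := lpair ja (lzero _ FC)) vrE.
  by move=> u; have [|y hy] := vr_ex (ja u, 0); [rewrite hr /= ra0 !linear0 addr0|exists y; rewrite hy].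
have hk' t : vr (k t) = (ja t, 0) by exact: hk.
have [|l hl] := factor_inj (i := jc) (f := lcomp (lsnd FA FC) vr) ic.
  by move=> x; apply/ec; rewrite -[RHS](linear0 p) -(vr0 x) pr.
have hl' t : jc (l t) = (vr t).2 by exact: hl.
exists Y, (FA * FC)%type, vr, r, k, l; split=> //.
- exact: prod_projective.
- split=> [x y e|c|x].
  + by apply: ia; have := hk' x; rewrite e hk' => -[].
  + have /ex[a ha] : p (g (jc c)) = 0 by rewrite hg.
    have [x hx] := sa (- a).
    have [|y hy] := vr_ex (x, jc c); first by rewrite hr /= hx linearN ha addNr.
    by exists y; apply: ic; rewrite hl' hy.
  + split=> [e|[u ->]]; last by apply: ic; rewrite hl' hk' linear0.
    have e2 : (vr x).2 = 0 by rewrite -hl' e linear0.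
    have := vr0 x; rewrite hr e2 linear0 addr0 => e1.
    have /ea[u hu] : ra (vr x).1 = 0 by apply: ii; rewrite e1 linear0.
    exists u; apply: vrE; rewrite hk' -hu -e2.
    by case: (vr x).
Qed.

Lemma extn_mid q : mid_exact q.
Proof.
elim: q => [|q IH] A B C i p h; first exact: ext1_ses h.
rewrite !extnS => eA eC.
have [Y [P [j [r [k [l [jr hP kl]]]]]]] := horseshoe h (syzygy_ses A) (syzygy_ses C)
  (@freeg_projective _ _) (@freeg_projective _ _).
apply: (cover_indep0 IH jr (syzygy_ses B) hP); first exact: freeg_projective.
exact: IH kl eA eC.
Qed.

Lemma extn_cover q B Y P (i : {linear Y -> P}) (p : {linear P -> B}) :
  ses i p -> projective P -> extn q.+1 B <-> extn q Y.
Proof.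
move=> h hP; rewrite extnS; split; last first.
  exact: (cover_indep0 (@extn_mid q) h (syzygy_ses B) hP (@freeg_projective _ _)).
exact: (cover_indep0 (@extn_mid q) (syzygy_ses B) h (@freeg_projective _ _) hP).
Qed.

(** Rotation of the long exact sequence: [Z] is at once a syzygy of [C] and an extension of [A] by
    the syzygy of [B], so exactness at the outer places reduces to [extn_mid]. *)
Lemma rotate_ses A B C (i : {linear A -> B}) (p : {linear B -> C}) : ses i p ->
  exists Z (j : {linear Z -> {freeg B / R}}) (k : {linear syzygy B -> Z}) (l : {linear Z -> A}),
  [/\ ses j (lcomp p (free_cover B)), ses k l & forall x, j (k x) = val x].
Proof.
move=> [ii sp ex]; have [ib sb eb] := syzygy_ses B.
pose q := lcomp p (free_cover B).
have sq : onto q by move=> c; have [b <-] := sp c; have [y <-] := sb b; exists y.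
have [|k hk] := factor_inj (i := (\val : {linear kerm q -> _}))
    (f := (\val : {linear syzygy B -> _})) val_inj.
  move=> x; have h : q (val x) = 0 by rewrite /= syzygy_cover0 linear0.
  by exists (mkpsub (ker_closed q) h).
have [|l hl] := factor_inj (i := i) (f := lcomp (free_cover B) (\val : {linear kerm q -> _})) ii.
  by move=> x; apply/ex; exact: (psubP x).
have hl' t : i (l t) = free_cover B (val t) by rewrite hl.
exists (kerm q), \val, k, l; split=> //; first exact: kerm_ses.
split=> [x y e|a|x].
- by apply: val_inj; rewrite -!hk e.
- have [y hy] := sb (i a).
  have h : q y = 0 by rewrite /= hy; apply/ex; exists a.
  by exists (mkpsub (ker_closed q) h); apply: ii; rewrite hl.
- split=> [e|[u ->]].
    have /eb[u hu] : free_cover B (val x) = 0 by move: (hl x); rewrite e linear0.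
    by exists u; apply: val_inj; rewrite hk.
  by apply: ii; rewrite hl' hk syzygy_cover0 linear0.
Qed.

Lemma extn_right q A B C (i : {linear A -> B}) (p : {linear B -> C}) :
  ses i p -> extn q A -> extn q.+1 B -> extn q.+1 C.
Proof.
move=> h eA; rewrite [X in X -> _]extnS => eB.
have [Z [j [k [l [hj kl _]]]]] := rotate_ses h.
apply/(extn_cover q hj); first exact: freeg_projective.
exact: extn_mid kl eB eA.
Qed.

Lemma extn_left q A B C (i : {linear A -> B}) (p : {linear B -> C}) :
  ses i p -> extn q B -> extn q.+1 C -> extn q A.
Proof.
move=> h eB eC; have [Z [j [k [l [hj kl jk]]]]] := rotate_ses h.
have eZ : extn q Z by apply/(extn_cover q hj) => //; exact: freeg_projective.
case: q eB eC eZ => [|q] eB eC eZ.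
  (* The lowest degree has no [extn] to shift from: a map on the syzygy of [B] extends over the free
     cover because [ext1 B] holds, and is then restricted along [j]. *)
  apply: (ext1_cover kl eZ) => f.
  have [g hg] := eB _ _ _ _ (syzygy_ses B) f.
  by exists (lcomp g j) => u /=; rewrite jk hg.
by move: eB; rewrite extnS => eB; exact: extn_right kl eB eZ.
Qed.
End ExtVanishing.

(** * Cocycles with values in modules *)

Section Cocycles.
Variable R : comNzRingType.
Implicit Types U V W N S X Y T : lmodType R.

(** No exactness is included: the cohomology of [Hom(P, N)] is studied for standard resolutions and
    for Koszul complexes alike, and the determinantal strands are chains whose exactness is the
    thing to prove. *)
Record chain := Chain {
  chterm :> nat -> lmodType R;
  chd : forall q, {linear chterm q.+1 -> chterm q};
  chdK : forall q x, chd q (chd q.+1 x) = 0 }.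

Definition proj_cx (P : chain) := forall q, projective (P q).

Section Cohomology.
Variable P : chain.

Definition coc q N (f : {linear P q -> N}) := forall x, f (chd P q x) = 0.

Definition triv q N : {linear P q -> N} -> Prop :=
  match q with
  | 0 => fun f => forall x, f x = 0
  | q'.+1 => fun f => exists g : {linear P q' -> N}, forall x, f x = g (chd P q' x)
  end.

(* Says [H^q(Hom(P, N)) = 0]. *)
Definition hv q N := forall f : {linear P q -> N}, coc f -> triv f.

Lemma triv_ext q N (f g : {linear P q -> N}) : f =1 g -> triv f -> triv g.
Proof.
by case: q f g => [|q] f g e; [move=> h x|case=> h hh; exists h => x]; rewrite -e.
Qed.

Lemma triv_lin q N (a : R) (f g h : {linear P q -> N}) :
  (forall x, h x = a *: f x + g x) -> triv f -> triv g -> triv h.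
Proof.
case: q f g h => [|q] f g h e.
  by move=> hf hg x; rewrite e hf hg scaler0 addr0.
case=> f' hf [g' hg]; exists (ladd (lscale f' a) g') => x.
by rewrite e hf hg.
Qed.

Lemma triv_comp q N N' (k : {linear N -> N'}) (f : {linear P q -> N}) :
  triv f -> triv (lcomp k f).
Proof.
case: q f => [|q] f; first by move=> h x /=; rewrite h linear0.
by case=> g hg; exists (lcomp k g) => x /=; rewrite hg.
Qed.

Lemma triv_zero q N : triv (lzero (P q) N).
Proof. by case: q => [|q]; [|exists (lzero _ _)]. Qed.

Lemma hv_retract q N W (s : {linear N -> W}) (r : {linear W -> N}) :
  (forall x, r (s x) = x) -> hv q W -> hv q N.
Proof.
move=> rs hW f cf; apply: (@triv_ext _ _ (lcomp r (lcomp s f))) => [x /=|]; first exact: rs.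
by apply: triv_comp; apply: hW => x /=; rewrite cf linear0.
Qed.

Lemma hv_prod q N W : hv q N -> hv q W -> hv q (N * W)%type.
Proof.
move=> hN hW f cf.
have h1 : triv (lcomp (lpair (lid N) (lzero N W)) (lcomp (lfst N W) f)).
  by apply: triv_comp; apply: hN => x /=; rewrite cf.
have h2 : triv (lcomp (lpair (lzero W N) (lid W)) (lcomp (lsnd N W) f)).
  by apply: triv_comp; apply: hW => x /=; rewrite cf.
apply: (triv_lin (a := 1) _ h1 h2) => x /=; rewrite scale1r; case: (f x) => a b.
by congr pair; rewrite /= ?addr0 ?add0r.
Qed.

Lemma hv_zero q N : (forall x : N, x = 0) -> hv q N.
Proof. by move=> h f _; apply: triv_ext (triv_zero q N) => x; rewrite [RHS]h. Qed.

Section Connecting.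
Variables (X S Y : lmodType R) (i : {linear X -> S}) (p : {linear S -> Y}).
Hypothesis ip : ses i p.
Hypothesis hP : proj_cx P.

(** The connecting map is kept as a relation between cocycles, since the lift [g] is not unique and
    only triviality is compared across it. *)
Definition delta q (f : {linear P q -> Y}) (f' : {linear P q.+1 -> X}) :=
  exists g : {linear P q -> S}, (forall x, p (g x) = f x) /\
    forall x, i (f' x) = g (chd P q x).

Lemma delta_coc q f f' : @delta q f f' -> coc f'.
Proof.
case: ip => ii _ _ [g [_ hg]] x; apply: ii.
by rewrite hg chdK !linear0.
Qed.

Lemma delta_ex q (f : {linear P q -> Y}) : coc f -> exists f', delta f f'.
Proof.
case: ip => ii sp ex cf; have [g hg] := hP f sp.
have [|f' hf'] := factor_inj (i := i) (f := lcomp g (chd P q)) ii.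
  by move=> x; apply/ex; rewrite /= hg cf.
by exists f', g.
Qed.

Lemma delta_triv q f f' : @delta q f f' -> triv f -> triv f'.
Proof.
case: ip => ii sp ex [g [pg hg]]; case: q f f' g pg hg => [|q] f f' g pg hg.
  move=> f0; have [|k hk] := factor_inj (i := i) (f := g) ii.
    by move=> x; apply/ex; rewrite pg f0.
  by exists k => x; apply: ii; rewrite hg hk.
case=> h hh; have [h' hh'] := hP h sp.
have [|k hk] := factor_inj (i := i) (f := lsub g (lcomp h' (chd P q))) ii.
  by move=> x; apply/ex; rewrite /= linearB pg hh' hh subrr.
by exists k => x; apply: ii; rewrite hk /= chdK linear0 subr0 hg.
Qed.

Lemma delta_triv_inv q f f' : hv q S -> @delta q f f' -> coc f -> triv f' -> triv f.
Proof.
case: ip => ii sp ex hS [g [pg hg]] cf [k hk].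
have pi x : p (i x) = 0 by apply/ex; exists x.
apply: (@triv_ext _ _ (lcomp p (lsub g (lcomp i k)))) => [x /=|].
  by rewrite linearB pi subr0.
by apply: triv_comp; apply: hS => x /=; rewrite -hg hk subrr.
Qed.

Lemma hv_quot q : hv q S -> hv q.+1 X -> hv q Y.
Proof.
move=> hS hX f cf; have [f' ff'] := delta_ex cf.
exact: delta_triv_inv hS ff' cf (hX _ (delta_coc ff')).
Qed.

Lemma hv_inj q (f : {linear P q.+1 -> X}) : hv q Y -> triv (lcomp i f) -> triv f.
Proof.
case: ip => ii sp ex hY [g hg].
have pi x : p (i x) = 0 by apply/ex; exists x.
apply: (@delta_triv q (lcomp p g)); first by exists g.
by apply: hY => x /=; rewrite -hg pi.
Qed.

Lemma hv_sub q : hv q Y -> hv q.+1 S -> hv q.+1 X.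
Proof. by move=> hY hS f cf; apply: hv_inj => //; apply: hS => x /=; rewrite cf linear0. Qed.
End Connecting.

Definition lmul N (a : R) : {linear N -> N} := lscale (lid N) a.

Lemma lmul_ses N (a : R) : (forall x : N, a *: x = 0 -> x = 0) ->
  exists (Q : lmodType R) (p : {linear N -> Q}), ses (lmul N a) p.
Proof.
move=> ra; have [Q [p [sp hp]]] := quot_ex (im_closed (lmul N a)).
by exists Q, p; split=> //; apply: lker_inj.
Qed.

(** Regular sequences on [N / U], without asking the last quotient to be nonzero. The predicate
    grows to [a N + U], so that all stages live on the same module [N]. *)
Fixpoint reg_on N (U : N -> Prop) (s : seq R) : Prop :=
  if s is a :: s' then
    (forall x, U (a *: x) -> U x) /\ reg_on (fun x => exists y u, U u /\ x = a *: y + u) s'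
  else True.

(** The exponent is uniform in the degree and in the coefficients, because the coefficient module
    changes in the induction of [hv_grade]. *)
Definition nullh (a : R) := exists k, forall q N (f : {linear P q -> N}),
  coc f -> triv (lscale f (a ^+ k)).

(** By induction the cohomology of [N' / a N'] vanishes in the lower degrees, so multiplication by
    [a] is injective on the next cohomology of [N']; being also nilpotent there, it forces that
    cohomology to be zero. *)
Lemma hv_grade s N N' (p : {linear N -> N'}) (U : N -> Prop) :
  proj_cx P ->
  onto p -> (forall x, p x = 0 <-> U x) -> reg_on U s ->
  (forall a, a \in s -> nullh a) -> forall q, (q < size s)%N -> hv q N'.
Proof.
move=> hP; elim: s N' p U => // a s IH N' p U sp kp [ra rs] hn.
have ra' (x : N') : a *: x = 0 -> x = 0.
  have [y <-] := sp x; rewrite -linearZ_LR => /kp/ra/kp; exact.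
have [N'' [r hr]] := lmul_ses ra'; have [_ sr er] := hr.
have IH' : forall q, (q < size s)%N -> hv q N''.
  apply: (IH N'' (lcomp r p) _ _ _ rs) => [y|x|b bs].
  - by have [x <-] := sr y; have [z <-] := sp x; exists z.
  - rewrite /=; split=> [/er[y hy]|[y [u [Uu ->]]]].
      have [z hz] := sp y; exists z, (x - a *: z); split; last by rewrite addrC subrK.
      by apply/kp; rewrite linearB linearZ_LR /= hz hy subrr.
    rewrite linearD linearZ_LR /= ((kp u).2 Uu) addr0; apply/er.
    by exists (p y).
  - by apply: hn; rewrite inE bs orbT.
have [k hk] := hn a (mem_head _ _).
case=> [_|q hq] f cf; last first.
  have := hk _ _ f cf; elim: k {hk} => [|k IHk].
    by apply: triv_ext => x /=; rewrite expr0 scale1r.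
  case=> g hg; apply: IHk; apply: (@delta_triv _ _ _ _ _ hr hP q (lcomp r g)).
    by exists g; split=> // x /=; rewrite -hg /= scalerA exprS.
  apply: IH' => // x /=; rewrite -hg; apply/er; exists (a ^+ k *: f x).
  by rewrite /= scalerA exprS.
have := hk _ _ f cf => /= {hk}; elim: k => [|k IHk] h x.
  by have := h x; rewrite expr0 scale1r.
by apply: IHk => y; apply: ra'; rewrite scalerA -exprS.
Qed.
End Cohomology.

Fact std_chdK (M : lmodType R) q (x : free_res M q.+2) :
  @free_res_diff R M q (@free_res_diff R M q.+1 x) = 0.
Proof. exact: free_res_diffK. Qed.
Definition std (M : lmodType R) : chain := Chain (@std_chdK M).

Lemma std_proj M : proj_cx (std M).
Proof. by move=> q; exact: freeg_projective. Qed.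

Lemma std_chdE M q (x : free_res M q.+1) : chd (std M) q x = val (free_cover (iter_syzygy M q.+1) x).
Proof. by []. Qed.

Lemma std_cover_chd M q (x : free_res M q.+1) : free_cover (iter_syzygy M q) (chd (std M) q x) = 0.
Proof. exact: syzygy_cover0. Qed.

Lemma std_ann (M : lmodType R) (a : R) : (forall x : M, a *: x = 0) ->
  forall q N (f : {linear std M q -> N}), coc f -> triv (lscale f a).
Proof.
move=> ha q N f cf; have lf : linear f by exact: linearP.
have df0 : hom_res_diff M N q (mkhom lf) = 0 by apply: val_inj; apply/funext => x; exact: cf.
have := hom_res_ann ha df0; case: q f cf lf df0 => [|q] f cf lf df0 /= h.
  by move=> x; have := congr1 (fun g => val g x) h.
case: h => g hg; exists (mklinear (hom_linear g)) => x.
by have := congr1 (fun g => val g x) hg.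
Qed.

Lemma std_null (M : lmodType R) (a : R) k : (forall x : M, a ^+ k *: x = 0) -> nullh (std M) a.
Proof. by move=> ha; exists k => q N f; exact: std_ann. Qed.

Lemma hv_std q C N : hv (std C) q.+1 N <-> extn N q C.
Proof.
split=> [h|h f cf].
  apply: (ext1_cover (syzygy_ses (iter_syzygy C q))) => [|f].
    by apply: ext1_proj; exact: freeg_projective.
  have [|g hg] := h (lcomp f (free_cover (iter_syzygy C q.+1))).
    by move=> x /=; rewrite (@std_cover_chd C q.+1) linear0.
  by exists g => z; have [y <-] := free_cover_surj z; exact/esym/(hg y).
have [||k hk] := factor_surj (p := free_cover (iter_syzygy C q.+1)) (f := f).
- exact: free_cover_surj.
- move=> x x0; have [_ _ ex] := syzygy_ses (iter_syzygy C q.+1).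
  have /ex[u ->] := x0; have [y <-] := free_cover_surj u.
  exact: (cf y).
- have [g hg] := h _ _ _ _ (syzygy_ses (iter_syzygy C q)) k.
  by exists g => x; rewrite std_chdE [RHS](hg (free_cover _ x)) hk.
Qed.

Lemma hv_std0 (C : lmodType R) N (f : {linear C -> N}) : hv (std C) 0 N -> forall x, f x = 0.
Proof.
move=> h x; have h0 : triv (lcomp f (free_cover C) : {linear std C 0 -> N}).
  by apply: h => y /=; rewrite (@std_cover_chd C 0) linear0.
by have [y <-] := free_cover_surj x; exact: (h0 y).
Qed.
End Cocycles.

(** * Acyclicity of complexes with torsion homology *)

Section Acyclicity.
Variables (R : comNzRingType) (C : chain R) (l : nat) (s : seq R).

Definition torsion_by (T : lmodType R) :=
  forall a, a \in s -> exists k, forall x : T, a ^+ k *: x = 0.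

Hypothesis C0 : forall e, (l < e)%N -> forall x : C e, x = 0.
Hypothesis hvC : forall T, torsion_by T -> forall e q, (q < size s)%N -> hv (std T) q (C e).

Definition bdry e (z : C e) := exists w, z = chd C e w.
Definition tors e (z : C e) := forall a, a \in s -> exists k, bdry (a ^+ k *: z).
Definition exact_at e := forall z : C e.+1, chd C e z = 0 -> bdry z.

Lemma bdry_closed e : subclosed (@bdry e).
Proof. exact: im_closed. Qed.

(** Exactness from [e] on resolves the boundaries in degree [e] by the terms of the complex; each of
    the [l - e] steps costs one cohomological degree. *)
Lemma hv_bdry T : torsion_by T -> forall e q, (forall e', (e <= e')%N -> exact_at e') ->
  (q + (l - e) <= size s)%N -> hv (std T) q (psub (bdry_closed e)).
Proof.
move=> hT e q; move Hn : (l - e)%N => n; elim: n e q Hn => [|n IH] e q Hn ex hq.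
  apply: hv_zero => x; apply: val_inj; have [w ->] := psubP x.
  by rewrite [w]C0 ?linear0 // ltnS -subn_eq0 Hn.
have [|p hp] := factor_inj (i := lval _ : {linear psub (bdry_closed e) -> C e})
    (f := chd C e) val_inj.
  by move=> x; have h : bdry (chd C e x) by [exists x]; exists (mkpsub (bdry_closed e) h).
have hp' x : val (p x) = chd C e x by exact: hp.
have hs : ses (lval _ : {linear psub (bdry_closed e.+1) -> C e.+1}) p.
  split=> [||v]; first exact: val_inj.
    move=> y; have [w hw] := psubP y; exists w; apply: val_inj; by rewrite hp' hw.
  split=> [e0|[u ->]].
    have h : bdry v by apply: (ex e) => //; rewrite -hp' e0.
    by exists (mkpsub (bdry_closed e.+1) h).
  apply: val_inj; rewrite hp'; have [w /= ->] := psubP u.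
  by rewrite chdK.
apply: (hv_quot hs (@std_proj _ T)).
  by apply: hvC => //; apply: leq_trans hq; rewrite addnS ltnS leq_addr.
apply: IH; last by rewrite addSnnS.
  by rewrite subnS Hn.
by move=> e' he; apply: ex; exact: ltnW.
Qed.

(** The class of [z] generates a cyclic torsion submodule [T] of [C e] modulo boundaries, while that
    quotient has enough depth for every map from [T] into it to vanish. *)
Lemma tors_bdry e (z : C e) : (forall e', (e <= e')%N -> exact_at e') ->
  (0 < size s)%N -> (l - e < size s)%N -> tors z -> bdry z.
Proof.
move=> ex s0 hs tz; have [Q [p [sp kp]]] := quot_ex (bdry_closed e).
have mcl : subclosed (fun y => exists a, y = a *: p z).
  split=> [|a _ _ [b ->] [b' ->]]; first by exists 0; rewrite scale0r.
  by exists (a * b + b'); rewrite scalerDl scalerA.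
pose T := psub mcl.
have hT : torsion_by T.
  move=> a /tz[k hk]; exists k => x; apply: val_inj; rewrite linearZ_LR /=.
  have [b ->] := psubP x; rewrite scalerA mulrC -scalerA -(linearZ_LR p).
  by have /kp -> := hk; rewrite scaler0.
have sq : ses (lval _ : {linear psub (bdry_closed e) -> C e}) p.
  split=> [||v]; [exact: val_inj|exact: sp|].
  split=> [/kp h|[u ->]]; first by exists (mkpsub (bdry_closed e) h).
  exact/kp/(psubP u).
have h0 : hv (std T) 0 Q.
  by apply: (hv_quot sq (@std_proj _ T)); [exact: hvC|exact: hv_bdry].
have h1 : exists a, p z = a *: p z by exists 1; rewrite scale1r.
apply/kp; exact: (hv_std0 (lval _ : {linear T -> Q}) h0 (mkpsub mcl h1)).
Qed.

(** The acyclicity lemma of Peskine and Szpiro. The induction comes down from the top degree, where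
    the terms are zero. *)
Lemma acyclic : (l <= size s)%N ->
  (forall e (z : C e.+1), chd C e z = 0 -> tors z) -> forall e, exact_at e.
Proof.
move=> ls ht e; move: {2}(l - e)%N (leqnn (l - e)) => n; elim: n e => [|n IH] e hn z hz.
  by exists 0; rewrite linear0 [z]C0 // ltnS -subn_eq0 -leqn0.
have [le|le] := leqP l e; first by exists 0; rewrite linear0 [z]C0.
have s0 : (0 < size s)%N by apply: leq_trans ls; apply: leq_trans le.
apply: tors_bdry => //; last exact: ht.
- move=> e' he; apply: IH; rewrite -ltnS; apply: leq_trans hn.
  by apply: ltn_sub2l.
- rewrite subnS; apply: leq_trans ls; rewrite prednK ?subn_gt0 //; exact: leq_subr.
Qed.

(** In degree 0 the inequality must be strict: the cokernel has a resolution of length [l] and keeps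
    depth [size s - l], which has to be positive. *)
Lemma tors_bdry0 : (l < size s)%N -> (forall e, exact_at e) -> forall z : C 0, tors z -> bdry z.
Proof.
move=> ls ex z; apply: tors_bdry => //; last by rewrite subn0.
exact: leq_trans ls.
Qed.
End Acyclicity.

(** * Exterior algebra and Koszul strands *)

Section ExteriorAlgebra.
Variables (R : comNzRingType).
Implicit Types (B : lmodType R) (u v w : nat -> R) (m k r : nat).

(* The exterior algebra on [m] generators with coefficients in [B]: the pair
   [(f, g)] stands for [f + e_0 /\ g], where [f] and [g] do not involve [e_0]. *)
Fixpoint ext m B : lmodType R := if m is m'.+1 then (ext m' B * ext m' B)%type else B.

Definition shift v : nat -> R := fun j => v j.+1.

(** Contraction against the linear form [v]; [wd] below is exterior product by the vector [v] on the
    left. The minus signs come from passing [e_0]. *)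
Fixpoint ct B m v : ext m B -> ext m B :=
  match m return ext m B -> ext m B with
  | 0 => fun _ => 0
  | m'.+1 => fun x => (ct (shift v) x.1 + v 0%N *: x.2, - ct (shift v) x.2)
  end.

Fixpoint wd B m v : ext m B -> ext m B :=
  match m return ext m B -> ext m B with
  | 0 => fun _ => 0
  | m'.+1 => fun x => (wd (shift v) x.1, v 0%N *: x.1 - wd (shift v) x.2)
  end.

Fixpoint emap B B' (f : {linear B -> B'}) m : ext m B -> ext m B' :=
  match m return ext m B -> ext m B' with
  | 0 => f
  | m'.+1 => fun x => (emap f x.1, emap f x.2)
  end.

(** [vac] embeds the coefficients as the part of exterior degree 0, and [vc] reads that part off. *)
Fixpoint vac B m : B -> ext m B :=
  match m return B -> ext m B with 0 => fun b => b | m'.+1 => fun b => (vac m' b, 0) end.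

Fixpoint vc B m : ext m B -> B :=
  match m return ext m B -> B with 0 => fun b => b | m'.+1 => fun x => vc x.1 end.

Lemma ext_eq B m (x y : ext m.+1 B) : x.1 = y.1 -> x.2 = y.2 -> x = y.
Proof. by case: x y => [a b] [c d] /= -> ->. Qed.

Fact ct_linear B m v : linear (@ct B m v).
Proof.
elim: m v => [|m IH] v a x y; first by rewrite /= scaler0 addr0.
apply: ext_eq; rewrite /= !IH.
  by rewrite !scalerDr !scalerA [v 0%N * a]mulrC addrACA.
by rewrite opprD scalerN.
Qed.
HB.instance Definition _ B m v := GRing.isLinear.Build R _ _ _ (@ct B m v) (ct_linear v).

Fact wd_linear B m v : linear (@wd B m v).
Proof.
elim: m v => [|m IH] v a x y; first by rewrite /= scaler0 addr0.
apply: ext_eq; rewrite /= !IH //.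
by rewrite opprD !scalerDr !scalerN !scalerA [v 0%N * a]mulrC addrACA.
Qed.
HB.instance Definition _ B m v := GRing.isLinear.Build R _ _ _ (@wd B m v) (wd_linear v).

Fact emap_linear B B' (f : {linear B -> B'}) m : linear (@emap B B' f m).
Proof.
elim: m => [|m IH] a x y; first exact: linearP.
by apply: ext_eq; rewrite /= !IH.
Qed.
HB.instance Definition _ B B' (f : {linear B -> B'}) m := GRing.isLinear.Build R _ _ _ (@emap B B' f m) (@emap_linear B B' f m).

Fact vac_linear B m : linear (@vac B m).
Proof. by elim: m => [|m IH] a x y //; apply: ext_eq; rewrite /= ?IH // scaler0 addr0. Qed.
HB.instance Definition _ B m := GRing.isLinear.Build R _ _ _ (@vac B m) (@vac_linear B m).

Fact vc_linear B m : linear (@vc B m).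
Proof. by elim: m => [|m IH] a x y //; rewrite /= IH. Qed.
HB.instance Definition _ B m := GRing.isLinear.Build R _ _ _ (@vc B m) (@vc_linear B m).

Lemma ctD B m v (x y : ext m B) : ct v (x + y) = ct v x + ct v y. Proof. exact: linearD. Qed.
Lemma ctN B m v (x : ext m B) : ct v (- x) = - ct v x. Proof. exact: linearN. Qed.
Lemma ctZ B m v a (x : ext m B) : ct v (a *: x) = a *: ct v x. Proof. exact: linearZ_LR. Qed.
Lemma ct00 B m v : ct v (0 : ext m B) = 0. Proof. exact: linear0. Qed.
Lemma wdD B m v (x y : ext m B) : wd v (x + y) = wd v x + wd v y. Proof. exact: linearD. Qed.
Lemma wdN B m v (x : ext m B) : wd v (- x) = - wd v x. Proof. exact: linearN. Qed.
Lemma wdZ B m v a (x : ext m B) : wd v (a *: x) = a *: wd v x. Proof. exact: linearZ_LR. Qed.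
Lemma wd00 B m v : wd v (0 : ext m B) = 0. Proof. exact: linear0. Qed.
Lemma emapD B B' (f : {linear B -> B'}) m (x y : ext m B) : emap f (x + y) = emap f x + emap f y.
Proof. exact: linearD. Qed.
Lemma emapN B B' (f : {linear B -> B'}) m (x : ext m B) : emap f (- x) = - emap f x.
Proof. exact: linearN. Qed.
Lemma emapZ B B' (f : {linear B -> B'}) m a (x : ext m B) : emap f (a *: x) = a *: emap f x.
Proof. exact: linearZ_LR. Qed.
Lemma emap00 B B' (f : {linear B -> B'}) m : emap f (0 : ext m B) = 0.
Proof. exact: linear0. Qed.

Definition dot m v u := \sum_(j < m) v j * u j.

Lemma dotS m v u : dot m.+1 v u = v 0%N * u 0%N + dot m (shift v) (shift u).
Proof. by rewrite /dot big_ord_recl. Qed.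

Lemma ctC B m v w (x : ext m B) : ct v (ct w x) = - ct w (ct v x).
Proof.
elim: m v w x => [|m IH] v w x; first by rewrite /= oppr0.
apply: ext_eq; rewrite /=; last by rewrite !ctN opprK IH opprK.
rewrite !ctD !ctZ IH !scalerN !opprD opprK -!addrA; congr (_ + _).
by rewrite addrC.
Qed.

Lemma ct2 B m v (x : ext m B) : ct v (ct v x) = 0.
Proof.
elim: m v x => [|m IH] v x //; apply: ext_eq; rewrite /=; last by rewrite ctN IH !oppr0.
by rewrite ctD IH ctZ add0r scalerN subrr.
Qed.

Lemma wdC B m v w (x : ext m B) : wd v (wd w x) = - wd w (wd v x).
Proof.
elim: m v w x => [|m IH] v w x; first by rewrite /= oppr0.
apply: ext_eq; rewrite /=; first exact: IH.
by rewrite !wdD !wdN !wdZ IH !opprD !opprK addrCA.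
Qed.

Lemma ct_wd B m v u (x : ext m B) : ct v (wd u x) = dot m v u *: x - wd u (ct v x).
Proof.
elim: m v u x => [|m IH] v u x; first by rewrite /= /dot big_ord0 scale0r subr0.
rewrite dotS; apply: ext_eq; rewrite /=.
  rewrite IH wdD wdZ scalerDl scalerDr scalerN scalerA opprD.
  by rewrite addrACA; congr (_ + _); rewrite addrC.
rewrite ctD ctN ctZ IH wdN scalerDl scalerDr scalerA [u 0%N * _]mulrC !opprD !opprK.
set a := u 0%N *: _; set b := dot _ _ _ *: _; set c := wd _ _; set d := _ *: x.2.
by rewrite !addrA; congr (_ - c); rewrite [RHS]addrAC [d + b]addrC addrK addrC.
Qed.

Lemma emap_ct B B' (f : {linear B -> B'}) m v (x : ext m B) :
  emap f (ct v x) = ct v (emap f x).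
Proof.
elim: m v x => [|m IH] v x; first exact: (linear0 f).
by apply: ext_eq; rewrite /= ?emapD ?emapN ?emapZ !IH.
Qed.

Lemma emap_wd B B' (f : {linear B -> B'}) m v (x : ext m B) :
  emap f (wd v x) = wd v (emap f x).
Proof.
elim: m v x => [|m IH] v x; first exact: (linear0 f).
by apply: ext_eq; rewrite /= ?emapD ?emapN ?emapZ !IH.
Qed.

Lemma emap_comp B B' B'' (f : {linear B' -> B''}) (g : {linear B -> B'}) m (x : ext m B) :
  emap f (emap g x) = emap (lcomp f g) x.
Proof. by elim: m x => [|m IH] x //=; apply: ext_eq; rewrite /= IH. Qed.

Lemma emap_lin B B' (a : R) (f g h : {linear B -> B'}) m (x : ext m B) :
  (forall b, h b = a *: f b + g b) -> emap h x = a *: emap f x + emap g x.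
Proof. by move=> e; elim: m x => [|m IH] x //=; apply: ext_eq; rewrite /= IH. Qed.

Lemma ct_eq B m v w (x : ext m B) : (forall j, (j < m)%N -> v j = w j) -> ct v x = ct w x.
Proof.
elim: m v w x => [|m IH] v w x e //=.
have e' j : (j < m)%N -> shift v j = shift w j by move=> h; apply: e.
by apply: ext_eq; rewrite /= !(IH _ _ _ e') // e.
Qed.

Lemma ct_comb B m (a : R) v w w' (x : ext m B) :
  (forall j, (j < m)%N -> w' j = a * v j + w j) -> ct w' x = a *: ct v x + ct w x.
Proof.
elim: m v w w' x => [|m IH] v w w' x e /=; first by rewrite scaler0 addr0.
have e' j : (j < m)%N -> shift w' j = a * shift v j + shift w j by move=> h; apply: e.
apply: ext_eq; rewrite /= !(IH _ _ _ _ e') ?e //.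
  by rewrite scalerDl scalerDr scalerA addrACA.
by rewrite opprD scalerN.
Qed.

Definition unitv (j : nat) : nat -> R := fun k => (k == j)%:R.

Lemma ct0 B m (x : ext m B) : ct (fun _ => 0) x = 0.
Proof.
elim: m x => [|m IH] x //=; apply: ext_eq; rewrite /=.
  by rewrite [ct _ _]IH scale0r addr0.
by rewrite [ct _ _]IH oppr0.
Qed.

Lemma ct_unit B m v (x : ext m B) : ct v x = \sum_(j < m) v j *: ct (unitv j) x.
Proof.
rewrite (@ct_eq _ _ v (fun k => \sum_(j < m) v j * unitv j k)); last first.
  move=> j jm; rewrite (bigD1 (Ordinal jm)) //= /unitv eqxx mulr1 big1 ?addr0 // => i.
  by rewrite -val_eqE /= eq_sym => /negPf ->; rewrite mulr0.
elim: (index_enum _) => [|j l IH].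
  by rewrite big_nil (@ct_eq _ _ _ (fun _ => 0)) ?ct0 // => j _; rewrite big_nil.
by rewrite big_cons -IH; apply: ct_comb => k _; rewrite big_cons.
Qed.

Lemma dot_unit m v j : (j < m)%N -> dot m v (unitv j) = v j.
Proof.
move=> jm; rewrite /dot (bigD1 (Ordinal jm)) //= /unitv eqxx mulr1 big1 ?addr0 // => i.
by rewrite -val_eqE /= => /negPf ->; rewrite mulr0.
Qed.

Fixpoint hdeg B m k : ext m B -> Prop :=
  match m return ext m B -> Prop with
  | 0 => fun x => if k is 0 then True else x = 0
  | m'.+1 => fun x => hdeg k x.1 /\ (if k is k'.+1 then hdeg k' x.2 else x.2 = 0)
  end.

Lemma hdeg_closed B m k : subclosed (@hdeg B m k).
Proof.
elim: m k => [|m IH] k.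
  by case: k => [|k] /=; split=> // a x y -> ->; rewrite scaler0 addr0.
split=> /=.
  by split; [exact: (IH k).1|case: k => [|k] //; exact: (IH k).1].
move=> a x y [x1 x2] [y1 y2]; split; first exact: (IH k).2.
case: k x1 x2 y1 y2 => [|k] _ x2 _ y2; first by rewrite x2 y2 scaler0 addr0.
exact: (IH k).2.
Qed.

Lemma hdeg0 B m k : hdeg k (0 : ext m B). Proof. exact: (hdeg_closed B m k).1. Qed.
Lemma hdegD B m k (x y : ext m B) : hdeg k x -> hdeg k y -> hdeg k (x + y).
Proof. by move=> hx hy; rewrite -[x]scale1r; exact: (hdeg_closed B m k).2. Qed.
Lemma hdegZ B m k a (x : ext m B) : hdeg k x -> hdeg k (a *: x).
Proof. by move=> hx; rewrite -[_ *: _]addr0; apply: (hdeg_closed B m k).2 => //; exact: hdeg0. Qed.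
Lemma hdegN B m k (x : ext m B) : hdeg k x -> hdeg k (- x).
Proof. by rewrite -scaleN1r; exact: hdegZ. Qed.

Lemma ct_hdeg0 B m v (x : ext m B) : hdeg 0 x -> ct v x = 0.
Proof.
elim: m v x => [|m IH] v x // [x1 x2]; apply: ext_eq; rewrite /= x2.
  by rewrite IH // scaler0 addr0.
by rewrite ct00 oppr0.
Qed.

Lemma hdeg_ct B m k v (x : ext m B) : hdeg k.+1 x -> hdeg k (ct v x).
Proof.
elim: m k v x => [|m IH] k v x /=; first by case: k.
case=> h1 h2; split; first by apply: hdegD; [exact: IH|exact: hdegZ].
case: k h1 h2 => [|k] h1 h2; last by apply: hdegN; exact: IH.
by rewrite ct_hdeg0 ?oppr0.
Qed.

Lemma hdeg_wd B m k v (x : ext m B) : hdeg k x -> hdeg k.+1 (wd v x).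
Proof.
elim: m k v x => [|m IH] k v x //= [h1 h2]; split; first exact: IH.
apply: hdegD; first exact: hdegZ.
apply: hdegN; case: k h1 h2 => [|k] h1 h2; last exact: IH.
by rewrite h2 wd00; exact: hdeg0.
Qed.

Lemma hdeg_emap B B' (f : {linear B -> B'}) m k (x : ext m B) : hdeg k x -> hdeg k (emap f x).
Proof.
elim: m k x => [|m IH] k x /=; first by case: k => // k ->; rewrite linear0.
case=> h1 h2; split; first exact: IH.
by case: k h1 h2 => [|k] _ h2; [rewrite h2 emap00|exact: IH].
Qed.

Lemma hdeg_gt B m k (x : ext m B) : (m < k)%N -> hdeg k x -> x = 0.
Proof.
elim: m k x => [|m IH] [|k] x //= mk [h1 h2].
by apply: ext_eq; [apply: IH h1; exact: ltnW|exact: IH h2].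
Qed.

Lemma hdeg_vac B m b : hdeg 0 (@vac B m b).
Proof. by elim: m. Qed.

Lemma vac_vc B m (x : ext m B) : hdeg 0 x -> vac m (vc x) = x.
Proof. by elim: m x => [|m IH] x //= [h1 h2]; apply: ext_eq; rewrite /= ?IH. Qed.

Lemma vc_vac B m b : vc (@vac B m b) = b.
Proof. by elim: m. Qed.

Fixpoint prj B m k : ext m B -> ext m B :=
  match m return ext m B -> ext m B with
  | 0 => fun x => if k is 0 then x else 0
  | m'.+1 => fun x => (prj k x.1, if k is k'.+1 then prj k' x.2 else 0)
  end.
Fact prj_linear B m k : linear (@prj B m k).
Proof.
elim: m k => [|m IH] [|k] a x y //=; rewrite ?scaler0 ?addr0 //;
  by apply: ext_eq; rewrite /= ?IH // scaler0 addr0.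
Qed.
HB.instance Definition _ B m k := GRing.isLinear.Build R _ _ _ (@prj B m k) (@prj_linear B m k).

Lemma hdeg_prj B m k (x : ext m B) : hdeg k (prj k x).
Proof. by elim: m k x => [|m IH] [|k] x //=; split=> //; exact: IH. Qed.

Lemma prj_id B m k (x : ext m B) : hdeg k x -> prj k x = x.
Proof.
by elim: m k x => [|m IH] [|k] x //= [h1 h2]; apply: ext_eq; rewrite /= ?IH.
Qed.

Fixpoint eall B (Q : B -> Prop) m : ext m B -> Prop :=
  match m return ext m B -> Prop with 0 => Q | m'.+1 => fun x => eall Q x.1 /\ eall Q x.2 end.

Lemma eall_closed B (Q : B -> Prop) m : subclosed Q -> subclosed (@eall B Q m).
Proof.
move=> [Q0 Qs]; elim: m => [|m [IH0 IHs]] //=; split=> //= a x y [x1 x2] [y1 y2].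
by split; exact: IHs.
Qed.

Lemma eall_lin B (Q : B -> Prop) m v (x : ext m B) : subclosed Q -> eall Q x ->
  eall Q (ct v x) /\ eall Q (wd v x).
Proof.
move=> hQ; elim: m v x => [|m IH] v x /=; first by split; exact: hQ.1.
case=> x1 x2; have [E0 Es] := eall_closed m hQ.
have EZ a (y : ext m B) : eall Q y -> eall Q (a *: y).
  by move=> hy; rewrite -[_ *: _]addr0; exact: Es.
have EN (y : ext m B) : eall Q y -> eall Q (- y) by rewrite -scaleN1r; exact: EZ.
have ED (y z : ext m B) : eall Q y -> eall Q z -> eall Q (y + z).
  by move=> hy hz; rewrite -[y]scale1r; exact: Es.
have [a1 b1] := IH (shift v) _ x1; have [a2 b2] := IH (shift v) _ x2.
by split; split=> //; rewrite ?[X in X.1]/= ?[X in X.2]/=; auto.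
Qed.

Lemma eall_prj B (Q : B -> Prop) m k (x : ext m B) : subclosed Q -> eall Q x -> eall Q (prj k x).
Proof.
move=> hQ; elim: m k x => [|m IH] [|k] x //=; first by move=> _; exact: hQ.1.
  by case=> x1 _; split; [exact: IH|exact: (eall_closed m hQ).1].
by case=> x1 x2; split; exact: IH.
Qed.

Lemma eall_emap B B' (Q : B -> Prop) (Q' : B' -> Prop) (f : {linear B -> B'}) m (x : ext m B) :
  (forall b, Q b -> Q' (f b)) -> eall Q x -> eall Q' (emap f x).
Proof.
by move=> h; elim: m x => [|m IH] x /=; [exact: h|case=> x1 x2; split; exact: IH].
Qed.

Lemma emap_eq B B' (Q : B -> Prop) (f g : {linear B -> B'}) m (x : ext m B) :
  (forall b, Q b -> f b = g b) -> eall Q x -> emap f x = emap g x.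
Proof.
by move=> h; elim: m x => [|m IH] x /=; [exact: h|case=> x1 x2; apply: ext_eq; exact: IH].
Qed.

(** The orders in [ctf] and [wdf] are matched, [vs ord0] contracting first and [us ord0] standing
    leftmost, so that [ctf_wdf] is a determinant without sign. *)
Fixpoint ctf B m r : ('I_r -> nat -> R) -> ext m B -> ext m B :=
  match r return ('I_r -> nat -> R) -> ext m B -> ext m B with
  | 0 => fun _ x => x
  | r'.+1 => fun vs x => ctf (fun i => vs (lift ord0 i)) (ct (vs ord0) x)
  end.

Fixpoint wdf B m r : ('I_r -> nat -> R) -> ext m B -> ext m B :=
  match r return ('I_r -> nat -> R) -> ext m B -> ext m B with
  | 0 => fun _ x => x
  | r'.+1 => fun us x => wd (us ord0) (wdf (fun i => us (lift ord0 i)) x)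
  end.

Fact ctf_linear B m r vs : linear (@ctf B m r vs).
Proof. by elim: r vs => [|r IH] vs a x y //=; rewrite linearP IH. Qed.
HB.instance Definition _ B m r vs := GRing.isLinear.Build R _ _ _ (@ctf B m r vs) (ctf_linear vs).

Fact wdf_linear B m r us : linear (@wdf B m r us).
Proof. by elim: r us => [|r IH] us a x y //=; rewrite IH linearP. Qed.
HB.instance Definition _ B m r us := GRing.isLinear.Build R _ _ _ (@wdf B m r us) (wdf_linear us).

Lemma hdeg_ctf B m r k vs (x : ext m B) : hdeg (r + k) x -> hdeg k (@ctf B m r vs x).
Proof. by elim: r vs x => [|r IH] vs x //= h; apply/IH/hdeg_ct. Qed.

Lemma hdeg_wdf B m r k us (x : ext m B) : hdeg k x -> hdeg (r + k) (@wdf B m r us x).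
Proof. by elim: r us => [|r IH] us //= h; apply/hdeg_wd/IH. Qed.

Lemma ctf_eq B m r vs ws (x : ext m B) : vs =1 ws -> @ctf B m r vs x = ctf ws x.
Proof. by elim: r vs ws x => [|r IH] vs ws x e //=; rewrite e; apply: IH => i; exact: e. Qed.

Lemma wdf_eq B m r vs ws (x : ext m B) : vs =1 ws -> @wdf B m r vs x = wdf ws x.
Proof.
by elim: r vs ws x => [|r IH] vs ws x e //=; rewrite e; congr wd; apply: IH => i; exact: e.
Qed.

Lemma ct_ctf B m r vs v (x : ext m B) : ct v (@ctf B m r vs x) = (-1) ^+ r *: ctf vs (ct v x).
Proof.
elim: r vs x => [|r IH] vs x /=; first by rewrite expr0 scale1r.
by rewrite IH ctC linearN exprS -scaleN1r scalerA mulrC.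
Qed.

Lemma wdf_linear0 B m r us : @wdf B m r us 0 = 0. Proof. exact: linear0. Qed.

Lemma ctf_first B m r (vs : 'I_r.+1 -> nat -> R) (x : ext m B) :
  ctf vs x = (-1) ^+ r *: ct (vs ord0) (ctf (fun i => vs (lift ord0 i)) x).
Proof. by rewrite ct_ctf scalerA -exprMn mulrNN mulr1 expr1n scale1r. Qed.

(** Leibniz rule for a contraction of a product. The inner match only makes the sum meaningful for
    [r = 0], where there is no vector to leave out. *)
Lemma ct_wdf B m r v (us : 'I_r -> nat -> R) (x : ext m B) :
  ct v (wdf us x) = (-1) ^+ r *: wdf us (ct v x) +
    \sum_(b < r) ((-1) ^+ b * dot m v (us b)) *:
       (if r is r'.+1 return ('I_r -> nat -> R) -> 'I_r -> ext m B
        then fun us b => wdf (fun i => us (lift b i)) x else fun _ _ => 0) us b.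
Proof.
elim: r us => [|r IH] us; first by rewrite expr0 scale1r big_ord0 addr0.
rewrite big_ord_recl /= ct_wd IH wdD opprD wdZ expr0 mul1r addrCA.
rewrite exprS mulN1r scaleNr; congr (_ + _); congr (_ + _).
rewrite (linear_sum (@wd B m (us ord0))) -sumrN; apply: eq_bigr => b _.
case: r us b {IH} => [|r] us b; first by case: b.
rewrite (linearZ_LR (@wd B m (us ord0))) /= -scaleNr /bump leq0n add1n exprS mulN1r mulNr; congr (_ *: _).
rewrite /= (_ : lift (lift ord0 b) ord0 = ord0); last exact: val_inj.
congr wd; apply: wdf_eq => i; congr us; apply: val_inj.
by rewrite /= /bump /= !add1n ltnS; case: leqP.
Qed.

(** A Cramer rule modulo [S]: by expansion along the first row, contracting with [r] forms and
    multiplying back by [r] vectors is multiplication by the determinant of their pairings. The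
    bound on [r] keeps [wdf us y] in degree [k.+1], where [S] absorbs its contraction. *)
Lemma wdf_ctf B m r k (S : ext m B -> Prop) (vs us : 'I_r -> nat -> R) (x : ext m B) :
  subclosed S -> (forall a y, hdeg k.+1 y -> S (ct (vs a) y)) -> hdeg k x -> (r <= k.+1)%N ->
  S (wdf us (ctf vs x) - \det (\matrix_(a, b) dot m (vs a) (us b)) *: x).
Proof.
move=> [S0 Sl]; have SZ a y : S y -> S (a *: y).
  by move=> h; rewrite -[_ *: _]addr0; apply: Sl.
elim: r vs us => [|r IH] vs us hS hx rk.
  by rewrite det_mx00 scale1r subrr.
have SD y1 y2 : S y1 -> S y2 -> S (y1 + y2) by move=> h h'; rewrite -[y1]scale1r; apply: Sl.
set vs' := fun i => vs (lift ord0 i); set y := ctf vs' x.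
have Ey : ctf vs x = (-1) ^+ r *: ct (vs ord0) y by rewrite ctf_first.
have hy : S (ct (vs ord0) (wdf us y)).
  apply: hS; have -> : k.+1 = (r.+1 + (k - r))%N by rewrite addSn subnKC // -ltnS.
  by apply: hdeg_wdf; apply: hdeg_ctf; rewrite subnKC // -ltnS.
have -> : wdf us (ctf vs x) = \sum_(b < r.+1)
    ((-1) ^+ b * dot m (vs ord0) (us b)) *: wdf (fun i => us (lift b i)) y
    - ct (vs ord0) (wdf us y).
  rewrite ct_wdf Ey opprD addrC -addrA addNr addr0.
  by rewrite [wdf us _](linearZ_LR (@wdf B m r.+1 us)) exprS mulN1r scaleNr opprK.
rewrite addrAC; apply: (SD); last by rewrite -scaleN1r; apply: SZ.
rewrite (expand_det_row _ ord0) scaler_suml -sumrB.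
apply: (big_ind S S0 SD) => b _; rewrite mxE /cofactor add0n.
rewrite [X in _ - X *: _]mulrCA mulrA -[X in _ - X]scalerA -scalerBr; apply: SZ.
have -> : row' ord0 (col' b (\matrix_(a, b) dot m (vs a) (us b)))
    = \matrix_(a, c) dot m (vs' a) (us (lift b c)) by apply/matrixP => i j; rewrite !mxE.
by apply: IH => //; [move=> a; exact: hS|exact: ltnW].
Qed.

Lemma ctf_wdf B m r (vs us : 'I_r -> nat -> R) (b : B) :
  ctf vs (wdf us (vac m b)) = \det (\matrix_(a, c) dot m (vs a) (us c)) *: vac m b.
Proof.
elim: r vs us => [|r IH] vs us; first by rewrite det_mx00 scale1r.
rewrite /= -[ct _ _]/(ct (vs ord0) (wdf us (vac m b))) ct_wdf.
rewrite [ct _ (vac m b)]ct_hdeg0; last exact: hdeg_vac.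
rewrite wdf_linear0 scaler0 add0r (linear_sum (ctf _)) (expand_det_row _ ord0) scaler_suml.
apply: eq_bigr => c _; rewrite (linearZ_LR (ctf _)) /= IH scalerA; congr (_ *: _).
rewrite mxE /cofactor add0n [in RHS]mulrCA mulrA; congr (_ * \det _).
by apply/matrixP => i j; rewrite !mxE.
Qed.

Lemma ctf_ct B m r (vs : 'I_r -> nat -> R) (i : 'I_r) (x : ext m B) : ctf vs (ct (vs i) x) = 0.
Proof.
elim: r vs i x => [|r IH] vs i x; first by case: i.
case: (unliftP ord0 i) => [j|] ->; rewrite /=; last by rewrite ct2 (linear0 (ctf _)).
by rewrite ctC (linearN (ctf _)) [X in - X](IH (fun i => vs (lift ord0 i)) j) oppr0.
Qed.

Lemma ctf_lift B m r (vs : 'I_r.+1 -> nat -> R) (i : 'I_r.+1) (x : ext m B) :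
  ctf vs x = (-1) ^+ i *: ctf (fun a => vs (lift i a)) (ct (vs i) x).
Proof.
elim: r vs i x => [|r IH] vs i x; first by rewrite (ord1 i) expr0 scale1r.
case: (unliftP ord0 i) => [j|] ->; last by rewrite expr0 scale1r.
rewrite [LHS]/= -[ctf _ _]/(ctf (fun a => vs (lift ord0 a)) (ct (vs ord0) x)) (IH _ j).
rewrite lift0 exprS mulN1r scaleNr -scalerN; congr (_ *: _).
rewrite ctC (linearN (ctf _)) /=; congr (- _).
rewrite (_ : lift (lift ord0 j) ord0 = ord0); last exact: val_inj.
apply: ctf_eq => a; congr vs; apply: val_inj.
by rewrite /= /bump /= !add1n ltnS; case: leqP.
Qed.
End ExteriorAlgebra.

Section FreeExterior.
Variable R : comNzRingType.

Lemma eall_true (B : lmodType R) m (x : ext m B) : eall (fun=> True) x.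
Proof. by elim: m x => //= m IH x; split. Qed.

Lemma ffunE_sum (T : finType) (f : {ffun T -> R^o}) :
  f = \sum_x f x *: [ffun y => (y == x)%:R : R^o].
Proof.
apply/ffunP => y; rewrite sum_ffunE (bigD1 y) //= !ffunE eqxx /= big1 => [|x].
  by rewrite addr0 [_ *: _]mulr1.
by rewrite !ffunE eq_sym => /negPf ->; rewrite [_ *: _]mulr0.
Qed.

Lemma ffun_projective (T : finType) : projective {ffun T -> R^o}.
Proof.
move=> V C p f sp.
have [g hg] := ex_choice (fun x : T => sp (f [ffun y => (y == x)%:R : R^o])).
have [h hh] : exists h : {linear {ffun T -> R^o} -> V}, forall u, h u = \sum_x (u x : R) *: g x.
  apply: ex_linear => a u v; rewrite scaler_sumr -big_split; apply: eq_bigr => x _.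
  by rewrite !ffunE scalerDl scalerA.
exists h => u; rewrite hh {2}[u]ffunE_sum !linear_sum; apply: eq_bigr => x _.
by rewrite !linearZ_LR hg.
Qed.

Lemma triv_sum (P : chain R) q (N : lmodType R) (T : Type) (s : seq T) (F : T -> {linear P q -> N})
    (f : {linear P q -> N}) :
  (forall x, f x = \sum_(i <- s) F i x) -> (forall i, triv (F i)) -> @triv R P q N f.
Proof.
elim: s f => [|i s IH] f e h.
  by apply: triv_ext (triv_zero P q N) => x; rewrite e big_nil.
have [g hg] : exists g : {linear P q -> N}, forall x, g x = \sum_(i <- s) F i x.
  apply: ex_linear => a x y; rewrite scaler_sumr -big_split; apply: eq_bigr => j _.
  by rewrite linearP.
apply: (triv_lin (a := 1) _ (h i) (IH g hg h)) => x.
by rewrite e big_cons scale1r hg.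
Qed.

Lemma hv_ffun (P : chain R) q (N : lmodType R) (T : finType) : hv P q N -> hv P q {ffun T -> N}.
Proof.
move=> hN f cf.
have [i hi] : exists i : T -> {linear N -> {ffun T -> N}}, forall x y z,
    i x y z = if z == x then y else 0.
  apply: (@ex_choice _ _ (fun x (i : {linear N -> {ffun T -> N}}) => forall y z,
    i y z = if z == x then y else 0)) => x.
  have [i hi] : exists i : {linear N -> {ffun T -> N}},
      forall y, i y = [ffun z => if z == x then y else 0].
    apply: ex_linear => a y y'; apply/ffunP => z; rewrite !ffunE.
    by case: eqP; rewrite ?scaler0 ?addr0.
  by exists i => y z; rewrite hi ffunE.
have [v hv'] : exists v : T -> {linear {ffun T -> N} -> N}, forall x u, v x u = u x.
  apply: (@ex_choice _ _ (fun x (v : {linear {ffun T -> N} -> N}) => forall u, v u = u x)) => x.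
  by apply: ex_linear => a y y'; rewrite !ffunE.
apply: (@triv_sum _ _ _ _ (index_enum T) (fun x => lcomp (i x) (lcomp (v x) f))) => x.
  apply/ffunP => z; rewrite sum_ffunE (bigD1 z) //= hi eqxx hv' big1 ?addr0 // => y.
  by rewrite hi eq_sym => /negPf ->.
by apply: triv_comp; apply: hN => y /=; rewrite cf linear0.
Qed.

Lemma ext_projective m (B : lmodType R) : projective B -> projective (ext m B).
Proof. by move=> hB; elim: m => [|m IH] //=; exact: prod_projective. Qed.

Lemma hv_ext (P : chain R) q m (B : lmodType R) : hv P q B -> hv P q (ext m B).
Proof. by move=> hB; elim: m => [|m IH] //=; exact: hv_prod. Qed.
End FreeExterior.

(** * Strands of the Koszul complex and the Weyl algebra homotopy *)

Section Strands.
Variables (R : comNzRingType) (t m : nat) (M : 'M[R]_(t, m)).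
Local Notation D := {mpoly R[t]}.
Local Notation W := (ext m D).

(** A row as a function on [nat], the shape that [ct] and [dot] expect; the default 0 is harmless
    because both read only the first [m] values. *)
Definition rw (i : 'I_t) : nat -> R := fun j => if insub j is Some k then M i k else 0.

Lemma rwE i (j : 'I_m) : rw i j = M i j.
Proof. by rewrite /rw valK. Qed.

Lemma dot_rw i (j : 'I_m) : dot m (rw i) (unitv R j) = M i j.
Proof. by rewrite dot_unit ?rwE. Qed.

Fact dY_linear i : linear (mderiv i : D -> D). Proof. exact: linearP. Qed.
Definition dY i : {linear D -> D} := mklinear (dY_linear i).
Fact mX_linear i : linear (fun p : D => 'X_i * p).
Proof. by move=> a p q; rewrite mulrDr scalerAr. Qed.
Definition mX i : {linear D -> D} := mklinear (mX_linear i).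

(* The differential of the Koszul complex of the linear forms [sum_i M i j * y_i],
   where [y_i] acts on [D] as the derivation with respect to the [i]-th variable. *)
Definition dl (w : W) : W := \sum_i ct (rw i) (emap (dY i) w).
Fact dl_linear : linear dl.
Proof.
move=> a x y; rewrite /dl scaler_sumr -big_split; apply: eq_bigr => i _.
by rewrite /= emapD emapZ ctD ctZ.
Qed.
HB.instance Definition _ := GRing.isLinear.Build R _ _ _ dl dl_linear.

Lemma alt_sum (V : zmodType) k (F : 'I_k -> 'I_k -> V) :
  (forall i, F i i = 0) -> (forall i j, F i j = - F j i) -> \sum_i \sum_j F i j = 0.
Proof.
elim: k F => [|k IH] F F0 FN; first by rewrite big_ord0.
rewrite big_ord_recl big_ord_recl F0 add0r.
rewrite [X in _ + X](eq_bigr (fun i => - F ord0 (lift ord0 i) +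
   \sum_j F (lift ord0 i) (lift ord0 j))); last by move=> i _; rewrite big_ord_recl FN.
rewrite big_split /= sumrN addrA subrr add0r.
by apply: IH => [i|i j]; [exact: F0|exact: FN].
Qed.

Lemma dlK w : dl (dl w) = 0.
Proof.
pose F i j := ct (rw i) (ct (rw j) (emap (dY i) (emap (dY j) w))).
transitivity (\sum_i \sum_j F i j).
  rewrite [LHS]/dl; apply: eq_bigr => i _; rewrite /dl (linear_sum (@emap R D D (dY i) m)).
  rewrite (linear_sum (ct (rw i))); apply: eq_bigr => j _.
  by rewrite /F; congr (ct _ _); exact: emap_ct.
apply: alt_sum => [i|i j]; first exact: ct2.
rewrite /F ctC; congr (- ct _ (ct _ _)).
by rewrite !emap_comp; apply: (emap_eq (Q := fun=> True)) => [p _|];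
   [exact: mderiv_comm|exact: eall_true].
Qed.

Definition cdeg e (p : D) := forall k, mdeg k != e -> p@_k = 0.

Lemma cdeg_closed e : subclosed (cdeg e).
Proof.
split=> [k _|a p q hp hq k hk]; first exact: mcoeff0.
by rewrite mcoeffD mcoeffZ hp // hq // mulr0 addr0.
Qed.

Lemma cdeg_dY i e p : cdeg e.+1 p -> cdeg e (dY i p).
Proof.
move=> hp k hk; rewrite /= mcoeff_deriv hp ?mul0rn // mdegD mdeg1 addn1.
by rewrite eqSS.
Qed.

Lemma cdeg_dY0 i p : cdeg 0 p -> dY i p = 0.
Proof.
move=> hp; apply/mpolyP => k; rewrite /= mcoeff_deriv mcoeff0 hp ?mul0rn //.
by rewrite mdegD mdeg1 addn1.
Qed.

Lemma cdeg_mX i e p : cdeg e p -> cdeg e.+1 (mX i p).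
Proof.
move=> hp k hk; rewrite /= [p]mpolyE mulr_sumr linear_sum /= big_seq big1 // => l hl.
rewrite -scalerAr mcoeffZ -mpolyXD mcoeffX; case: eqP => [e1|]; last by rewrite mulr0.
rewrite hp ?mul0r //; apply: contraNneq hk => <-.
by rewrite -e1 mdegD mdeg1 add1n.
Qed.

Lemma euler e p : cdeg e p -> \sum_i mX i (dY i p) = e%:R *: p.
Proof.
move=> hp.
have [f hf] : exists f : {linear D -> D}, forall q, f q = \sum_i mX i (dY i q).
  apply: ex_linear => a x y; rewrite scaler_sumr -big_split; apply: eq_bigr => i _.
  by rewrite /= mderivD mderivZ mulrDr scalerAr.
have fX k : f 'X_[k] = (mdeg k)%:R *: 'X_[k].
  rewrite hf mdegE natr_sum scaler_suml; apply: eq_bigr => i _.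
  rewrite /= mderivX -scalerAr -mpolyXD.
  case: (posnP (k i)) => [->|ki]; first by rewrite !scale0r.
  congr (_ *: 'X_[_]); apply/mnmP => j; rewrite mnmDE mnmBE mnm1E.
  by case: eqP => [<-|]; rewrite ?subn0 // subnKC.
rewrite -hf [in LHS](mpolyE p) [in RHS](mpolyE p) linear_sum scaler_sumr big_seq [RHS]big_seq.
apply: eq_bigr => k hk; rewrite linearZ_LR fX.
have -> : mdeg k = e.
  by apply/eqP; apply: contraTT hk => /hp h0; rewrite mcoeff_msupp h0 eqxx.
by rewrite !scalerA mulrC.
Qed.

(** The commutation relation of the Weyl algebra; its Kronecker term produces the operators [Pr j]
    in the homotopy formula. *)
Lemma dY_mX i j p : dY i (mX j p) = (i == j)%:R *: p + mX j (dY i p).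
Proof.
rewrite /= mderivM mderivX mnm1E eq_sym; case: eqP => [->|_].
  have -> : (U_(j) - U_(j))%MM = 0%MM :> 'X_{1..t} by apply/mnmP => k; rewrite mnmBE mnm0E subnn.
  by rewrite mpolyX0 -scalerAl mul1r.
by rewrite !scale0r mul0r !add0r.
Qed.

(** The differential lowers exterior and polynomial degree together, so their difference [s] labels
    a strand. With [t] rows, strand [t] continued by [omega] is the Eagon-Northcott complex, and
    strand [t - 1] has cokernel [L]. *)
Definition St s e (w : W) := hdeg (s + e) w /\ eall (cdeg e) w.

Lemma St_closed s e : subclosed (St s e).
Proof.
have [h0 hl] := hdeg_closed D m (s + e); have [e0 el] := eall_closed m (cdeg_closed e).
by split=> // a x y [x1 x2] [y1 y2]; split; auto.
Qed.

Lemma St_comb s e a x y : St s e x -> St s e y -> St s e (a *: x + y).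
Proof. exact: (St_closed s e).2. Qed.
Lemma St0 s e : St s e 0. Proof. exact: (St_closed s e).1. Qed.
Lemma StZ s e a x : St s e x -> St s e (a *: x).
Proof. by move=> h; rewrite -[_ *: _]addr0; apply: St_comb => //; exact: St0. Qed.
Lemma StD s e x y : St s e x -> St s e y -> St s e (x + y).
Proof. by move=> h h'; rewrite -[x]scale1r; exact: St_comb. Qed.
Lemma St_sum s e (T : Type) (l : seq T) (F : T -> W) :
  (forall i, St s e (F i)) -> St s e (\sum_(i <- l) F i).
Proof. by move=> h; elim/big_ind: _ => [|x y|i _]; [exact: St0|exact: StD|exact: h]. Qed.

Lemma St_dl s e w : St s e.+1 w -> St s e (dl w).
Proof.
case=> h1 h2; apply: St_sum => i; split.
  by apply: hdeg_ct; rewrite -addnS; exact: hdeg_emap.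
apply: (eall_lin _ (cdeg_closed e) _).1.
by apply: eall_emap h2 => p; exact: cdeg_dY.
Qed.

Section Homotopy.
Variables (v : 'I_t -> nat -> R) (De : R).
Hypothesis vE : forall i j, dot m (rw i) (v j) = De * (i == j)%:R.

(** With [v] dual to the rows up to the factor [De], this is a candidate for a contracting homotopy;
    its defect is the operator [Qr]. *)
Definition hl (w : W) : W := \sum_i wd (v i) (emap (mX i) w).
Definition Pr i (w : W) : W := wd (v i) (ct (rw i) w).
Definition Qr (w : W) : W := \sum_i Pr i w.

Fact Pr_linear i : linear (Pr i).
Proof. by move=> a x y; rewrite /Pr ctD ctZ wdD wdZ. Qed.
HB.instance Definition _ i := GRing.isLinear.Build R _ _ _ (Pr i) (Pr_linear i).
Fact Qr_linear : linear Qr.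
Proof.
move=> a x y; rewrite /Qr scaler_sumr -big_split; apply: eq_bigr => i _; exact: linearP.
Qed.
HB.instance Definition _ := GRing.isLinear.Build R _ _ _ Qr Qr_linear.

Lemma Pr2 i w : Pr i (Pr i w) = De *: Pr i w.
Proof. by rewrite /Pr ct_wd vE eqxx mulr1 ct2 wd00 subr0 wdZ. Qed.

Lemma PrC i j w : Pr i (Pr j w) = Pr j (Pr i w).
Proof.
have [->//|ij] := eqVneq i j; have ji : (j == i) = false by rewrite eq_sym (negPf ij).
rewrite /Pr !ct_wd !vE (negPf ij) ji mulr0 !scale0r !sub0r !wdN; congr (- _).
by rewrite wdC ctC !wdN opprK.
Qed.

Lemma St_Pr s e i w : St s e w -> St s e (Pr i w).
Proof.
case=> h1 h2; have [h3 _] := eall_lin (rw i) (cdeg_closed e) h2.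
split; last exact: (eall_lin (v i) (cdeg_closed e) h3).2.
rewrite /Pr; case: (s + e)%N h1 => [|k] h1; first by rewrite ct_hdeg0 // wd00; exact: hdeg0.
by apply: hdeg_wd; exact: hdeg_ct.
Qed.

Lemma St_Qr s e w : St s e w -> St s e (Qr w).
Proof. by move=> h; apply: St_sum => i; exact: St_Pr. Qed.

Lemma St_hl s e w : St s e w -> St s e.+1 (hl w).
Proof.
case=> h1 h2; apply: St_sum => i; split.
  by rewrite addnS; apply: hdeg_wd; exact: hdeg_emap.
by apply: (eall_lin _ (cdeg_closed _) _).2; apply: eall_emap h2 => p; exact: cdeg_mX.
Qed.

(** In [dl hl + hl dl] the terms with different indices cancel. The diagonal ones give [De * t]
    minus [Qr] from the Weyl relation, and [De * e] from Euler's formula. *)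
Lemma dl_hl s e w : St s e w -> dl w = 0 -> Qr w = (De * (e + t)%:R) *: w - dl (hl w).
Proof.
move=> [_ he] w0; have hl0 : hl (dl w) = 0.
  by rewrite w0 /hl big1 // => i _; rewrite emap00 wd00.
suff E : dl (hl w) + hl (dl w) = (De * (e + t)%:R) *: w - Qr w.
  by move: E; rewrite hl0 addr0 => ->; rewrite opprB addrC subrK.
have E1 : dl (hl w) = \sum_j \sum_i ct (rw i) (wd (v j) (emap (lcomp (dY i) (mX j)) w)).
  rewrite exchange_big /= [LHS]/dl; apply: eq_bigr => i _.
  rewrite /hl (linear_sum (@emap R D D (dY i) m)) (linear_sum (ct (rw i))); apply: eq_bigr => j _.
  by congr (ct _ _); rewrite -emap_comp; exact: emap_wd.
have E2 : hl (dl w) = \sum_j \sum_i wd (v j) (ct (rw i) (emap (lcomp (mX j) (dY i)) w)).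
  rewrite [LHS]/hl; apply: eq_bigr => j _.
  rewrite /dl (linear_sum (@emap R D D (mX j) m)) (linear_sum (wd (v j))); apply: eq_bigr => i _.
  by congr (wd _ _); rewrite -emap_comp; exact: emap_ct.
have E3 i j : ct (rw i) (wd (v j) (emap (lcomp (dY i) (mX j)) w)) +
    wd (v j) (ct (rw i) (emap (lcomp (mX j) (dY i)) w)) =
    (i == j)%:R *: (De *: w - Pr j w + De *: emap (lcomp (mX j) (dY j)) w).
  rewrite (@emap_lin _ _ _ (i == j)%:R (lid D) (lcomp (mX j) (dY i))); last exact: dY_mX.
  have -> : emap (lid D) w = w by elim: (m) (w) => [|k IH] x //; apply: ext_eq; rewrite /= IH.
  rewrite wdD wdZ ctD ctZ -!addrA [X in _ + X](_ : _ =
     (De * (i == j)%:R) *: emap (lcomp (mX j) (dY i)) w); last by rewrite ct_wd vE subrK.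
  have [->|_] := eqVneq i j; last by rewrite !mulr0 !scale0r addr0.
  by rewrite !scale1r mulr1 ct_wd vE eqxx mulr1 addrA.
rewrite E1 E2 -big_split /=.
have -> : \sum_j (\sum_i ct (rw i) (wd (v j) (emap (lcomp (dY i) (mX j)) w)) +
   \sum_i wd (v j) (ct (rw i) (emap (lcomp (mX j) (dY i)) w))) =
   \sum_j (De *: w - Pr j w + De *: emap (lcomp (mX j) (dY j)) w).
  apply: eq_bigr => j _; rewrite -big_split /=.
  under eq_bigr => i _ do rewrite E3.
  rewrite (bigD1 j) //= eqxx scale1r big1 ?addr0 // => i /negPf ->.
  by rewrite scale0r.
rewrite !big_split /= sumrN -/(Qr w) -[X in _ + X]scaler_sumr.
have -> : \sum_j emap (lcomp (mX j) (dY j)) w = e%:R *: w.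
  have [f hf] : exists f : {linear D -> D}, forall p, f p = \sum_j mX j (dY j p).
    apply: ex_linear => a x y; rewrite scaler_sumr -big_split; apply: eq_bigr => i _.
    by rewrite /= mderivD mderivZ mulrDr scalerAr.
  transitivity (emap f w).
    elim: (m) (w) => [|k IH] x /=; first by rewrite hf.
    by apply: ext_eq; rewrite /= -IH; elim/big_rec2: _ => //= i y1 y2 _ <-.
  rewrite (@emap_eq _ _ _ (cdeg e) f (lscale (lid D) e%:R)) //; last first.
    by move=> p hp; rewrite hf; exact: euler.
  by elim: (m) (w) => [|k IH] x //; apply: ext_eq; rewrite /= IH.
rewrite sumr_const card_ord natrD mulrDr scalerDl.
rewrite scalerA -[De *: w *+ t]scaler_nat scalerA [t%:R * De]mulrC.
set A := (De * e%:R) *: w; set B := (De * t%:R) *: w.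
by rewrite addrAC [B + A]addrC.
Qed.

Definition Ta a (w : W) : W := Qr w - (a%:R * De) *: w.
Fact Ta_linear a : linear (Ta a).
Proof.
move=> b x y; rewrite /Ta linearP scalerDr opprD addrACA; congr (_ + _).
by rewrite scalerBr !scalerA mulrC.
Qed.
HB.instance Definition _ a := GRing.isLinear.Build R _ _ _ (Ta a) (Ta_linear a).

(** [Pr i] is [De] times a projector, so [De *: y] is the sum of the eigenvectors [Pr i y] and
    [De *: y - Pr i y]. The [Pr i] commute, hence a joint splitting costs one factor [De] per
    index. *)
Lemma eigen_split (l : seq 'I_t) w : exists s : seq W,
  De ^+ size l *: w = \sum_(y <- s) y /\
  forall y, y \in s -> forall i, i \in l -> exists b : bool, Pr i y = (b%:R * De) *: y.
Proof.
elim: l => [|i l [s [es hs]]].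
  by exists [:: w]; rewrite big_seq1 expr0 scale1r; split.
exists ([seq Pr i y | y <- s] ++ [seq De *: y - Pr i y | y <- s]); split.
  rewrite big_cat !big_map /= -big_split /= exprS -scalerA es scaler_sumr.
  by apply: eq_bigr => y _; rewrite addrC subrK.
move=> y; rewrite mem_cat => /orP[] /mapP[z zs ->] j; rewrite inE.
  have [->|ji] := eqVneq j i; first by exists true; rewrite mul1r Pr2.
  move=> /= jl; have [b hb] := hs z zs j jl; exists b.
  by rewrite PrC hb linearZ_LR.
have [->|ji] := eqVneq j i.
  by exists false; rewrite mul0r scale0r linearB linearZ_LR /= Pr2 subrr.
move=> /= jl; have [b hb] := hs z zs j jl; exists b.
have e1 : De *: ((b%:R * De) *: z) = (b%:R * De) *: (De *: z) by rewrite !scalerA mulrC.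
by rewrite (linearB (Pr j)) (linearZ_LR (Pr j)) /= PrC hb (linearZ_LR (Pr i)) scalerBr e1.
Qed.

(** On a joint eigenvector [Qr] is multiplication by [k * De], where [k] counts the indices with
    nonzero eigenvalue and is at most [t]; the factor with [a = k] kills it. *)
Lemma Ta_vanish w : foldr Ta (De ^+ t *: w) (iota 0 t.+1) = 0.
Proof.
have lin (l : seq nat) (T : Type) (s : seq T) (F : T -> W) :
    foldr Ta (\sum_(y <- s) F y) l = \sum_(y <- s) foldr Ta (F y) l.
  by elim: l => [|a l IH] //=; rewrite IH (linear_sum (Ta a)).
have [s [es hs]] := eigen_split (enum 'I_t) w.
rewrite -[X in De ^+ X](card_ord t) cardE es (lin _ _ _ id) big_seq big1 // => y ys.
have [b hb] := ex_choice (fun i => hs y ys i (mem_enum _ i)).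
pose k := (\sum_i b i)%N.
have kt : (k <= t)%N.
  rewrite -[t]card_ord -sum1_card; apply: leq_sum => i _; exact: leq_b1.
have Qy : Qr y = (k%:R * De) *: y.
  rewrite /Qr (eq_bigr _ (fun i _ => hb i)) -scaler_suml -mulr_suml natr_sum.
  by [].
have fE l : foldr Ta y l = (\prod_(a <- l) ((k%:R - a%:R) * De)) *: y.
  elim: l => [|a l IH]; first by rewrite big_nil scale1r.
  rewrite /= IH linearZ_LR /= /Ta Qy -scalerBl -mulrBl scalerA big_cons.
  by rewrite mulrC.
rewrite fE (big_rem k) /=; first by rewrite subrr !mul0r scale0r.
by rewrite -[_ :: _]/(iota 0 t.+1) mem_iota add0n ltnS.
Qed.

(** Modulo boundaries [Qr] acts on cycles of polynomial degree [e.+1] as the scalar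
    [De * (e.+1 + t)], whereas its possible eigenvalues are [a * De] with [a <= t]. So the product
    of the differences annihilates the class. The exponent is [t] for splitting into eigenvectors
    plus [t.+1] for the product. *)
Lemma cycle_torsion s e w : (forall k, exists r : R, k.+1%:R * r = 1) ->
  St s e.+1 w -> dl w = 0 -> exists u, St s e.+2 u /\ De ^+ (t + t.+1) *: w = dl u.
Proof.
move=> inv hw w0.
have main y l : St s e.+1 y -> dl y = 0 ->
    [/\ St s e.+1 (foldr Ta y l), dl (foldr Ta y l) = 0 & exists u, St s e.+2 u /\
      foldr Ta y l = (\prod_(a <- l) (((e.+1 + t)%:R - a%:R) * De)) *: y + dl u].
  move=> hy y0; elim: l => [|a l [h1 h2 [u [hu eu]]]] /=.
    by split=> //; exists 0; split; [exact: St0|rewrite big_nil scale1r linear0 addr0].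
  have E : Ta a (foldr Ta y l) =
      (((e.+1 + t)%:R - a%:R) * De) *: foldr Ta y l - dl (hl (foldr Ta y l)).
    rewrite /Ta (dl_hl h1 h2) addrAC -scalerBl; congr (_ *: _ - _).
    by rewrite mulrBl mulrC.
  split.
  - rewrite /Ta -scaleNr addrC; apply: St_comb => //; exact: St_Qr.
  - by rewrite E linearB linearZ_LR /= h2 scaler0 dlK subrr.
  - exists ((((e.+1 + t)%:R - a%:R) * De) *: u - hl (foldr Ta y l)); split.
      by apply: St_comb => //; rewrite -scaleN1r; apply: StZ; exact: St_hl.
    by rewrite big_cons E {1}eu scalerDr scalerA linearB linearZ_LR /= addrA.
have [] := main (De ^+ t *: w) (iota 0 t.+1); first exact: StZ.
  by rewrite linearZ_LR /= w0 scaler0.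
move=> _ _ [u [hu]]; rewrite Ta_vanish => /esym/eqP; rewrite addr_eq0 => /eqP E.
(* Each integer [e.+1 + t - a] is positive since [a <= t], hence invertible. In polynomial degree 0
   the factor for [a = t] would vanish. *)
have [c hc] : exists c, c * \prod_(a <- iota 0 t.+1) (((e.+1 + t)%:R - a%:R) * De) = De ^+ t.+1.
  have : forall a, a \in iota 0 t.+1 -> (a <= t)%N by move=> a; rewrite mem_iota add0n ltnS.
  rewrite -[X in De ^+ X](size_iota 0 t.+1); elim: (iota 0 t.+1) => [|a l IH] h.
    by exists 1; rewrite big_nil mul1r expr0.
  have [|c hc] := IH; first by move=> b bl; apply: h; rewrite inE bl orbT.
  have [r hr] := inv (e + t - a)%N; have at_ : (a <= t)%N by apply: h; rewrite mem_head.
  exists (r * c); rewrite big_cons /= -natrB; last by apply: leq_trans at_ _; rewrite leq_addl.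
  have -> : (e.+1 + t - a = (e + t - a).+1)%N by rewrite addSn subSn // (leq_trans at_) // leq_addl.
  rewrite mulrACA [r * _]mulrA [r * _]mulrC hr mul1r exprS -hc.
  by rewrite mulrCA.
exists (- c *: u); split; first exact: StZ.
rewrite linearZ_LR /= scaleNr -scalerN -E scalerA hc.
by rewrite scalerA -exprD addnC.
Qed.
End Homotopy.
End Strands.

Section Generators.
Variable R : comNzRingType.

Lemma eall_ctf (B : lmodType R) (Q : B -> Prop) m r (vs : 'I_r -> nat -> R) (x : ext m B) :
  subclosed Q -> eall Q x -> eall Q (ctf vs x).
Proof.
move=> hQ; elim: r vs x => [|r IH] vs x h //=.
by apply: IH; exact: (eall_lin _ hQ h).1.
Qed.

Lemma eall_wdf (B : lmodType R) (Q : B -> Prop) m r (vs : 'I_r -> nat -> R) (x : ext m B) :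
  subclosed Q -> eall Q x -> eall Q (wdf vs x).
Proof.
move=> hQ; elim: r vs => [|r IH] vs h //=.
by apply: (eall_lin _ hQ _).2; exact: IH.
Qed.

Lemma eall_vc (B : lmodType R) (Q : B -> Prop) m (x : ext m B) : eall Q x -> Q (vc x).
Proof. by elim: m x => [|m IH] x //= [x1 _]; exact: IH. Qed.

Lemma wd0 (B : lmodType R) m (v : nat -> R) (x : ext m B) : (forall j, v j = 0) -> wd v x = 0.
Proof.
elim: m v x => [|m IH] v x v0 //; have s0 j : shift v j = 0 by exact: v0.
by apply: ext_eq; rewrite /= !IH // v0 scale0r subr0.
Qed.

Lemma wdf_shift (B : lmodType R) m k (g : 'I_k -> nat) (x : ext m B) :
  wdf (fun a => unitv R (g a).+1) ((x, 0) : ext m.+1 B) = (wdf (fun a => unitv R (g a)) x, 0).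
Proof.
elim: k g => [|k IH] g //.
rewrite -[LHS]/(wd (unitv R (g ord0).+1) (wdf (fun a => unitv R (g (lift ord0 a)).+1) ((x, 0) : ext m.+1 B))).
rewrite (IH (fun a => g (lift ord0 a))).
by apply: ext_eq; rewrite /= ?wd00 ?scale0r ?subr0.
Qed.

Lemma ext_gen (B : lmodType R) (Q : B -> Prop) m k (S : ext m B -> Prop) :
  subclosed S ->
  (forall g : 'I_k -> nat, {homo g : a b / (a < b)%N} -> (forall a, (g a < m)%N) ->
     forall b, Q b -> S (wdf (fun a => unitv R (g a)) (vac m b))) ->
  forall x, hdeg k x -> eall Q x -> S x.
Proof.
elim: m k S => [|m IH] k S hS hg x.
  case: k hg => [|k] hg /=; last by move=> -> _; exact: hS.1.
  by move=> _ Qx; have := hg (fun=> 0%N) _ _ x Qx; apply=> -[].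
case=> h1 h2 [q1 q2].
have -> : x = (x.1, 0) + (0, x.2).
  by case: x {h1 h2 q1 q2} => a b; apply: ext_eq; rewrite /= ?addr0 ?add0r.
have SD y z : S y -> S z -> S (y + z) by move=> hy hz; rewrite -[y]scale1r; apply: hS.2.
apply: (SD).
  apply: (IH k (fun f => S (f, 0)) _ _ _ h1 q1).
    split=> [|a y z Sy Sz]; first exact: hS.1.
    by have := hS.2 a _ _ Sy Sz; congr S; apply: ext_eq; rewrite /= ?scaler0 ?addr0.
  move=> g gm gl b Qb; rewrite -wdf_shift.
  by apply: (hg (fun a => (g a).+1)) => // a; rewrite ltnS.
case: k hg h1 h2 => [|k] hg h1 h2; first by rewrite h2; exact: hS.1.
apply: (IH k (fun f => S (0, f)) _ _ _ h2 q2).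
  split=> [|a y z Sy Sz]; first exact: hS.1.
  by have := hS.2 a _ _ Sy Sz; congr S; apply: ext_eq; rewrite /= ?scaler0 ?addr0.
move=> g gm gl b Qb.
(* The second component carries the factor [e_0]: the index 0 is put in front of the shifted
   indices. *)
pose g' (a : 'I_k.+1) := if unlift ord0 a is Some c then (g c).+1 else 0%N.
have -> : (0, wdf (fun a => unitv R (g a)) (vac m b)) =
    wdf (fun a => unitv R (g' a)) (vac m.+1 b) :> ext m.+1 B.
  have gS (a : 'I_k) : g' (lift ord0 a) = (g a).+1 by rewrite /g' liftK.
  rewrite -[RHS]/(wd (unitv R (g' ord0)) (wdf (fun a => unitv R (g' (lift ord0 a)))
     ((vac m b, 0) : ext m.+1 B))).
  have E (y : ext m.+1 B) : wdf (fun a : 'I_k => unitv R (g' (lift ord0 a))) y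
      = wdf (fun a => unitv R (g a).+1) y by apply: wdf_eq => a; rewrite gS.
  rewrite E {E}.
  rewrite wdf_shift /g' unlift_none; apply: ext_eq; rewrite /=.
    by rewrite wd0.
  by rewrite wd00 subr0 scale1r.
apply: (hg g') Qb => [a c|a]; rewrite /g'.
  case: unliftP => [a' ->|->]; case: unliftP => [c' ->|->] //=; rewrite ?ltn0 //.
  by rewrite /bump /= !add1n !ltnS; exact: gm.
by case: unliftP => [a' _|_] //; rewrite ltnS.
Qed.

(** In the binomial expansion with exponent [k + l], each term contains the [k]-th power of [a] or
    the [l]-th power of [c]. This reduces torsion statements for elements of the ideal to statements
    for single minors. *)
Lemma radical_closed (V : lmodType R) (S : V -> Prop) (x : V) : subclosed S ->
  subclosed (fun a : R^o => exists k, S ((a : R) ^+ k *: x)).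
Proof.
move=> [S0 Sl]; have SZ a y : S y -> S (a *: y).
  by move=> h; rewrite -[_ *: _]addr0; apply: Sl.
have SD y z : S y -> S z -> S (y + z) by move=> h h'; rewrite -[y]scale1r; apply: Sl.
split; first by exists 1%N; rewrite expr1 scale0r.
move=> b a c [k hk] [l hl]; exists (k + l)%N.
rewrite exprDn scaler_suml; apply: (big_ind S S0 SD) => i _.
set u := _ *+ _.
suff [r [e|e]] : exists r, u = r * (a : R) ^+ k \/ u = r * (c : R) ^+ l.
- by rewrite e -scalerA; exact: SZ.
- by rewrite e -scalerA; exact: SZ.
have [il|/ltnW il] := leqP i l.
  exists (((b * a) ^+ (l - i) * (c : R) ^+ i * b ^+ k) *+ 'C(k + l, i)); left.
  rewrite /u mulrnAl; congr (_ *+ _); rewrite -addnBA // exprD exprMn.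
  by rewrite -[RHS]mulrA [RHS]mulrC mulrA.
exists (((b * a) ^+ (k + l - i) * (c : R) ^+ (i - l)) *+ 'C(k + l, i)); right.
by rewrite /u mulrnAl; congr (_ *+ _); rewrite -mulrA -exprD subnK.
Qed.
End Generators.

Section StrandChain.
Variables (R : comNzRingType) (t m : nat) (M : 'M[R]_(t, m)).
Local Notation D := {mpoly R[t]}.
Local Notation W := (ext m D).
Hypothesis inv_nat : forall k, exists r : R, k.+1%:R * r = 1.

Definition sterm s e : lmodType R := psub (@St_closed R t m s e).

Definition sdiff0 s e (x : sterm s e.+1) : sterm s e :=
  mkpsub (@St_closed R t m s e) (St_dl M (psubP x)).
Fact sdiff_linear s e : linear (@sdiff0 s e).
Proof. by move=> a x y; apply: val_inj; rewrite /= (linearP (dl M)). Qed.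
Definition sdiff s e : {linear sterm s e.+1 -> sterm s e} := mklinear (@sdiff_linear s e).

Lemma val_sdiff s e x : val (sdiff s e x) = dl M (val x).
Proof. by []. Qed.

Fact sdiffK s e x : sdiff s e (sdiff s e.+1 x) = 0.
Proof. by apply: val_inj; rewrite /= dlK. Qed.
Definition strand s : chain R := Chain (@sdiffK s).

Local Notation B e := {ffun 'X_{1..t < e.+1} -> R^o}.

(** Polynomials of degree [e] are encoded by their coefficients on a finite set of exponents, so a
    strand term is a retract of a finite free module; projectivity and vanishing of cohomology both
    pass to retracts. *)
Lemma sterm_ext s e : exists (i : {linear sterm s e -> ext m (B e)})
  (r : {linear ext m (B e) -> sterm s e}), forall x, r (i x) = x.
Proof.
have [f hf] : exists f : {linear D -> B e}, forall p, f p = [ffun k : 'X_{1..t < e.+1} => p@_k : R^o].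
  by apply: ex_linear => a p q; apply/ffunP => k; rewrite !ffunE mcoeffD mcoeffZ.
have [g hg] : exists g : {linear B e -> D}, forall u, g u =
    \sum_(k : 'X_{1..t < e.+1} | mdeg k == e) (u k : R) *: 'X_[k].
  apply: ex_linear => a u v; rewrite scaler_sumr -big_split; apply: eq_bigr => k _.
  by rewrite !ffunE scalerDl scalerA.
have gh u : cdeg e (g u).
  move=> k hk; rewrite hg linear_sum big1 // => l /eqP le.
  rewrite /= mcoeffZ mcoeffX; case: eqP => [lk|_]; last exact: mulr0.
  by rewrite -lk le eqxx in hk.
have gf p : cdeg e p -> g (f p) = p.
  move=> hp; rewrite hg; have sz : (msize p <= e.+1)%N.
    rewrite msizeE; apply/bigmax_leqP_seq => k kp _; rewrite ltnS.
    apply: contraTT kp => ke; rewrite mcoeff_msupp negbK hp //.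
    by apply: contraNneq ke => ->.
  rewrite [RHS](mpolywE sz) [RHS](bigID (fun k : 'X_{1..t < e.+1} => mdeg k == e)) /=.
  rewrite [X in _ = _ + X]big1 ?addr0 => [|k hk]; last by rewrite hp // scale0r.
  by apply: eq_bigr => k _; rewrite hf ffunE.
have Sr (x : ext m (B e)) : St s e (prj (s + e) (emap g x)).
  split; first exact: hdeg_prj.
  apply: eall_prj; first exact: cdeg_closed.
  by apply: (eall_emap (Q := fun=> True)) => [u _|]; [exact: gh|exact: eall_true].
have [r hr] : exists r : {linear ext m (B e) -> sterm s e},
    forall x, val (r x) = prj (s + e) (emap g x).
  have [r hr] : exists r : {linear ext m (B e) -> sterm s e},
      forall x, r x = mkpsub (@St_closed R t m s e) (Sr x).
    apply: ex_linear => a x y; apply: val_inj.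
    by rewrite /= emapD emapZ (linearP (@prj R D m (s + e))).
  by exists r => x; rewrite hr.
exists (lcomp (@emap R _ _ f m : {linear W -> ext m (B e)}) (lval _)), r => x.
apply: val_inj; rewrite hr /= emap_comp; have [h1 h2] := psubP x.
have -> : emap (lcomp g f) (submod_val x) = emap (lid D) (val x).
  by apply: (emap_eq _ h2) => p hp /=; exact: gf.
have -> : emap (lid D) (val x) = val x.
  by elim: (m) (val x : W) => [|k IH] y //; apply: ext_eq; rewrite /= IH.
exact: prj_id.
Qed.

Lemma sterm_projective s e : projective (sterm s e).
Proof.
have [i [r ri]] := sterm_ext s e; apply: (retract_projective (s := i) (r := r)) => //.
by apply: ext_projective; exact: ffun_projective.
Qed.

Lemma hv_sterm (P : chain R) q s e : hv P q R^o -> hv P q (sterm s e).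
Proof.
move=> h; have [i [r ri]] := sterm_ext s e; apply: (hv_retract (s := i) (r := r)) => //.
by apply: hv_ext; exact: hv_ffun.
Qed.

Lemma sterm_gt s e (x : sterm s e) : (m - s < e)%N -> x = 0.
Proof.
move=> h; apply: val_inj; have [h1 _] := psubP x; apply: hdeg_gt h1.
lia.
Qed.

Definition bd s e (w : W) := exists u, St s e.+1 u /\ w = dl M u.

Lemma bd_closed s e : subclosed (bd s e).
Proof.
split=> [|a _ _ [u [hu ->]] [v [hv' ->]]]; first by exists 0; rewrite linear0; split=> //; exact: St0.
by exists (a *: u + v); rewrite (linearP (dl M)); split=> //; exact: St_comb.
Qed.

Lemma bdP s e (x : sterm s e) : bdry (C := strand s) x <-> bd s e (val x).
Proof.
split=> [[w ->]|[u [hu eu]]]; first by exists (val w); split=> //; exact: (psubP w).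
by exists (mkpsub (@St_closed R t m s e.+1) hu); apply: val_inj; rewrite /= eu.
Qed.

(* The value on [w] of the [t]-form [row_0 /\ ... /\ row_(t-1)]; the image of [omega] is
   the ideal of maximal minors. *)
Definition omega (w : W) : R^o := (vc (ctf (rw M) w))@_0.
Fact omega_linear : linear omega.
Proof. by move=> a x y; rewrite /omega (linearP (ctf _)) (linearP (@vc R _ _)) mcoeffD mcoeffZ. Qed.
HB.instance Definition _ := GRing.isLinear.Build R _ _ _ omega omega_linear.

Definition basis k (g : 'I_k -> nat) : W := wdf (fun a => unitv R (g a)) (vac m 1).

Lemma cdeg0E (p : D) : cdeg 0 p -> p = (p@_0)%:MP.
Proof.
move=> hp; apply/mpolyP => k; rewrite mcoeffC.
have [->|k0] := eqVneq k 0%MM; first by rewrite mulr1.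
by rewrite mulr0 hp // mdeg_eq0.
Qed.

Lemma St_basis k g : (forall a, (g a < m)%N) -> St k 0 (@basis k g).
Proof.
move=> _; split; first by apply: hdeg_wdf; exact: hdeg_vac.
have h1 : eall (cdeg 0) (vac m (1 : D)).
  elim: (m) => [|l IH] /=; last by split=> //; exact: (eall_closed l (cdeg_closed R t 0)).1.
  by move=> j hj; rewrite mcoeff1 -mdeg_eq0 (negPf hj).
exact: eall_wdf (cdeg_closed R t 0) h1.
Qed.

Lemma St_gen k (S : W -> Prop) : subclosed S ->
  (forall g : 'I_k -> nat, {homo g : a b / (a < b)%N} -> (forall a, (g a < m)%N) -> S (basis g)) ->
  forall x, St k 0 x -> S x.
Proof.
move=> hS hg x [h1 h2]; rewrite addn0 in h1; apply: (ext_gen hS _ h1 h2) => g gm gl b hb.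
rewrite (cdeg0E hb); set c := _@_ _.
have -> : vac m c%:MP = c *: vac m (1 : D).
  by rewrite -[RHS](linearZ_LR (@vac R D m)) -mul_mpolyC mulr1.
rewrite (linearZ_LR (wdf _)) /= -[_ *: _]addr0; apply: hS.2; last exact: hS.1.
exact: hg.
Qed.

Lemma omega_basis (g : 'I_t -> nat) :
  omega (basis g) = \det (\matrix_(a, b) dot m (rw M a) (unitv R (g b))).
Proof.
rewrite /omega /basis ctf_wdf (linearZ_LR (@vc R D m)) /= vc_vac mcoeffZ mcoeff1 eqxx.
exact: mulr1.
Qed.

Lemma ctf_top (w : W) : St t 0 w -> ctf (rw M) w = omega w *: vac m 1.
Proof.
move=> [h1 h2]; rewrite -[LHS]vac_vc; last by apply: hdeg_ctf.
have h3 : cdeg 0 (vc (ctf (rw M) w)).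
  have : eall (cdeg 0) (ctf (rw M) w).
    exact: eall_ctf (cdeg_closed R t 0) h2.
  exact: eall_vc.
rewrite (cdeg0E h3) -/(omega w) -[RHS](linearZ_LR (@vac R D m)) -mul_mpolyC mulr1.
by [].
Qed.

(** Multiplying [w] by the variable [y_i] gives a preimage: only the [i]-th derivation sees it. *)
Lemma ct_bd s i w : St s.+1 0 w -> bd s 0 (ct (rw M i) w).
Proof.
move=> [h1 h2]; exists (emap (mX R i) w); split.
  split; first by rewrite addn1 -[s.+1]addn0; exact: hdeg_emap.
  by apply: eall_emap h2 => p; exact: cdeg_mX.
have z j : emap (dY R j) (emap (mX R i) w) = (i == j)%:R *: w.
  rewrite emap_comp (@emap_eq _ _ _ (cdeg 0) _ (lscale (lid D) (i == j)%:R)) //.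
    by elim: (m) (w) => [|k IH] x //; apply: ext_eq; rewrite /= IH.
  move=> p hp; have -> : lcomp (dY R j) (mX R i) p = dY R j (mX R i p) by [].
  by rewrite dY_mX (cdeg_dY0 j hp) linear0 addr0 eq_sym.
rewrite /dl (bigD1 i) //= z eqxx scale1r big1 ?addr0 // => j ji.
by rewrite z eq_sym (negPf ji) scale0r ct00.
Qed.

Lemma bd_ct s w : bd s 0 w -> exists u : 'I_t -> W,
  (forall i, St s.+1 0 (u i)) /\ w = \sum_i ct (rw M i) (u i).
Proof.
case=> u [[h1 h2] ->]; exists (fun i => emap (dY R i) u); split=> // i; split.
  by rewrite addn0 -addn1; exact: hdeg_emap.
by apply: eall_emap h2 => p; exact: cdeg_dY.
Qed.

Fact c0_linear : linear (fun p : D => (p@_0)%:MP : D).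
Proof. by move=> a p q; rewrite mcoeffD mcoeffZ mpolyCD mpolyCM mul_mpolyC. Qed.
Definition c0 : {linear D -> D} := mklinear c0_linear.

Lemma emap_c0 (w : W) : eall (cdeg 0) w -> emap c0 w = w.
Proof.
move=> h; rewrite (@emap_eq _ _ _ (cdeg 0) c0 (lid D)) //.
  by elim: (m) (w) => [|k IH] x //; apply: ext_eq; rewrite /= IH.
by move=> p hp /=; rewrite -cdeg0E.
Qed.

Lemma eall_c0 (w : W) : eall (cdeg 0) (emap c0 w).
Proof.
apply: (eall_emap (Q := fun=> True)) => [p _ k k0|]; last exact: eall_true.
by rewrite /= mcoeffC -mdeg_eq0 (negPf k0) mulr0.
Qed.

Lemma wdf_ctf_bd s r (vs us : 'I_r -> nat -> R) (x : W) :
  (forall a, exists i, vs a = rw M i) -> St s 0 x -> (r <= s.+1)%N ->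
  bd s 0 (wdf us (ctf vs x) - \det (\matrix_(a, b) dot m (vs a) (us b)) *: x).
Proof.
move=> hvs [h1 h2] rs; rewrite addn0 in h1.
(* [wdf_ctf] ignores polynomial degree, while boundaries here must come from constant coefficients;
   composing with the constant term [c0] reconciles the two. *)
have hS : subclosed (fun w => bd s 0 (emap c0 w)).
  split=> [|a y z]; first by rewrite emap00; exact: (bd_closed s 0).1.
  by rewrite emapD emapZ; exact: (bd_closed s 0).2.
have e0 : emap c0 x = x by exact: emap_c0.
have := wdf_ctf us (vs := vs) hS _ h1 rs.
rewrite emapD emapN emapZ e0.
have -> : emap c0 (wdf us (ctf vs x)) = wdf us (ctf vs x).
  by apply: emap_c0; apply: eall_wdf (cdeg_closed R t 0) _; exact: eall_ctf (cdeg_closed R t 0) h2.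
apply=> a y hy; rewrite emap_ct; have [i ->] := hvs a; apply: ct_bd.
by split; [rewrite addn0; exact: hdeg_emap|exact: eall_c0].
Qed.

Definition max_minor (g : 'I_t -> 'I_m) : R := \det (mxsub id g M).

Lemma dot_mxsub (k : nat) (f : 'I_k -> 'I_t) (g : 'I_k -> 'I_m) :
  \matrix_(a, b) dot m (rw M (f a)) (unitv R (g b)) = mxsub f g M.
Proof. by apply/matrixP => a b; rewrite !mxE dot_rw. Qed.

Lemma omega_ideal (S : R^o -> Prop) : subclosed S ->
  (forall g : 'I_t -> 'I_m, {homo g : a b / (a < b)%N} -> S (max_minor g)) ->
  forall w, St t 0 w -> S (omega w).
Proof.
move=> hS hg; apply: St_gen => [|g gm gl].
  split=> [|a x y]; first by rewrite linear0; exact: hS.1.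
  by rewrite (linearP omega); exact: hS.2.
have -> : g = fun a => val (Ordinal (gl a)) by [].
by rewrite omega_basis (dot_mxsub id (fun a => Ordinal (gl a))); exact: hg.
Qed.

Lemma omega_minor (g : 'I_t -> 'I_m) : exists w, St t 0 w /\ omega w = max_minor g.
Proof.
exists (basis (fun a => val (g a))); split.
  by apply: St_basis => a; exact: ltn_ord.
by rewrite omega_basis (dot_mxsub id g).
Qed.

Section Exactness.
Variable (as_ : seq R).
Hypothesis reg_as : reg_on (fun x : R^o => x = 0) as_.
Hypothesis minor_as : forall a, a \in as_ -> exists w, St t 0 w /\ a = omega w.

Lemma hv_R T : torsion_by as_ T -> forall q, (q < size as_)%N -> hv (std T) q R^o.
Proof.
move=> hT; apply: (hv_grade (p := lid R^o) (@std_proj _ T) _ _ reg_as) => [x|x|a /hT[k hk]].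
- by exists x.
- by [].
- exact: std_null hk.
Qed.

(** By [radical_closed] a single maximal minor can be treated. The vectors dual to the rows up to
    that minor are given by the adjugate of the submatrix. *)
Lemma strand_cycle s e (w : sterm s e.+1) a : a \in as_ -> sdiff s e w = 0 ->
  exists k, bdry (C := strand s) (a ^+ k *: w : sterm s e.+1).
Proof.
move=> /minor_as[z [hz ->]] w0.
have dw : dl M (val w) = 0 by rewrite -val_sdiff w0.
apply: (omega_ideal _ _ hz (S := fun a : R^o => exists k, bdry (C := strand s) ((a : R) ^+ k *: w : sterm s e.+1))).
  exact: (radical_closed (V := sterm s e.+1) _ (bdry_closed (strand s) e.+1)).
move=> g _; pose N := mxsub id g M.
pose v (j : 'I_t) : nat -> R := fun x => \sum_k (\adj N) k j * unitv R (g k) x.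
have vE i j : dot m (rw M i) (v j) = max_minor g * (i == j)%:R.
  have -> : max_minor g * (i == j)%:R = (N *m \adj N) i j by rewrite mul_mx_adj !mxE mulr_natr.
  rewrite mxE /dot /v; under eq_bigr => x _ do rewrite mulr_sumr.
  rewrite exchange_big; apply: eq_bigr => k _ /=.
  have -> : N i k = M i (g k) by rewrite mxE.
  rewrite -(dot_rw M) /dot mulr_suml; apply: eq_bigr => x _.
  by rewrite mulrCA mulrC.
have [u [hu eu]] := cycle_torsion vE inv_nat (psubP w) dw.
by exists (t + t.+1)%N; apply/bdP; exists u.
Qed.

Lemma strand_exact s : (m - s <= size as_)%N -> forall e, exact_at (strand s) e.
Proof.
move=> ls; apply: (acyclic (l := (m - s)%N) (s := as_)) => //.
- by move=> e he x; exact: sterm_gt.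
- by move=> T hT e q hq; apply: hv_sterm; exact: hv_R.
- by move=> e z hz a ha; exact: strand_cycle.
Qed.

(** When [omega w = 0], contracting [w] by all rows gives 0, so the Cramer rule makes every maximal
    minor times [w] a boundary. Thus [w] is torsion in the cokernel, which has none by
    [tors_bdry0]. *)
Lemma omega_exact w : (m - t < size as_)%N -> St t 0 w -> omega w = 0 -> bd t 0 w.
Proof.
move=> ls hw w0; pose x : sterm t 0 := mkpsub (@St_closed R t m t 0) hw.
apply: (bdP x).1; apply: (tors_bdry0 (l := (m - t)%N) (s := as_)) => //.
- by move=> e he y; exact: sterm_gt.
- by move=> T hT e q hq; apply: hv_sterm; exact: hv_R.
- by apply: strand_exact; exact: ltnW.
- move=> a /minor_as[z [hz ->]].
  apply: (omega_ideal _ _ hz (S := fun a : R^o => exists k, bdry (C := strand t) ((a : R) ^+ k *: x : sterm t 0))).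
    exact: (radical_closed (V := sterm t 0) _ (bdry_closed (strand t) 0)).
  move=> g _; exists 1%N; apply/bdP; rewrite expr1 /=.
  have := @wdf_ctf_bd t t (rw M) (fun a => unitv R (g a)) w (fun a => ex_intro _ a erefl) hw (leqnSn _).
  rewrite ctf_top // w0 scale0r (linear0 (wdf _)) sub0r (dot_mxsub id g) -/(max_minor g).
  rewrite -scaleN1r => /(fun h => (bd_closed t 0).2 (-1) _ _ h (bd_closed t 0).1).
  by rewrite addr0 !scaleN1r opprK.
Qed.
End Exactness.
End StrandChain.

(** The position [e] is free because the kernel of [p] is again a cokernel of the complex, one place
    further; at [l <= e] the cokernel is projective. *)
Lemma res_extn (R : comNzRingType) (C : chain R) (l : nat) (N Q : lmodType R)
    (e : nat) (p : {linear C e -> Q}) (q : nat) :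
  proj_cx C -> (forall e, (l < e)%N -> forall x : C e, x = 0) ->
  (forall e, exact_at C e) -> onto p -> (forall x, p x = 0 <-> bdry x) ->
  (l <= e + q)%N -> extn N q Q.
Proof.
move=> hC C0 ex; elim: q e Q p => [|q IH] e Q p sp kp leq.
  have b0 (x : C e) : bdry x -> x = 0.
    by case=> y ->; rewrite [y]C0 ?linear0 // ltnS -[e]addn0.
  apply: ext1_proj; have [|r hr] := factor_surj (p := p) (f := lid (C e)) sp.
    by move=> x /kp/b0.
  have [s hs] := ex_choice sp.
  apply: (retract_projective (s := r) (r := p) _ (hC e)) => y.
  by have [x <-] := sp y; rewrite hr.
have hs : ses (lval _ : {linear kerm p -> C e}) p by exact: kerm_ses.
apply/(extn_cover N q hs (hC e)).
have [|d hd] := factor_inj (i := lval _ : {linear kerm p -> C e}) (f := chd C e) val_inj.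
  by move=> x; have h : p (chd C e x) = 0 by [apply/kp; exists x]; exists (mkpsub (ker_closed p) h).
apply: (IH e.+1 (kerm p) d) => [y|x|]; last by rewrite addSnnS.
- have /kp[w hw] : p (val y) = 0 := psubP y.
  by exists w; apply: val_inj; rewrite [LHS]hd hw.
- have E y : val (d y) = chd C e y := hd y.
  split=> [d0|[w ->]]; first by apply: ex; rewrite -E d0.
  by apply: val_inj; rewrite E chdK.
Qed.

(** * The complex of the conormal module *)

Section Subquotients.
Variable R : comNzRingType.

Lemma subclosed_sum (V : lmodType R) (S : V -> Prop) (T : Type) (l : seq T) (F : T -> V) :
  subclosed S -> (forall i, S (F i)) -> S (\sum_(i <- l) F i).
Proof.
move=> hS h; elim: l => [|i l IH]; rewrite ?big_nil ?big_cons; first exact: hS.1.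
by rewrite -[F i]scale1r; exact: hS.2.
Qed.

Lemma subclosedZ (V : lmodType R) (S : V -> Prop) a x : subclosed S -> S x -> S (a *: x).
Proof. by move=> hS h; rewrite -[_ *: _]addr0; apply: hS.2 h hS.1. Qed.

Lemma subclosedD (V : lmodType R) (S : V -> Prop) x y : subclosed S -> S x -> S y -> S (x + y).
Proof. by move=> hS h1 h2; rewrite -[x]scale1r; apply: hS.2. Qed.

Lemma subclosedN (V : lmodType R) (S : V -> Prop) x : subclosed S -> S x -> S (- x).
Proof. by move=> hS h; rewrite -scaleN1r; exact: subclosedZ. Qed.

Lemma subclosedB (V : lmodType R) (S : V -> Prop) x y : subclosed S -> S x -> S y -> S (x - y).
Proof. by move=> hS h1 h2; apply: subclosedD => //; exact: subclosedN. Qed.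

Lemma regular_projective : projective R^o.
Proof.
move=> V C p f sp; have [v hv'] := sp (f (1 : R)).
have [g hg] : exists g : {linear R^o -> V}, forall x, g x = (x : R) *: v.
  by apply: ex_linear => a x y; rewrite scalerDl scalerA.
exists g => x; rewrite hg linearZ_LR /= hv' -(linearZ_LR f) /=; congr (f _).
exact: mulr1.
Qed.

Lemma sub_ses (V : lmodType R) (S S' : V -> Prop) (hS : subclosed S) (hS' : subclosed S') :
  (forall x, S x -> S' x) ->
  exists (T : lmodType R) (i : {linear psub hS -> psub hS'}) (p : {linear psub hS' -> T}),
    ses i p /\ forall a, (forall x, S' x -> S (a *: x)) -> forall y : T, a *: y = 0.
Proof.
move=> SS'; have hc : subclosed (fun x : psub hS' => S (val x)).
  by split=> [|a x y]; [exact: hS.1|exact: hS.2].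
have [T [p [sp kp]]] := quot_ex hc.
have [|i hi] := factor_inj (i := lval _ : {linear psub hS' -> V})
    (f := lval _ : {linear psub hS -> V}) val_inj.
  by move=> x; exists (mkpsub hS' (SS' _ (psubP x))).
have hi' x : val (i x) = val x := hi x.
exists T, i, p; split; last first.
  move=> a h y; have [x <-] := sp y; rewrite -linearZ_LR; apply/kp.
  exact: h (psubP x).
split=> // [x y e|v]; first by apply: val_inj; rewrite -!hi' e.
split=> [/kp h|[u ->]]; last by apply/kp; rewrite hi'; exact: psubP.
by exists (mkpsub hS h); apply: val_inj; rewrite hi'.
Qed.

Lemma im_ex (V W : lmodType R) (f : {linear V -> W}) :
  exists p : {linear V -> psub (im_closed f)}, onto p /\ forall x, val (p x) = f x.
Proof.
have [|p hp] := factor_inj (i := lval _ : {linear psub (im_closed f) -> W}) (f := f) val_inj.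
  move=> x; have h : exists u, f x = f u by exists x.
  by exists (mkpsub (im_closed f) h).
have hp' x : val (p x) = f x := hp x.
exists p; split=> // y; have [x hx] := psubP y; exists x; apply: val_inj.
by rewrite hp' hx.
Qed.

Lemma extn_ffun (N L : lmodType R) q m : extn N q L -> extn N q {ffun 'I_m -> L}.
Proof.
move=> hL; elim: m => [|m IH].
  apply: extn_proj => V C p f sp; exists (lzero _ V) => x.
  by have -> : x = 0 by [apply/ffunP => -[]]; rewrite !linear0.
pose F := {ffun 'I_m -> L}.
have [s hs] : exists s : {linear {ffun 'I_m.+1 -> L} -> (L * F)%type},
    forall x, s x = (x ord0, [ffun i => x (lift ord0 i)]).
  apply: ex_linear => a x y; congr pair; rewrite ?ffunE //.
  by apply/ffunP => i; rewrite !ffunE.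
have [r hr] : exists r : {linear (L * F)%type -> {ffun 'I_m.+1 -> L}},
    forall x, r x = [ffun i => if unlift ord0 i is Some j then x.2 j else x.1].
  apply: ex_linear => a x y; apply/ffunP => i; rewrite !ffunE.
  by case: unliftP => [j _|_] //=; rewrite !ffunE.
apply: (extn_retract (s := s) (r := r)) => [x|].
  rewrite hr hs; apply/ffunP => i; rewrite !ffunE /=.
  by case: unliftP => [j ->|->]; rewrite ?ffunE.
apply: (extn_mid (i := lpair (lid L) (lzero L F)) (p := lsnd L F) _ hL IH).
split=> [x y /= [] //|y|[a b] /=]; first by exists (0, y).
by split=> [->|[u [_ ->]] //]; exists a.
Qed.

(** Cutting the complex into short exact sequences, the kernel of [psi] enters at [extn q], and the
    homology at [FL], [GL] and [A] at [q.+1], [q + 2] and [q + 3]. The modules [FL], [GL] and [A]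
    themselves only enter between [q] and [q + 2]. *)
Lemma ext_chain (N0 N FL GL A : lmodType R) (J : R -> Prop) (psi : {linear N -> FL})
    (mu : {linear FL -> GL}) (ev : {linear GL -> A}) q :
  (forall n, mu (psi n) = 0) -> (forall x, ev (mu x) = 0) ->
  (forall a n, J a -> psi n = 0 -> a *: n = 0) ->
  (forall a x, J a -> mu x = 0 -> exists n, a *: x = psi n) ->
  (forall a y, J a -> ev y = 0 -> exists x, a *: y = mu x) ->
  (forall a z, J a -> exists y, a *: z = ev y) ->
  (forall k, (q <= k)%N -> extn N0 k FL) -> (forall k, (q <= k)%N -> extn N0 k GL) ->
  (forall k, (q <= k)%N -> extn N0 k A) ->
  (forall T : lmodType R, (forall a, J a -> forall x : T, a *: x = 0) ->
     forall k, (k <= q + 3)%N -> extn N0 k T) ->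
  extn N0 q N.
Proof.
move=> c1 c2 k1 k2 k3 k4 eF eG eA eT.
have [p1 [sp1 hp1]] := im_ex psi.
have s1 : ses (lval _ : {linear kerm p1 -> N}) p1 by exact: kerm_ses.
apply: (extn_mid s1).
  apply: eT => [a Ja x|]; last exact: leq_addr.
  apply: val_inj => /=; apply: k1 => //; rewrite -hp1.
  by have -> : p1 (val x) = 0 := psubP x.
have [|T2 [i2 [p2 [s2 t2]]]] := sub_ses (im_closed psi) (ker_closed mu).
  by move=> _ [n ->].
apply: (extn_left s2); last first.
  apply: eT => [a Ja x|]; last by rewrite -addn1 leq_add2l.
  by apply: t2 => y hy; exact: k2.
have [p3 [sp3 hp3]] := im_ex mu.
have s3 : ses (lval _ : {linear kerm mu -> FL}) p3.
  split=> [||v]; [exact: val_inj|by []|].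
  split=> [e|[u ->]].
    have h : mu v = 0 by rewrite -hp3 e.
    by exists (mkpsub (ker_closed mu) h).
  by apply: val_inj; rewrite hp3; exact: (psubP u).
apply: (extn_left s3); first exact: eF.
have [|T4 [i4 [p4 [s4 t4]]]] := sub_ses (im_closed mu) (ker_closed ev).
  by move=> _ [n ->].
apply: (extn_left s4); last first.
  apply: eT => [a Ja x|]; last by rewrite -addn2 leq_add2l.
  by apply: t4 => y hy; exact: k3.
have [p5 [sp5 hp5]] := im_ex ev.
have s5 : ses (lval _ : {linear kerm ev -> GL}) p5.
  split=> [||v]; [exact: val_inj|by []|].
  split=> [e|[u ->]].
    have h : ev v = 0 by rewrite -hp5 e.
    by exists (mkpsub (ker_closed ev) h).
  by apply: val_inj; rewrite hp5; exact: (psubP u).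
apply: (extn_left s5); first exact: eG.
have [T6 [p6 [sp6 kp6]]] := quot_ex (im_closed ev).
have s6 : ses (lval _ : {linear psub (im_closed ev) -> A}) p6.
  split=> [||v]; [exact: val_inj|by []|].
  split=> [/kp6 h|[u ->]]; first by exists (mkpsub (im_closed ev) h).
  exact/kp6/(psubP u).
apply: (extn_left s6); first by apply: eA; rewrite -addn2 leq_addr.
apply: eT => [a Ja x|]; last by rewrite addnS addn2.
have [y <-] := sp6 x; rewrite -linearZ_LR; apply/kp6; exact: k4.
Qed.
End Subquotients.

Section Submaximal.
Variables (R : comNzRingType) (t m : nat) (M : 'M[R]_(t.+1, m)).
Local Notation D := {mpoly R[t.+1]}.
Local Notation W := (ext m D).

Lemma ctf_wd r (vs : 'I_r.+1 -> nat -> R) u (x : W) :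
  ctf vs (wd u x) = (-1) ^+ r.+1 *: wd u (ctf vs x) +
    \sum_(i < r.+1) ((-1) ^+ i * dot m (vs i) u) *: ctf (fun a => vs (lift i a)) x.
Proof.
elim: r vs x => [|r IH] vs x.
  by rewrite big_ord_recl big_ord0 addr0 /= expr1 scaleN1r mul1r ct_wd addrC.
set vs' := fun a => vs (lift ord0 a).
have -> : ctf vs (wd u x) = dot m (vs ord0) u *: ctf vs' x - ctf vs' (wd u (ct (vs ord0) x)).
  by rewrite -(linearZ_LR (ctf vs')) -(linearB (ctf vs')) -ct_wd.
rewrite IH opprD addrCA [in RHS]big_ord_recl expr0 mul1r.
rewrite [in RHS]exprS mulN1r scaleNr; congr (_ + (_ + _)).
rewrite -sumrN; apply: eq_bigr => i _; rewrite -scaleNr.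
rewrite -[nat_of_ord (lift ord0 i)]/(bump 0 i) /bump leq0n add1n exprS mulN1r mulNr.
congr (_ *: _); rewrite /= (_ : lift (lift ord0 i) ord0 = ord0); last exact: val_inj.
apply: ctf_eq => a; congr vs; apply: val_inj.
by rewrite /= /bump /= !add1n ltnS; case: leqP.
Qed.

Lemma ctf_const r (vs : 'I_r -> nat -> R) (w : W) : St r 0 w ->
  ctf vs w = (vc (ctf vs w))@_0 *: vac m 1.
Proof.
move=> [h1 h2]; rewrite -[LHS]vac_vc; last by apply: hdeg_ctf.
have h3 : cdeg 0 (vc (ctf vs w)) by apply: eall_vc; exact: eall_ctf (cdeg_closed R _ 0) h2.
rewrite {1}(cdeg0E h3) -[RHS](linearZ_LR (@vac R D m)) -mul_mpolyC mulr1.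
by [].
Qed.

(* The value on [w] of the [t]-form obtained from [omega] by leaving out row [i]. *)
Definition omegai (i : 'I_t.+1) (w : W) : R^o := (-1) ^+ i * (vc (ctf (fun a : 'I_t => rw M (lift i a)) w))@_0.
Fact omegai_linear i : linear (omegai i).
Proof.
move=> a x y; rewrite /omegai (linearP (ctf _)) (linearP (@vc R _ _)) mcoeffD mcoeffZ mulrDr.
by rewrite mulrCA.
Qed.
HB.instance Definition _ i := GRing.isLinear.Build R _ _ _ (omegai i) (omegai_linear i).

Lemma omega_sum (T : Type) (l : seq T) (F : T -> W) :
  omega M (\sum_(i <- l) F i) = \sum_(i <- l) (omega M (F i) : R).
Proof. exact: (linear_sum (omega M)). Qed.
Lemma omegai_sum i (T : Type) (l : seq T) (F : T -> W) :
  omegai i (\sum_(k <- l) F k) = \sum_(k <- l) (omegai i (F k) : R).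
Proof. exact: (linear_sum (omegai i)). Qed.
Lemma omegaZ a w : omega M (a *: w) = a * (omega M w : R).
Proof. exact: (linearZ_LR (omega M)). Qed.
Lemma omegaiZ i a w : omegai i (a *: w) = a * (omegai i w : R).
Proof. exact: (linearZ_LR (omegai i)). Qed.

(** Contracting by row [k] and then by all rows except [i] repeats a row unless [k = i]. *)
Lemma omegai_ct i k w : omegai i (ct (rw M k) w) = (i == k)%:R * omega M w :> R.
Proof.
case: (unliftP i k) => [a|] ->; last first.
  rewrite eqxx mul1r /omega (ctf_lift (rw M) i) (linearZ_LR (@vc R _ _)) /= mcoeffZ.
  by [].
rewrite (negPf (neq_lift _ _)) mul0r /omegai (ctf_ct (fun a => rw M (lift i a)) a).
by rewrite (linear0 (@vc R _ _)) mcoeff0 mulr0.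
Qed.

Lemma omega_wd u w : St t 0 w -> omega M (wd u w) = \sum_i dot m (rw M i) u * omegai i w :> R.
Proof.
move=> [h1 h2]; rewrite /omega ctf_wd.
have -> : ctf (rw M) w = 0.
  rewrite ctf_first ct_hdeg0 ?scaler0 //; exact: hdeg_ctf.
rewrite wd00 scaler0 add0r (linear_sum (@vc R _ _)) (linear_sum (mcoeff 0)).
apply: eq_bigr => i _; rewrite (linearZ_LR (@vc R _ _)) /= mcoeffZ.
by rewrite /omegai mulrAC [RHS]mulrC.
Qed.

(** The ideal of maximal minors kills [L]: contracting [w], of degree [t], by all [t.+1] rows gives
    0, and the Cramer rule leaves the minor times [w]. *)
Lemma omega_bd w z : St t 0 w -> St t.+1 0 z -> bd M t 0 (omega M z *: w).
Proof.
move=> hw hz; apply: (St_gen (S := fun z => bd M t 0 ((omega M z : R) *: w)) _ _ hz).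
  split=> [|a x y hx hy].
    by rewrite linear0 scale0r; exact: (bd_closed M t 0).1.
  by rewrite (linearP (omega M)) scalerDl -scalerA; exact: (bd_closed M t 0).2.
move=> g _ gl; rewrite omega_basis.
have := @wdf_ctf_bd R t.+1 m M t t.+1 (rw M) (fun a => unitv R (g a)) w
  (fun a => ex_intro _ a erefl) hw (leqnn _).
have -> : ctf (rw M) w = 0.
  by rewrite ctf_first ct_hdeg0 ?scaler0 //; case: hw => h1 _; exact: hdeg_ctf.
rewrite (linear0 (wdf _)) sub0r => h.
have := (bd_closed M t 0).2 (-1) _ _ h (bd_closed M t 0).1.
by rewrite addr0 scaleN1r opprK.
Qed.

(** The Cramer rule for all rows but [i]: the contraction of [w] is the scalar [omegai i w] up to
    sign, and the determinant is [omegai i] of the basis element. It expresses that [L] has rank one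
    over [A]. *)
Lemma omegai_sym i (w w' : W) : St t 0 w -> St t 0 w' ->
  bd M t 0 ((omegai i w : R) *: w' - (omegai i w' : R) *: w).
Proof.
move=> hw hw'; apply: (St_gen (S := fun w' => bd M t 0 ((omegai i w : R) *: w' - (omegai i w' : R) *: w)) _ _ hw').
  split=> [|a x y hx hy].
    by rewrite (linear0 (omegai i)) scale0r scaler0 subr0; exact: (bd_closed M t 0).1.
  have := (bd_closed M t 0).2 a _ _ hx hy; congr (bd _ _ _).
  rewrite (linearP (omegai i)) [in LHS]scalerBr scalerDl opprD addrACA; congr (_ + _).
    by rewrite scalerDr !scalerA [a * _]mulrC.
  by rewrite scalerA.
move=> g _ gl.
have := @wdf_ctf_bd R t.+1 m M t t (fun a => rw M (lift i a)) (fun a => unitv R (g a)) w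
  (fun a => ex_intro _ (lift i a) erefl) hw (leqnSn _).
rewrite (ctf_const _ hw) (linearZ_LR (wdf _)) /= => h.
have := (bd_closed M t 0).2 ((-1) ^+ i) _ _ h (bd_closed M t 0).1.
rewrite addr0 scalerBr !scalerA; congr (bd _ _ _ (_ *: _ - _ *: _)).
rewrite /omegai /basis ctf_wdf (linearZ_LR (@vc R _ _)) /= vc_vac mcoeffZ mcoeff1 eqxx.
by rewrite mulr1.
Qed.

(** Dropping rows [i] and [lift i a] in either order leaves the same rows; the sign changes because
    exactly one of the two positions moves by one. *)
Lemma lift2 (i : 'I_t.+1) (a : 'I_t) : exists b : 'I_t,
  [/\ lift (lift i a) b = i, (-1) ^+ (lift i a + b) = - (-1) ^+ (i + a) :> R
    & forall c : 'I_t.-1, lift (lift i a) (lift b c) = lift i (lift a c)].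
Proof.
have [ai|ia] := ltnP a i.
  have hb : (i.-1 < t)%N by have := ltn_ord i; have := ltn_ord a; lia.
  exists (Ordinal hb); split.
  - by apply: val_inj; rewrite /= /bump; lia.
  - have -> : (i + a = (lift i a + i.-1).+1)%N by rewrite /= /bump leqNgt ai; lia.
    by rewrite exprS mulN1r opprK.
  - by move=> c; apply: val_inj; rewrite /= /bump; lia.
have hb : (i < t)%N by have := ltn_ord a; lia.
exists (Ordinal hb); split.
- by apply: val_inj; rewrite /= /bump; lia.
- have -> : (lift i a + i = (i + a).+1)%N by rewrite /= /bump ia; lia.
  by rewrite exprS mulN1r.
- by move=> c; apply: val_inj; rewrite /= /bump; lia.
Qed.
End Submaximal.

Section ConormalComplex.
Variables (R : comNzRingType) (t m : nat) (M : 'M[R]_(t.+2, m)).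
Local Notation D := {mpoly R[t.+2]}.
Local Notation W := (ext m D).
Local Notation T0 := (sterm R t.+2 m t.+1 0).
Local Notation T1 := (sterm R t.+2 m t.+2 0).

(* Expansion of [omegai] along one more row, [v] taking the place of that row. *)
Definition gam (i : 'I_t.+2) (a : 'I_t.+1) (v : nat -> R) (w : W) : R :=
  (-1) ^+ (a + i) * (vc (ctf (fun b : 'I_t => rw M (lift i (lift a b))) (ct v w)))@_0.

Lemma gam_unit i a v w : gam i a v w = \sum_(j < m) v j * gam i a (unitv R j) w.
Proof.
rewrite /gam ct_unit (linear_sum (ctf _)) (linear_sum (@vc R D m)) (linear_sum (mcoeff 0)) /=.
rewrite mulr_sumr; apply: eq_bigr => j _.
by rewrite (linearZ_LR (ctf _)) (linearZ_LR (@vc R D m)) /= mcoeffZ mulrCA.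
Qed.

Lemma gam_lift i a b w : gam i a (rw M (lift i b)) w = (a == b)%:R * omegai M i w.
Proof.
rewrite /gam; have [<-|nab] := eqVneq a b.
  rewrite mul1r /omegai (ctf_lift (fun b => rw M (lift i b)) a) (linearZ_LR (@vc R D m)) /= mcoeffZ.
  by rewrite mulrA -exprD addnC.
have [b' ->] : exists b', b = lift a b' by case: (unliftP a b) nab => [b' ->|->]; [exists b'|rewrite eqxx].
rewrite (ctf_ct (fun c => rw M (lift i (lift a c))) b').
by rewrite (linear0 (@vc R D m)) mcoeff0 mulr0 mul0r.
Qed.

Lemma gam_row i a w : gam i a (rw M i) w = - omegai M (lift i a) w.
Proof.
have [b [e1 e2 e3]] := lift2 R i a.
rewrite /omegai (ctf_lift (fun c => rw M (lift (lift i a) c)) b) (linearZ_LR (@vc R D m)) /= mcoeffZ.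
rewrite mulrA -exprD e2 mulNr opprK /gam e1 addnC; congr (_ * (vc _)@_0).
by apply: ctf_eq => c; rewrite e3.
Qed.

Lemma omegai_wd i u w : St t 0 w ->
  omegai M i (wd u w) = \sum_a dot m (rw M (lift i a)) u *
    ((-1) ^+ (a + i) * (vc (ctf (fun b : 'I_t => rw M (lift i (lift a b))) w))@_0) :> R.
Proof.
move=> [h1 h2]; rewrite /omegai ctf_wd.
have -> : ctf (fun a => rw M (lift i a)) w = 0.
  by rewrite ctf_first ct_hdeg0 ?scaler0 //; exact: hdeg_ctf.
rewrite wd00 scaler0 add0r (linear_sum (@vc R _ _)) (linear_sum (mcoeff 0)) mulr_sumr.
apply: eq_bigr => a _; rewrite (linearZ_LR (@vc R _ _)) /= mcoeffZ.
by rewrite exprD; ring.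
Qed.

Variables (N L A : lmodType R) (pN : {linear T1 -> N}) (pL : {linear T0 -> L}) (pA : {linear R^o -> A}).
Variable I2 : R^o -> Prop.
Hypotheses (spN : onto pN) (spL : onto pL) (spA : onto pA).
Hypothesis kpN : forall z, pN z = 0 <-> I2 (omega M (val z)).
Hypothesis kpL : forall z, pL z = 0 <-> bd M t.+1 0 (val z).
Hypothesis kpA : forall a, pA a = 0 <-> exists z, St t.+2 0 z /\ a = omega M z.
Hypothesis I2_closed : subclosed I2.
Hypothesis I2_mul : forall z z', St t.+2 0 z -> St t.+2 0 z' -> I2 ((omega M z : R) * omega M z').
Hypothesis I2_min : forall S : R^o -> Prop, subclosed S ->
  (forall z z', St t.+2 0 z -> St t.+2 0 z' -> S ((omega M z : R) * omega M z')) ->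
  forall a, I2 a -> S a.
Hypothesis inv_nat : forall k, exists r : R, k.+1%:R * r = 1.
Variables (as_ : seq R) (js : seq R).
Hypothesis reg_as : reg_on (fun x : R^o => x = 0) as_.
Hypothesis as_omega : forall a, a \in as_ -> exists w, St t.+2 0 w /\ a = omega M w.
Hypothesis reg_js : reg_on (fun x : R^o => x = 0) js.
Definition subminor (a : R) := exists i w, St t.+1 0 w /\ a = omegai M i w.
Hypothesis js_sub : forall S : R^o -> Prop, subclosed S -> (forall a, subminor a -> S a) ->
  forall a, a \in js -> S a.
Hypothesis size_as : (m - t.+1 <= size as_)%N.
Hypothesis tm : (t.+1 < m)%N.

Lemma ct_unit_bd j z : bd M t.+2 0 z -> bd M t.+1 0 (ct (unitv R j) z).
Proof.
move=> /bd_ct[u [hu ->]]; rewrite linear_sum.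
apply: (subclosed_sum _ (bd_closed M t.+1 0)) => i.
rewrite -[X in bd _ _ _ X]/(ct (unitv R j) (ct (rw M i) (u i))) ctC.
apply: (subclosedN (bd_closed M t.+1 0)).
apply: ct_bd; have [h1 h2] := hu i; split; first exact: hdeg_ct.
exact: (eall_lin _ (cdeg_closed R _ 0) h2).1.
Qed.

Lemma St_ct s v z : St s.+1 0 z -> St s 0 (ct v z : W).
Proof.
move=> [h1 h2]; split; first exact: hdeg_ct.
exact: (eall_lin _ (cdeg_closed R _ 0) h2).1.
Qed.

Lemma St_wd s v z : St s 0 z -> St s.+1 0 (wd v z : W).
Proof.
move=> [h1 h2]; split; first exact: hdeg_wd.
exact: (eall_lin _ (cdeg_closed R _ 0) h2).2.
Qed.

Definition mkT s (w : W) (hw : St s 0 w) : sterm R t.+2 m s 0 := mkpsub (@St_closed R t.+2 m s 0) hw.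

(** This makes [psi] well defined. An element of the square of the ideal is [omega] of a combination
    of elements [omega z1 *: z2], whose contractions are boundaries by [omega_bd]; the difference to
    [z] is itself a boundary by [omega_exact], and contractions by coordinates preserve boundaries
    up to sign. *)
Lemma omega_sq_bd (j : 'I_m) z : St t.+2 0 z -> I2 (omega M z) -> bd M t.+1 0 (ct (unitv R j) z).
Proof.
move=> hz hI.
have [z' [hz' e h']] : exists z', [/\ St t.+2 0 z', omega M z = omega M z'
    & bd M t.+1 0 (ct (unitv R j) z')].
  apply: (I2_min (S := fun a => exists z', [/\ St t.+2 0 z', a = omega M z'
    & bd M t.+1 0 (ct (unitv R j) z')]) _ _ hI).
    split=> [|a x y [z1 [h1 -> b1]] [z2 [h2 -> b2]]].
      exists 0; rewrite (linear0 (omega M)) ct00; split=> //; first exact: St0.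
      exact: (bd_closed M _ 0).1.
    exists (a *: z1 + z2); split; first exact: St_comb.
      by rewrite (linearP (omega M)).
    by rewrite linearP; exact: (bd_closed M _ 0).2.
  move=> z1 z2 h1 h2; exists (omega M z1 *: z2); split; first exact: StZ.
    by rewrite (linearZ_LR (omega M)).
  by rewrite ctZ; apply: omega_bd => //; exact: St_ct.
have b1 : bd M t.+2 0 (z - z').
  apply: (omega_exact inv_nat reg_as as_omega).
  - by lia.
  - by apply: (subclosedB (@St_closed _ _ _ _ _)).
  - have -> : omega M (z - z') = omega M z - omega M z' := linearB (omega M) z z'.
    by rewrite e subrr.
have := (bd_closed M t.+1 0).2 1 _ _ (ct_unit_bd j b1) h'.
by rewrite scale1r -ctD subrK.
Qed.

Lemma omegai_bd i w : bd M t.+1 0 w -> exists z, St t.+2 0 z /\ omegai M i w = omega M z.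
Proof.
move=> /bd_ct[u [hu ->]]; exists (u i); split=> //.
rewrite omegai_sum (bigD1 i) //= big1 ?addr0 => [|k ki].
  by rewrite omegai_ct eqxx mul1r.
by rewrite omegai_ct eq_sym (negPf ki) mul0r.
Qed.

(** The map from [I/I^2] to [F (x) L]: the class of [omega z] is sent to the contractions of [z] by
    the coordinate forms. *)
Lemma psi_ex : exists psi : {linear N -> {ffun 'I_m -> L}},
  forall z : T1, psi (pN z) = [ffun j : 'I_m => pL (mkT (St_ct (unitv R j) (psubP z)))].
Proof.
have [|f hf] := ex_linear (f := fun z : T1 =>
    [ffun j : 'I_m => pL (mkT (St_ct (unitv R j) (psubP z)))] : {ffun 'I_m -> L}).
  move=> a x y; apply/ffunP => j; rewrite !ffunE -linearP; congr (pL _); apply: val_inj.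
  by rewrite /= linearP.
have [|g hg] := factor_surj (f := f) spN.
  move=> z /kpN h; rewrite hf; apply/ffunP => j; rewrite !ffunE; apply/kpL => /=.
  exact: omega_sq_bd (psubP z) h.
by exists g => z; rewrite hg hf.
Qed.

Lemma ev_ex : exists ev : {linear {ffun 'I_t.+2 -> L} -> A},
  forall y : 'I_t.+2 -> T0, ev [ffun i => pL (y i)] = \sum_i pA (omegai M i (val (y i))).
Proof.
have h i : exists g : {linear L -> A}, forall w, g (pL w) = pA (omegai M i (val w)).
  have [|g hg] := factor_surj (f := lcomp pA (lcomp (omegai M i) (lval _)) : {linear T0 -> A}) spL.
    by move=> w /kpL /(omegai_bd i) [z [hz e]]; apply/kpA; exists z.
  by exists g => w; rewrite hg.
have [g hg] := ex_choice h.
have [|f hf] := ex_linear (f := fun y : {ffun 'I_t.+2 -> L} => \sum_i g i (y i)).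
  move=> a x y; rewrite scaler_sumr -big_split /=; apply: eq_bigr => i _.
  by rewrite !ffunE linearP.
by exists f => y; rewrite hf; apply: eq_bigr => i _; rewrite ffunE hg.
Qed.

Lemma mu_ex : exists mu : {linear {ffun 'I_m -> L} -> {ffun 'I_t.+2 -> L}},
  forall x, mu x = [ffun i => \sum_j M i j *: x j].
Proof.
apply: ex_linear => a x y; apply/ffunP => i; rewrite !ffunE scaler_sumr -big_split /=.
by apply: eq_bigr => j _; rewrite !ffunE scalerDr !scalerA mulrC.
Qed.

Lemma pL_rep k (x : {ffun 'I_k -> L}) : exists w : 'I_k -> T0, x = [ffun i => pL (w i)].
Proof.
have [w hw] := ex_choice (fun i : 'I_k => spL (x i)).
by exists w; apply/ffunP => i; rewrite ffunE hw.
Qed.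

Lemma pL_eq (x y : T0) : bd M t.+1 0 (val x - val y) -> pL x = pL y.
Proof. by move=> h; apply/eqP; rewrite -subr_eq0 -linearB; apply/eqP/kpL. Qed.

Lemma val_sum k (F : 'I_k -> T0) : val (\sum_i F i) = \sum_i val (F i).
Proof. exact: (linear_sum (lval _)). Qed.

Section Homology.
Variables (psi : {linear N -> {ffun 'I_m -> L}}) (mu : {linear {ffun 'I_m -> L} -> {ffun 'I_t.+2 -> L}})
  (ev : {linear {ffun 'I_t.+2 -> L} -> A}).
Hypothesis psiE : forall z : T1, psi (pN z) = [ffun j : 'I_m => pL (mkT (St_ct (unitv R j) (psubP z)))].
Hypothesis evE : forall y : 'I_t.+2 -> T0, ev [ffun i => pL (y i)] = \sum_i pA (omegai M i (val (y i))).
Hypothesis muE : forall x, mu x = [ffun i => \sum_j M i j *: x j].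

Lemma muE' (w : 'I_m -> T0) : mu [ffun j => pL (w j)] = [ffun i => pL (\sum_j M i j *: w j)].
Proof.
rewrite muE; apply/ffunP => i; rewrite !ffunE linear_sum; apply: eq_bigr => j _.
by rewrite ffunE linearZ_LR.
Qed.

Lemma mu_psi n : mu (psi n) = 0.
Proof.
have [z <-] := spN n; rewrite psiE muE'; apply/ffunP => i; rewrite !ffunE; apply/kpL.
rewrite val_sum; have := ct_bd M i (psubP z); rewrite ct_unit; congr (bd _ _ _ _).
by apply: eq_bigr => j _; rewrite rwE.
Qed.

(** By Laplace expansion the value is represented by [omega] of the sum of the products of [e_j]
    with [w j], which lies in the ideal. *)
Lemma ev_mu x : ev (mu x) = 0.
Proof.
have [w ->] := pL_rep x; rewrite muE' evE -linear_sum; apply/kpA.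
exists (\sum_(j < m) wd (unitv R j) (val (w j))); split.
  by apply: (subclosed_sum _ (@St_closed _ _ _ _ _)) => j; apply: St_wd (psubP (w j)).
rewrite omega_sum.
under [RHS]eq_bigr => j _ do rewrite (omega_wd _ _ (psubP (w j))).
rewrite exchange_big; apply: eq_bigr => i _; rewrite val_sum omegai_sum.
by apply: eq_bigr => j _; rewrite dot_rw -omegaiZ.
Qed.

(** A submaximal value [omegai i w] times [omega z] is the sum over [j] of [omegai i] of the [j]-th
    contraction of [z] times [omega] of the product of [e_j] with [w]. If the contractions vanish in
    [L], both factors lie in the ideal. *)
Lemma psi_tors a n : subminor a -> psi n = 0 -> a *: n = 0.
Proof.
move=> [i [w [hw ->]]]; have [z <-] := spN n => e; rewrite -linearZ_LR; apply/kpN.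
have hz : St t.+2 0 (val z) := psubP z.
have -> : omega M (val (omegai M i w *: z)) =
    \sum_(j < m) (omegai M i (ct (unitv R j) (val z)) : R) * omega M (wd (unitv R j) w).
  rewrite -[val (_ *: _)]/(omegai M i w *: val z) omegaZ.
  under eq_bigr => j _ do rewrite omega_wd // mulr_sumr.
  rewrite exchange_big /= (bigD1 i) //= [X in _ + X]big1 ?addr0 => [|k ki].
    under eq_bigr => j _ do rewrite dot_rw mulrA.
    rewrite -mulr_suml.
    have -> : \sum_(j < m) (omegai M i (ct (unitv R j) (val z)) : R) * M i j = omega M (val z).
      transitivity (omegai M i (ct (rw M i) (val z)) : R); last by rewrite omegai_ct eqxx mul1r.
      rewrite ct_unit omegai_sum; apply: eq_bigr => j _.
      by rewrite omegaiZ rwE mulrC.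
    exact: mulrC.
  under eq_bigr => j _ do rewrite dot_rw mulrA.
  rewrite -mulr_suml.
  have -> : \sum_(j < m) (omegai M i (ct (unitv R j) (val z)) : R) * M k j = 0; last exact: mul0r.
  transitivity (omegai M i (ct (rw M k) (val z)) : R); last by rewrite omegai_ct eq_sym (negPf ki) mul0r.
  rewrite ct_unit omegai_sum; apply: eq_bigr => j _.
  by rewrite omegaiZ rwE mulrC.
apply: (subclosed_sum _ I2_closed) => j.
have /omegai_bd -/(_ i) [z' [hz' ->]] : bd M t.+1 0 (ct (unitv R j) (val z)).
  by have := congr1 (fun x : {ffun 'I_m -> L} => x j) e; rewrite psiE !ffunE => /kpL.
by apply: I2_mul => //; exact: St_wd.
Qed.

(** The preimage is the sum of [omegai i (w j)] times the product of [e_j] with [tau]. Its [k]-th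
    contraction yields [omegai i (w k) *: tau], which symmetry turns into [omegai i tau *: w k]; in
    the other terms symmetry moves [w j] out, and the remaining sums are rows of [M] applied to [w],
    hence boundaries. *)
Lemma mu_tors a x : subminor a -> mu x = 0 -> exists n, a *: x = psi n.
Proof.
move=> [i [tau [hw ->]]]; have [w ->] := pL_rep x; rewrite muE' => e.
have hb k : bd M t.+1 0 (\sum_j M k j *: val (w j)).
  have : pL (\sum_j M k j *: w j) = 0 by have := congr1 (fun x : {ffun 'I_t.+2 -> L} => x k) e; rewrite !ffunE.
  by move=> /kpL; rewrite val_sum.
pose z : W := \sum_(j < m) omegai M i (val (w j)) *: wd (unitv R j) tau.
have hz : St t.+2 0 z.
  by apply: (subclosed_sum _ (@St_closed _ _ _ _ _)) => j; apply: StZ; apply: St_wd.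
exists (pN (mkT hz)); rewrite psiE; apply/ffunP => k; rewrite !ffunE -linearZ_LR.
apply: pL_eq; rewrite -[val (_ *: _)]/(omegai M i tau *: val (w k)).
have hk := St_ct (unitv R k) hw.
rewrite -[val (mkT _)]/(ct (unitv R k) z).
have -> : ct (unitv R k) z = omegai M i (val (w k)) *: tau -
    \sum_(j < m) omegai M i (val (w j)) *: wd (unitv R j) (ct (unitv R k) tau).
  rewrite /z linear_sum -sumrN.
  have -> : omegai M i (val (w k)) *: tau =
      \sum_(j < m) (omegai M i (val (w j)) * (k == j)%:R) *: tau.
    rewrite (bigD1 k) //= eqxx mulr1 big1 ?addr0 // => j jk.
    by rewrite eq_sym (negPf jk) mulr0 scale0r.
  rewrite -big_split; apply: eq_bigr => j _ /=; rewrite ctZ ct_wd dot_unit // scalerBr scalerA.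
  by rewrite /unitv eqE /= eq_sym.
rewrite opprB addrCA addrC -opprB; apply: (subclosedD (bd_closed M _ _)).
  by apply: (subclosedN (bd_closed M _ _)); apply: omegai_sym => //; exact: psubP.
pose y := ct (unitv R k) tau.
have -> : \sum_(j < m) omegai M i (val (w j)) *: wd (unitv R j) y =
    \sum_(j < m) (omegai M i (val (w j)) *: wd (unitv R j) y - omegai M i (wd (unitv R j) y) *: val (w j)) +
    \sum_(j < m) omegai M i (wd (unitv R j) y) *: val (w j).
  by rewrite -big_split; apply: eq_bigr => j _ /=; rewrite subrK.
apply: (subclosedD (bd_closed M _ _)).
  apply: (subclosed_sum _ (bd_closed M _ _)) => j; apply: omegai_sym; first exact: psubP.
  exact: St_wd.
under eq_bigr => j _ do rewrite omegai_wd // scaler_suml.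
rewrite exchange_big; apply: (subclosed_sum _ (bd_closed M _ _)) => b /=.
under eq_bigr => j _ do rewrite dot_rw mulrC -scalerA.
rewrite -scaler_sumr; apply: (subclosedZ _ (bd_closed M _ _)); exact: hb.
Qed.

(** The coefficients [gam] form a partial inverse of [M]: row [lift i b] gives [omegai i tau] at [b]
    and 0 elsewhere. Row [i] gives the remaining values [omegai (lift i a) tau] with a sign, and
    there [ev y = 0] together with symmetry supplies the missing component. *)
Lemma ev_tors r y : subminor r -> ev y = 0 -> exists x, r *: y = mu x.
Proof.
move=> [i [tau [hw ->]]]; have [v ->] := pL_rep y; rewrite evE -linear_sum => /kpA [z0 [hz0 ez]].
pose w (j : 'I_m) : T0 := \sum_a gam i a (unitv R j) tau *: v (lift i a).
exists [ffun j => pL (w j)]; rewrite muE'; apply/ffunP => k; rewrite !ffunE -linearZ_LR.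
apply: pL_eq.
have -> : val (\sum_j M k j *: w j) = \sum_a gam i a (rw M k) tau *: val (v (lift i a)).
  rewrite val_sum.
  transitivity (\sum_j \sum_a (M k j * gam i a (unitv R j) tau) *: val (v (lift i a))).
    apply: eq_bigr => j _; rewrite -[LHS]/(M k j *: val (w j)) val_sum scaler_sumr.
    by apply: eq_bigr => a _; rewrite scalerA.
  rewrite exchange_big; apply: eq_bigr => a _; rewrite -scaler_suml gam_unit.
  by congr (_ *: _); apply: eq_bigr => j _; rewrite rwE.
rewrite -[val (_ *: _)]/(omegai M i tau *: val (v k)).
case: (unliftP i k) => [b|] ->.
  rewrite (bigD1 b) //= gam_lift eqxx mul1r big1 ?addr0 ?subrr; first exact: (bd_closed M _ _).1.
  by move=> a ab; rewrite gam_lift (negPf ab) mul0r scale0r.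
under eq_bigr => a _ do rewrite gam_row scaleNr.
rewrite sumrN opprK.
have -> : omegai M i tau *: val (v i) + \sum_a omegai M (lift i a) tau *: val (v (lift i a)) =
  \sum_k (omegai M k tau *: val (v k) - omegai M k (val (v k)) *: tau) + omega M z0 *: tau.
  rewrite -ez scaler_suml -big_split /=.
  under [RHS]eq_bigr => b _ do rewrite subrK.
  by rewrite [RHS](bigD1_ord i).
apply: (subclosedD (bd_closed M _ _)); last exact: omega_bd.
by apply: (subclosed_sum _ (bd_closed M _ _)) => b; apply: omegai_sym => //; exact: psubP.
Qed.

Lemma ev_onto a z : subminor a -> exists y, a *: z = ev y.
Proof.
move=> [i [tau [hw ->]]]; have [r <-] := spA z.
exists [ffun k => pL (if k == i then (r : R) *: mkT hw else 0)]; rewrite evE (bigD1 i) //= eqxx.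
rewrite big1 ?addr0 => [|k /negPf ->]; last by rewrite (linear0 (omegai M k)) linear0.
rewrite -linearZ_LR; congr (pA _).
by rewrite -[val (_ *: _)]/((r : R) *: tau) omegaiZ; exact: mulrC.
Qed.
End Homology.

Lemma extn_L k : (m - t.+1 <= k)%N -> extn R^o k L.
Proof.
move=> hk; apply: (res_extn (C := strand M t.+1) (l := m - t.+1) (e := 0) (p := pL)) => //.
- exact: sterm_projective.
- by move=> e he x; exact: sterm_gt he.
- exact: strand_exact inv_nat _ reg_as as_omega _ size_as.
- by move=> x; rewrite kpL bdP.
Qed.

(** The strand resolves the ideal, not [A]; one step through the sequence of the ideal, [R] and [A]
    adds 1 to its length [m - t.+2]. *)
Lemma extn_A k : (m - t.+1 <= k)%N -> extn R^o k A.
Proof.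
case: k => [|k] hk; first by lia.
have s1 : ses (lval _ : {linear kerm pA -> R^o}) pA by exact: kerm_ses.
apply: (extn_right s1); last by apply: extn_proj; exact: regular_projective.
have [|f hf] := factor_inj (i := lval _ : {linear kerm pA -> R^o})
    (f := lcomp (omega M) (lval _) : {linear T1 -> R^o}) val_inj.
  move=> z; have h : pA (omega M (val z)) = 0.
    by apply/kpA; exists (val z); split=> //; exact: psubP.
  by exists (mkpsub (ker_closed pA) h).
have hf' z : val (f z) = omega M (val z) := hf z.
apply: (res_extn (C := strand M t.+2) (l := m - t.+2) (e := 0) (p := f)).
- exact: sterm_projective.
- by move=> e he x; exact: sterm_gt he.
- by apply: strand_exact reg_as as_omega _ _ => //; lia.
- move=> a; have /kpA [z [hz e]] := psubP a.
  by exists (mkT hz); apply: val_inj; rewrite hf' e.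
- move=> z; rewrite bdP; split=> [e|[u [hu e]]].
    apply: (omega_exact inv_nat reg_as as_omega).
    + by lia.
    + exact: psubP.
    + by rewrite -hf' e.
  apply: val_inj; rewrite hf' e.
  have /bd_ct[u' [hu' ->]] : bd M t.+2 0 (dl M u) by exists u.
  rewrite omega_sum big1 // => i _.
  by rewrite /omega (ctf_ct (rw M)) (linear0 (@vc R _ _)) mcoeff0.
- lia.
Qed.

Theorem extn_conormal q : (m - t.+1 <= q)%N -> (q.+4 < size js)%N -> extn R^o q N.
Proof.
move=> hq hs; have [psi psiE] := psi_ex; have [mu muE] := mu_ex; have [ev evE] := ev_ex.
apply: (ext_chain (J := subminor) (psi := psi) (mu := mu) (ev := ev)).
- exact: mu_psi.
- exact: ev_mu.
- exact: psi_tors.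
- exact: mu_tors.
- exact: ev_tors.
- exact: ev_onto.
- by move=> k hk; apply: extn_ffun; apply: extn_L; lia.
- by move=> k hk; apply: extn_ffun; apply: extn_L; lia.
- by move=> k hk; apply: extn_A; lia.
(* Here [k <= q + 3] stands for [Ext] of degree at most [q + 4], whence the strict bound on
   [size js]. *)
move=> T hT k hk; apply/hv_std.
apply: (@hv_grade _ (std T) js R^o R^o (lid R^o) (fun x => x = 0)) => //; last by lia.
- exact: std_proj.
- by move=> x; exists x.
move=> a aj; apply: (@std_null _ _ _ 1) => x; rewrite expr1.
apply: (js_sub (S := fun a => a *: x = 0) _ _ aj) => [|b hb]; last exact: hT.
split=> [|b c d h1 h2]; first exact: scale0r.
by rewrite scalerDl h2 addr0 -scalerA h1 scaler0.
Qed.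
End ConormalComplex.

(** * Noetherian modules and homogeneous primes *)

Section Noetherian.
Variable R : comNzRingType.
Implicit Types V A B C : lmodType R.

(** Stated impredicatively so that an induction over generated elements is an instantiation;
    [gen_comb] recovers coefficients. *)
Definition gen V (l : seq V) (x : V) :=
  forall S : V -> Prop, subclosed S -> (forall y, y \in l -> S y) -> S x.

Lemma gen_closed V (l : seq V) : subclosed (gen l).
Proof.
split=> [S hS _|a x y hx hy S hS h]; first exact: hS.1.
by apply: hS.2; [exact: hx|exact: hy].
Qed.

Lemma gen_in V (l : seq V) x : x \in l -> gen l x.
Proof. by move=> h S _; apply. Qed.

Lemma gen_comb V (l : seq V) x : gen l x ->
  exists c : 'I_(size l) -> R, x = \sum_i c i *: l`_i.
Proof.
move=> h; apply: (h (fun x => exists c : 'I_(size l) -> R, x = \sum_i c i *: l`_i)).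
  split=> [|a y z [c ->] [d ->]].
    by exists (fun _ => 0); rewrite big1 // => i _; rewrite scale0r.
  exists (fun i => a * c i + d i); rewrite scaler_sumr -big_split; apply: eq_bigr => i _ /=.
  by rewrite scalerDl scalerA.
move=> y yl; have yi : (index y l < size l)%N by rewrite index_mem.
exists (fun i => (i == Ordinal yi)%:R); rewrite (bigD1 (Ordinal yi)) //= eqxx scale1r nth_index //.
by rewrite big1 ?addr0 // => i /negPf ->; rewrite scale0r.
Qed.

Definition fg V (S : V -> Prop) :=
  exists l : seq V, (forall y, y \in l -> S y) /\ forall x, S x -> gen l x.

Definition noeth V := forall S : V -> Prop, subclosed S -> fg S.

Lemma seq_lift (X Y : choiceType) (P : X -> Y -> Prop) (l : seq Y) :
  (forall y, y \in l -> exists x, P x y) ->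
  exists l' : seq X, (forall y, y \in l -> exists2 x, x \in l' & P x y) /\
    forall x, x \in l' -> exists2 y, y \in l & P x y.
Proof.
elim: l => [|y l IH] h; first by exists [::].
have [|l' [h1 h2]] := IH; first by move=> z zl; apply: h; rewrite inE zl orbT.
have [x hx] := h y (mem_head _ _); exists (x :: l'); split=> z.
  rewrite inE => /predU1P[->|/h1[x' xl p]]; first by exists x; rewrite ?mem_head.
  by exists x' => //; rewrite inE xl orbT.
rewrite inE => /predU1P[->|/h2[y' yl p]]; first by exists y; rewrite ?mem_head.
by exists y' => //; rewrite inE yl orbT.
Qed.

Lemma noeth_onto V C (p : {linear V -> C}) : onto p -> noeth V -> noeth C.
Proof.
move=> sp hV S hS; have [|l [h1 h2]] := hV (fun v => S (p v)).
  by split=> [|a x y hx hy]; rewrite ?linear0 ?linearP; [exact: hS.1|exact: hS.2].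
exists (map p l); split=> [_ /mapP[y /h1 h ->] //|x].
have [v <-] := sp x => /h2 hv T hT h; apply: (hv (fun v => T (p v))).
  by split=> [|a y z hy hz]; rewrite ?linear0 ?linearP; [exact: hT.1|exact: hT.2].
by move=> y yl; apply: h; rewrite map_f.
Qed.

Lemma noeth_ses A B C (i : {linear A -> B}) (p : {linear B -> C}) :
  ses i p -> noeth A -> noeth C -> noeth B.
Proof.
move=> [ii sp ip] hA hC S hS.
have [|la [a1 a2]] := hA (fun a => S (i a)).
  by split=> [|a x y hx hy]; rewrite ?linear0 ?linearP; [exact: hS.1|exact: hS.2].
have [|lc [c1 c2]] := hC (fun c => exists2 b, S b & p b = c).
  split=> [|a _ _ [x hx <-] [y hy <-]]; first by exists 0; [exact: hS.1|exact: linear0].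
  by exists (a *: x + y); [exact: hS.2|rewrite linearP].
have [|lb [b1 b2]] := @seq_lift B C (fun b c => S b /\ p b = c) lc.
  by move=> c /c1[b hb e]; exists b.
exists (map i la ++ lb); split=> [y|x Sx T hT h].
  by rewrite mem_cat => /orP[/mapP[z /a1 ? ->] //|/b2[c _ []]].
have hi a : S (i a) -> T (i a).
  move=> /a2 ga; apply: (ga (fun a => T (i a))).
    by split=> [|r y z hy hz]; rewrite ?linear0 ?linearP; [exact: hT.1|exact: hT.2].
  by move=> y yl; apply: h; rewrite mem_cat map_f.
have : exists b, [/\ S b, T b & p b = p x].
  apply: (c2 (p x) _ (fun c => exists b, [/\ S b, T b & p b = c])); first by exists x.
    split=> [|r _ _ [y [y1 y2 <-]] [z [z1 z2 <-]]].
      by exists 0; split; [exact: hS.1|exact: hT.1|exact: linear0].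
    by exists (r *: y + z); split; [exact: hS.2|exact: hT.2|rewrite linearP].
  move=> c /b1[b bl [Sb e]]; exists b; split=> //; apply: h.
  by rewrite mem_cat bl orbT.
move=> [b [Sb Tb e]]; have /ip [a ha] : p (x - b) = 0 by rewrite linearB e subrr.
rewrite -[x](subrK b) ha addrC -[b]scale1r; apply: hT.2 => //; apply: hi; rewrite -ha addrC -scaleN1r.
exact: hS.2.
Qed.

Lemma noeth_ffun b : noeth R^o -> noeth {ffun 'I_b -> R^o}.
Proof.
move=> hR; elim: b => [|b IH].
  move=> S hS; exists [::]; split=> // x _ T hT _.
  by have -> : x = 0 by [apply/ffunP => -[]]; exact: hT.1.
pose F := {ffun 'I_b -> R^o}.
have [r hr] : exists r : {linear (R^o * F)%type -> {ffun 'I_b.+1 -> R^o}},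
    forall x, r x = [ffun i => if unlift ord0 i is Some j then x.2 j else x.1].
  apply: ex_linear => a x y; apply/ffunP => i; rewrite !ffunE.
  by case: unliftP => [j _|_] //=; rewrite !ffunE.
apply: (noeth_onto (p := r)) => [y|].
  exists (y ord0, [ffun i => y (lift ord0 i)]); rewrite hr; apply/ffunP => i; rewrite !ffunE /=.
  by case: unliftP => [j ->|->]; rewrite ?ffunE.
apply: (noeth_ses (i := lpair (lid R^o) (lzero R^o F)) (p := lsnd R^o F) _ hR IH).
split=> [x y /= [] //|y|[u v] /=]; first by exists (0, y).
by split=> [->|[w [_ ->]] //]; exists u.
Qed.

Definition fgm V := exists b (p : {linear {ffun 'I_b -> R^o} -> V}), onto p.

Lemma noeth_fgm V (S : V -> Prop) (h : subclosed S) : noeth V -> fgm (psub h).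
Proof.
move=> nV; have [l [l1 l2]] := nV S h.
have hS (c : {ffun 'I_(size l) -> R^o}) : S (\sum_i (c i : R) *: l`_i).
  by apply: (subclosed_sum _ h) => i; apply: subclosedZ => //; apply: l1; exact: mem_nth.
have [D hD] : exists D : {linear {ffun 'I_(size l) -> R^o} -> psub h}, forall c, D c = mkpsub h (hS c).
  apply: ex_linear => a x y; apply: val_inj; rewrite /= scaler_sumr -big_split; apply: eq_bigr => i _ /=.
  by rewrite !ffunE scalerDl scalerA.
exists (size l), D => v; have [c hc] := gen_comb (l2 _ (psubP v)).
exists [ffun i => c i]; rewrite hD; apply: val_inj; rewrite /= hc.
by apply: eq_bigr => i _; rewrite ffunE.
Qed.

Lemma noeth_acc V (F : nat -> V -> Prop) : noeth V -> (forall k, subclosed (F k)) ->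
  (forall k x, F k x -> F k.+1 x) -> exists k, forall j x, F j x -> F k x.
Proof.
move=> hV hF hS; have mono j k x : (j <= k)%N -> F j x -> F k x.
  by move=> /subnK <-; elim: (k - j)%N => // d IH /IH /hS; rewrite addSn.
have [|l [h1 h2]] := hV (fun x => exists k, F k x).
  split=> [|a x y [j hj] [k hk]]; first by exists 0%N; exact: (hF 0%N).1.
  exists (maxn j k); apply: (hF _).2; first exact: mono (leq_maxl _ _) hj.
  exact: mono (leq_maxr _ _) hk.
have [k hk] : exists k, forall y, y \in l -> F k y.
  elim: l h1 {h2} => [|y l IH] h; first by exists 0%N.
  have [|k hk] := IH; first by move=> z zl; apply: h; rewrite inE zl orbT.
  have [j hj] := h y (mem_head _ _); exists (maxn j k) => z.
  rewrite inE => /predU1P[->|/hk]; first exact: mono (leq_maxl _ _) hj.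
  exact: mono (leq_maxr _ _).
exists k => j x hx; apply: (h2 x) => //; by exists j.
Qed.

(** Otherwise every member of the family has a strictly larger one, and iterating a choice
    contradicts the ascending chain condition. *)
Lemma noeth_max V (Phi : (V -> Prop) -> Prop) : noeth V -> (forall S, Phi S -> subclosed S) ->
  (exists S, Phi S) -> exists S, Phi S /\ forall T, Phi T -> (forall x, S x -> T x) -> forall x, T x -> S x.
Proof.
move=> hV hP [S0 p0]; apply: contrapT => hno.
have h (S : {S | Phi S}) : exists T : {S | Phi S}, (forall x, sval S x -> sval T x) /\
    exists x, sval T x /\ ~ sval S x.
  apply: contrapT => hn; apply: hno; exists (sval S); split; first exact: svalP S.
  move=> T pT ST x Tx; apply: contrapT => nS; apply: hn.
  by exists (exist _ T pT); split=> //; exists x.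
have [f hf] := ex_choice h.
pose F k := iter k f (exist _ S0 p0).
have [|k x /=|k hk] := @noeth_acc V (fun k => sval (F k)) hV.
- by move=> k; exact: hP (svalP (F k)).
- exact: (hf (F k)).1.
have [x [h1 h2]] := (hf (F k)).2; apply: h2; exact: hk k.+1 x h1.
Qed.
End Noetherian.

(** * Dickson's lemma and the Hilbert basis theorem *)

Section HilbertBasis.

(** Let [k0] be the largest last exponent in a set [L0] found for the first [n] coordinates. Where
    the last exponent is at least [k0], an element of [L0] lies below; the [k0] remaining slices
    have fixed last exponent. Exponents are functions on [nat] so that [n] can vary. *)
Lemma dickson n (P : (nat -> nat) -> Prop) : exists L : seq (nat -> nat),
  (forall g, g \in L -> P g) /\
  forall f, P f -> exists2 g, g \in L & forall j, (j < n)%N -> (g j <= f j)%N.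
Proof.
elim: n P => [|n IH] P.
  case: (pselect (exists f, P f)) => [[f Pf]|nP].
    exists [:: f]; split=> [g|g _]; first by rewrite inE => /eqP ->.
    by exists f; rewrite ?mem_head.
  by exists [::]; split=> // f Pf; case: nP; exists f.
have [L0 [h1 h2]] := IH P; have hk k := IH (fun f => P f /\ f n = k).
have [L hL] := ex_choice hk.
pose k0 := \max_(g <- L0) g n.
exists (L0 ++ flatten [seq L k | k <- iota 0 k0]); split=> [g|f Pf].
  by rewrite mem_cat => /orP[/h1 //|/flatten_mapP[k _ /(hL k).1 []]].
have [fk|kf] := ltnP (f n) k0.
  have [g gL hg] := (hL (f n)).2 f (conj Pf erefl); exists g.
    by rewrite mem_cat; apply/orP; right; apply/flatten_mapP; exists (f n); rewrite ?mem_iota.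
  move=> j; rewrite ltnS leq_eqVlt => /predU1P[->|]; last exact: hg.
  by have [_ ->] := (hL (f n)).1 g gL.
have [g gL hg] := h2 f Pf; exists g; first by rewrite mem_cat gL.
move=> j; rewrite ltnS leq_eqVlt => /predU1P[->|]; last exact: hg.
by apply: leq_trans kf; rewrite /k0 (big_rem g) //= leq_maxl.
Qed.

(** Division by leading terms: Dickson's lemma selects finitely many leading monomials, and
    cancelling the leading term by a matching generator descends in the well-founded monomial
    order. *)
Lemma noeth_mpoly (K : fieldType) n : noeth ({mpoly K[n]}^o).
Proof.
move=> S hS; pose mn (m : 'X_{1..n}) j := if insub j is Some i then m i else 0%N.
have mnE (m : 'X_{1..n}) (i : 'I_n) : mn m i = m i by rewrite /mn valK.
have [L [h1 h2]] := dickson n (fun g => exists f : {mpoly K[n]}, [/\ S f, f != 0 & g = mn (mlead f)]).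
have [|l [l1 l2]] := @seq_lift {mpoly K[n]} (nat -> nat) (fun f g => [/\ S f, f != 0 & g = mn (mlead f)]) L.
  by move=> g /h1.
have lc := @gen_closed _ {mpoly K[n]}^o l.
exists l; split=> [f /l2[g _ []] //|f].
have [m] : exists m, m = mlead f by exists (mlead f).
elim/(@ltmwf n): m f => m IH f em Sf; have [->|f0] := eqVneq f 0; first exact: lc.1.
have [|g /l1[q ql [Sq q0 ->]] hg] := h2 (mn (mlead f)); first by exists f.
have qf : (mlead q <= mlead f)%MM by apply/mnm_lepP => i; have := hg i (ltn_ord i); rewrite !mnE.
pose c := (mleadc f / mleadc q)%:MP * 'X_[mlead f - mlead q].
have cq0 : mleadc q != 0 by rewrite mleadc_eq0.
have fm : forall k, (mlead f <= k)%O -> (f - c * q)@_k = 0.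
  move=> k fk; rewrite mcoeffB /c -mulrA mul_mpolyC mcoeffZ.
  have qX : mleadc ('X_[mlead f - mlead q] : {mpoly K[n]}) = 1.
    by rewrite mleadXm mcoeffX eqxx.
  have lX : mlead ('X_[mlead f - mlead q] * q) = mlead f.
    rewrite mleadM_proper; first by rewrite mleadXm submK.
    by rewrite qX mul1r.
  move: fk; rewrite Order.POrderTheory.le_eqVlt => /predU1P[<-|fk].
    by rewrite -{3}lX mleadcM_proper ?qX mul1r ?divfK ?subrr.
  have Xk : (mlead ('X_[mlead f - mlead q] * q)%R < k)%O by rewrite lX.
  by rewrite (mcoeff_gt_mlead fk) (mcoeff_gt_mlead Xk) mulr0 subrr.
rewrite -[f](subrK (c * q)) -[c * q]/(c *: (q : {mpoly K[n]}^o)) addrC.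
apply: lc.2; first exact: (@gen_in _ {mpoly K[n]}^o).
have [->|d0] := eqVneq (f - c * q) 0; first exact: lc.1.
apply: (IH (mlead (f - c * q))) => //; last first.
  by rewrite addrC -mulNr; apply: hS.2.
rewrite em Order.TotalTheory.ltNge; apply/negP => /fm /eqP; rewrite mleadc_eq0.
exact/negP.
Qed.
End HilbertBasis.

Section Extension.
Variable R : comNzRingType.
Implicit Types N : lmodType R.

Definition extU N (U : N -> Prop) (a : R) : N -> Prop := fun x => exists y u, U u /\ x = a *: y + u.

Lemma extU_closed N (U : N -> Prop) a : subclosed U -> subclosed (extU U a).
Proof.
move=> hU; split=> [|b _ _ [y [u [Uu ->]]] [z [v [Uv ->]]]].
  by exists 0, 0; split; [exact: hU.1|rewrite scaler0 addr0].
exists (b *: y + z), (b *: u + v); split; first exact: hU.2.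
by rewrite !scalerDr !scalerA [a * b]mulrC addrACA.
Qed.

Lemma reg_on_ext N (U U' : N -> Prop) s : (forall x, U x <-> U' x) -> reg_on U s -> reg_on U' s.
Proof.
elim: s U U' => // a s IH U U' h [h1 h2]; split=> [x /h /h1 /h //|].
by apply: IH h2 => x; split=> -[y [u [/h Uu ->]]]; exists y, u.
Qed.

Lemma reg_on_rcons N (U : N -> Prop) s a : reg_on U (rcons s a) <->
  reg_on U s /\ forall x, foldl (@extU N) U s (a *: x) -> foldl (@extU N) U s x.
Proof.
elim: s U => [|b s IH] U /=; first by split=> [[]|[]].
by rewrite IH; split=> [[h1 [h2 h3]]|[[h1 h2] h3]].
Qed.

Lemma foldl_extU_closed N (U : N -> Prop) s : subclosed U -> subclosed (foldl (@extU N) U s).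
Proof. by elim: s U => //= a s IH U hU; apply: IH; exact: extU_closed. Qed.

Lemma reg_step N N' N1 (p : {linear N -> N'}) (p1 : {linear N -> N1}) (U : N -> Prop) a :
  onto p -> (forall x, p x = 0 <-> U x) -> onto p1 -> (forall x, p1 x = 0 <-> extU U a x) ->
  (forall x, U (a *: x) -> U x) ->
  exists r : {linear N' -> N1}, ses (lmul N' a) r /\ forall x, r (p x) = p1 x.
Proof.
move=> sp kp sp1 kp1 ra; have [|r hr] := factor_surj (f := p1) sp.
  by move=> x /kp Ux; apply/kp1; exists 0, x; rewrite scaler0 add0r.
exists r; split=> //; split=> [|y|y].
- apply: lker_inj => y; have [x <-] := sp y; rewrite -[lmul _ _ _]/(a *: p x) -linearZ_LR.
  by move=> /kp /ra /kp.
- by have [x <-] := sp1 y; exists (p x).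
have [x <-] := sp y; rewrite hr kp1; split=> [[z [u [/kp pu ->]]]|[z]].
  by exists (p z); rewrite linearD pu addr0 linearZ_LR.
have [v <-] := sp z => e; exists v, (x - a *: v); split; last by rewrite addrC subrK.
by apply/kp; rewrite linearB linearZ_LR e subrr.
Qed.

(** Each further quotient by an element of the sequence trades one cohomological degree, so degrees
    [q] to [q + size s] over [N'] control degree [q] over [N'']. *)
Lemma hv_seq (P : chain R) s : proj_cx P -> forall N N' N'' (p : {linear N -> N'})
  (p' : {linear N -> N''}) (U : N -> Prop) q, subclosed U ->
  onto p -> (forall x, p x = 0 <-> U x) ->
  onto p' -> (forall x, p' x = 0 <-> foldl (@extU N) U s x) -> reg_on U s ->
  (forall j, (j <= size s)%N -> hv P (q + j) N') -> hv P q N''.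
Proof.
move=> hP; elim: s => [|a s IH] N N' N'' p p' U q hU sp kp sp' kp' /= => [_|[ra rs]] hv'.
  have [|g hg] := factor_surj (f := p') sp; first by move=> x /kp /kp'.
  have [|g' hg'] := factor_surj (f := p) sp'; first by move=> x /kp' /kp.
  apply: (hv_retract (s := g') (r := g)); last by rewrite -[q]addn0; exact: hv'.
  by move=> y; have [x <-] := sp' y; rewrite hg' hg.
have [N1 [p1 [sp1 kp1]]] := quot_ex (extU_closed a hU).
have [r [hs hr]] := reg_step sp kp sp1 kp1 ra.
apply: (IH N N1 N'' p1 p' _ q (extU_closed a hU)) => // j hj.
apply: (hv_quot hs); first by exact: hP.
  by apply: hv'; exact: leqW.
by rewrite -addnS; exact: hv'.
Qed.
End Extension.

(** * Associated primes of homogeneous ideals *)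

Section GradedPrimes.
Variables (K : fieldType) (n : nat).
Local Notation R := {mpoly K[n]}.
Local Notation extR := (@extU R R^o).
Implicit Types (U P : R -> Prop) (f g w x : R).

(** Ideals remain predicates here; only the chains compared with [proj_codim] are packed into
    [prime_idealr]. *)
Definition idl U := @subclosed R R^o U.
Definition hid U := idl U /\ forall f d, U f -> U (pihomog mdeg d f).
Definition hgen f := exists d, f \is d.-homog.
Definition ann U w : R -> Prop := fun r => U (r * w).
Definition prm P := ~ P 1 /\ forall f g, P (f * g) -> P f \/ P g.
Lemma idlM U a x : idl U -> U x -> U (a * x).
Proof. exact: (@subclosedZ R R^o). Qed.
Lemma idlD U x y : idl U -> U x -> U y -> U (x + y).
Proof. exact: (@subclosedD R R^o). Qed.
Lemma idlB U x y : idl U -> U x -> U y -> U (x - y).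
Proof. exact: (@subclosedB R R^o). Qed.

Lemma pihomog_mul d f k g : f \is d.-homog ->
  pihomog mdeg k (f * g) = if (d <= k)%N then f * pihomog mdeg (k - d) g else 0.
Proof.
move=> hf; have [N hN kN] : exists2 N, (mmeasure mdeg g <= N)%N & (k < N)%N.
  by exists (maxn (mmeasure mdeg g) k.+1); rewrite ?leq_maxl // leq_maxr.
rewrite {1}(pihomog_partitionE hN) mulr_sumr linear_sum /=.
have hfe e : f * pihomog mdeg e g \is (d + e).-homog by apply: dhomogM => //; exact: pihomogP.
case: ifP => [dk|/negbT dk]; last first.
  by rewrite big1 // => e _; apply: pihomog_ne0 (hfe e); lia.
have lt : (k - d < N)%N by lia.
rewrite (bigD1 (Ordinal lt)) //= big1 ?addr0 => [|e /eqP ne].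
  by apply: pihomog_dE; have := hfe (k - d)%N; rewrite subnKC.
apply: pihomog_ne0 (hfe e); apply/eqP => h; apply: ne; apply: val_inj => /=; lia.
Qed.

Lemma mcoeff_pihomog d f m : (pihomog mdeg d f)@_m = if mdeg m == d then f@_m else 0.
Proof.
case: eqP => [<-|/eqP ne]; last by apply: dhomog_nemf_coeff (pihomogP mdeg d f) ne.
have [N hN kN] : exists2 N, (mmeasure mdeg f <= N)%N & (mdeg m < N)%N.
  by exists (maxn (mmeasure mdeg f) (mdeg m).+1); rewrite ?leq_maxl // leq_maxr.
have E : f@_m = \sum_(e < N) (pihomog mdeg e f)@_m.
  by rewrite -(linear_sum (mcoeff m)) -(pihomog_partitionE hN).
rewrite [RHS]E [RHS](bigD1 (Ordinal kN)) //= [X in _ = _ + X]big1 ?addr0 // => e ne.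
apply: dhomog_nemf_coeff (pihomogP mdeg e f) _; apply: contraNneq ne => e1.
by apply/eqP/val_inj.
Qed.

Lemma hid_test U f : hid U -> ~ U f -> exists d, ~ U (pihomog mdeg d f).
Proof.
move=> [hU _] nf; apply: contrapT => h; apply: nf.
rewrite (pihomog_partitionE (leqnn (mmeasure mdeg f))).
apply: (@subclosed_sum R R^o) => // d; apply: contrapT => nd; apply: h; by exists d.
Qed.

Lemma hgenM f g : hgen f -> hgen g -> hgen (f * g).
Proof. by move=> [d hd] [e he]; exists (d + e)%N; exact: dhomogM. Qed.

Lemma hgen_pi d f : hgen (pihomog mdeg d f).
Proof. by exists d; exact: pihomogP. Qed.

Lemma hid_ann U w : hid U -> hgen w -> hid (ann U w).
Proof.
move=> [hU hp] [d hw]; split=> [|f k].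
  split=> [|a x y hx hy]; rewrite /ann ?mul0r; first exact: hU.1.
  by rewrite mulrDl -[_ *: _]/(a * x) -mulrA; exact: hU.2.
rewrite /ann [f * w]mulrC => /(hp _ (k + d)%N).
by rewrite (pihomog_mul _ _ hw) leq_addl addnK mulrC.
Qed.

(* Compare the top components of [f] and [g]. *)
Lemma hprime P : hid P -> ~ P 1 -> (forall f g, hgen f -> hgen g -> P (f * g) -> P f \/ P g) -> prm P.
Proof.
move=> [hP hp] n1 hh; split=> //.
have main N : forall (a b : nat) (F G : nat -> R), (a + b <= N)%N ->
    (forall i, F i \is i.-homog) -> (forall i, G i \is i.-homog) ->
    P ((\sum_(i < a) F i) * (\sum_(j < b) G j)) -> P (\sum_(i < a) F i) \/ P (\sum_(j < b) G j).
  elim: N => [|N IH] a b F G hN hF hG.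
    by move: hN; rewrite leqn0 addn_eq0 => /andP[/eqP -> _] _; left; rewrite big_ord0; exact: hP.1.
  case: a hN => [|a] hN; first by left; rewrite big_ord0; exact: hP.1.
  case: b hN => [|b] hN; first by right; rewrite big_ord0; exact: hP.1.
  move=> h; have h' := hp _ (a + b)%N h.
  have FG i j : F i * G j \is (i + j).-homog by exact: dhomogM.
  have top : P (F a * G b).
    move: h'; rewrite big_distrlr linear_sum (bigD1 ord_max) //= linear_sum (bigD1 ord_max) //=.
    rewrite (pihomog_dE (FG a b)) big1 ?addr0 => [|j /eqP ne].
      rewrite big1 ?addr0 // => i /eqP ne; rewrite linear_sum big1 // => j _ /=.
      apply: pihomog_ne0 (FG i j); apply/eqP => e; apply: ne; apply: val_inj => /=.
      have := ltn_ord i; have := ltn_ord j; lia.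
    apply: pihomog_ne0 (FG a j); apply/eqP => e; apply: ne; apply: val_inj => /=; lia.
  have [Fa|Gb] := hh _ _ (ex_intro _ a (hF a)) (ex_intro _ b (hG b)) top.
    move: h; rewrite big_ord_recr /= mulrDl => h.
    have [||h1|h1] := IH a b.+1 F G _ hF hG.
    - by rewrite addSn in hN.
    - rewrite -[_ * _](addrK (F a * \sum_(j < b.+1) G j)); apply: idlB => //.
      by rewrite mulrC; exact: idlM.
    - by left; exact: idlD.
    - by right.
  move: h; rewrite [X in _ * X]big_ord_recr /= mulrDr => h.
  have [||h1|h1] := IH a.+1 b F G _ hF hG.
  - by rewrite addnS in hN.
  - rewrite -[_ * _](addrK ((\sum_(j < a.+1) F j) * G b)); apply: idlB => //.
    exact: idlM.
  - by left.
  - by right; rewrite big_ord_recr; exact: idlD.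
move=> f g; have := main _ (mmeasure mdeg f) (mmeasure mdeg g)
  (fun i => pihomog mdeg i f) (fun i => pihomog mdeg i g) (leqnn _).
rewrite -(pihomog_partitionE (leqnn (mmeasure mdeg f))).
rewrite -(pihomog_partitionE (leqnn (mmeasure mdeg g))).
by apply=> i; exact: pihomogP.
Qed.

(** Associated primes of [R / U] in graded form: annihilators of homogeneous elements that are
    maximal among such annihilators. *)
Definition mxann U w := [/\ hgen w, ~ U w & forall w', hgen w' -> ~ U w' ->
  (forall r, ann U w r -> ann U w' r) -> forall r, ann U w' r -> ann U w r].

Lemma max_ann U w0 : hid U -> hgen w0 -> ~ U w0 ->
  exists w, mxann U w /\ forall r, ann U w0 r -> ann U w r.
Proof.
move=> hU h0 n0; pose Phi S := exists w, [/\ hgen w, ~ U w, forall r, ann U w0 r -> ann U w r & S = ann U w].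
have [||S [[w [hw nw ww ->]] mx]] := @noeth_max R R^o Phi (@noeth_mpoly K n).
- by move=> _ [w [hw _ _ ->]]; exact: (hid_ann hU hw).1.
- by exists (ann U w0), w0.
exists w; split=> //; split=> // w' hw' nw' ww'; apply: mx => //.
by exists w'; split=> // r /ww /ww'.
Qed.

(** If [g] is not in the annihilator of [w], then [g * w] is nonzero modulo [U] with an annihilator
    containing that of [w], hence equal to it by maximality. *)
Lemma mxann_prm U w : hid U -> mxann U w -> prm (ann U w).
Proof.
move=> hU [hw nw mx]; apply: hprime; first exact: hid_ann.
  by rewrite /ann mul1r.
move=> f g hf hg hfg; have [|ng] := pselect (ann U w g); [by right|left].
apply: (mx (g * w)) => //; first exact: hgenM.
  by move=> r; rewrite /ann mulrCA => h; apply: idlM => //; case: hU.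
by rewrite /ann mulrA.
Qed.

Lemma prm_exp P f k : prm P -> P (f ^+ k) -> P f.
Proof.
move=> [n1 hP]; elim: k => [|k IH]; first by rewrite expr0.
by rewrite exprS => /hP[].
Qed.

Lemma avoid1 U JJ (l : seq R) w : hid U -> hid JJ -> mxann U w ->
  (exists f, JJ f /\ ~ ann U w f) -> (forall v, v \in l -> exists f, hgen v /\ ann U v f /\ ~ ann U w f) ->
  exists g, [/\ hgen g, JJ g, forall v, v \in l -> ann U v g & ~ ann U w g].
Proof.
move=> hU hJ mw [j [Jj nj]]; have hw : hgen w by case: mw.
elim: l => [_|v l IH hl].
  have [d nd] := hid_test (hid_ann hU hw) nj.
  by exists (pihomog mdeg d j); split=> //; [exact: hgen_pi|exact: hJ.2].
have [|g [hg Jg gl ng]] := IH; first by move=> u ul; apply: hl; rewrite inE ul orbT.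
have [h0 [hv [h1 nh0]]] := hl v (mem_head _ _).
have [d nd] := hid_test (hid_ann hU hw) nh0.
exists (pihomog mdeg d h0 * g); split.
- by apply: hgenM => //; exact: hgen_pi.
- by apply: idlM => //; case: hJ.
- move=> u; rewrite inE => /predU1P[->|/gl h].
    by rewrite mulrC; apply: idlM; [case: (hid_ann hU hv)|apply: (hid_ann hU hv).2].
  by rewrite /ann -mulrA; apply: idlM => //; case: hU.
- by move=> /(mxann_prm hU mw).2[].
Qed.

Lemma homog0_unit U f w : hid U -> f \is 0.-homog -> ~ U w -> U (f * w) -> f = 0.
Proof.
move=> [hU _] f0 nw fw; have fE : f = (f@_0)%:MP.
  apply/mpolyP => m; rewrite mcoeffC; have [->|m0] := eqVneq 0%MM m; first by rewrite mulr1.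
  by rewrite mulr0; apply: dhomog_nemf_coeff f0 _; rewrite mdeg_eq0 eq_sym.
have [c0|c0] := eqVneq f@_0 0; first by rewrite fE c0.
case: nw; have := idlM ((f@_0)^-1)%:MP hU fw.
by rewrite mulrA {2}fE -mpolyCM mulVf // mul1r.
Qed.

(** Graded prime avoidance. An element [f] that avoids the primes of [l] but lies in the one of [w]
    is corrected by a [g] from [avoid1] with the opposite behaviour. *)
Lemma avoid U JJ (l : seq R) : hid U -> hid JJ -> (forall w, w \in l -> mxann U w) ->
  (forall w, w \in l -> exists f, JJ f /\ ~ ann U w f) ->
  exists f, [/\ hgen f, JJ f & forall w, w \in l -> ~ ann U w f].
Proof.
move=> hU hJ; elim: l => [_ _|w l IH ml jl].
  by exists 0; split=> //; [exists 0%N; exact: dhomog0|exact: hJ.1.1].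
have mw := ml w (mem_head _ _).
have [||f [hf Jf nf]] := IH.
- by move=> v vl; apply: ml; rewrite inE vl orbT.
- by move=> v vl; apply: jl; rewrite inE vl orbT.
have [wf|nwf] := pselect (ann U w f); last first.
  by exists f; split=> // v; rewrite inE => /predU1P[->|/nf].
have mv v : v \in l -> mxann U v by move=> vl; apply: ml; rewrite inE vl orbT.
have [|g [hg Jg gl ng]] := avoid1 (l := l) hU hJ mw (jl w (mem_head _ _)).
  move=> v vl; apply: contrapT => h; apply: (nf v vl); have [h1 h2 h3] := mv v vl.
  have [w1 w2 w3] := mw; apply: (h3 w) => // r hr; apply: contrapT => nr; apply: h.
  by exists r.
have [l0|[v vl]] : l = [::] \/ exists v, v \in l.
- by case: (l) => [|v l']; [left|right; exists v; rewrite mem_head].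
- by exists g; split=> // u; rewrite l0 inE => /eqP ->.
have [df hdf] := hf; have [dg hdg] := hg; have [_ nw _] := mw; have [_ nv _] := mv v vl.
have f0 : f != 0.
  by apply/eqP => e; apply: (nf v vl); rewrite e /ann mul0r; case: hU => -[].
have g0 : g != 0.
  by apply/eqP => e; apply: ng; rewrite e /ann mul0r; case: hU => -[].
have dfP : (0 < df)%N.
  by case: df hdf => // /homog0_unit -/(_ U w hU nw wf) e; rewrite e eqxx in f0.
have dgP : (0 < dg)%N.
  by case: dg hdg => // /homog0_unit -/(_ U v hU nv (gl v vl)) e; rewrite e eqxx in g0.
have idlX P x k : idl P -> (0 < k)%N -> P x -> P (x ^+ k).
  by case: k => // k hP _ hx; rewrite exprSr; exact: idlM.
(* The powers equalize the degrees so that the sum is homogeneous. Both degrees are positive because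
   homogeneous elements of degree 0 are constants, and a nonzero constant lies in none of these
   primes. *)
exists (f ^+ dg + g ^+ df); split.
- exists (df * dg)%N; apply: dhomogD; first exact: dhomogMn.
  by rewrite mulnC; exact: dhomogMn.
- by apply: (idlD hJ.1); apply: idlX => //; case: hJ.
move=> u; rewrite inE => /predU1P[->|ul] h.
  apply: ng; apply: (prm_exp (k := df) (mxann_prm hU mw)).
  have hw := (hid_ann hU (let: And3 a _ _ := mw in a)).1.
  by rewrite -[g ^+ df](addrK (f ^+ dg)) [g ^+ df + _]addrC; apply: idlB => //; exact: idlX.
have mu := mv u ul; apply: (nf u ul); apply: (prm_exp (k := dg) (mxann_prm hU mu)).
have hu := (hid_ann hU (let: And3 a _ _ := mu in a)).1.
by rewrite -[f ^+ dg](addrK (g ^+ df)); apply: idlB => //; apply: idlX => //; exact: gl.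
Qed.

(** Finiteness of the associated primes is replaced by a maximal submodule [gen l] spanned by
    elements [w] as in [mxann]. If some [f] in [JJ] avoided all primes of [l], a zero divisor
    relation for [f] would give a further [w] whose prime contains [f]. By maximality [w] lies in
    [gen l], yet an element that kills all of [l] but not [w] exists by [avoid1]. *)
Lemma assoc_prime U JJ : hid U -> hid JJ ->
  (forall f, hgen f -> JJ f -> exists x, U (f * x) /\ ~ U x) ->
  exists w, mxann U w /\ forall f, JJ f -> ann U w f.
Proof.
move=> hU hJ hz; apply: contrapT => hno.
pose Phi S := exists l : seq R, (forall w, w \in l -> mxann U w) /\ S = @gen R R^o l.
have [||S [[l [ml ->]] mx]] := @noeth_max R R^o Phi (@noeth_mpoly K n).
- by move=> _ [l [_ ->]]; exact: gen_closed.
- by exists (gen [::]), [::].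
have [w wl|f [hf Jf nf]] := avoid hU hJ ml.
  apply: contrapT => h; apply: hno; exists w; split=> [|f Jf]; first exact: ml.
  by apply: contrapT => nf; apply: h; exists f.
have [x [fx nx]] := hz f hf Jf; have [d nd] := hid_test hU nx.
have fxd : U (f * pihomog mdeg d x).
  have [df hdf] := hf; have := hU.2 _ (df + d)%N fx.
  by rewrite (pihomog_mul _ _ hdf) leq_addr addKn.
have [w [mw wf]] := max_ann hU (hgen_pi d x) nd; have {}wf := wf f fxd.
have wl : @gen R R^o l w.
  apply: (mx (@gen R R^o (w :: l))); last exact: (@gen_in R R^o) (mem_head _ _).
    by exists (w :: l); split=> // v; rewrite inE => /predU1P[->|/ml].
  by move=> y hy T hT h; apply: (hy T hT) => z zl; apply: h; rewrite inE zl orbT.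
have hT : hid (fun _ => True) by split.
have [|v vl|g [_ _ gl ng]] := avoid1 (JJ := fun _ => True) (l := l) hU hT mw.
- by exists 1; split=> //; rewrite /ann mul1r; case: mw.
- apply: contrapT => h; apply: (nf v vl); have [v1 v2 v3] := ml v vl.
  have [w1 w2 w3] := mw; apply: (v3 w) => // r hr; apply: contrapT => nr; apply: h.
  by exists r.
apply: ng; apply: (wl (fun y => U (g * y))) => [|v /gl //].
split=> [|a y z hy hz']; first by rewrite mulr0; exact: hU.1.1.
by rewrite mulrDr -[a *: y]/(a * y) mulrCA; exact: hU.1.2.
Qed.

Lemma extU_hid U a : hid U -> hgen a -> hid (extR U a).
Proof.
move=> hU [d hd]; split=> [|f k [y [u [Uu ->]]]].
  split=> [|b _ _ [y [u [Uu ->]]] [z [v [Uv ->]]]].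
    by exists 0, 0; split; [exact: hU.1.1|rewrite scaler0 addr0].
  exists (b * y + z), (b * u + v); split; first exact: hU.1.2.
  rewrite -[_ *: _]/(b * (a * y + u)) -![a *: _]/(a * _).
  ring.
rewrite linearD /= -[a *: y]/(a * y) (pihomog_mul _ _ hd); case: ifP => _.
  by exists (pihomog mdeg (k - d) y), (pihomog mdeg k u); split=> //; exact: hU.2.
by exists 0, (pihomog mdeg k u); split; [exact: hU.2|rewrite scaler0].
Qed.

(* If [P w = 0] modulo [U] then, by Nakayama, the elements killed by [P] are not all divisible
   by [a], so [P + (a)] kills some nonzero element modulo [U + (a)]. *)
Lemma next_prime U a d w : hid U -> a \is d.+1.-homog -> (forall x, U (a * x) -> U x) ->
  hgen w -> ~ U w -> exists w', mxann (extR U a) w' /\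
    forall r, ann U w r -> ann (extR U a) w' r.
Proof.
move=> hU ha ra hw nw; have hE : hid (extR U a) by apply: extU_hid => //; exists d.+1.
suff [x [hx nx Nx]] : exists x, [/\ hgen x, ~ extR U a x & forall r, ann U w r -> U (r * x)].
  have [w' [m' w'x]] := max_ann hE hx nx; exists w'; split=> // r /Nx h; apply: w'x.
  by exists 0, (r * x); rewrite scaler0 add0r.
apply: contrapT => hno.
have main N : forall x, x \is N.-homog -> (forall r, ann U w r -> U (r * x)) -> U x.
  elim/ltn_ind: N => N IH x hx Nx.
  have [y [u [Uu xE]]] : extR U a x.
    by apply: contrapT => nx; apply: hno; exists x; split=> //; exists N.
  have := pihomog_dE hx; rewrite {1}xE linearD /= -[a *: y]/(a * y) (pihomog_mul _ _ ha).
  case: ifP => dN <-; last by rewrite add0r; exact: hU.2.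
  apply: (idlD hU.1); last exact: hU.2.
  apply: idlM; first exact: hU.1.
  apply: (IH (N - d.+1)%N); [by lia|exact: pihomogP|].
  move=> r hr; apply: ra; have := Nx r hr; have := pihomog_dE hx; rewrite {1}xE linearD /= -[a *: y]/(a * y) (pihomog_mul _ _ ha) dN => <-.
  rewrite mulrDr => h; rewrite mulrCA -[_ * _](addrK (r * pihomog mdeg N u)).
  by apply: (idlB hU.1) => //; apply: (idlM _ hU.1); exact: hU.2.
by apply: nw; have [e he] := hw; apply: (main e w he).
Qed.
End GradedPrimes.

(** * Powers of the variables as a regular sequence *)

Section Monomials.
Variables (K : fieldType) (n : nat).
Local Notation R := {mpoly K[n]}.

(* The ideal generated by the [s]-th powers of the first [j] variables. *)
Definition mon_ideal s j (f : R) := forall m, f@_m != 0 -> exists2 i : 'I_n, (i < j)%N & (s <= m i)%N.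

Lemma mon_ideal_closed s j : @subclosed R R^o (mon_ideal s j).
Proof.
split=> [m|a f g hf hg m]; first by rewrite mcoeff0 eqxx.
have hM (b : R) : mon_ideal s j (b * f).
  move=> k; rewrite -mcoeff_msupp => /msuppM_le /allpairsP[[k1 k2] /= [_ h2 ->]].
  have [|i ij si] := hf k2; first by rewrite -mcoeff_msupp.
  by exists i => //; rewrite mnmDE (leq_trans si) ?leq_addl.
rewrite mcoeffD; have [e|/hM //] := eqVneq (a * f)@_m 0.
by rewrite -[_ *: _]/(a * f) e add0r => /hg.
Qed.

Lemma mon_ideal0 s f : mon_ideal s 0 f <-> f = 0.
Proof.
split=> [h|-> m]; last by rewrite mcoeff0 eqxx.
by apply/mpolyP => m; rewrite mcoeff0; apply/eqP; apply: contraT => /h[].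
Qed.

Lemma mon_ideal_mono s j k f : (j <= k)%N -> mon_ideal s j f -> mon_ideal s k f.
Proof. by move=> jk h m /h[i ij si]; exists i => //; exact: leq_trans ij jk. Qed.

Lemma mon_idealX s (i : 'I_n) : mon_ideal s i.+1 ('X_i ^+ s).
Proof.
move=> m; rewrite mpolyXn mcoeffX; have [<- _|_] := eqVneq (U_(i) *+ s)%MM m; last by rewrite eqxx.
by exists i => //; rewrite mulmnE mnm1E eqxx mul1n.
Qed.

Lemma mpoly_mon_split (S : R^o -> Prop) (f : R) : subclosed S ->
  (forall m, f@_m != 0 -> S 'X_[m]) -> S f.
Proof.
move=> hS h; rewrite [f]mpolyE; apply: (subclosed_sum _ hS) => m.
have [->|/h Sm] := eqVneq f@_m 0; first by rewrite scale0r; exact: hS.1.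
by rewrite -mul_mpolyC; exact: subclosedZ.
Qed.

Lemma mon_idealS s (i : 'I_n) f :
  mon_ideal s i.+1 f <-> @extU R R^o (mon_ideal s i) ('X_i ^+ s) f.
Proof.
split=> [h|[y [u [hu ->]]]]; last first.
  rewrite addrC; apply: (@subclosedD R R^o) (mon_ideal_closed _ _) _ _.
    exact: mon_ideal_mono hu.
  rewrite -[_ *: _]/('X_i ^+ s * y) mulrC.
  by apply: (@subclosedZ R R^o) (mon_ideal_closed _ _) _; exact: mon_idealX.
have hc := extU_closed ('X_i ^+ s) (mon_ideal_closed s i).
apply: (mpoly_mon_split hc) => m /h[k]; rewrite ltnS leq_eqVlt => /predU1P[/val_inj ->|ki] sm.
  exists 'X_[m - U_(i) *+ s], 0; split; first exact: (mon_ideal_closed s i).1.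
  rewrite addr0 -[_ *: _]/(_ * _) mpolyXn -mpolyXD addmC submK //.
  apply/mnm_lepP => j; rewrite mulmnE mnm1E; case: eqP => [<-|_]; rewrite ?mul1n //.
exists 0, 'X_[m]; split; last by rewrite scaler0 add0r.
by move=> m'; rewrite mcoeffX; have [<- _|_] := eqVneq m m'; [exists k|rewrite eqxx].
Qed.

Lemma mon_ideal_reg s (i : 'I_n) f : mon_ideal s i ('X_i ^+ s * f) -> mon_ideal s i f.
Proof.
move=> h m fm; have [|k ki sk] := h (U_(i) *+ s + m)%MM.
  by rewrite mpolyXn mulrC mcoeffMX.
exists k => //; move: sk; rewrite mnmDE mulmnE mnm1E.
by have [e|//] := eqVneq i k; move: ki; rewrite e ltnn.
Qed.

Definition xpow s : seq R := [seq 'X_i ^+ s | i <- enum 'I_n].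

Lemma size_xpow s : size (xpow s) = n.
Proof. by rewrite size_map size_enum_ord. Qed.

Lemma xpow_reg s : @reg_on R R^o (fun x => x = 0) (xpow s).
Proof.
have main k : forall j, (j + k = n)%N -> @reg_on R R^o (mon_ideal s j) (drop j (xpow s)).
  elim: k => [|k IH] j jk; first by rewrite drop_oversize ?size_xpow // -jk addn0.
  have jn : (j < n)%N by rewrite -jk addnS ltnS leq_addr.
  rewrite (drop_nth 0) ?size_xpow //.
  have -> : nth 0 (xpow s) j = 'X_(Ordinal jn) ^+ s.
    rewrite (nth_map (Ordinal jn)) ?size_enum_ord //; congr ('X_ _ ^+ _).
    by apply: val_inj; rewrite /= nth_enum_ord.
  split=> [x|]; first exact: (@mon_ideal_reg s (Ordinal jn)).
  apply: reg_on_ext (IH j.+1 _) => [x|]; last by rewrite addSn -addnS.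
  exact: (@mon_idealS s (Ordinal jn)).
have := main n 0%N (add0n n); rewrite drop0.
by apply: reg_on_ext => x; exact: mon_ideal0.
Qed.
End Monomials.

(** * Grade of homogeneous ideals and chains of homogeneous primes *)

Section Height.
Variables (K : fieldType) (n : nat).
Local Notation R := {mpoly K[n.+1]}.
Implicit Types (s : seq R) (f g w x : R).

Definition Uof s : R -> Prop := foldl (@extU R R^o) (fun x => x = 0) s.

Lemma Uof_rcons s a : Uof (rcons s a) = @extU R R^o (Uof s) a.
Proof. by rewrite /Uof -cats1 foldl_cat. Qed.

Lemma Uof_idl s : idl (Uof s).
Proof.
apply: foldl_extU_closed; split=> // a x y -> ->.
by rewrite scaler0 addr0.
Qed.

Lemma Uof_hid s : (forall a, a \in s -> hgen a) -> hid (Uof s).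
Proof.
elim/last_ind: s => [_|s a IH h].
  by split=> [|f d ->]; [exact: (Uof_idl [::])|exact: pihomog0].
rewrite Uof_rcons; apply: extU_hid; last by apply: h; rewrite mem_rcons mem_head.
by apply: IH => b bs; apply: h; rewrite mem_rcons inE bs orbT.
Qed.

(** The depth of [R/(s)] is still positive: the cyclic module generated by the class of [w] is
    killed by the variables, so its [Ext] into [R] vanishes up to degree [n], and hence so does
    every map from it to [R/(s)]. *)
Lemma irr_not_ann s w : @reg_on R R^o (fun x => x = 0) s -> (size s <= n)%N ->
  (forall i, Uof s ('X_i * w)) -> Uof s w.
Proof.
move=> hs sn hw.
have hc : @subclosed R R^o (ann (Uof s) w).
  split=> [|a x y hx hy]; rewrite /ann ?mul0r; first exact: (Uof_idl s).1.
  by rewrite mulrDl -[_ *: _]/(a * x) -mulrA; exact: (Uof_idl s).2.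
have [T [p [sp kp]]] := quot_ex hc; have [Q [q [sq kq]]] := quot_ex (Uof_idl s).
have [mw mwE] : exists g : {linear R^o -> R^o}, forall x, g x = (x : R) * w.
  by apply: ex_linear => a x y; rewrite mulrDl -[_ *: _]/(a * x) -mulrA.
have [|g hg] := factor_surj (f := lcomp q mw) sp.
  by move=> x /kp h; apply/kq; rewrite mwE.
have h0 : hv (std T) 0 Q.
  apply: (@hv_seq R (std T) s (@std_proj _ T) R^o R^o Q (lid R^o) q (fun x => x = 0)) => //.
  - by split=> // a x y -> ->; rewrite scaler0 addr0.
  - by move=> x; exists x.
  move=> j js; rewrite add0n.
  apply: (@hv_grade _ (std T) (xpow K n.+1 1) R^o R^o (lid R^o) (fun x => x = 0)) => //.
  - exact: std_proj.
  - by move=> x; exists x.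
  - exact: xpow_reg.
  - move=> a /mapP[i _ ->]; apply: (@std_null _ _ _ 1) => x; rewrite !expr1.
    have [y <-] := sp x; rewrite -linearZ_LR; apply/kp; rewrite /ann -[_ *: _]/('X_i * y).
    by rewrite mulrAC mulrC; apply: (idlM _ (Uof_idl s)); exact: hw.
  - by rewrite size_xpow ltnS (leq_trans js).
apply/kq; have := hv_std0 g h0 (p 1); rewrite hg.
by rewrite -[lcomp _ _ _]/(q (mw 1)) mwE mul1r.
Qed.

Definition irr0 (f : R) := f@_0 = 0.

Lemma irr0_hid : hid irr0.
Proof.
split=> [|f d h]; rewrite /irr0.
  split=> [|a x y hx hy]; rewrite ?mcoeff0 // mcoeffD -[_ *: _]/(a * x) hy addr0.
  by rewrite -[LHS]/((a * x)@_0) rmorphM /= [X in _ * X]hx mulr0.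
by rewrite mcoeff_pihomog; case: ifP.
Qed.

Lemma irr0X i : irr0 'X_i.
Proof. by rewrite /irr0 mcoeffX mnm1_eq0. Qed.

Lemma irr0_deg f d : irr0 f -> f \is d.-homog -> f != 0 -> (0 < d)%N.
Proof.
case: d => // h f0 /eqP[]; apply/mpolyP => m; rewrite mcoeff0; have [->//|m0] := eqVneq m 0%MM.
by apply: dhomog_nemf_coeff f0 _; rewrite mdeg_eq0.
Qed.

(** While [size s < n], some homogeneous [a] without constant term is regular modulo [s], and
    [next_prime] finds an associated prime of the longer sequence above the given one. The inclusion
    is strict because [a] lies in the new prime but, being regular, not in the old one. *)
Lemma height_chain k s w : (size s + k = n)%N -> (forall a, a \in s -> hgen a) ->
  @reg_on R R^o (fun x => x = 0) s -> mxann (Uof s) w ->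
  exists Q : nat -> R -> Prop,
  [/\ Q 0%N = ann (Uof s) w,
      forall i, [/\ hid (Q i), prm (Q i) & exists j, ~ Q i 'X_j],
      forall i f, Q i f -> Q i.+1 f
    & forall i, (i < k)%N -> exists f, Q i.+1 f /\ ~ Q i f].
Proof.
elim: k s w => [|k IH] s w sk hs rs mw; have hU := Uof_hid hs; have [hw nw _] := mw.
  exists (fun _ => ann (Uof s) w); split=> // _; split; [exact: hid_ann|exact: mxann_prm|].
  apply: contrapT => h; apply: nw; apply: irr_not_ann rs _ _; first by lia.
  by move=> i; apply: contrapT => ni; apply: h; exists i.
have ni : exists j, ~ ann (Uof s) w 'X_j.
  apply: contrapT => h; apply: nw; apply: irr_not_ann rs _ _; first by lia.
  by move=> i; apply: contrapT => ni; apply: h; exists i.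
have [a [ha a0 ra]] : exists a, [/\ hgen a, irr0 a & forall x, Uof s (a * x) -> Uof s x].
  apply: contrapT => h.
  have [|v [[_ nv _] hv]] := assoc_prime hU irr0_hid.
    move=> f hf f0; apply: contrapT => nf; apply: h; exists f; split=> // x fx.
    by apply: contrapT => nx; apply: nf; exists x.
  apply: nv; apply: irr_not_ann rs _ _; first by lia.
  by move=> i; apply: hv; exact: irr0X.
have an0 : a != 0.
  by apply/eqP => e; apply: nw; apply: ra; rewrite e mul0r; exact: (Uof_idl s).1.
have [d hd] := ha; have dP := irr0_deg a0 hd an0.
case: d hd dP => // d hd _.
have [w' [mw' ww']] := next_prime hU hd ra hw nw; rewrite -Uof_rcons in mw' ww'.
have [||||Q [Q0 Q1 Q2 Q3]] := IH (rcons s a) w'.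
- by rewrite size_rcons addSn -addnS.
- by move=> b; rewrite mem_rcons inE => /predU1P[->|/hs].
- by apply/reg_on_rcons; split.
- by [].
exists (fun i => if i is i'.+1 then Q i' else ann (Uof s) w); split=> [//|[|i]|[|i]|[|i]] //=.
- by split; [exact: hid_ann|exact: mxann_prm|].
- by rewrite Q0; exact: ww'.
- exact: Q2.
- move=> _; rewrite Q0; exists a; split; last by move=> /ra.
  rewrite /ann Uof_rcons; exists w', 0; split; first exact: (Uof_idl s).1.
  by rewrite addr0.
by rewrite ltnS; exact: Q3.
Qed.

(** If no further regular element exists in [I], an associated prime of the sequence contains [I],
    and the chain of primes starting there is longer than the dimension permits. *)
Lemma grade_codim (I : idealr R) c : homogeneous_ideal I -> proj_codim I c -> forall e, (e <= c)%N ->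
  exists s, [/\ size s = e, forall a, a \in s -> hgen a, forall a, a \in s -> a \in (I : {pred R})
    & @reg_on R R^o (fun x => x = 0) s].
Proof.
move=> hI [d [_ nd] cd]; have hid_I : hid (fun f => f \in (I : {pred R})).
  split; last exact: hI.
  by split=> [|a x y hx hy]; [exact: rpred0|apply: rpredD => //; exact: idealMr].
elim=> [_|e IH ec]; first by exists [::].
have [s [se hs sI rs]] := IH (ltnW ec).
have hU := Uof_hid hs.
have [[a [ha aI ra]]|h] := pselect (exists a, [/\ hgen a, a \in (I : {pred R}) & forall x, Uof s (a * x) -> Uof s x]).
  exists (rcons s a); split=> [|b|b|]; first by rewrite size_rcons se.
  - by rewrite mem_rcons inE => /predU1P[->|/hs].
  - by rewrite mem_rcons inE => /predU1P[->|/sI].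
  - by apply/reg_on_rcons; split.
have [|w [mw hw]] := assoc_prime hU hid_I.
  move=> f hf fI; apply: contrapT => nf; apply: h; exists f; split=> // x fx.
  by apply: contrapT => nx; apply: nf; exists x.
(* The chain has [n - e] steps; [e < c] and [c + d = n] make this at least [d + 1]. *)
have [|Q [Q0 Q1 Q2 Q3]] := @height_chain (n - e) s w _ hs rs mw; first by rewrite se; lia.
case: nd; have hP i : exists P : prime_idealr R, forall f, (f \in (P : {pred R})) <-> Q i f.
  have [[[q0 qD] _] [q1 qM] _] := Q1 i.
  pose S : {pred R} := fun f => `[< Q i f >].
  have Sc : idealr_closed S.
    split=> [||a x y /asboolP hx /asboolP hy]; [exact/asboolP|exact/asboolP|].
    by apply/asboolP; exact: qD.
  have Sp : prime_idealr_closed S.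
    by move=> x y /asboolP /qM[h'|h']; apply/orP; [left|right]; apply/asboolP.
  pose P := HB.pack_for (prime_idealr R) (S : R -> bool) (isIdealr.Build R S Sc) (isPrimeIdealrClosed.Build R S Sp).
  by exists P => f; split=> [/asboolP|h']; [|exact/asboolP].
have [P PE] := ex_choice hP.
have IQ i f : f \in (I : {pred R}) -> Q i f.
  by elim: i => [|i IHi] fI; [rewrite Q0; exact: hw|exact/Q2/IHi].
exists P; split=> i hi.
  have [q1 q2 [j nj]] := Q1 i; split.
  - by move=> f k /PE h'; apply/PE; exact: q1.2.
  - by move=> f fI; apply/PE; exact: IQ.
  - move=> h'; apply: nj; apply/PE; apply: h'; apply: ideal_gen_in; by exists j.
split; first by move=> f /PE h'; apply/PE; exact: Q2.
have [|f [f1 f2]] := Q3 i; first by lia.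
by move=> h'; apply: f2; apply/PE; apply: h'; apply/PE.
Qed.
End Height.

(** * Grade of the ideal of submaximal minors *)

Section TopForms.
Variable R : comNzRingType.
Implicit Types B : lmodType R.

Fixpoint topv B m : B -> ext m B :=
  match m return B -> ext m B with 0 => fun b => b | m'.+1 => fun b => (0, topv m' b) end.

Fixpoint topc B m : ext m B -> B :=
  match m return ext m B -> B with 0 => fun x => x | m'.+1 => fun x => topc x.2 end.

Fact topv_linear B m : linear (@topv B m).
Proof. elim: m => //= m IH a x y; apply: ext_eq => /=; last exact: IH.
by rewrite scaler0 addr0. Qed.
HB.instance Definition _ B m := GRing.isLinear.Build R _ _ _ (@topv B m) (@topv_linear B m).

Fact topc_linear B m : linear (@topc B m).
Proof. by elim: m => //= m IH a x y; rewrite IH. Qed.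
HB.instance Definition _ B m := GRing.isLinear.Build R _ _ _ (@topc B m) (@topc_linear B m).

Lemma topc_topv B m b : topc (@topv B m b) = b.
Proof. by elim: m => //=. Qed.

Lemma hdeg_topv B m b : hdeg m (@topv B m b).
Proof. by elim: m => //= m IH; split=> //; exact: hdeg0. Qed.

Lemma topv_topc B m (x : ext m B) : hdeg m x -> topv m (topc x) = x.
Proof.
elim: m x => //= m IH [x1 x2] [/= h1 h2]; rewrite IH //.
by congr pair; apply/esym; apply: hdeg_gt h1.
Qed.

Lemma emap_topv B B' (f : {linear B -> B'}) m b : emap f (@topv B m b) = topv m (f b).
Proof. by elim: m => //= m ->; rewrite emap00. Qed.

Lemma eall_topv B (Q : B -> Prop) m b : Q 0 -> Q b -> eall Q (@topv B m b).
Proof.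
move=> Q0 Qb; elim: m => //= m IH; split=> //.
by elim: (m) => //= k ->.
Qed.
End TopForms.

Section Tower.
Variable R : comNzRingType.

(* The composite of the connecting maps [H^q(N / s N) -> H^(q + size s)(N)] along a regular
   sequence [s], as a relation between cocycles. *)
Lemma tower (s : seq R) : forall (N N' N'' : lmodType R)
  (p : {linear N -> N'}) (p' : {linear N -> N''}) (U : N -> Prop), subclosed U ->
  onto p -> (forall x, p x = 0 <-> U x) ->
  onto p' -> (forall x, p' x = 0 <-> foldl (@extU R N) U s x) -> reg_on U s ->
  exists rho : forall (P : chain R) q, {linear P q -> N''} -> {linear P (size s + q)%N -> N'} -> Prop,
  [/\ forall (P : chain R) q a f f' g g' (h : {linear P q -> N''}) (h' : {linear P (size s + q)%N -> N'}),
        rho P q f f' -> rho P q g g' -> (forall x, h x = a *: f x + g x) ->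
        (forall x, h' x = a *: f' x + g' x) -> rho P q h h',
      forall (P : chain R) q (f : {linear P q -> N''}), proj_cx P -> coc f -> exists f', coc f' /\ rho P q f f',
      forall (P : chain R) q f f', proj_cx P -> rho P q f f' -> triv f -> triv f',
      forall (P : chain R) q, proj_cx P -> (forall j, (j < size s)%N -> hv P (j + q) N') ->
        forall f f', rho P q f f' -> coc f -> triv f' -> triv f
    & forall (P : chain R) q, (forall a, a \in s -> forall k (V : lmodType R) (f : {linear P k -> V}), coc f -> triv (lscale f a)) ->
        forall f', coc f' -> exists f, coc f /\ rho P q f f'] /\
    forall (P P' : chain R) q (phi : forall k, {linear P k -> P' k}),
      (forall k x, chd P' k (phi k.+1 x) = phi k (chd P k x)) ->
      forall f f', rho P' q f f' -> rho P q (lcomp f (phi q)) (lcomp f' (phi (size s + q)%N)).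
Proof.
elim: s => [|a s IH] N N' N'' p p' U hU sp kp sp' kp' /=.
  (* For the empty sequence [N'] and [N''] are isomorphic, and [rho] is composition with the
     isomorphism. *)
  move=> _; have [|g hg] := factor_surj (f := p') sp; first by move=> x /kp /kp'.
  have [|g' hg'] := factor_surj (f := p) sp'; first by move=> x /kp' /kp.
  have gg' y : g (g' y) = y by have [x <-] := sp' y; rewrite hg' hg.
  have g'g y : g' (g y) = y by have [x <-] := sp y; rewrite hg hg'.
  exists (fun P q f f' => forall x, f' x = g' (f x)); split; last first.
    by move=> P P' q phi hphi f f' e x; exact: e.
  split.
  - move=> P q b f f' f1 f1' h h' e1 e2 eh eh' x.
    by rewrite eh' eh e1 e2 linearP.
  - by move=> P q f _ cf; exists (lcomp g' f); split=> // x /=; rewrite cf linear0.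
  - by move=> P q f f' _ e tf; apply: triv_ext (triv_comp g' tf) => x; rewrite e.
  - move=> P q _ _ f f' e _ tf'; apply: triv_ext (triv_comp g tf') => x /=.
    by rewrite e gg'.
  - move=> P q _ f' cf'; exists (lcomp g f'); split=> x /=; first by rewrite cf' linear0.
    by rewrite g'g.
move=> [ra rs]; have [N1 [p1 [sp1 kp1]]] := quot_ex (extU_closed a hU).
have [r [hs hr]] := reg_step sp kp sp1 kp1 ra.
have [rho [[r1 r2 r3 r4 r5] r6]] := IH N N1 N'' p1 p' _ (extU_closed a hU) sp1 kp1 sp' kp' rs.
(* The tail of the sequence is treated over the quotient [N1] of [N'] by [a]; the connecting map of
   multiplication by [a] then raises the degree once more. *)
exists (fun P q f f' => exists f1, [/\ rho P q f f1, coc f1 & delta (lmul N' a) r f1 f']); split; last first.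
  move=> P P' q phi hphi f f' [f1 [rf c1 [g [g1 g2]]]].
  exists (lcomp f1 (phi (size s + q)%N)); split.
  - exact: r6.
  - by move=> x; rewrite -[LHS]/(f1 (phi _ (chd P _ x))) -hphi c1.
  exists (lcomp g (phi (size s + q)%N)); split=> x; first exact: g1.
  rewrite -[RHS]/(g (phi _ (chd P _ x))) -hphi; exact: g2.
split.
- move=> P q b f f' g g' h h' [f1 [rf cf [u [u1 u2]]]] [g1 [rg cg [v [v1 v2]]]] eh eh'.
  exists (ladd (lscale f1 b) g1); split.
  + exact: (r1 _ _ b) rf rg eh _.
  + by move=> x /=; rewrite cf cg scaler0 addr0.
  exists (ladd (lscale u b) v); split=> x /=.
    by rewrite linearP u1 v1.
  by rewrite eh' linearP u2 v2.
- move=> P q f hP /(r2 _ _ _ hP)[f1 [c1 rf]]; have [f' d'] := delta_ex hs hP c1.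
  by exists f'; split; [exact: delta_coc d'|exists f1].
- by move=> P q f f' hP [f1 [rf c1 d1]] /(r3 _ _ _ _ hP rf) /(delta_triv hs hP d1).
- move=> P q hP hv' f f' [f1 [rf c1 d1]] cf tf'.
  apply: (r4 _ _ hP _ _ _ rf cf).
    move=> j js; apply: (hv_quot hs hP); first by apply: hv'; exact: leqW.
    by apply: (hv' j.+1).
  exact: (delta_triv_inv hs (hv' _ (leqnn _)) d1 c1 tf').
move=> P q hk f' cf'; have [h hh] := hk a (mem_head _ _) _ _ _ cf'.
pose f1 := lcomp r h.
have c1 : coc f1.
  move=> x; rewrite /f1 /= -hh; case: hs => _ _ ex; apply/ex.
  by exists (f' x).
have [|f [cf rf]] := r5 P q _ f1 c1; first by move=> b bs; apply: hk; rewrite inE bs orbT.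
by exists f; split=> //; exists f1; split=> //; exists h; split=> // x; rewrite -hh.
Qed.
End Tower.

Section MinorKernel.
Variables (R : comNzRingType) (P : R -> Prop) (T m : nat) (M : 'M[R]_(T, m)).
Hypotheses (P0 : P 0) (PD : forall a x y, P x -> P y -> P (a * x + y)) (P1 : ~ P 1).
Hypothesis minors : forall g : 'I_T -> 'I_m, P (\det (mxsub id g M)).

(** Take the largest size [r] of a minor outside [P] and border that minor by one more row and a
    variable column. All bordered minors lie in [P], and their cofactors along the column form the
    vector [u], one of them being the chosen minor. *)
Lemma minor_kernel : exists u : 'I_T -> R, (exists i, ~ P (u i)) /\ forall j, P (\sum_i u i * M i j).
Proof.
pose big r := `[< exists (f : 'I_r -> 'I_T) (g : 'I_r -> 'I_m), ~ P (\det (mxsub f g M)) >].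
have big0 : exists r, big r && (r <= T)%N.
  exists 0%N; rewrite andbT; apply/asboolP.
  by exists (widen_ord (leq0n T)), (widen_ord (leq0n m)); rewrite det_mx00.
(* A minor with [T] rows is a multiple of a maximal minor on the same columns; so [r < T], and a row
   [i0] remains for the bordering. *)
have bT : ~~ big T.
  apply/asboolP => -[f [g]]; apply; rewrite -[mxsub f g M]/(mxsub (id \o f) (g \o id) M).
  have -> : mxsub (id \o f) (g \o id) M = rowsub f 1%:M *m mxsub id g M.
    by rewrite -rowsubE; apply/matrixP => i j; rewrite !mxE.
  by rewrite det_mulmx -[_ * _]addr0; apply: PD.
have [|r /andP[br rT] mx] := ex_maxnP big0 (m := T); first by move=> r /andP[].
have {}rT : (r < T)%N.
  by rewrite ltn_neqAle rT andbT; apply: contraNneq bT => <-.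
move/asboolP: br => [f [g nP]].
have [i0 ni0] : exists i0, forall a, f a != i0.
  apply: contrapT => h; have : (T <= r)%N; last by rewrite leqNgt rT.
  have := leq_imset_card f predT; rewrite [X in (_ <= X)%N -> _]card_ord; apply: leq_trans.
  have -> : [set f x | x in predT] = finset.setTfor 'I_T; last by rewrite cardsT card_ord.
  apply/setP => i; rewrite finset.in_setT; apply/imsetP; apply: contrapT => hn; apply: h.
  by exists i => a; apply/eqP => e; apply: hn; exists a.
pose rows (b : 'I_r.+1) := if unlift ord0 b is Some a then f a else i0.
pose cols j (b : 'I_r.+1) := if unlift ord0 b is Some a then g a else j.
(* These cofactors do not depend on the column [j]. Gathering them over all positions that carry row
   [i] spares a proof that the chosen rows are distinct. *)
pose cf (b : 'I_r.+1) : R := (-1) ^+ (b + 0) * \det (mxsub (fun a => rows (lift b a)) g M).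
pose u i := \sum_(b | rows b == i) cf b.
exists u; split.
  exists i0; rewrite /u (bigD1 ord0) /=; last by rewrite /rows unlift_none.
  rewrite big1 ?addr0 => [|b /andP[/eqP rb b0]].
    rewrite /cf expr0 mul1r; have -> : mxsub (fun a => rows (lift ord0 a)) g M = mxsub f g M => //.
    by apply/matrixP => a b; rewrite !mxE /rows liftK.
  case: (unliftP ord0 b) b0 rb => [a ->|->]; last by rewrite eqxx.
  by move=> _; rewrite /rows liftK => e; have := ni0 a; rewrite e eqxx.
move=> j; have -> : \sum_i u i * M i j = \det (mxsub rows (cols j) M).
  rewrite (expand_det_col _ ord0).
  transitivity (\sum_i \sum_(b | rows b == i) cf b * M i j).
    by apply: eq_bigr => i _; rewrite mulr_suml.
  rewrite (exchange_big_dep predT) //=; apply: eq_bigr => b _.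
  rewrite (big_pred1 (rows b)); last by move=> i; rewrite eq_sym.
  rewrite mulrC mxE /cols unlift_none; congr (_ * _); rewrite /cofactor /cf; congr (_ * \det _).
  by apply/matrixP => a a'; rewrite !mxE /cols liftK.
apply: contrapT => h; have : (r.+1 <= r)%N; last by rewrite ltnn.
by apply: mx; rewrite rT andbT; apply/asboolP; exists rows, (cols j).
Qed.
End MinorKernel.

(** * Lengthening a regular sequence in the ideal of submaximal minors *)

Section GradeStep.
Variables (K : fieldType) (n t m : nat).
Local Notation R := {mpoly K[n.+1]}.
Variable M : 'M[R]_(t.+2, m).
Local Notation D := {mpoly R[t.+2]}.
Local Notation W := (ext m D).
Local Notation Cx := (strand M t.+2).
Hypothesis inv_nat : forall k, exists r : R, k.+1%:R * r = 1.
Hypothesis tm : (t.+1 < m)%N.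
Variable JJ : R -> Prop.
Hypothesis hJJ : hid JJ.
Hypothesis omJ : forall z, St t.+2 0 z -> JJ (omega M z).
Variables as_ bs : seq R.
Hypothesis reg_as : @reg_on R R^o (fun x => x = 0) as_.
Hypothesis as_omega : forall a, a \in as_ -> exists w, St t.+2 0 w /\ a = omega M w.
Hypothesis size_as : (m - t.+1 <= size as_)%N.
Hypothesis bsJ : forall a, a \in bs -> JJ a.
Hypothesis reg_bs : @reg_on R R^o (fun a => exists z, St t.+2 0 z /\ a = omega M z) bs.

Section Class.
Variables (s : seq R) (w : R).
Hypothesis (hs : forall a, a \in s -> hgen a) (sJ : forall a, a \in s -> JJ a).
Hypothesis reg_s : @reg_on R R^o (fun x => x = 0) s.
Hypothesis (mw : mxann (Uof s) w) (Jw : forall f, JJ f -> ann (Uof s) w f).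
Variables (T : lmodType R) (pT : {linear R^o -> T}).
Hypothesis (spT : onto pT) (kpT : forall a, pT a = 0 <-> ann (Uof s) w a).

Lemma T_ann a : ann (Uof s) w a -> forall x : T, a *: x = 0.
Proof.
move=> ha x; have [b <-] := spT x; rewrite -linearZ_LR; apply/kpT.
rewrite -[_ *: _]/(a * b) mulrC; apply: idlM ha; apply: (hid_ann (Uof_hid hs) _).1.
by case: mw.
Qed.

Lemma hv_T q : (q < size s)%N -> hv (std T) q R^o.
Proof.
move=> qs; apply: (@hv_grade _ (std T) s R^o R^o (lid R^o) (fun x => x = 0)) => //.
- exact: std_proj.
- by move=> x; exists x.
- by move=> a /sJ /Jw ha; apply: (@std_null _ _ _ 1) => x; rewrite expr1; exact: T_ann.
Qed.

(** The map from [T] to [R/(s)] that sends 1 to the class of [w] is pushed up the tower of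
    connecting maps. These are injective on classes because the lower [Ext] of [T] vanishes, so
    multiples of the class by elements outside the prime stay nontrivial. *)
Lemma socle_class : exists f : {linear std T (size s) -> R^o}, coc f /\
  forall r, triv (lscale f r) -> ann (Uof s) w r.
Proof.
have : exists f : {linear std T (size s + 0)%N -> R^o}, coc f /\
    forall r, triv (lscale f r) -> ann (Uof s) w r; last by rewrite addn0.
have [Q [q [sq kq]]] := quot_ex (Uof_idl s).
have h0 : @subclosed R R^o (fun x => x = 0).
  by split=> // a x y -> ->; rewrite scaler0 addr0.
have [||rho [[r1 r2 r3 r4 _] _]] := @tower R s R^o R^o Q (lid R^o) q
    (fun x => x = 0) h0 _ _ sq kq reg_s; [by move=> x; exists x|by []|].
have hP := @std_proj _ T.
have [g hg] : exists g : {linear T -> Q}, forall r : R^o, g (pT r) = q ((r : R) * w).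
  have [k hk] : exists k : {linear R^o -> Q}, forall r, k r = q ((r : R) * w).
    by apply: ex_linear => a x y; rewrite mulrDl -[_ *: _]/(a * x) -mulrA -linearP.
  have [|g hg] := factor_surj (f := k) spT.
    by move=> x /kpT h; rewrite hk; apply/kq.
  by exists g => r; rewrite hg hk.
pose f0 : {linear std T 0 -> Q} := lcomp g (free_cover T).
have c0 : coc f0.
  by move=> x; have e : free_cover T (chd (std T) 0 x) = 0 := std_cover_chd x; rewrite /f0 /= e linear0.
have [f [cf rf]] := r2 _ _ f0 hP c0; exists f; split=> // r tr.
have [z [cz rz]] := r2 (std T) 0%N (lzero _ _) hP (fun x => erefl).
have z0 : triv z by apply: r3 hP rz _ => x.
have t0 : triv (lscale f0 r).
  apply: (r4 _ _ hP _ _ (ladd (lscale f r) z)).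
  - by move=> j js; rewrite addn0; exact: hv_T.
  - by apply: (r1 _ _ r _ _ _ _ _ _ rf rz) => x //=; rewrite addr0.
  - by move=> x; rewrite -[LHS]/(r *: f0 (chd (std T) 0 x)) c0 scaler0.
  - by apply: (triv_lin (a := 1) (f := lscale f r) (g := z)) => // x /=; rewrite scale1r.
have := t0 << pT 1 >>; rewrite /= /f0 /= free_coverU hg mul1r -linearZ_LR => /kq.
by [].
Qed.

Local Notation l := (m - t.+2)%N.
Variable u : 'I_t.+2 -> R.
Hypothesis uM : forall j, ann (Uof s) w (\sum_i u i * M i j).

Definition uform : D := \sum_i u i *: 'X_i.

Lemma uform_mX p : uform * p = \sum_i u i *: mX R i p.
Proof. by rewrite mulr_suml; apply: eq_bigr => i _; rewrite -scalerAl. Qed.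

Lemma cdeg_uform k : cdeg k (uform ^+ k).
Proof.
elim: k => [|k IH]; first by move=> v; rewrite expr0 mcoeff1; have [->|//] := eqVneq v 0%MM; rewrite mdeg0.
rewrite exprS uform_mX; apply: (subclosed_sum _ (cdeg_closed R _ k.+1)) => i.
by apply: (subclosedZ _ (cdeg_closed R _ k.+1)); exact: cdeg_mX.
Qed.

Lemma dY_uform i k : dY R i (uform ^+ k.+1) = (k.+1%:R * u i) *: uform ^+ k.
Proof.
have d1 : mderiv i uform = u i *: 1.
  rewrite /uform linear_sum (bigD1 i) //= big1 ?addr0 => [|j ji]; rewrite linearZ_LR /=.
    rewrite mderivX mnm1E eqxx scale1r; have -> : (U_(i) - U_(i) = 0 :> 'X_{1..t.+2})%MM.
      by apply/mnmP => j; rewrite mnmBE subnn mnm0E.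
    by rewrite mpolyX0.
  by rewrite mderivX mnm1E (negPf ji) scale0r scaler0.
elim: k => [|k IH]; first by rewrite expr1 expr0 mul1r.
rewrite exprS [LHS]mderivM d1 -[mderiv i _]/(dY R i (uform ^+ k.+1)) IH.
rewrite -scalerAl mul1r -scalerAr -exprS -scalerDl; congr (_ *: _).
by rewrite -[k.+2]addn1 natrD; ring.
Qed.

(** The top form times a power of the linear form [u]. If the entries of [u M] lie in the prime,
    [dl_xi] shows that it is a cycle modulo the prime. *)
Definition xi k : W := topv m (uform ^+ k).

Lemma dl_xi k : dl M (xi k.+1) = \sum_(j < m) (k.+1%:R * \sum_i u i * M i j) *: ct (unitv R j) (xi k).
Proof.
transitivity (\sum_i \sum_(j < m) (k.+1%:R * u i * M i j) *: ct (unitv R j) (xi k)).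
  apply: eq_bigr => i _; rewrite emap_topv dY_uform (linearZ_LR (@topv R D m)) ctZ -/(xi k).
  by rewrite ct_unit scaler_sumr; apply: eq_bigr => j _; rewrite scalerA rwE.
rewrite exchange_big; apply: eq_bigr => j _ /=; rewrite -scaler_suml mulr_sumr; congr (_ *: _).
by apply: eq_bigr => i _; rewrite mulrA.
Qed.

Lemma St_xi : St t.+2 l (xi l).
Proof.
split; last by apply: eall_topv; [exact: (cdeg_closed R _ _).1|exact: cdeg_uform].
have -> : (t.+2 + l = m)%N by lia.
exact: hdeg_topv.
Qed.

Lemma St_ct_xi k j : (l = k.+1)%N -> St t.+2 k (ct (unitv R j) (xi k)).
Proof.
move=> lk; split.
  apply: hdeg_ct; have -> : ((t.+2 + k).+1 = m)%N by lia.
  exact: hdeg_topv.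
apply: (eall_lin _ (cdeg_closed R _ _) _).1.
by apply: eall_topv; [exact: (cdeg_closed R _ _).1|exact: cdeg_uform].
Qed.

Definition xiT : Cx l := mkpsub (@St_closed R t.+2 m t.+2 l) St_xi.

Lemma hat (N : lmodType R) (x : N) : exists g : {linear R^o -> N}, forall r : R^o, g r = (r : R) *: x.
Proof. by apply: ex_linear => a b c; rewrite scalerDl -[_ *: b]/(a * b) scalerA. Qed.

(** Evaluation of the variables at the [i]-th unit point reads off the coefficient. *)
Lemma xi_coeff i : exists g : {linear Cx l -> R^o}, g xiT = u i ^+ l.
Proof.
pose v (j : 'I_t.+2) : R := (j == i)%:R.
have [g hg] : exists g : {linear Cx l -> R^o}, forall x, g x = (topc (val x)).@[v].
  apply: ex_linear => a x y; rewrite -[val (a *: x + y)]/(a *: val x + val y).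
  by rewrite (linearP (@topc R D m)) mevalD mevalZ.
exists g; rewrite hg /= topc_topv (rmorphXn (meval v)); congr (_ ^+ _).
rewrite /uform raddf_sum (bigD1 i) //= big1 ?addr0 => [|j ji].
  by rewrite mevalZ mevalXU /v eqxx mulr1.
by rewrite mevalZ mevalXU /v (negPf ji) mulr0.
Qed.

Variables (A : lmodType R) (pA : {linear R^o -> A}) (k : nat).
Hypotheses (spA : onto pA) (kpA : forall a, pA a = 0 <-> exists z, St t.+2 0 z /\ a = omega M z).
Hypotheses (kh : (k < size bs)%N) (sk : size s = (k + l).+1).

(** The successive syzygies of [A]: the ideal itself at 0, then the boundaries of the strand one
    degree lower. *)
Definition cyc j : lmodType R :=
  if j is j'.+1 then psub (@bdry_closed R Cx j') else kerm pA.

Lemma exCx : forall e, exact_at Cx e.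
Proof.
apply: (@strand_exact _ _ _ M inv_nat as_ reg_as as_omega t.+2).
by apply: leq_trans size_as; rewrite leq_sub2l.
Qed.

Lemma omega0_bd z : St t.+2 0 z -> (omega M z = 0 <-> bd M t.+2 0 z).
Proof.
move=> hz; split=> [e|/bd_ct[v [hv' ->]]].
  by apply: (omega_exact inv_nat reg_as as_omega); [apply: leq_trans size_as; lia|..].
rewrite omega_sum big1 // => i _.
by rewrite /omega (ctf_ct (rw M)) (linear0 (@vc R _ _)) mcoeff0.
Qed.

Lemma cyc_ses j : exists (i : {linear cyc j.+1 -> Cx j}) (p : {linear Cx j -> cyc j}), ses i p /\
  forall x, p x = 0 <-> bdry x.
Proof.
have [p [sp kp]] : exists p : {linear Cx j -> cyc j}, onto p /\ forall x, p x = 0 <-> bdry x.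
  case: j => [|j].
    have [|f hf] := factor_inj (i := lval _ : {linear kerm pA -> R^o})
        (f := lcomp (omega M) (lval _) : {linear Cx 0 -> R^o}) val_inj.
      move=> z; have h : pA (omega M (val z)) = 0.
        by apply/kpA; exists (val z); split=> //; exact: psubP.
      by exists (mkpsub (ker_closed pA) h).
    have hf' z : val (f z) = omega M (val z) := hf z.
    exists f; split=> [a|z].
      have /kpA [z [hz e]] := psubP a.
      by exists (mkpsub (@St_closed R t.+2 m t.+2 0) hz); apply: val_inj; rewrite hf' e.
    rewrite bdP -omega0_bd; last exact: psubP.
    split=> [e|e]; first by rewrite -hf' e.
    by apply: val_inj; rewrite hf' e.
  have [|f hf] := factor_inj (i := lval _ : {linear psub (@bdry_closed R Cx j) -> Cx j})
      (f := chd Cx j) val_inj.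
    move=> z; have h : bdry (chd Cx j z) by exists z.
    by exists (mkpsub (@bdry_closed R Cx j) h).
  have hf' z : val (f z) = chd Cx j z := hf z.
  exists f; split=> [a|z].
    by have [z hz] := psubP a; exists z; apply: val_inj; rewrite hf' hz.
  split=> [e|[z' ->]]; first by apply: exCx; rewrite -hf' e.
  by apply: val_inj; rewrite hf' chdK.
exists (lval _ : {linear psub (@bdry_closed R Cx j) -> Cx j}), p; split=> //.
split=> [x y||x] //; first exact: val_inj.
 rewrite kp; split=> [h|[b ->]]; last exact: psubP.
by exists (mkpsub (@bdry_closed R Cx j) h).
Qed.

Lemma hv_cx q j : (q < size s)%N -> hv (std T) q (Cx j).
Proof. by move=> /hv_T; exact: hv_sterm. Qed.

Lemma hvA : hv (std T) k A.
Proof.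
apply: (@hv_grade _ (std T) bs R^o A pA (fun a => exists z, St t.+2 0 z /\ a = omega M z)) => //.
  exact: std_proj.
by move=> a /bsJ /Jw ha; apply: (@std_null _ _ _ 1) => x; rewrite expr1; exact: T_ann.
Qed.

(** Dimension shifting along the strand, starting from the vanishing over [A] in degree [k] that the
    sequence [bs] provides. *)
Lemma hv_cyc j : (j < l)%N -> hv (std T) (k + j.+1)%N (cyc j).
Proof.
elim: j => [|j IH] jl.
  rewrite addn1; apply: (hv_sub (kerm_ses spA) (@std_proj _ T) hvA).
  by apply: hv_T; rewrite sk; lia.
have [i [p [sip _]]] := cyc_ses j.
rewrite addnS; apply: (hv_sub sip (@std_proj _ T)); first by apply: IH; exact: ltnW.
by apply: hv_cx; rewrite sk; lia.
Qed.

(** The strand augmented by [omega], with [R^o] following position 0, so that a strand of length 0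
    needs no separate treatment in [no_socle]. *)
Definition prev j : lmodType R := if j is j'.+1 then Cx j' else R^o.
Definition next j : {linear Cx j -> prev j} :=
  match j with 0 => lcomp (omega M) (lval _) | j'.+1 => chd Cx j' end.

(** At its top position the augmented strand is injective, with cokernel [cyc] or [A]; the
    cohomology of that cokernel vanishes one degree lower, so no nontrivial class dies under
    [next]. *)
Lemma next_triv j (F : {linear std T (k + j).+1 -> Cx j}) : l = j -> triv (lcomp (next j) F) -> triv F.
Proof.
move=> lj tF.
have z0 (x : Cx j.+1) : x = 0 by apply: sterm_gt; rewrite lj.
have b0 (x : Cx j) : bdry x -> x = 0 by move=> [y ->]; rewrite [y]z0 linear0.
have ij : injective (next j).
  apply: lker_inj => x; case: j lj F tF z0 b0 x => [|j] lj F tF z0 b0 x /= h; apply: b0; last exact: exCx.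
  by apply/bdP; apply/omega0_bd => //; exact: psubP.
case: j lj F tF z0 b0 ij => [|j] lj F tF z0 b0 ij.
  have sq : ses (next 0) (pA : {linear prev 0 -> A}); last first.
    have hA : hv (std T) (k + 0)%N A by rewrite addn0; exact: hvA.
    exact: (hv_inj sq (@std_proj _ T) hA tF).
  split=> // a; rewrite kpA; split=> [[z [hz ->]]|[z ->]].
    by exists (mkpsub (@St_closed R t.+2 m t.+2 0) hz).
  by exists (val z); split=> //; exact: psubP.
have [i [p [[_ sp _] kp]]] := cyc_ses j.
have sq : ses (next j.+1) (p : {linear prev j.+1 -> cyc j}) by split=> // v; rewrite kp.
by apply: (hv_inj sq (@std_proj _ T) _ tF); apply: hv_cyc; rewrite lj.
Qed.

Lemma next_xi j (h : St t.+2 j (xi j)) : l = j -> exists k (r : 'I_k -> R) (z : 'I_k -> prev j),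
  (forall i, ann (Uof s) w (r i)) /\
  next j (mkpsub (@St_closed R t.+2 m t.+2 j) h) = \sum_i r i *: z i.
Proof.
case: j h => [|j] h lj.
  (* For a strand of length 0 the next map is [omega], whose values lie in [JJ] and therefore in the
     prime. *)
  exists 1%N, (fun _ => omega M (xi 0)), (fun _ => (1 : R^o)); split=> [_|].
    by apply: Jw; apply: omJ.
  by rewrite big_ord1 -[RHS]/(omega M (xi 0) * 1) mulr1.
exists m, (fun i => j.+1%:R * \sum_i0 u i0 * M i0 i), (fun i : 'I_m => mkpsub (@St_closed R t.+2 m t.+2 j) (St_ct_xi i lj)).
split=> [i|]; first by apply: idlM; [apply: (hid_ann (Uof_hid hs) _).1; case: mw|exact: uM].
by apply: val_inj; rewrite [RHS](linear_sum (lval _)) -[LHS]/(dl M (xi j.+1)) dl_xi.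
Qed.

(** The class of [socle_class] times [xi] dies in the next term, since there it is a combination of
    multiples by elements of the prime, which kill [T]. Hence it was trivial; reading off a
    coefficient puts a power of [u i], and so [u i], in the prime. *)
Lemma no_socle i : ann (Uof s) w (u i).
Proof.
have [f [cf hf]] := socle_class; move: f cf hf; rewrite sk => f cf hf.
have mp := mxann_prm (Uof_hid hs) mw.
have [g hg] := xi_coeff i; have [x hx] := hat xiT.
suff tF : triv (lcomp x f).
  apply: (prm_exp (k := l) mp); apply: hf; apply: triv_ext (triv_comp g tF) => y.
  by rewrite /= hx linearZ_LR hg; exact: mulrC.
apply: next_triv => //; have [k' [r [z [hr e]]]] := next_xi St_xi erefl.
have hz i' := hat (z i'); have [zz hzz] := ex_choice hz.
apply: (triv_sum (s := index_enum 'I_k') (F := fun i' => lcomp (zz i') (lscale f (r i')))) => [y|i'].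
  rewrite /= hx linearZ_LR -/xiT /= e scaler_sumr; apply: eq_bigr => i' _.
  by rewrite hzz scalerA; congr (_ *: _); exact: mulrC.
apply: triv_comp; apply: std_ann => //; exact: T_ann.
Qed.
End Class.

Lemma grade_step s : (forall a, a \in s -> hgen a) -> (forall a, a \in s -> JJ a) ->
  @reg_on R R^o (fun x => x = 0) s -> (m - t.+1 <= size s < (m - t.+1) + size bs)%N ->
  exists a, [/\ hgen a, JJ a & forall x, Uof s (a * x) -> Uof s x].
Proof.
move=> hs sJ rs /andP[s1 s2]; apply: contrapT => hno.
have [|w [mw Jw]] := assoc_prime (Uof_hid hs) hJJ.
  move=> f hf Jf; apply: contrapT => nf; apply: hno; exists f; split=> // x fx.
  by apply: contrapT => nx; apply: nf; exists x.
have hA := (hid_ann (Uof_hid hs) (let: And3 a _ _ := mw in a)).1.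
have [||||u [[i nu] uM]] := @minor_kernel R (ann (Uof s) w) t.+2 m M.
- exact: hA.1.
- by move=> a x y; exact: hA.2.
- by rewrite /ann mul1r; case: mw.
- by move=> g; have [z [hz e]] := omega_minor M g; rewrite -[\det _]/(max_minor M g) -e; apply/Jw/omJ.
have [T [pT [spT kpT]]] := quot_ex hA.
have hI : @subclosed R R^o (fun a => exists z, St t.+2 0 z /\ a = omega M z).
  split=> [|a _ _ [x [hx ->]] [y [hy ->]]].
    by exists 0; split; [exact: St0|rewrite (linear0 (omega M))].
  by exists (a *: x + y); split; [exact: St_comb|rewrite (linearP (omega M))].
have [A [pA [spA kpA]]] := quot_ex hI.
(* With [c = m - t.+1] the strand has length [c - 1], so a class of degree [size s] is compared with
   degree [size s - c] over [A], where [bs] is long enough. *)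
apply: nu; apply: (no_socle hs sJ rs mw Jw spT kpT uM spA kpA (k := size s - (m - t.+1))).
  by rewrite ltn_subLR.
have el : (m - t.+2).+1 = (m - t.+1)%N by rewrite -subSn.
by rewrite -addnS el subnK.
Qed.

Lemma grade_up s : (forall a, a \in s -> hgen a) -> (forall a, a \in s -> JJ a) ->
  @reg_on R R^o (fun x => x = 0) s -> size s = (m - t.+1)%N ->
  exists js, [/\ size js = (m - t.+1 + size bs)%N, forall a, a \in js -> JJ a
    & @reg_on R R^o (fun x => x = 0) js].
Proof.
move=> hs sJ rs ss.
suff main h : (h <= size bs)%N -> exists js, [/\ size js = (m - t.+1 + h)%N,
    forall a, a \in js -> hgen a, forall a, a \in js -> JJ a & @reg_on R R^o (fun x => x = 0) js].
  by have [js [h1 _ h2 h3]] := main _ (leqnn _); exists js.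
elim: h => [_|h IH hb]; first by exists s; rewrite addn0.
have [js [h1 h2 h3 h4]] := IH (ltnW hb).
have [|a [ha Ja ra]] := grade_step h2 h3 h4; first by rewrite h1 leq_addr ltn_add2l.
exists (rcons js a); split=> [|b|b|]; first by rewrite size_rcons h1 addnS.
- by rewrite mem_rcons inE => /predU1P[->|/h2].
- by rewrite mem_rcons inE => /predU1P[->|/h3].
- by apply/reg_on_rcons; split.
Qed.
End GradeStep.

(** * Vanishing of local cohomology *)

Section Koszul.
Variables (R : comNzRingType) (m : nat).
Implicit Types (v d : nat -> R).

Definition kterm q : lmodType R := psub (@hdeg_closed R R^o m q).
Definition mkK q (x : ext m R^o) (hx : hdeg q x) : kterm q := mkpsub (@hdeg_closed R R^o m q) hx.

Definition kdiff0 v q (x : kterm q.+1) : kterm q := mkK (hdeg_ct v (psubP x)).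
Fact kdiff_linear v q : linear (@kdiff0 v q).
Proof. by move=> a x y; apply: val_inj; rewrite /= linearP. Qed.
Definition kdiff v q : {linear kterm q.+1 -> kterm q} := mklinear (@kdiff_linear v q).
Fact kdiffK v q x : kdiff v q (kdiff v q.+1 x) = 0.
Proof. by apply: val_inj; rewrite /= ct2. Qed.
Definition kos v : chain R := Chain (@kdiffK v).

Definition kwd0 u q (x : kterm q) : kterm q.+1 := mkK (hdeg_wd u (psubP x)).
Fact kwd_linear u q : linear (@kwd0 u q).
Proof. by move=> a x y; apply: val_inj; rewrite /= linearP. Qed.
Definition kwd u q : {linear kterm q -> kterm q.+1} := mklinear (@kwd_linear u q).

Lemma kterm_retract q : exists r : {linear ext m R^o -> kterm q}, forall x, r (lval _ x) = x.
Proof.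
have [r hr] : exists r : {linear ext m R^o -> kterm q}, forall x, r x = mkK (hdeg_prj q x).
  by apply: ex_linear => a x y; apply: val_inj; rewrite /= linearP.
exists r => x; rewrite hr; apply: val_inj; exact: prj_id (psubP x).
Qed.

Lemma kos_proj v : proj_cx (kos v).
Proof.
move=> q; have [r hr] := kterm_retract q; apply: retract_projective hr _.
by apply: ext_projective; exact: regular_projective.
Qed.

Lemma hv_kterm (P : chain R) q e : hv P q R^o -> hv P q (kterm e).
Proof. by move=> h; have [r hr] := kterm_retract e; apply: hv_retract hr _; exact: hv_ext. Qed.

Lemma kterm_gt q (x : kterm q) : (m < q)%N -> x = 0.
Proof. by move=> h; apply: val_inj; exact: hdeg_gt h (psubP x). Qed.

Lemma kdiff_kwd v j q (x : kterm q.+1) : (j < m)%N ->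
  kdiff v q.+1 (kwd (unitv R j) q.+1 x) = v j *: x - kwd (unitv R j) q (kdiff v q x).
Proof. by move=> jm; apply: val_inj; rewrite /= ct_wd dot_unit. Qed.

Lemma kdiff_kwd0 v j (x : kterm 0) : (j < m)%N -> kdiff v 0 (kwd (unitv R j) 0 x) = v j *: x.
Proof.
move=> jm; apply: val_inj; rewrite /= ct_wd dot_unit //.
by rewrite ct_hdeg0 ?wd00 ?subr0 //; exact: psubP x.
Qed.

(** Exterior product with the [j]-th basis vector is a homotopy from multiplication by [v j] to
    zero. *)
Lemma kos_ann v j q (N : lmodType R) (f : {linear kos v q -> N}) : (j < m)%N -> coc f -> triv (lscale f (v j)).
Proof.
move=> jm; case: q f => [|q] f cf.
  by move=> x; rewrite /= -linearZ_LR -kdiff_kwd0 // cf.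
exists (lcomp f (kwd (unitv R j) q)) => x /=.
have := cf (kwd (unitv R j) q.+1 x).
rewrite [X in f X](kdiff_kwd v x jm) linearB linearZ_LR => /eqP.
by rewrite subr_eq0 => /eqP.
Qed.

Definition vlist v : seq R := [seq v j | j <- iota 0 m].

Lemma kos_exact v : reg_on (fun x : R^o => x = 0) (vlist v) -> forall e, exact_at (kos v) e.
Proof.
have sv : size (vlist v) = m by rewrite size_map size_iota.
move=> rv; apply: (acyclic (l := m) (s := vlist v)); rewrite ?sv //.
- by move=> e me x; exact: kterm_gt.
- move=> T hT e q qm; apply: hv_kterm.
  apply: (@hv_grade _ (std T) (vlist v) R^o R^o (lid R^o) (fun x => x = 0)) => //; last by rewrite sv.
  + exact: std_proj.
  + by move=> x; exists x.
  + by move=> a /hT[k hk]; exact: std_null hk.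
move=> e z dz a /mapP[j]; rewrite mem_iota => /= jm ->; exists 1%N; rewrite expr1.
exists (kwd (unitv R j) e.+1 z); apply: (etrans _ (esym (kdiff_kwd v z jm))).
by have -> : kdiff v e z = 0 := dz; rewrite linear0 subr0.
Qed.

(** The exterior powers of the diagonal matrix with entries [d]; [dm_ct] makes them a map between
    Koszul complexes. *)
Fixpoint dm k d : ext k R^o -> ext k R^o :=
  match k return ext k R^o -> ext k R^o with
  | 0 => fun x => x
  | k'.+1 => fun x => (dm (shift d) x.1, d 0%N *: dm (shift d) x.2)
  end.

Fact dm_linear k d : linear (@dm k d).
Proof.
elim: k d => //= k IH d a x y; apply: ext_eq => /=; first exact: IH.
by rewrite IH scalerDr !scalerA mulrC.
Qed.
HB.instance Definition _ k d := GRing.isLinear.Build R _ _ _ (@dm k d) (@dm_linear k d).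

Lemma dm_ct k v d (x : ext k R^o) : ct v (dm d x) = dm d (ct (fun j => d j * v j) x).
Proof.
elim: k v d x => //= k IH v d [x1 x2] /=; apply: ext_eq => /=.
  by rewrite IH (linearD (dm _)) (linearZ_LR (dm _)) /= scalerA [v 0%N * _]mulrC.
by rewrite ctZ IH (linearN (dm _)) scalerN.
Qed.

Lemma hdeg_dm k q d (x : ext k R^o) : hdeg q x -> hdeg q (dm d x).
Proof.
elim: k q d x => //= k IH q d [x1 x2] [/= h1 h2]; split; first exact: IH.
by case: q h2 {h1} => [->|q h2]; [rewrite linear0 scaler0|apply: hdegZ; exact: IH].
Qed.

Lemma dm_vac k d b : dm d (@vac R R^o k b) = vac k b.
Proof. by elim: k d => //= k IH d; rewrite IH linear0 scaler0. Qed.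

Lemma dm_topv k d b : dm d (@topv R R^o k b) = topv k ((\prod_(j < k) d j) *: b).
Proof.
elim: k d => [|k IH] d; first by rewrite big_ord0 scale1r.
by rewrite big_ord_recl /= IH linear0 -(linearZ_LR (@topv R R^o k)) /= scalerA.
Qed.

Definition kmap0 d q (x : kterm q) : kterm q := mkK (hdeg_dm d (psubP x)).
Fact kmap_linear d q : linear (@kmap0 d q).
Proof. by move=> a x y; apply: val_inj; rewrite /= linearP. Qed.
Definition kmap d q : {linear kterm q -> kterm q} := mklinear (@kmap_linear d q).

Lemma kdiff_kmap v d w q x : (forall j, (j < m)%N -> w j = d j * v j) ->
  kdiff v q (kmap d q.+1 x) = kmap d q (kdiff w q x).
Proof. by move=> h; apply: val_inj; rewrite /= dm_ct; congr (dm d _); apply: ct_eq => j /h. Qed.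

Definition ktop : kterm m := mkK (hdeg_topv m (1 : R^o)).

Lemma ktopE (x : kterm m) : x = (topc (val x) : R) *: ktop.
Proof.
apply: val_inj; rewrite -[RHS]/((topc (val x) : R) *: topv m (1 : R^o)).
rewrite -(linearZ_LR (@topv R R^o m)) /= -[_ *: 1]/(_ * 1) mulr1 topv_topc //; exact: psubP.
Qed.
End Koszul.

(** * An Artin-Rees lemma for powers of several elements *)

Section ArtinRees.
Variables (R : comNzRingType) (V : lmodType R).
Implicit Types (W U S : V -> Prop) (l : seq R).

Fixpoint pws W s l : V -> Prop :=
  if l is y :: l' then fun x => exists w x', [/\ W w, pws W s l' x' & x = y ^+ s *: w + x']
  else fun x => x = 0.

Lemma pws_closed W s l : subclosed W -> subclosed (pws W s l).
Proof.
move=> hW; elim: l => [|y l IH]; first by split=> // a x z -> ->; rewrite scaler0 addr0.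
split=> [|a _ _ [w [x [hw hx ->]]] [w' [x' [hw' hx' ->]]]].
  by exists 0, 0; split; [exact: hW.1|exact: IH.1|rewrite scaler0 addr0].
exists (a *: w + w'), (a *: x + x'); split; [exact: hW.2|exact: IH.2|].
by rewrite !scalerDr !scalerA [a * _]mulrC addrACA.
Qed.

Lemma pws_in W s l y w : subclosed W -> y \in l -> W w -> pws W s l (y ^+ s *: w).
Proof.
move=> hW; elim: l => // z l IH; rewrite inE => /predU1P[->|yl] hw.
  by exists w, 0; split=> //; [exact: (pws_closed s l hW).1|rewrite addr0].
by exists 0, (y ^+ s *: w); split; [exact: hW.1|exact: IH|rewrite scaler0 add0r].
Qed.

Lemma pws_ind W s l S : subclosed S -> (forall y w, y \in l -> W w -> S (y ^+ s *: w)) ->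
  forall x, pws W s l x -> S x.
Proof.
move=> hS; elim: l => [_ x ->|y l IH h x [w [x' [hw hx ->]]]]; first exact: hS.1.
apply: subclosedD => //; first by apply: h => //; exact: mem_head.
by apply: IH hx => z v zl; apply: h; rewrite inE zl orbT.
Qed.

Lemma pws_sub W s l x : subclosed W -> pws W s l x -> W x.
Proof. by move=> hW; apply: pws_ind => // y w _; exact: subclosedZ. Qed.

Lemma pws_mono s s' l x : (s' <= s)%N -> pws (fun=> True) s l x -> pws (fun=> True) s' l x.
Proof.
move=> ss; have hT : @subclosed R V (fun=> True) by [].
apply: pws_ind; first exact: pws_closed.
by move=> y w yl _; rewrite -(subnKC ss) exprD -scalerA; exact: pws_in.
Qed.

(** The submodules of those [g] with [y ^+ j *: g] in [W + U] increase with [j] and become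
    stationary at some [k]. The exponent [k + s] then leaves a factor [y ^+ s] in front of an
    element of [W]. *)
Lemma artin_rees1 W U y s : noeth V -> subclosed W -> subclosed U -> exists k, forall w g u,
  W w -> U u -> w = y ^+ k *: g + u -> exists w' u', [/\ W w', U u' & w = y ^+ s *: w' + u'].
Proof.
move=> hV hW hU; pose F j g := exists w u, [/\ W w, U u & y ^+ j *: g = w + u].
have [||k hk] := @noeth_acc R V F hV.
- move=> j; split=> [|a x z [w [u [hw hu e]]] [w' [u' [hw' hu' e']]]].
    by exists 0, 0; split; [exact: hW.1|exact: hU.1|rewrite scaler0 addr0].
  exists (a *: w + w'), (a *: u + u'); split; [exact: hW.2|exact: hU.2|].
  by rewrite scalerDr scalerA mulrC -scalerA e e' scalerDr addrACA.
- move=> j x [w [u [hw hu e]]]; exists (y *: w), (y *: u); split; [exact: subclosedZ|exact: subclosedZ|].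
  by rewrite exprS -scalerA e scalerDr.
exists (k + s)%N => w g u hw hu e.
have [|w' [u' [hw' hu' e']]] := hk (k + s)%N g.
  by exists w, (- u); split=> //; [exact: subclosedN|rewrite e addrK].
exists w', (y ^+ s *: u' + u); split=> //; first by apply: subclosedD => //; exact: subclosedZ.
by rewrite e addnC exprD -scalerA e' scalerDr addrA.
Qed.

(** Induction on the list: a high power of [y] times the whole module is first absorbed into [U],
    and the one-element case then removes it again. *)
Lemma artin_rees l : noeth V -> forall W U s, subclosed W -> subclosed U -> exists s', forall w x u,
  W w -> pws (fun=> True) s' l x -> U u -> w = x + u ->
  exists x' u', [/\ pws W s l x', U u' & w = x' + u'].
Proof.
move=> hV; elim: l => [|y l IH] W U s hW hU.
  by exists 0%N => w x u hw hx hu e; exists 0, u; split=> //; rewrite e hx.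
have [s1 h1] := artin_rees1 y s hV hW hU.
have [s2 h2] := IH W (extU U (y ^+ s1)) s hW (extU_closed _ hU).
exists (maxn s1 s2) => w x u hw [g [x' [_ hx' ->]]] hu e.
have [|||x2 [u2 [hx2 [g2 [u3 [hu3 eu2]]] e2]]] := h2 w x' (y ^+ maxn s1 s2 *: g + u) hw.
- exact: pws_mono (leq_maxr _ _) hx'.
- exists (y ^+ (maxn s1 s2 - s1) *: g), u; split=> //.
  by rewrite scalerA -exprD subnKC // leq_maxl.
- by rewrite e addrA [x' + _]addrC.
have hu2 : W u2.
  have -> : u2 = w - x2 by rewrite e2 addrC addKr.
  by apply: subclosedB => //; exact: pws_sub hx2.
have [w' [u' [hw' hu' e']]] := h1 u2 g2 u3 hu2 hu3 eu2.
exists (y ^+ s *: w' + x2), u'; split=> //; first by exists w', x2.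
by rewrite e2 e' addrA [x2 + _]addrC.
Qed.
End ArtinRees.

(** * Local duality in vanishing form *)

Section LocalCohomologyVanishing.
Variables (K : fieldType) (n : nat).
Local Notation m := n.+1.
Local Notation R := {mpoly K[m]}.
Implicit Types N F : lmodType R.

Definition xv s : nat -> R := fun j => if insub j is Some i then 'X_(i : 'I_m) ^+ s else 0.

Lemma xvE s (i : 'I_m) : xv s i = 'X_i ^+ s.
Proof. by rewrite /xv valK. Qed.

Lemma xvD k s j : (j < m)%N -> xv (k + s) j = xv k j * xv s j.
Proof. by move=> jm; rewrite -[j]/(nat_of_ord (Ordinal jm)) !xvE exprD. Qed.

Lemma vlist_xv s : vlist m (xv s) = xpow K m s.
Proof.
rewrite /vlist /xpow -val_enum_ord -map_comp; apply: eq_map => i; exact: xvE.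
Qed.

Local Notation C s := (kos m (xv s)).
(** The transition maps of the direct system whose colimit is local cohomology; they compare the
    powers [k + s] with the powers [s]. *)
Definition tau s k q : {linear C (k + s)%N q -> C s q} := kmap m (xv k) q.

Lemma tau_chd s k q x : chd (C s) q (tau s k q.+1 x) = tau s k q (chd (C (k + s)%N) q x).
Proof. by apply: kdiff_kmap => j jm; rewrite xvD. Qed.

Lemma hv_kos s q : (q <= n)%N -> hv (C s) q R^o.
Proof.
move=> qn; apply: (@hv_grade _ (C s) (xpow K m s) R^o R^o (lid R^o) (fun x => x = 0)) => //.
- exact: kos_proj.
- by move=> x; exists x.
- exact: xpow_reg.
- move=> a /mapP[i _ ->]; exists 1%N => k N f cf; rewrite expr1 -xvE; exact: kos_ann.
- by rewrite size_xpow.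
Qed.

Lemma kos_exactX s e : exact_at (C s) e.
Proof. by apply: kos_exact; rewrite vlist_xv; exact: xpow_reg. Qed.

(* Vanishing of [colim_s H^q(Hom(C s, N))]. *)
Definition cv q N := forall s (f : {linear C s q -> N}), coc f -> exists k, triv (lcomp f (tau s k q)).

Lemma coc_tau s k q N (f : {linear C s q -> N}) : coc f -> coc (lcomp f (tau s k q)).
Proof. by move=> cf x; rewrite -[LHS]/(f (tau s k q (chd (C (k + s)%N) q x))) -tau_chd cf. Qed.

Lemma cv_step N' F N (i : {linear N' -> F}) (p : {linear F -> N}) q : ses i p ->
  (forall s, hv (C s) q F) -> cv q.+1 N' -> cv q N.
Proof.
move=> sip hF hN' s f cf; have [f' d'] := delta_ex sip (@kos_proj _ _ _) cf.
have [k tk] := hN' s f' (delta_coc sip d'); exists k.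
have d'' : delta i p (lcomp f (tau s k q)) (lcomp f' (tau s k q.+1)).
  have [g [g1 g2]] := d'; exists (lcomp g (tau s k q)); split=> x /=; first exact: g1.
  by rewrite g2 tau_chd.
exact: (delta_triv_inv sip (hF (k + s)%N) d'' (coc_tau cf) tk).
Qed.

Lemma mon_ind b s (S : {ffun 'I_b -> R^o} -> Prop) (z : {ffun 'I_b -> R^o}) : subclosed S ->
  (forall i v, S ('X_i ^+ s *: v)) -> (forall a, mon_ideal s m (z a)) -> S z.
Proof.
move=> hS h hz; rewrite [z]ffunE_sum; apply: subclosed_sum => // a.
set e := [ffun _ => _]; have hc : @subclosed R R^o (fun f => S ((f : R) *: e)).
  split=> [|r x y hx hy]; first by rewrite scale0r; exact: hS.1.
  by rewrite scalerDl -[r *: x]/(r * x) -scalerA; exact: hS.2.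
apply: (mpoly_mon_split hc) => k /(hz a)[i _ si].
have -> : 'X_[k] = 'X_i ^+ s * 'X_[k - U_(i) *+ s] :> R.
  rewrite mpolyXn -mpolyXD addmC submK //; apply/mnm_lepP => j; rewrite mulmnE mnm1E.
  by case: eqP => [<-|_]; rewrite ?mul1n.
by rewrite -scalerA; exact: h.
Qed.

(* The coefficient functional that makes [R / (x_0^s, .., x_n^s)] a Gorenstein ring. *)
Definition soc s : 'X_{1..m} := [multinom s | _ < m].
Definition scf s (f : R) : K := f@_(soc s).

Lemma scfD s f g : scf s (f + g) = scf s f + scf s g. Proof. exact: mcoeffD. Qed.
Lemma scfB s f g : scf s (f - g) = scf s f - scf s g. Proof. exact: mcoeffB. Qed.
Lemma scfZ s (c : K) f : scf s (c%:MP * f) = c * scf s f.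
Proof. by rewrite /scf mul_mpolyC mcoeffZ. Qed.

(** Mind the shift: the monomial with all exponents [s] spans the socle of the quotient by the
    powers [s.+1]. *)
Lemma scf_mon s f : mon_ideal s.+1 m f -> scf s f = 0.
Proof.
move=> h; apply/eqP; apply: contraT => /h[i _].
by rewrite mnmE ltnn.
Qed.

Lemma scf_shift s k f : scf (k + s) ((\prod_(i < m) 'X_i ^+ k) * f) = scf s f.
Proof.
have -> : \prod_(i < m) ('X_i : R) ^+ k = 'X_[soc k].
  by rewrite mpolyXE_id; apply: eq_bigr => i _; rewrite mnmE.
rewrite /scf mulrC.
have -> : soc (k + s) = (soc k + soc s)%MM by apply/mnmP => i; rewrite mnmDE !mnmE.
by rewrite mcoeffMX.
Qed.

(** A monomial of [f] outside the ideal has all exponents at most [s]; multiplying by the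
    complementary monomial moves its coefficient to the socle. *)
Lemma scf_nondeg s f : (forall g, scf s (g * f) = 0) -> mon_ideal s.+1 m f.
Proof.
move=> h k fk; apply: contrapT => nk.
have ks i : (k i <= s)%N by rewrite leqNgt; apply/negP => si; apply: nk; exists i.
have e : (soc s - k + k)%MM = soc s by rewrite submK //; apply/mnm_lepP => i; rewrite mnmE.
have := h 'X_[soc s - k]; rewrite /scf mulrC -[X in _@_X]e mcoeffMX => fk0.
by rewrite fk0 eqxx in fk.
Qed.

Lemma triv_tau s k q N (f : {linear C s q -> N}) : triv f -> triv (lcomp f (tau s k q)).
Proof.
case: q f => [|q] f; first by move=> f0 x; exact: f0.
case=> g hg; exists (lcomp g (tau s k q)) => x.
by rewrite -[LHS]/(f (tau s k q.+1 x)) hg tau_chd.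
Qed.

Section FunctionalExtension.
Variable V : lmodType R.
Implicit Types L : V -> K -> Prop.

(** A partially defined functional given by its graph, with [K] acting through constant polynomials.
    The condition that 0 has only the value 0 makes it single valued. *)
Definition klin L := L 0 0 /\ forall c v a v' a', L v a -> L v' a' -> L (c%:MP *: v + v') (c * a + a').

Lemma klin_extend L (B : seq V) : klin L -> (forall a, L 0 a -> a = 0) ->
  exists L', [/\ klin L', forall a, L' 0 a -> a = 0, forall v a, L v a -> L' v a
    & forall b, b \in B -> exists a, L' b a].
Proof.
elim: B L => [|b B IH] L kL fL; first by exists L.
have [L1 [k1 f1 s1 d1]] := IH L kL fL.
have [[a ha]|nb] := pselect (exists a, L1 b a).
  by exists L1; split=> // v; rewrite inE => /predU1P[->|/d1]; [exists a|].
pose L2 v a := exists c w, L1 w a /\ v = c%:MP *: b + w.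
exists L2; split=> [|a [c [w [hw e]]]|v a /s1 hv|v].
- split; first by exists 0, 0; split; [exact: k1.1|rewrite scale0r addr0].
  move=> c _ a _ a' [d [w [hw ->]]] [d' [w' [hw' ->]]].
  exists (c * d + d'), (c%:MP *: w + w'); split; first exact: k1.2.
  by rewrite mpolyCD mpolyCM scalerDr scalerDl !scalerA addrACA.
- have [c0|c0] := eqVneq c 0; first by apply: f1; move: e; rewrite c0 scale0r add0r => ->.
  case: nb; exists (- c^-1 * a + 0); have -> : b = (- c^-1)%:MP *: w + 0.
    have -> : w = - (c%:MP *: b) by apply/eqP; rewrite -addr_eq0 addrC -e.
    by rewrite addr0 scalerN mpolyCN scaleNr opprK scalerA -mpolyCM mulVf // scale1r.
  by apply: k1.2 => //; exact: k1.1.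
- by exists 0, v; rewrite scale0r add0r.
rewrite inE => /predU1P[->|/d1[a ha]].
  by exists 0, 1, 0; split; [exact: k1.1|rewrite scale1r addr0].
by exists a, 0, v; rewrite scale0r add0r.
Qed.

(** The induction hypothesis on [S] says that [B] and the domain of [L] span [V] over [K]. As [B] is
    finite, a finite induction replaces a maximality argument. *)
Lemma klin_functional L (B : seq V) : klin L -> (forall a, L 0 a -> a = 0) ->
  (forall S : V -> Prop, S 0 -> (forall c v v', S v -> S v' -> S (c%:MP *: v + v')) ->
    (forall v a, L v a -> S v) -> (forall b, b \in B -> S b) -> forall v, S v) ->
  exists mu : V -> K, (forall v a, L v a -> mu v = a) /\
    forall c v v', mu (c%:MP *: v + v') = c * mu v + mu v'.
Proof.
move=> kL fL hB; have [L' [k' f' s' d']] := klin_extend B kL fL.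
have tot v : exists a, L' v a.
  apply: (hB (fun v => exists a, L' v a)) => [|c w w' [a ha] [a' ha']|w a /s' hw|//].
  - by exists 0; exact: k'.1.
  - by exists (c * a + a'); exact: k'.2.
  - by exists a.
have uniq v a a' : L' v a -> L' v a' -> a = a'.
  move=> h h'; have := k'.2 (-1) _ _ _ _ h h'; rewrite mpolyCN scaleN1r addNr mulN1r => /f'.
  by move=> /eqP; rewrite addrC subr_eq0 => /eqP.
have [mu hmu] := ex_choice tot; exists mu; split=> [v a /s' h|c v v'].
  exact: uniq (hmu v) h.
by apply: uniq (hmu _) _; exact: k'.2.
Qed.
End FunctionalExtension.

Lemma soc_dual s (nu : R -> K) : (forall c f g, nu (c%:MP * f + g) = c * nu f + nu g) ->
  (forall f, mon_ideal s.+1 m f -> nu f = 0) -> exists h, forall f, nu f = scf s (f * h).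
Proof.
move=> nl nm; pose B := (m * s).+1.
(* Monomials outside the ideal have exponents at most [s], hence degree at most [m * s]. For every
   other [al] in the sum the value of [nu] is 0, so truncation in [soc s - al] does no harm. *)
pose h : R := \sum_(al : 'X_{1..m < B}) (nu 'X_[al])%:MP * 'X_[soc s - al].
have nu0 : nu 0 = 0 by apply: nm; exact: (@mon_ideal_closed K m s.+1 m).1.
exists h => f.
have hc : @subclosed K {mpoly K[m]} (fun f => nu f = scf s (f * h)).
  split=> [|c f1 f2 e1 e2]; first by rewrite nu0 mul0r /scf mcoeff0.
  by rewrite -mul_mpolyC nl e1 e2 mulrDl -mulrA scfD scfZ.
rewrite [f]mpolyE; apply: (subclosed_sum _ hc) => be.
apply: (subclosedZ _ hc).
have [[i si]|nbe] := pselect (exists i, (s < be i)%N).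
  have hm : mon_ideal s.+1 m ('X_[be] : R).
    by move=> k; rewrite mcoeffX; have [<- _|_] := eqVneq be k; [exists i|rewrite eqxx].
  rewrite nm // scf_mon // mulrC; by apply: (@subclosedZ R R^o (mon_ideal s.+1 m)) => //; exact: mon_ideal_closed.
have bes i : (be i <= s)%N by rewrite leqNgt; apply/negP => si; apply: nbe; exists i.
have beB : (mdeg be < B)%N.
  rewrite mdegE ltnS (leq_trans (leq_sum _ (fun i _ => bes i))) //.
  by rewrite sum_nat_const card_ord.
rewrite /h mulr_sumr /scf (linear_sum (mcoeff (soc s))) (bigD1 (BMultinom beB)) //= big1 => [|al ne].
  rewrite addr0 mulrCA mcoeffCM -mpolyXD mcoeffX addmC submK ?eqxx ?mulr1 //.
  by apply/mnm_lepP => i; rewrite mnmE.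
rewrite mulrCA mcoeffCM -mpolyXD mcoeffX; case: eqP => [e|_]; last by rewrite mulr0.
have [als|nal] := pselect (forall i, (al i <= s)%N); last first.
  rewrite nm ?mul0r // => k; rewrite mcoeffX; have [<- _|_] := eqVneq (val al) k; last by rewrite eqxx.
  apply: contrapT => nn; apply: nal => i; rewrite leqNgt; apply/negP => si; apply: nn; by exists i.
case/eqP: ne; apply: val_inj; apply/mnmP => i /=.
have /mnmP /(_ i) := e; rewrite mnmDE mnmBE mnmE; have := als i; have := bes i; lia.
Qed.

Definition ev b (a : 'I_b) : {ffun 'I_b -> R^o} := [ffun c => (c == a)%:R : R^o].
Definition pr b (f g : {ffun 'I_b -> R^o}) : R := \sum_a f a * g a.

Lemma pr_linear b f : linear (fun g : {ffun 'I_b -> R^o} => pr f g : R^o).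
Proof.
move=> r g h; rewrite /pr scaler_sumr -big_split; apply: eq_bigr => a _ /=.
by rewrite !ffunE mulrDr -[r *: g a]/(r * g a) -[_ *: (_ * _)]/(r * (f a * g a)) mulrCA.
Qed.

Lemma prC b (f g : {ffun 'I_b -> R^o}) : pr f g = pr g f.
Proof. by apply: eq_bigr => a _; rewrite mulrC. Qed.

Lemma pr_ev b (f : {ffun 'I_b -> R^o}) a : pr f (ev a) = f a.
Proof.
rewrite /pr (bigD1 a) //= ffunE eqxx mulr1 big1 ?addr0 // => c /negPf ca.
by rewrite ffunE ca mulr0.
Qed.

Lemma ffun_ev b (f : {ffun 'I_b -> R^o}) : f = \sum_a f a *: ev a.
Proof. exact: ffunE_sum. Qed.

Lemma lin_pr b (phi : {linear {ffun 'I_b -> R^o} -> R^o}) :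
  forall g, phi g = pr [ffun a => phi (ev a)] g.
Proof.
move=> g; rewrite {1}[g]ffun_ev linear_sum; apply: eq_bigr => a _.
by rewrite linearZ_LR ffunE; exact: mulrC.
Qed.

Definition trp b c (E2 : {linear {ffun 'I_c -> R^o} -> {ffun 'I_b -> R^o}}) (f : {ffun 'I_b -> R^o}) :
  {ffun 'I_c -> R^o} := [ffun a => pr f (E2 (ev a))].

Fact trp_linear b c E2 : linear (@trp b c E2).
Proof.
move=> r f g; apply/ffunP => a; rewrite !ffunE prC [in RHS]prC [X in _ = _ + X]prC.
exact: (pr_linear (E2 (ev a))).
Qed.

Lemma pr_trp b c (E2 : {linear {ffun 'I_c -> R^o} -> {ffun 'I_b -> R^o}}) f g :
  pr f (E2 g) = pr (trp E2 f) g.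
Proof.
have [phi hphi] := ex_linear (pr_linear f).
by rewrite -hphi -[phi (E2 g)]/(lcomp phi E2 g) lin_pr; apply: eq_bigr => a _; rewrite !ffunE /= hphi.
Qed.

Section Core.
Variables (N : lmodType R) (b b1 b2 : nat).
Variables (p : {linear {ffun 'I_b -> R^o} -> N}) (D : {linear {ffun 'I_b1 -> R^o} -> kerm p}).
Variable E2 : {linear {ffun 'I_b2 -> R^o} -> {ffun 'I_b1 -> R^o}}.
Hypotheses (sp : onto p) (sD : onto D) (kD : forall y, D y = 0 <-> exists h, y = E2 h).
Hypothesis extN : extn R^o 0 N.

(** A form killed by the transpose factors through [D] and so lives on the kernel of [p]; it extends
    to the free module because [Ext^1(N, R)] is zero. *)
Lemma dual_ext f : trp E2 f = 0 -> exists z, forall y, pr f y = pr z (val (D y)).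
Proof.
move=> f0; have [phi hphi] := ex_linear (pr_linear f).
have [|psi hpsi] := factor_surj (f := phi) sD.
  move=> _ /kD [h ->]; rewrite hphi pr_trp f0 /pr big1 // => a _.
  by rewrite ffunE mul0r.
have [chi hchi] := extN (kerm_ses sp) psi.
exists [ffun a => chi (ev a)] => y.
by rewrite -lin_pr hchi hpsi hphi.
Qed.

Variables (s : nat) (y : {ffun 'I_b1 -> R^o}).
Hypothesis hy : forall a, mon_ideal s.+1 m ((val (D y) : {ffun 'I_b -> R^o}) a).

Lemma mon_pr c k (z g : {ffun 'I_c -> R^o}) : (forall a, mon_ideal k m (g a)) -> mon_ideal k m (pr z g).
Proof.
move=> h; apply: (@subclosed_sum R R^o (mon_ideal k m)) => [|a]; first exact: mon_ideal_closed.
by apply: (@subclosedZ R R^o (mon_ideal k m)) => //; exact: mon_ideal_closed.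
Qed.

Lemma trp0_scf f : trp E2 f = 0 -> scf s (pr f y) = 0.
Proof. by move=> /dual_ext[z ->]; apply: scf_mon; exact: mon_pr. Qed.

Lemma trp_eq_scf f g : trp E2 f = trp E2 g -> scf s (pr f y) = scf s (pr g y).
Proof.
move=> e; apply/eqP; rewrite -subr_eq0 -scfB; apply/eqP.
have -> : pr f y - pr g y = pr (f - g) y.
  rewrite /pr -sumrB; apply: eq_bigr => a _.
  by rewrite !ffunE mulrBl.
apply: trp0_scf; have [T hT] := ex_linear (@trp_linear b1 b2 E2).
by rewrite -hT linearB !hT e subrr.
Qed.

Local Notation xs := [seq 'X_i : R | i <- enum 'I_m].
Definition imT (w : {ffun 'I_b2 -> R^o}) := exists f, w = trp E2 f.

Lemma imT_closed : subclosed imT.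
Proof.
have [T hT] := ex_linear (@trp_linear b1 b2 E2).
split=> [|a _ _ [f ->] [g ->]]; first by exists 0; rewrite -hT linear0.
by exists (a *: f + g); rewrite trp_linear.
Qed.

(** Such an element is the transpose of some [g] divisible by the powers, and by [trp_eq_scf] the
    value may be computed from [g]. *)
Lemma pws_scf f : pws imT s.+1 xs (trp E2 f) -> scf s (pr f y) = 0.
Proof.
have [T hT] := ex_linear (@trp_linear b1 b2 E2).
move=> h; have : exists g, trp E2 f = trp E2 g /\ mon_ideal s.+1 m (pr g y).
  move: h; apply: (pws_ind (S := fun w => exists g, w = trp E2 g /\ mon_ideal s.+1 m (pr g y))).
    split=> [|a _ _ [g [-> hg]] [g' [-> hg']]].
      exists 0; split; first by rewrite -hT linear0.
      by rewrite prC; apply: mon_pr => a; rewrite ffunE; exact: (@mon_ideal_closed K m s.+1 m).1.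
    exists (a *: g + g'); split; first by rewrite trp_linear.
    by rewrite prC pr_linear ![pr y _]prC; exact: (@mon_ideal_closed K m s.+1 m).2.
  move=> x w /mapP[i _ ->] [g ->]; exists ('X_i ^+ s.+1 *: g); split; first by rewrite -!hT linearZ_LR.
  rewrite prC; apply: mon_pr => a; rewrite ffunE -[_ *: _]/(_ * _) mulrC.
  apply: (@subclosedZ R R^o (mon_ideal s.+1 m)); first exact: mon_ideal_closed.
  by apply: (@mon_ideal_mono K m _ i.+1) => //; exact: mon_idealX.
by move=> [g [/trp_eq_scf -> hg]]; exact: scf_mon.
Qed.

(* [f |-> scf s (pr f y)] descends to the image of the transpose of [E2]; by Artin-Rees it extends
   to a functional on the whole free module killing high powers of the variables. *)
Lemma core_claim : exists k h, forall a, mon_ideal (k + s).+1 m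
  (((\prod_(i < m) 'X_i ^+ k) *: y - E2 h : {ffun 'I_b1 -> R^o}) a).
Proof.
have [T hT] := ex_linear (@trp_linear b1 b2 E2).
have nV := @noeth_ffun _ b2 (@noeth_mpoly K m).
have h0 : @subclosed R {ffun 'I_b2 -> R^o} (fun x => x = 0).
  by split=> // a x z -> ->; rewrite scaler0 addr0.
have [k hk] := artin_rees xs nV s.+1 imT_closed h0.
(* The functional is prescribed on the image of the transpose and set to 0 on the multiples of the
   powers [(k + s).+1]; the choice of [k] by Artin-Rees makes these agree where they overlap. *)
pose L (v : {ffun 'I_b2 -> R^o}) (c : K) := exists f (u : {ffun 'I_b2 -> R^o}),
  [/\ v = trp E2 f + u, forall a, mon_ideal (k + s).+1 m (u a) & c = scf s (pr f y)].
have Lz (u : {ffun 'I_b2 -> R^o}) : (forall a, mon_ideal (k + s).+1 m (u a)) -> L u 0.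
  move=> hu; exists 0, u; split=> //; first by rewrite -hT linear0 add0r.
  by rewrite /pr big1 ?/scf ?mcoeff0 // => a _; rewrite ffunE mul0r.
have kL : klin L.
  split; first by apply: Lz => a; rewrite ffunE; exact: (@mon_ideal_closed K m (k + s).+1 m).1.
  move=> c _ _ _ _ [f [u [-> hu ->]]] [f' [u' [-> hu' ->]]].
  exists (c%:MP *: f + f'), (c%:MP *: u + u'); split.
  - by rewrite trp_linear scalerDr addrACA.
  - by move=> a; rewrite !ffunE; exact: (@mon_ideal_closed K m (k + s).+1 m).2.
  - by rewrite [in RHS]prC pr_linear ![pr y _]prC scfD -[_ *: _]/(_ * _) scfZ.
have fL c : L 0 c -> c = 0.
  move=> [f [u [e hu ->]]]; apply: pws_scf.
  have [||||x [u' [hx -> ->]]] := hk (trp E2 f) (- u) 0; last by rewrite addr0.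
  - by exists f.
  - have hT' : @subclosed R {ffun 'I_b2 -> R^o} (fun=> True) by [].
    have hc := pws_closed k xs hT'.
    apply: (mon_ind hc) => [i v|a].
      by apply: pws_in => //; apply: map_f; rewrite mem_enum.
    rewrite ffunE; apply: (@subclosedN R R^o (mon_ideal k m)); first exact: mon_ideal_closed.
    by move=> q /(hu a)[i im si]; exists i => //; apply: leq_trans si; rewrite -addnS leq_addr.
  - by [].
  - by rewrite addr0; apply/eqP; rewrite -addr_eq0 -e.
(* Monomials of degree at least [B] have an exponent above [k + s] and already lie in the domain, so
   finitely many vectors remain. *)
pose B := (m * (k + s)).+1.
pose bs := [seq ('X_[al : 'X_{1..m}] : R) *: ev a | al <- [seq val al | al <- enum {: 'X_{1..m < B}}], a <- enum 'I_b2].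
have [S S0 SD SL SB v|mu [mu1 mu2]] := klin_functional (B := bs) kL fL.
  have Ssum (J : Type) (r : seq J) (F : J -> {ffun 'I_b2 -> R^o}) : (forall i, S (F i)) -> S (\sum_(i <- r) F i).
    move=> hF; elim: r => [|j r IH]; rewrite ?big_nil ?big_cons //.
    by rewrite -[F j]scale1r -mpolyC1; exact: SD.
  rewrite [v]ffun_ev; apply: (Ssum) => a.
  rewrite [v a]mpolyE scaler_suml; apply: (Ssum) => al.
  rewrite -mul_mpolyC -scalerA -[_ *: _]addr0; apply: SD => //.
  have [alB|alB] := ltnP (mdeg al) B.
    apply: SB; apply/allpairsP; exists (al, a); split=> //=; last by rewrite mem_enum.
    by apply/mapP; exists (BMultinom alB); rewrite ?mem_enum.
  apply: (SL _ 0); apply: Lz => c; rewrite ffunE -[_ *: _]/(_ * _) mulrC.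
  apply: (@subclosedZ R R^o (mon_ideal (k + s).+1 m)); first exact: mon_ideal_closed.
  move=> q; rewrite mcoeffX; have [<- _|_] := eqVneq al q; last by rewrite eqxx.
  apply: contrapT => nn; move: alB; rewrite leqNgt => /negP; apply.
  have als i : (al i <= k + s)%N by rewrite leqNgt; apply/negP => si; apply: nn; exists i.
  by rewrite mdegE ltnS (leq_trans (leq_sum _ (fun i _ => als i))) // sum_nat_const card_ord.
have hd a : exists h, forall f, mu (f *: ev a) = scf (k + s) (f * h).
  apply: soc_dual => [c f g|f hf]; first by rewrite scalerDl -scalerA mu2.
  apply: mu1; apply: Lz => c; rewrite ffunE -[_ *: _]/(_ * _) mulrC.
  by apply: (@subclosedZ R R^o (mon_ideal (k + s).+1 m)) => //; exact: mon_ideal_closed.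
have [h hh] := ex_choice hd.
exists k, [ffun a => h a] => a; apply: scf_nondeg => g.
have mu0 : mu 0 = 0 by apply: mu1; exact: kL.1.
(* [soc_dual] represents the extended functional by the vector [h]; moving [E2] across the pairing
   and shifting the left side by [scf_shift], all socle functionals of the difference vanish. *)
have key f : scf s (pr f y) = scf (k + s) (pr f (E2 [ffun a => h a])).
  rewrite pr_trp -(mu1 (trp E2 f) (scf s (pr f y))); last first.
    by exists f, 0; split; rewrite ?addr0 // => c; rewrite ffunE; exact: (@mon_ideal_closed K m (k + s).+1 m).1.
  rewrite {1}[trp E2 f]ffun_ev /pr; elim: (index_enum _) => [|c r IH].
    by rewrite !big_nil mu0 /scf mcoeff0.
  rewrite !big_cons scfD -IH -[_ *: ev c]scale1r -mpolyC1 mu2 mul1r hh.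
  by rewrite [X in _ = scf _ (_ * X) + _]ffunE.
have := key (g *: ev a); rewrite -(scf_shift s k) => e.
have -> : g * ((\prod_(i < m) 'X_i ^+ k) *: y - E2 [ffun a => h a]) a =
   (\prod_(i < m) 'X_i ^+ k) * pr (g *: ev a) y - pr (g *: ev a) (E2 [ffun a => h a]).
  have prg z : pr (g *: ev a) z = g * z a.
    by rewrite prC -[g *: ev a]addr0 pr_linear pr_ev /pr big1 ?addr0 // => c _; rewrite ffunE mulr0.
  by rewrite !prg !ffunE mulrBr -[_ *: y a]/(_ * y a) mulrCA.
by rewrite scfB e subrr.
Qed.
End Core.

Lemma fgm_sub b (S : {ffun 'I_b -> R^o} -> Prop) (h : subclosed S) : fgm (psub h).
Proof. by apply: noeth_fgm; apply: noeth_ffun; exact: noeth_mpoly. Qed.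

(** The connecting map turns a class of degree [n] into the value of [f'] on the top form,
    represented by [y]. By [core_claim], after a transition this value comes from a vector divisible
    by the powers of the variables, which makes the class trivial. *)
Lemma cv_core N : fgm N -> extn R^o 0 N -> cv n N.
Proof.
move=> [b [p sp]] eN [|s] f cf.
  (* For [s = 0] the Koszul sequence consists of units and the complex is contractible; afterwards
     the exponent has the form [s.+1] that [core_claim] expects. *)
  exists 0%N; apply: triv_tau; apply: triv_ext (kos_ann (ltn0Sn n) cf) => x.
  by rewrite /= (xvE 0 ord0) expr0 scale1r.
have [b1 [D sD]] : fgm (kerm p) by exact: fgm_sub.
have [b2 [E' sE]] : fgm (kerm D) by exact: fgm_sub.
have [E2 E2E] : exists E2 : {linear {ffun 'I_b2 -> R^o} -> {ffun 'I_b1 -> R^o}}, forall h, E2 h = val (E' h).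
  by exists (lcomp (lval _) E').
have kD y : D y = 0 <-> exists h, y = E2 h.
  split=> [e|[h ->]]; last by rewrite E2E; exact: psubP (E' h).
  have [h hh] := sE (mkpsub (ker_closed D) e).
  by exists h; rewrite E2E hh.
have sip := kerm_ses sp.
have [f' d'] := delta_ex sip (@kos_proj _ _ _) cf.
have [y hy] := sD (f' (ktop R m)).
have my a : mon_ideal s.+1 m ((val (D y) : {ffun 'I_b -> R^o}) a).
  have [g [_ g2]] := d'; rewrite hy; have -> : val (f' (ktop R m)) = g (chd (C s.+1) n (ktop R m)) := g2 _.
  pose w j : kterm R m n := mkK (hdeg_ct (unitv R j) (hdeg_topv m (1 : R^o))).
  have -> : chd (C s.+1) n (ktop R m) = \sum_(j < m) 'X_j ^+ s.+1 *: w j.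
    apply: val_inj; rewrite [RHS](linear_sum (lval _)) -[LHS]/(ct (xv s.+1) (topv m 1)) ct_unit.
    by apply: eq_bigr => j _; rewrite xvE.
  rewrite linear_sum sum_ffunE; apply: (@subclosed_sum R R^o (mon_ideal s.+1 m)) => [|j]; first exact: mon_ideal_closed.
  rewrite linearZ_LR ffunE -[_ *: _]/(_ * _) mulrC.
  apply: (@subclosedZ R R^o (mon_ideal s.+1 m)); first exact: mon_ideal_closed.
  by apply: (@mon_ideal_mono K m _ j.+1) => //; exact: mon_idealX.
have [k [h hz]] := core_claim sp sD kD eN my.
set z := (_ *: y - E2 h) in hz.
have Dz : D z = (\prod_(i < m) 'X_i ^+ k) *: f' (ktop R m).
  rewrite /z linearB linearZ_LR hy; have -> : D (E2 h) = 0 by apply/kD; exists h.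
  by rewrite subr0.
exists k.
have hF : hv (C (k + s.+1)%N) n {ffun 'I_b -> R^o} by apply: hv_ffun; exact: hv_kos.
have d'' : delta (\val : {linear kerm p -> {ffun 'I_b -> R^o}}) p (lcomp f (tau s.+1 k n)) (lcomp f' (tau s.+1 k m)).
  have [g [g1 g2]] := d'; exists (lcomp g (tau s.+1 k n)); split=> x; first exact: g1.
  apply: (etrans (g2 (tau s.+1 k m x))); congr (g _); exact: tau_chd.
apply: (delta_triv_inv sip hF d'' (coc_tau cf)).
(* For [z'] a multiple of ['X_i ^+ (k + s.+1)], exterior product with the [i]-th basis vector
   factors the corresponding map through the differential. *)
have main z' : (forall a, mon_ideal (k + s.+1)%N m ((z' : {ffun 'I_b1 -> R^o}) a)) ->
    exists g : {linear C (k + s.+1)%N n -> kerm p}, forall x : C (k + s.+1)%N m,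
      (topc (val x) : R) *: D z' = g (chd (C (k + s.+1)%N) n x).
  apply: (mon_ind (S := fun z' => exists g : {linear C (k + s.+1)%N n -> kerm p}, forall x : C (k + s.+1)%N m,
      (topc (val x) : R) *: D z' = g (chd (C (k + s.+1)%N) n x))).
    split=> [|a z1 z2 [g1 h1] [g2 h2]].
      by exists (lzero _ _) => x; rewrite linear0 scaler0.
    exists (ladd (lscale g1 a) g2) => x; rewrite /= -h1 -h2 linearP scalerDr !scalerA.
    by rewrite mulrC.
  move=> i v.
  have [g hg] : exists g : {linear C (k + s.+1)%N n -> kerm p}, forall w,
      g w = (topc (val (kwd m (unitv R i) n w)) : R) *: D v.
    have [tc htc] : exists tc : {linear C (k + s.+1)%N n -> R^o}, forall w,
        tc w = topc (val (kwd m (unitv R i) n w)).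
      by exists (lcomp (@topc R R^o m) (lcomp (lval _) (kwd m (unitv R i) n))).
    by apply: ex_linear => a w w'; rewrite -!htc linearP scalerDl scalerA.
  exists g => x; rewrite hg.
  have := kdiff_kwd (xv (k + s.+1)) x (ltn_ord i).
  have e0 : kwd m (unitv R i) m x = 0 by exact: kterm_gt.
  rewrite e0 linear0 => /esym /eqP; rewrite subr_eq0 => /eqP e.
  rewrite -[chd _ n x]/(kdiff m (xv (k + s.+1)) n x) -e -[val (_ *: x)]/(_ *: val x).
  by rewrite (linearZ_LR (@topc R R^o m)) /= xvE linearZ_LR scalerA mulrC.
have [|g hg] := main z; first by move=> a; rewrite addnS; exact: hz.
have tt : tau s.+1 k m (ktop R m) = (\prod_(i < m) 'X_i ^+ k) *: ktop R m.
  apply: val_inj; rewrite -[LHS]/(dm (xv k) (topv m 1)) dm_topv.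
  rewrite (linearZ_LR (@topv R R^o m)); congr (_ *: _); apply: eq_bigr => i _; exact: xvE.
exists g => x; apply: (etrans _ (hg x)); rewrite Dz -[LHS]/(f' (tau s.+1 k m x)).
have e1 : tau s.+1 k m x = (topc (val x) : R) *: tau s.+1 k m (ktop R m).
  by rewrite -(linearZ_LR (tau s.+1 k m)); congr (tau s.+1 k m _); exact: ktopE.
by rewrite e1 tt (linearZ_LR f') (linearZ_LR f').
Qed.

(** Passing to the kernel of a free cover lowers the [Ext] index by one and raises the cohomological
    degree by one, down to the case [q = 0]. *)
Lemma cv_ext q N : (q <= n)%N -> fgm N -> extn R^o q N -> cv (n - q) N.
Proof.
elim: q N => [|q IH] N qn fN eN; first by rewrite subn0; exact: cv_core.
have [b [p sp]] := fN; have sip := kerm_ses sp.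
apply: (cv_step sip).
  by move=> s; apply: hv_ffun; apply: hv_kos; lia.
have -> : (n - q.+1).+1 = (n - q)%N by lia.
apply: IH; [exact: ltnW|exact: fgm_sub|].
by apply/(extn_cover _ _ sip) => //; exact: ffun_projective.
Qed.

Section Descent.
Variables (N : lmodType R) (E : injective_resolution N).

Lemma inj_factor (A B I : lmodType R) (d : {linear A -> B}) (h : {linear A -> I}) : injective_module I ->
  (forall a, d a = 0 -> h a = 0) -> exists g : {linear B -> I}, forall a, g (d a) = h a.
Proof.
move=> hI hd; have [p [sp hp]] := im_ex d.
have [|g hg] := factor_surj (f := h) sp.
  by move=> a e; apply: hd; rewrite -hp e.
have [g' hg'] := hI _ _ (lval _ : {linear psub (im_closed d) -> B}) g val_inj.
by exists g' => a; rewrite -hp hg' hg.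
Qed.

Lemma proj_factor (P A B D : lmodType R) (e : {linear A -> B}) (f : {linear P -> B}) : projective P ->
  (forall x, exists a, f x = e a) -> exists g : {linear P -> A}, forall x, e (g x) = f x.
Proof.
move=> hP hf; have [p [sp hp]] := im_ex e.
have [|f' hf'] := factor_inj (i := lval _ : {linear psub (im_closed e) -> B}) (f := f) val_inj.
  by move=> x; have [a ha] := hf x; exists (p a); rewrite /= hp.
have [g hg] := hP _ _ p f' sp; exists g => x.
by rewrite -hp hg -hf'.
Qed.

(** A staircase in the double complex of maps from Koszul terms to injective terms: [f] is lifted
    along the resolution, the lift composed with the Koszul differential is a cocycle one step
    further, and the process ends in [N], where [cv] applies. The match is needed because [N] plays
    the part of the term before [E 0]. *)
Lemma descent k : forall q s (f : {linear C s q -> E k}), coc f -> (forall x, cdiff E k (f x) = 0) ->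
  cv (q + k) N -> exists j,
  match k return {linear C s q -> E k} -> Prop with
  | 0 => fun f => exists g : {linear C (j + s)%N q -> N}, triv g /\ forall x, f (tau s j q x) = inj_aug E (g x)
  | k'.+1 => fun f => exists h : {linear C (j + s)%N q -> E k'}, coc h /\
      forall x, cdiff E k' (h x) = f (tau s j q x)
  end f.
Proof.
elim: k => [|k IH] q s f cf df.
  rewrite addn0 => hN.
  have [|g hg] := factor_inj (i := inj_aug E) (f := f) (@inj_aug_inj _ _ E).
    by move=> x; exact: (proj1 (@inj_aug_exact _ _ E (f x)) (df x)).
  have cg : coc g by move=> x; apply: (@inj_aug_inj _ _ E); rewrite hg cf linear0.
  have [j tj] := hN s g cg; exists j, (lcomp g (tau s j q)); split=> // x.
  by rewrite /= hg.
rewrite addnS -addSn => hN.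
have [|chi hchi] := proj_factor N (e := cdiff E k) (f := f) (@kos_proj _ _ _ q).
  by move=> x; exact: (@inj_exact _ _ E k (f x) (df x)).
have [|x|j] := IH q.+1 s (lcomp chi (chd (C s) q)) _ _ hN.
- by move=> x; rewrite -[LHS]/(chi (chd (C s) q (chd (C s) q.+1 x))) chdK linear0.
- by rewrite /= hchi cf.
case: k f IH df hN chi hchi cf => [|k] f IH df hN chi hchi cf.
  move=> [g [[g' hg'] hg]]; exists j.
  exists (lsub (lcomp chi (tau s j q)) (lcomp (inj_aug E) g')); split=> x.
    rewrite -[LHS]/(chi (tau s j q (chd (C (j + s)%N) q x)) - inj_aug E (g' (chd (C (j + s)%N) q x))).
    rewrite -hg' -hg -tau_chd; exact: subrr.
  rewrite -[LHS]/(cdiff E 0 (chi (tau s j q x) - inj_aug E (g' x))) linearB hchi; have -> : cdiff E 0 (inj_aug E (g' x)) = 0 by apply: (proj2 (@inj_aug_exact _ _ E _)); exists (g' x).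
  by rewrite subr0.
move=> [h [ch dh]]; exists j.
(* [h] vanishes on Koszul cycles by exactness, so it extends along the differential into the
   injective term. *)
have [|h2 hh2] := inj_factor (d := chd (C (j + s)%N) q) (h := h) (@inj_term _ _ E k).
  by move=> a /kos_exactX [w ->]; rewrite ch.
exists (lsub (lcomp chi (tau s j q)) (lcomp (cdiff E k) h2)); split=> x.
  rewrite -[LHS]/(chi (tau s j q (chd (C (j + s)%N) q x)) - cdiff E k (h2 (chd (C (j + s)%N) q x))).
  rewrite hh2 dh -tau_chd; exact: subrr.
rewrite -[LHS]/(cdiff E k.+1 (chi (tau s j q x) - cdiff E k (h2 x))).
by rewrite linearB hchi cdiffK subr0.
Qed.

Lemma exp_mdeg t (a : R) : ideal_exp (@irrelevant_ideal K n) t a -> forall al, a@_al != 0 -> (t <= mdeg al)%N.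
Proof.
elim: t a => [//|t IH] a ha.
apply: (@ideal_gen_sub _ _ (fun a => forall al, a@_al != 0 -> (t < mdeg al)%N) _ _ _ a ha) => {a ha}.
- by move=> al; rewrite mcoeff0 eqxx.
- move=> b x y hx hy al; have hc : @subclosed R R^o (fun a => forall al, a@_al != 0 -> (t < mdeg al)%N).
    split=> [be|c f g hf hg be]; first by rewrite mcoeff0 eqxx.
    rewrite mcoeffD; have [e|/negPf ne] := boolP ((c *: f)@_be == 0).
      by rewrite (eqP e) add0r => /hg.
    move=> _; have := negbT ne; rewrite -[c *: f]/(c * f) -mcoeff_msupp => /msuppM_le /allpairsP[[k1 k2] /= [_ h2 ->]].
    by rewrite mdegD (leq_trans (hf k2 _)) ?leq_addl // -mcoeff_msupp.
  exact: hc.2.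
move=> _ [x [y [hx hy ->]]] al; rewrite -mcoeff_msupp => /msuppM_le /allpairsP[[k1 k2] /= [h1 h2 ->]].
rewrite mdegD -add1n leq_add //; last by apply: (IH y) => //; rewrite -mcoeff_msupp.
move: h1; rewrite mcoeff_msupp lt0n mdeg_eq0; apply: contraNneq => ->; apply/eqP.
apply: (@ideal_gen_sub _ _ (fun x => x@_0 = 0) _ _ _ x hx).
- exact: (@irr0_hid K n).1.1.
- exact: (@irr0_hid K n).1.2.
- by move=> _ [i ->]; exact: irr0X.
Qed.

Lemma irrX_exp t (i : 'I_m) : ideal_exp (@irrelevant_ideal K n) t ('X_i ^+ t).
Proof.
elim: t => [//|t IH]; apply: ideal_gen_in; exists 'X_i, ('X_i ^+ t); split=> //; last exact: exprS.
by apply: ideal_gen_in; exists i.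
Qed.

(** A torsion cocycle [z] is the value at 1 of a Koszul cocycle of degree 0. [descent] writes it as
    the image of some [h], and the value of [h] at 1 is torsion because [h] is a Koszul cocycle as
    well. *)
Lemma torsion_lift k (z : E k) t : cdiff E k z = 0 -> (forall i, 'X_i ^+ t *: z = 0) -> cv k N ->
  match k return E k -> Prop with
  | 0 => fun z => z = 0
  | k'.+1 => fun z => exists j y, cdiff E k' y = z /\ forall i : 'I_m, 'X_i ^+ j *: y = 0
  end z.
Proof.
move=> dz zt hN.
have [f hf] : exists f : {linear C t 0 -> E k}, forall x, f x = (vc (val x) : R) *: z.
  apply: ex_linear => a x y; rewrite -[val (_ + _)]/(a *: val x + val y) (linearP (@vc R R^o m)).
  by rewrite scalerDl scalerA.
have cf : coc f.
  move=> x; rewrite hf -[val _]/(ct (xv t) (val x)) ct_unit (linear_sum (@vc R R^o m)) scaler_suml.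
  rewrite big1 // => j _; rewrite (linearZ_LR (@vc R R^o m)) /= xvE -[_ *: vc _]/(_ * _) mulrC -scalerA.
  by rewrite zt scaler0.
have df x : cdiff E k (f x) = 0 by rewrite hf linearZ_LR dz scaler0.
have [j] := descent (q := 0%N) cf df hN.
pose one s : C s 0 := mkK (hdeg_vac m (1 : R^o)).
have fone : f (tau t j 0 (one (j + t)%N)) = z.
  by rewrite hf -[val _]/(dm (xv j) (vac m (1 : R^o))) dm_vac vc_vac scale1r.
clear df; case: k z f hf cf hN dz zt fone => [|k] z f hf cf hN dz zt fone.
  by move=> [g [g0 hg]]; rewrite -fone hg g0 linear0.
move=> [h [ch dh]]; exists (j + t)%N, (h (one _)); split; first by rewrite dh fone.
move=> i; rewrite -linearZ_LR; have := ch (kwd m (unitv R i) 0 (one (j + t)%N)).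
by rewrite -[chd _ _ _]/(kdiff m (xv (j + t)) 0 _) kdiff_kwd0 // xvE.
Qed.

Theorem local_cohomology_cv k : cv k N ->
  forall x : local_cohomology (@irrelevant_ideal K n) E k, x = 0.
Proof.
move=> hN; elim/quotm_ind => z; rewrite -[RHS](_ : \pi_(quotm _) 0 = 0); last by rewrite /quotm piE.
apply/quotm_eqP; rewrite subr0; apply/asboolP.
have /asboolP [t ht] := valP (val z).
have dz : cdiff E k (val (val z)) = 0.
  by have /eqP := valP z => /(congr1 val).
have zt i : 'X_i ^+ t *: val (val z) = 0 by apply: ht; exact: irrX_exp.
have := torsion_lift dz zt hN; case: k hN z t ht dz zt => [|k] hN z t ht dz zt /=.
  by move=> z0; apply: val_inj.
move=> [j [y [dy hy]]].
have ty : y \in submod_mem (torsion (@irrelevant_ideal K n) (E k)).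
  (* Pigeonhole: a monomial of degree above [m * j] has an exponent at least [j]. *)
  apply/asboolP; exists (m * j).+1 => a /exp_mdeg ha.
  have hc : @subclosed R R^o (fun a => (a : R) *: y = 0).
    split=> [|b c d h1 h2]; first exact: scale0r.
    by rewrite scalerDl h2 addr0 -scalerA h1 scaler0.
  apply: (mpoly_mon_split hc) => al /ha mal.
  have [i ji] : exists i, (j <= al i)%N.
    apply: contrapT => nn; move: mal; rewrite ltnNge => /negP; apply.
    have als i : (al i <= j)%N by apply: ltnW; rewrite ltnNge; apply/negP => si; apply: nn; exists i.
    by rewrite mdegE (leq_trans (leq_sum _ (fun i _ => als i))) // sum_nat_const card_ord.
  have -> : 'X_[al] = 'X_[al - U_(i) *+ j] * 'X_i ^+ j :> R.
    rewrite mpolyXn -mpolyXD submK //; apply/mnm_lepP => i'; rewrite mulmnE mnm1E.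
    by case: eqP => [<-|_]; rewrite ?mul1n.
  by rewrite -scalerA hy scaler0.
by exists (Submod ty); apply: val_inj.
Qed.
End Descent.
End LocalCohomologyVanishing.

(** * Rees' isomorphism and the canonical module *)

Section SyzygySequences.
Variable R : comNzRingType.
Implicit Types Z F X : lmodType R.

(** Basis elements of [{freeg Z / R}] go to basis elements of [{freeg F / R}], so the quotient [Q]
    is a retract of a free module. It covers [X], and [Y] is the kernel of that cover. *)
Lemma syz_ses Z F X (i : {linear Z -> F}) (p : {linear F -> X}) : ses i p ->
  exists (Y : lmodType R) (r : {linear syzygy F -> Y}), ses (syz_map i) r /\
    forall N k, extn N k.+1 X -> extn N k Y.
Proof.
move=> [ii sp ip].
have hx x : exists z, (exists y, x = i y) -> x = i z.
  by have [[y ->]|n] := pselect (exists y, x = i y); [exists y|exists 0].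
have [iv hiv] := ex_choice hx.
pose inim x := `[< exists y, x = i y >].
pose h : {linear {freeg F / R} -> {freeg Z / R}} := fglift (fun x => if inim x then << iv x >> else 0).
pose e : {linear {freeg F / R} -> {freeg F / R}} := fglift (fun x => if inim x then 0 else << x >>).
have hU x : h << x >> = if inim x then << iv x >> else 0 := fgliftU _ x.
have eU x : e << x >> = if inim x then 0 else << x >> := fgliftU _ x.
have split_e D : D = e D + fgmap R i (h D).
  apply: (freeg_linear_ext (g := lid _) (h := ladd e (lcomp (fgmap R i) h))) => x /=.
  rewrite hU eU; case: ifP => [/asboolP xi|_]; last by rewrite linear0 addr0.
  by rewrite add0r fgmapU -(hiv x xi).
have inz z : inim (i z) by apply/asboolP; exists z.
have e_i u : e (fgmap R i u) = 0.
  apply: (freeg_linear_ext (g := lcomp e (fgmap R i)) (h := lzero _ _)) => z /=.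
  by rewrite fgmapU eU inz.
have h_i u : h (fgmap R i u) = u.
  apply: (freeg_linear_ext (g := lcomp h (fgmap R i)) (h := lid _)) => z /=.
  by rewrite fgmapU hU inz; congr << _ >>; apply: ii; rewrite -hiv //; exists z.
have [Q [pi [spi kpi]]] := quot_ex (im_closed (fgmap R i)).
have [|s hs] := factor_surj (f := e) spi; first by move=> _ /kpi [u ->].
have pQ : projective Q.
  apply: (retract_projective (s := s) (r := pi)); last exact: freeg_projective.
  move=> y; have [D <-] := spi y; rewrite hs {2}[D]split_e linearD.
  by have -> : pi (fgmap R i (h D)) = 0 by [apply/kpi; exists (h D)]; rewrite addr0.
have [|q hq] := factor_surj (f := lcomp p (free_cover F)) spi.
  move=> _ /kpi [u ->] /=; rewrite cover_map; apply/ip; by exists (free_cover Z u).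
have sq : onto q.
  by move=> x; have [y <-] := sp x; exists (pi << y >>); rewrite hq /= free_coverU.
have [|r hr] := factor_inj (i := lval _ : {linear kerm q -> Q})
    (f := lcomp pi (lval _) : {linear syzygy F -> Q}) val_inj.
  move=> x; have hx0 : q (pi (val x)) = 0 by rewrite hq /= syzygy_cover0 linear0.
  by exists (mkpsub (ker_closed q) hx0).
have hr' x : val (r x) = pi (val x) := hr x.
exists (kerm q), r; split; last first.
  by move=> N k /(extn_cover N k (kerm_ses sq) pQ).
split.
- move=> x y exy; apply: val_inj; rewrite -[val x]h_i -[val y]h_i; congr (h _).
  exact: (congr1 val exy).
- move=> y; have [D hD] := spi (val y).
  have /ip [z hz] : p (free_cover F D) = 0 by have := psubP y; rewrite -hD hq.
  have hk : D - fgmap R i << z >> \in submod_mem (Submodule (@syzygy_closed R F)).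
    by apply/eqP; rewrite linearB cover_map free_coverU hz subrr.
  exists (Submod hk : syzygy F); apply: val_inj; rewrite hr' -hD /= linearB.
  by have -> : pi (fgmap R i << z >>) = 0 by [apply/kpi; exists << z >>]; rewrite subr0.
move=> x; split=> [rx|[u ->]]; last first.
  by apply: val_inj; rewrite hr'; apply/kpi; exists (val u).
have /kpi [u hu] : pi (val x) = 0 by rewrite -hr' rx.
have hk : u \in submod_mem (Submodule (@syzygy_closed R Z)).
  apply/eqP; apply: ii; rewrite linear0 -cover_map -hu; exact: syzygy_cover0.
by exists (Submod hk : syzygy Z); apply: val_inj.
Qed.

Fixpoint syz_iter Z F (i : {linear Z -> F}) q : {linear iter_syzygy Z q -> iter_syzygy F q} :=
  match q with 0 => i | q'.+1 => syz_map (syz_iter i q') end.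

Lemma syz_iter_ses Z F X (i : {linear Z -> F}) (p : {linear F -> X}) q : ses i p ->
  exists (Y : lmodType R) (r : {linear iter_syzygy F q -> Y}), ses (syz_iter i q) r /\
    forall N k, extn N (q + k) X -> extn N k Y.
Proof.
move=> sip; elim: q => [|q [Y [r [sr er]]]]; first by exists X, p.
have [Y' [r' [sr' er']]] := syz_ses sr; exists Y', r'; split=> // N k.
by rewrite addSnnS => /er /er'.
Qed.

Definition std_map Z F (i : {linear Z -> F}) q : {linear std Z q -> std F q} := fgmap R (syz_iter i q).

Lemma std_map_chd Z F (i : {linear Z -> F}) q x :
  chd (std F) q (std_map i q.+1 x) = std_map i q (chd (std Z) q x).
Proof. by rewrite !std_chdE /std_map cover_map. Qed.

Lemma coc_factor (C N : lmodType R) q (f : {linear std C q -> N}) : coc f ->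
  exists g : {linear iter_syzygy C q -> N}, forall x, f x = g (free_cover (iter_syzygy C q) x).
Proof.
move=> cf; have [|g hg] := factor_surj (f := f) (@free_cover_surj R (iter_syzygy C q)).
  move=> v v0; have hk : v \in submod_mem (Submodule (@syzygy_closed R (iter_syzygy C q))) by apply/eqP.
  have := cf << (Submod hk : syzygy (iter_syzygy C q)) >>.
  by rewrite std_chdE free_coverU.
by exists g => x; rewrite -hg.
Qed.

(* Rees: for modules killed by a regular sequence [s] of length [c] the functors
   [Ext^c(-, R)] and [Hom(-, R / s)] agree; hence surjectivity of restriction transfers. *)
Lemma rees_extend (s : seq R) (Q : lmodType R) (q : {linear R^o -> Q}) Z F X (i : {linear Z -> F}) (p : {linear F -> X}) :
  reg_on (fun x : R^o => x = 0) s -> onto q ->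
  (forall x, q x = 0 <-> foldl (@extU R R^o) (fun x => x = 0) s x) ->
  ses i p -> (forall a, a \in s -> forall x : F, a *: x = 0) -> extn R^o (size s) X ->
  forall f : {linear Z -> Q}, exists g : {linear F -> Q}, forall z, g (i z) = f z.
Proof.
move=> rs sq kq sip aF eX f; have [ii _ _] := sip.
have aZ a : a \in s -> forall x : Z, a *: x = 0.
  by move=> /aF h x; apply: ii; rewrite linearZ_LR h linear0.
have h0 : @subclosed R R^o (fun x => x = 0) by split=> // a x y -> ->; rewrite scaler0 addr0.
have [||rho [[r1 r2 r3 r4 r5] r6]] := @tower R s R^o R^o Q (lid R^o) q
    (fun x => x = 0) h0 _ _ sq kq rs; [by move=> x; exists x|by []|].
pose f0 : {linear std Z 0 -> Q} := lcomp f (free_cover Z).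
have c0 : coc f0.
  by move=> x; have e : free_cover Z (chd (std Z) 0 x) = 0 := std_cover_chd x; rewrite /f0 /= e linear0.
have [f' [cf' rf]] := r2 _ _ f0 (@std_proj _ Z) c0.
have [fb hfb] := coc_factor cf'.
(* A cocycle on [Z] of degree [size s] is a map on the corresponding syzygy; the obstruction to
   extending it to the syzygy of [F] lies in [Ext^1] of [Y], that is in [Ext^(size s + 1)(X, R)]. *)
have [Y [r [sr er]]] := syz_iter_ses (size s + 0) sip.
have [|gb hgb] := er R^o 0%N _ _ _ _ _ sr fb; first by rewrite !addn0.
pose g' : {linear std F (size s + 0)%N -> R^o} := lcomp gb (free_cover _).
have cg' : coc g' by move=> x; rewrite /g' -[LHS]/(gb (free_cover _ (chd (std F) _ x))) std_cover_chd linear0.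
have [|g [cg rg]] := r5 (std F) 0%N _ g' cg'.
  by move=> a /aF h k V f1 cf1; apply: std_ann.
have rgi := r6 _ _ _ (std_map i) (std_map_chd i) _ _ rg.
have d0 : triv (lsub f0 (lcomp g (std_map i 0))).
  apply: (r4 (std Z) 0%N (@std_proj _ Z) _ _ (lsub f' (lcomp g' (std_map i (size s + 0)%N)))).
  - move=> j js; rewrite addn0.
    apply: (@hv_grade _ (std Z) s R^o R^o (lid R^o) (fun x => x = 0)) => //.
    + exact: std_proj.
    + by move=> x; exists x.
    + by move=> a /aZ h; apply: (@std_null _ _ _ 1) => x; rewrite expr1.
  - by apply: (r1 _ _ (-1) _ _ _ _ _ _ rgi rf) => x; rewrite /= scaleN1r addrC.
  - move=> x; rewrite -[LHS]/(f0 (chd (std Z) 0 x) - g (std_map i 0 (chd (std Z) 0 x))).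
    by rewrite c0 -std_map_chd cg subrr.
  have z0 : forall x, f' x - g' (std_map i (size s + 0)%N x) = 0.
    by move=> x; rewrite hfb /g' /= /std_map cover_map hgb subrr.
  apply: (triv_ext (f := lzero _ _)) => [x|]; first exact/esym/z0.
  exact: triv_zero.
have [g1 hg1] := coc_factor cg; exists g1 => z.
have := d0 << z >>; rewrite -[lsub _ _ _]/(f0 << z >> - g (fgmap R i << z >>)) fgmapU hg1.
rewrite -[f0 _]/(f (free_cover Z << z >>)) !free_coverU => /eqP.
by rewrite subr_eq0 => /eqP ->.
Qed.
End SyzygySequences.

(** * Cocycles and classes in [Ext] *)

Section ExtModules.
Variable R : comNzRingType.
Implicit Types C N : lmodType R.

Definition hom_lin C N (f : Defs.hom C N) : {linear C -> N} := mklinear (hom_linear f).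

Definition lin_hom C N (f : {linear C -> N}) : Defs.hom C N :=
  mkhom (fun a x y => linearP f a x y).

Lemma ext_coc C N k (f : Defs.hom (free_res C k) N) :
  hom_res_diff C N k f = 0 <-> coc (hom_lin f : {linear std C k -> N}).
Proof.
split=> [f0 x|cf]; first exact: (congr1 (fun g => val g x) f0).
by apply: val_inj; apply/funext => x; exact: cf x.
Qed.

Lemma ext_triv C N k (f : Defs.hom (free_res C k) N) :
  @is_coboundary R (hom_res C N) k f <-> triv (hom_lin f : {linear std C k -> N}).
Proof.
case: k f => [|k] f /=; split.
- by move=> f0 x; exact: (congr1 (fun g => val g x) f0).
- by move=> f0; apply: val_inj; apply/funext => x; exact: f0 x.
- by move=> [g fg]; exists (hom_lin g) => x; exact: (congr1 (fun g => val g x) fg).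
- by move=> [g fg]; exists (lin_hom g); apply: val_inj; apply/funext => x; exact: fg x.
Qed.

(** Links the cocycles used so far with the quotient that defines [Ext]; a relation, since a class
    has no preferred cocycle. *)
Definition ext_class C N k (f : {linear std C k -> N}) (e : Ext k C N) :=
  exists z : submod (cocycle (hom_res C N) k),
    e = \pi_(quotm (coboundary (hom_res C N) k)) z /\ forall x, val (val z) x = f x.

Lemma ext_class_ex C N k (e : Ext k C N) : exists f, coc f /\ ext_class f e.
Proof.
elim/quotm_ind: e => z; exists (hom_lin (val z)); split; last by exists z.
by apply/ext_coc/eqP; exact: (valP z).
Qed.

Lemma ext_class_of C N k (f : {linear std C k -> N}) : coc f -> exists e, ext_class f e.
Proof.
move=> cf; have hz : lin_hom f \in submod_mem (cocycle (hom_res C N) k).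
  by apply/eqP/ext_coc => x; exact: cf.
by exists (\pi_(quotm (coboundary (hom_res C N) k)) (Submod hz)), (Submod hz).
Qed.

Lemma ext_class_lin C N k (a : R) (f g h : {linear std C k -> N}) e e' :
  (forall x, h x = a *: f x + g x) -> ext_class f e -> ext_class g e' -> ext_class h (a *: e + e').
Proof.
move=> hh [z [-> hz]] [w [-> hw]]; exists (a *: z + w); split.
  by rewrite quotm_piD -quotm_piZ.
move=> x.
have e1 := linearP (lval (cocycle (hom_res C N) k)) a z w.
have e2 := linearP (lval (hom_sub (free_res C k) N)) a (val z) (val w).
by rewrite hh; apply: (etrans (congr1 (fun v => val v x) e1)); rewrite [X in X x]e2 -hz -hw.
Qed.

Lemma ext_class0 C N k (f : {linear std C k -> N}) e : ext_class f e -> e = 0 <-> triv f.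
Proof.
move=> [z [-> hz]].
have e0 : \pi_(quotm (coboundary (hom_res C N) k)) z = 0 <-> @is_coboundary R (hom_res C N) k (val z).
  have {1}-> : 0 = \pi_(quotm (coboundary (hom_res C N) k)) 0 by rewrite /quotm piE.
  by split=> [/quotm_eqP|h]; [rewrite subr0 => /asboolP|apply/quotm_eqP; rewrite subr0; apply/asboolP].
split=> [/e0 /ext_triv h|h]; first by apply: triv_ext h => x; exact: hz.
by apply/e0/ext_triv; apply: triv_ext h => x; exact/esym/hz.
Qed.

Lemma Ext_extn C N q : extn N q C -> forall x : Ext q.+1 C N, x = 0.
Proof.
move=> /hv_std h x; have [f [cf fx]] := ext_class_ex x.
by apply/(ext_class0 fx); exact: h.
Qed.
End ExtModules.

Section ReesIsomorphism.
Variables (R : comNzRingType) (I : idealr R) (s : seq R) (Q : lmodType R) (q : {linear R^o -> Q}).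
Hypotheses (rs : @reg_on R R^o (fun x => x = 0) s) (oq : onto q).
Hypothesis kq : forall x, q x = 0 <-> foldl (@extU R R^o) (fun x => x = 0) s x.
Hypothesis sI : forall a, a \in s -> a \in (I : {pred R}).
Local Notation C := (cyclic_mod I).

Lemma cyc_proj : exists p : {linear R^o -> C}, onto p /\ forall a, p a = 0 <-> a \in (I : {pred R}).
Proof.
have [p hp] : exists p : {linear R^o -> C}, forall a, p a = \pi_(quotm (ideal_mem I)) a.
  by apply: ex_linear => a x y; rewrite quotm_piD -quotm_piZ.
exists p; split=> [|a].
  by elim/quotm_ind => a; exists a; rewrite hp.
rewrite hp; have {1}-> : 0 = \pi_(quotm (ideal_mem I)) 0 by rewrite /quotm piE.
by split=> [/quotm_eqP|h]; [rewrite subr0|apply/quotm_eqP; rewrite subr0].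
Qed.

(** [kap] takes a class down the tower to a map from [R/I] to [R/(s)] and evaluates it at 1. The
    tower is bijective on classes because [s] kills [R/I] and the lower cohomology vanishes. *)
Lemma rees_iso c : c = size s ->
  exists kap : {linear Ext c C R^o -> Q}, injective kap /\
    forall w, (forall a, a \in (I : {pred R}) -> a *: w = 0) -> exists e, w = kap e.
Proof.
move=> ->; rewrite -[size s]addn0.
have h0 : @subclosed R R^o (fun x => x = 0) by split=> // a x y -> ->; rewrite scaler0 addr0.
have [||rho [[r1 r2 r3 r4 r5] _]] := @tower R s R^o R^o Q (lid R^o) q
    (fun x => x = 0) h0 _ _ oq kq rs; [by move=> x; exists x|by []|].
have [p [op kp]] := cyc_proj.
pose one : std C 0 := << p 1 >>.
have aC a : a \in s -> forall x : C, a *: x = 0 by move=> /sI h x; exact: cyclic_mod_ann.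
have gr f f' : rho (std C) 0 f f' -> coc f -> triv f' -> triv f.
  apply: r4 => [|j js]; first exact: std_proj.
  rewrite addn0; apply: (@hv_grade _ (std C) s R^o R^o (lid R^o) (fun x => x = 0)) => //.
  - exact: std_proj.
  - by move=> x; exists x.
  - by move=> a /aC h; apply: (@std_null _ _ _ 1) => x; rewrite expr1.
pose Th (e : Ext (size s + 0) C R^o) y := exists f f',
  [/\ coc f, rho (std C) 0 f f', ext_class f' e & y = f one].
have Th_ex e : exists y, Th e y.
  have [f' [cf' fe]] := ext_class_ex e.
  have [|f [cf rf]] := r5 (std C) 0%N _ f' cf'; first by move=> a /aC h k V g cg; apply: std_ann.
  by exists (f one), f, f'.
have Th_lin a e e' y y' : Th e y -> Th e' y' -> Th (a *: e + e') (a *: y + y').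
  move=> [f [f' [cf rf ef ->]]] [g [g' [cg rg eg ->]]].
  exists (ladd (lscale f a) g), (ladd (lscale f' a) g'); split=> //.
  - by move=> x /=; rewrite cf cg scaler0 addr0.
  - exact: (r1 _ _ a _ _ _ _ _ _ rf rg).
  - exact: (ext_class_lin (a := a) _ ef eg).
have Th0 e y : Th e y -> e = 0 <-> y = 0.
  move=> [f [f' [cf rf ef ->]]]; rewrite (ext_class0 ef); split.
    by move=> /(gr _ _ rf cf) h; exact: h.
  move=> f1; apply: (r3 _ _ _ _ _ rf); first exact: std_proj.
  have [g hg] := coc_factor cf; move=> x; rewrite hg.
  have g1 : g (p 1) = 0 by rewrite -f1 hg free_coverU.
  have [a <-] := op (free_cover (iter_syzygy C 0) x).
  by rewrite -[a]mulr1 -[a * 1]/(a *: (1 : R^o)) (linearZ_LR p) (linearZ_LR g) g1 scaler0.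
have [k hk] := ex_choice Th_ex.
have k_uniq e y : Th e y -> k e = y.
  move=> hy; have := Th_lin (-1) _ _ _ _ hy (hk e); rewrite scaleN1r addNr => /Th0 [/(_ erefl) + _].
  by rewrite scaleN1r addrC => /eqP; rewrite subr_eq0 => /eqP.
have [kap hkap] : exists kap : {linear Ext (size s + 0) C R^o -> Q}, forall e, kap e = k e.
  by apply: ex_linear => a e e'; apply: k_uniq; apply: Th_lin.
exists kap; split.
  apply: lker_inj => e; rewrite hkap => ke; by apply/(Th0 e (k e)).
move=> w aw.
have [g0 hg0] : exists g0 : {linear R^o -> Q}, forall a, g0 a = a *: w.
  by apply: ex_linear => a x y; rewrite scalerDl -scalerA.
have [|g hg] := factor_surj (f := g0) op; first by move=> a /kp /aw; rewrite hg0.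
pose f : {linear std C 0 -> Q} := lcomp g (free_cover C).
have cf : coc f by move=> x; have e : free_cover C (chd (std C) 0 x) = 0 := std_cover_chd x; rewrite /f /= e linear0.
have [|f' [cf' rf]] := r2 (std C) 0%N f _ cf; first exact: std_proj.
have [e he] := ext_class_of cf'.
exists e; rewrite hkap; apply/esym/k_uniq; exists f, f'; split=> //.
by rewrite -[f one]/(g (free_cover C << p 1 >>)) free_coverU hg hg0 scale1r.
Qed.
End ReesIsomorphism.

(** * Modules over the quotient ring as modules over [R] *)

Section RestrictionOfScalars.
Variables (R : comNzRingType) (I : idealr R).
Local Notation A := {ideal_quot I}.

Definition restr (X : lmodType A) : Type := X.
HB.instance Definition _ (X : lmodType A) := GRing.Zmodule.on (restr X).

Section Action.
Variable X : lmodType A.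
Definition restr_scale (a : R) (x : restr X) : restr X := (\pi_A a : A) *: (x : X).
Fact restr_scaleA a b x : restr_scale a (restr_scale b x) = restr_scale (a * b) x.
Proof. by rewrite /restr_scale scalerA -rmorphM. Qed.
Fact restr_scale1 : left_id 1 restr_scale.
Proof. by move=> x; rewrite /restr_scale rmorph1 scale1r. Qed.
Fact restr_scaleDr : right_distributive restr_scale +%R.
Proof. by move=> a x y; exact: scalerDr. Qed.
Fact restr_scaleDl (x : restr X) : {morph restr_scale^~ x : a b / a + b >-> a + b}.
Proof. by move=> a b; rewrite /restr_scale rmorphD scalerDl. Qed.
HB.instance Definition _ := GRing.Zmodule_isLmodule.Build R (restr X)
  restr_scaleA restr_scale1 restr_scaleDr restr_scaleDl.
End Action.

Implicit Types X Y : lmodType A.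

Lemma pi0 a : (\pi_A a = 0 :> A) <-> a \in (I : {pred R}).
Proof.
rewrite -(rmorph0 \pi_A); split=> [h|h].
  by rewrite -[a]subr0 (idealrBE I) h.
by apply/eqP; rewrite -(idealrBE I) subr0.
Qed.

Lemma restr_ann X a (x : restr X) : a \in (I : {pred R}) -> a *: x = 0.
Proof. by move=> /pi0 h; rewrite -[LHS]/((\pi_A a : A) *: (x : X)) h scale0r. Qed.

Lemma restrict X Y (f : {linear X -> Y}) :
  exists g : {linear restr X -> restr Y}, forall x, g x = f x.
Proof. by apply: ex_linear => a x y; exact: (linearP f). Qed.

Lemma restrict_ses X Y (Z : lmodType A) (i : {linear X -> Y}) (p : {linear Y -> Z})
    (i' : {linear restr X -> restr Y}) (p' : {linear restr Y -> restr Z}) :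
  (forall x, i' x = i x) -> (forall y, p' y = p y) -> ses i p -> ses i' p'.
Proof.
move=> hi hp [ii op ip]; split.
- by move=> x y; rewrite !hi => /ii.
- by move=> z; have [y <-] := op z; exists y.
- move=> y; rewrite hp; split=> [/ip [x ->]|[x ->]]; first by exists x; rewrite hi.
  by rewrite hi; apply/ip; exists x.
Qed.

Lemma descend_restrict (N : lmodType R) (aN : forall a (x : N), a \in (I : {pred R}) -> a *: x = 0) X :
  (forall f : {linear X -> descend aN}, exists g : {linear restr X -> N}, forall x, g x = f x) /\
  (forall f : {linear restr X -> N}, exists g : {linear X -> descend aN}, forall x, g x = f x).
Proof.
split=> f; apply: ex_linear => a x y.
  by rewrite -[LHS]/(f ((\pi_A a : A) *: (x : X) + y)) (linearP f); congr (_ + _); exact: descend_piE.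
by rewrite -[a]reprK; apply: etrans (linearP f (repr a) (x : restr X) y) _; congr (_ + _); exact/esym/descend_piE.
Qed.

Lemma noeth_quotient : noeth R^o -> noeth A^o.
Proof.
move=> nR S [S0 SD].
have [|l [lS Sl]] := nR (fun a => S (\pi_A a)).
  by split=> [|a x y hx hy]; rewrite ?rmorph0 // rmorphD rmorphM; apply: SD.
exists [seq \pi_A a | a <- l]; split=> [_ /mapP [a /lS h ->] //|x].
rewrite -[x]reprK => /Sl h T [T0 TD] hT; apply: (h (fun a => T (\pi_A a))).
  by split=> [|a u v hu hv]; rewrite ?rmorph0 // rmorphD rmorphM; apply: TD.
by move=> y yl; apply: hT; apply: map_f.
Qed.

Lemma pi_linear : exists p' : {linear R^o -> restr A^o}, forall a, p' a = (\pi_A a : A).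
Proof.
have lin : linear ((fun a => \pi_A a : A) : R^o -> restr A^o).
  move=> a x y; have e : \pi_A (a * x + y) = (\pi_A a : A) * \pi_A x + \pi_A y :> A.
    by rewrite rmorphD rmorphM.
  exact: e.
by exists (mklinear lin) => a.
Qed.

(** [{ideal_quot I}] and [cyclic_mod I] are two different quotient types; they are identified by
    factoring each projection through the other. *)
Lemma restrict_free b : exists (f : {linear restr {ffun 'I_b -> A^o} -> {ffun 'I_b -> cyclic_mod I}})
  (g : {linear {ffun 'I_b -> cyclic_mod I} -> restr {ffun 'I_b -> A^o}}), forall x, g (f x) = x.
Proof.
have [p [op kp]] := cyc_proj I.
have [p' hp'] := pi_linear.
have op' : onto p' by move=> x; exists (repr x); rewrite hp'; exact: reprK.
have kk a : p a = 0 <-> p' a = 0 by rewrite kp hp' -pi0.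
have [f hf] := factor_surj op' (fun a => (kk a).2).
have [g hg] := factor_surj op (fun a => (kk a).1).
have gf x : g (f x) = x by have [a <-] := op' x; rewrite hf hg.
have [f1 hf1] : exists f1 : {linear restr {ffun 'I_b -> A^o} -> {ffun 'I_b -> cyclic_mod I}},
    forall x, f1 x = [ffun i => f ((x : {ffun 'I_b -> A^o}) i : A^o)].
  apply: ex_linear => a x y; apply/ffunP => i; rewrite !ffunE -(linearP f); congr (f _).
have [g1 hg1] : exists g1 : {linear {ffun 'I_b -> cyclic_mod I} -> restr {ffun 'I_b -> A^o}},
    forall x, g1 x = ([ffun i => (g (x i) : A^o)] : {ffun 'I_b -> A^o}).
  apply: ex_linear => a x y; apply/ffunP => i; rewrite !ffunE (linearP g).
  by [].
by exists f1, g1 => x; rewrite hg1; apply/ffunP => i; rewrite ffunE hf1 ffunE gf.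
Qed.

Lemma extn_descend (N0 N : lmodType R) (aN : forall a (x : N), a \in (I : {pred R}) -> a *: x = 0) k :
  extn N0 k N -> extn N0 k (restr (descend aN)).
Proof.
have [f hf] : exists f : {linear restr (descend aN) -> N}, forall x, f x = x.
  by apply: ex_linear => a x y; congr (_ + _); exact: descend_piE.
have [g hg] : exists g : {linear N -> restr (descend aN)}, forall x, g x = x.
  by apply: ex_linear => a x y; congr (_ + _); exact/esym/descend_piE.
by apply: (extn_retract (s := f) (r := g)) => x; rewrite hg hf.
Qed.

Lemma fgm_descend (N : lmodType R) (aN : forall a (x : N), a \in (I : {pred R}) -> a *: x = 0) :
  fgm N -> fgm (descend aN).
Proof.
move=> [b [p op]].
pose e i : descend aN := p [ffun j => (j == i)%:R].
have [p' hp'] : exists p' : {linear {ffun 'I_b -> A^o} -> descend aN},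
    forall u, p' u = \sum_i (u i : A) *: e i.
  apply: ex_linear => a u v; rewrite scaler_sumr -big_split /=; apply: eq_bigr => i _.
  by rewrite !ffunE scalerDl scalerA.
exists b, p' => y; have [u <-] := op y; exists [ffun i => \pi_A (u i)].
rewrite hp' [in RHS](ffunE_sum u) (linear_sum p); apply: eq_bigr => i _.
by rewrite ffunE (linearZ_LR p); exact: descend_piE.
Qed.
End RestrictionOfScalars.

Section CanonicalModule.
Variables (R : comNzRingType) (I : idealr R) (s : seq R).
Hypotheses (nR : noeth R^o) (rs : @reg_on R R^o (fun x => x = 0) s).
Hypothesis sI : forall a, a \in s -> a \in (I : {pred R}).
Local Notation A := {ideal_quot I}.
Hypothesis extA : forall k, (size s <= k)%N -> extn R^o k (cyclic_mod I).

Lemma extn_restrict_free b k : (size s <= k)%N -> extn R^o k (restr {ffun 'I_b -> A^o}).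
Proof.
move=> sk; have [f [g gf]] := restrict_free I b.
apply: (extn_retract (s := f) (r := g) gf).
by apply: extn_ffun; exact: extA.
Qed.

(* Change of rings: [Ext^j_A(X, K_A) = Ext^(j+c)_R(X, R)] for [j > 0]; only the
   vanishing is needed. *)
Lemma extn_canonical k (X : lmodType A) : fgm X -> extn R^o (size s + k) (restr X) ->
  extn (canonical_quot I (size s)) k X.
Proof.
elim: k X => [|k IH] X [b [p op]] eX; have sip := kerm_ses op.
- have [i' hi'] := restrict (lval _ : {linear kerm p -> _}); have [p' hp'] := restrict p.
  have sip' := restrict_ses hi' hp' sip; rewrite addn0 in eX.
  apply: (ext1_cover sip) => [|f]; first by apply: ext1_proj; exact: ffun_projective.
  have [Q [q [oq kq]]] := quot_ex (foldl_extU_closed (U := fun x : R^o => x = 0) s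
    (conj erefl (fun a x y x0 y0 => etrans (congr2 (fun u v => a *: u + v) x0 y0) (etrans (addr0 _) (scaler0 _ _))))).
  have [kap [ikap skap]] := rees_iso rs oq kq sI (erefl (size s)).
  have [[dr _] _] := (descend_restrict (@Ext_cyclic_ann R I (size s)) (kerm p),
                      descend_restrict (@Ext_cyclic_ann R I (size s)) {ffun 'I_b -> A^o}).
  have [_ rd] := descend_restrict (@Ext_cyclic_ann R I (size s)) {ffun 'I_b -> A^o}.
  have [f' hf'] := dr f.
  (* Through [kap] the canonical module is the part of [R/(s)] killed by [I]. The extension over [R]
     has its values there, since its source is an [A]-module, and so comes back through [kap]. *)
  have [|g hg] := rees_extend rs oq kq sip' _ eX (lcomp kap f').
    by move=> a /sI h x; exact: restr_ann.
  have [|g1 hg1] := factor_inj (f := g) ikap.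
    by move=> x; apply: skap => a h; rewrite -(linearZ_LR g) (restr_ann x h) linear0.
  have [g2 hg2] := rd g1; exists g2 => u; rewrite hg2 -hf'; apply: ikap.
  by rewrite hg1 -[X in g X]hi' hg.
- have [i' hi'] := restrict (lval _ : {linear kerm p -> _}); have [p' hp'] := restrict p.
  have sip' := restrict_ses hi' hp' sip.
  apply/(extn_cover _ _ sip); first exact: ffun_projective.
  apply: IH; first by apply: noeth_fgm; apply: noeth_ffun; exact: noeth_quotient.
  apply: (extn_left sip'); first by apply: extn_restrict_free; exact: leq_addr.
  by rewrite -addnS.
Qed.
End CanonicalModule.

(** * Determinantal ideals *)

Section IncreasingOrdinals.
Lemma homo_ord_gap k m (f : 'I_k -> 'I_m) : {homo f : i j / (i < j)%N} ->
  forall i j : 'I_k, (i <= j)%N -> (f i + j <= f j + i)%N.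
Proof.
move=> hf i j /subnKC; move: (j - i)%N => p; elim: p j => [|p IH] j ij.
  by have -> : i = j by [apply: val_inj; rewrite /= -ij addn0].
have pk : (i + p < k)%N by have := ltn_ord j; lia.
have lj : (Ordinal pk < j)%N by rewrite /=; lia.
by have := hf _ _ lj; have := IH (Ordinal pk) erefl; rewrite /=; lia.
Qed.

Lemma homo_ord_bounds k m (f : 'I_k -> 'I_m) : {homo f : i j / (i < j)%N} ->
  forall i : 'I_k, (i <= f i)%N /\ (f i + k <= m + i)%N.
Proof.
move=> hf i; have k0 : (0 < k)%N by apply: leq_ltn_trans (ltn_ord i).
have k1 : (k.-1 < k)%N by rewrite prednK.
have := homo_ord_gap hf (i := Ordinal k0) (leq0n i).
have li : (i <= Ordinal k1)%N by rewrite /=; have := ltn_ord i; lia.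
by have := homo_ord_gap hf li; have := ltn_ord (f (Ordinal k1)); rewrite /=; split; lia.
Qed.

Lemma homo_ord_id k (f : 'I_k -> 'I_k) : {homo f : i j / (i < j)%N} -> f =1 id.
Proof. by move=> hf i; apply: val_inj; have [h1 h2] := homo_ord_bounds hf i; move: h1 h2 => /=; lia. Qed.

Lemma homo_ord_lift k (f : 'I_k -> 'I_k.+1) : {homo f : i j / (i < j)%N} ->
  exists i0 : 'I_k.+1, forall j, f j = lift i0 j.
Proof.
move=> hf; have hb i := homo_ord_bounds hf i.
have mono (i j : 'I_k) : (i <= j)%N -> f i = i.+1 :> nat -> f j = j.+1 :> nat.
  by move=> ij fi; have := homo_ord_gap hf ij; have [] := hb j; lia.
have [[i0 fi0 mi0]|nf] : (exists2 i0 : 'I_k, f i0 = i0.+1 :> nat & forall j : 'I_k, (j < i0)%N -> f j = j :> nat)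
    \/ forall j : 'I_k, f j = j :> nat.
  case: (pickP [pred i : 'I_k | val (f i) == i.+1]) => [i1 hi1|no]; last first.
    by right => j; have := no j; have [] := hb j; rewrite /= => ? ? /eqP; lia.
  left; case: (arg_minnP (fun i : 'I_k => val i) hi1) => i0 /eqP fi0 mi0.
  exists i0 => // j ji; have [h1 h2] := hb j.
  case e : (val (f j) == j.+1); first by have /= := mi0 j e; rewrite leqNgt ji.
  have e' : nat_of_ord (f j) <> j.+1 by move=> h; move: e; rewrite /= h eqxx.
  by clear e; lia.
- exists (inord i0) => j; apply: val_inj; rewrite /= /bump inordK; last by have := ltn_ord i0; lia.
  by case: leqP => h; [rewrite (mono i0 j h fi0)|rewrite mi0].
- by exists ord_max => j; apply: val_inj; rewrite -[LHS]/(nat_of_ord (f j)) nf /= /bump leqNgt ltn_ord.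
Qed.
End IncreasingOrdinals.

Section HomogeneousMinors.
Variables (K : fieldType) (n : nat).
Local Notation R := {mpoly K[n.+1]}.
Implicit Types x y : R.

Definition ihomog (D : int) x := x = 0 \/ exists2 d : nat, d%:Z = D & x \is d.-homog.

Lemma ihomogD D x y : ihomog D x -> ihomog D y -> ihomog D (x + y).
Proof.
move=> [->|[d dD xd]]; first by rewrite add0r.
move=> [->|[e eD ye]]; first by rewrite addr0; right; exists d.
right; exists d => //; apply: rpredD => //; suff -> : d = e by [].
by apply/eqP; rewrite -eqz_nat dD eD.
Qed.

Lemma ihomogM D E x y : ihomog D x -> ihomog E y -> ihomog (D + E) (x * y).
Proof.
move=> [->|[d <- xd]]; first by rewrite mul0r; left.
move=> [->|[e <- ye]]; first by rewrite mulr0; left.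
by right; exists (d + e)%N; [rewrite PoszD|exact: dhomogM].
Qed.

Lemma ihomog_det k (D E : 'I_k -> int) (M : 'M[R]_k) :
  (forall i j, ihomog (E j - D i) (M i j)) -> ihomog (\sum_j E j - \sum_i D i) (\det M).
Proof.
move=> hM; rewrite /determinant; apply: (big_ind (ihomog _)); first by left.
  exact: ihomogD.
move=> s _; rewrite -[X in ihomog X]add0r; apply: ihomogM.
  right; exists 0%N => //; rewrite -signr_odd.
  by case: (odd _); rewrite ?expr1 ?expr0 ?rpredN; apply: dhomog1.
rewrite (reindex_inj (@perm.perm_inj _ s)) /= -sumrB.
apply: (big_ind2 (fun (d : int) x => ihomog d x)) => [|d x e y|i _]; last exact: hM.
- by right; exists 0%N => //; exact: dhomog1.
- exact: ihomogM.
Qed.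

Lemma ihomog_hgen D x : ihomog D x -> hgen x.
Proof. by move=> [->|[d _ hd]]; [exists 0%N; exact: dhomog0|exists d]. Qed.

Lemma ideal_gen_hid (S : set R) : (forall x, S x -> hgen x) -> hid (ideal_gen S).
Proof.
move=> hS; have gD := @ideal_genD R S; have g0 := @ideal_gen0 R S.
split; first by split.
move=> _ d [l [hl ->]]; rewrite linear_sum /= big_seq; apply: (big_ind (ideal_gen S)) => //.
  by move=> x y hx hy; rewrite -[x]mul1r; apply: gD.
move=> i /hl hi; have [e he] := hS _ hi.
rewrite -[i.1 *: i.2]/(i.1 * i.2) mulrC (pihomog_mul d _ he); case: ifP => // _.
by rewrite mulrC -[_ * _]addr0; apply: gD => //; exact: ideal_gen_in.
Qed.

Lemma minor_ideal_hid p q (M : 'M[R]_(p, q)) k : homogeneous_mx M -> hid (minor_ideal M k).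
Proof.
move=> [a [b hM]]; apply: ideal_gen_hid => _ [f [g [_ _ ->]]].
apply: ihomog_hgen; apply: (ihomog_det (D := fun i => a (f i)) (E := fun j => b (g j))) => i j.
by rewrite mxE; have [->|/hM] := eqVneq (M (f i) (g j)) 0; [left|right].
Qed.
End HomogeneousMinors.

Section SequenceSubmodule.
Variable R : comNzRingType.

Lemma seq_submod_rcons (V : lmodType R) s a (y : V) :
  @seq_submod R V (rcons s a) y <-> exists x u, @seq_submod R V s u /\ y = a *: x + u.
Proof.
split.
  apply: (span_sub (T := fun y => exists x u, @seq_submod R V s u /\ y = a *: x + u)) => [|b v w|].
  - by exists 0, 0; split; [exact: span0|rewrite scaler0 addr0].
  - move=> [x [u [hu ->]]] [x' [u' [hu' ->]]]; exists (b *: x + x'), (b *: u + u').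
    split; first exact: spanD.
    by rewrite !scalerDr !scalerA [b * a]mulrC addrACA.
  move=> _ [b [x [+ ->]]]; rewrite mem_rcons inE => /orP [/eqP ->|bs].
    by exists x, 0; split; [exact: span0|rewrite addr0].
  exists 0, (b *: x); split; last by rewrite scaler0 add0r.
  by apply: span_gen; exists b, x.
move=> [x [u [hu ->]]]; rewrite -[a *: x]scale1r; apply: spanD.
  by apply: span_gen; exists a, x; rewrite mem_rcons inE eqxx.
move: u hu; apply: span_sub; first exact: span0.
  by move=> *; exact: spanD.
move=> _ [b [z [bs ->]]]; apply: span_gen; exists b, z; split=> //.
by rewrite mem_rcons inE bs orbT.
Qed.
End SequenceSubmodule.

Section WeakRegularity.
Variables (R : comNzRingType) (V : lmodType R) (p : {linear R^o -> V}) (U : R^o -> Prop).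
Hypotheses (op : onto p) (kp : forall a, p a = 0 <-> U a).

(** Connects the predicates on [R] with [seq_submod] on the quotient, in terms of which depth is
    defined. *)
Lemma foldl_extU_seq s a : foldl (@extU R R^o) U s a <-> @seq_submod R V s (p a).
Proof.
elim/last_ind: s a => [|s b IH] a.
  rewrite -[foldl _ _ _ _]/(U a) -kp; split=> [->|]; first exact: span0.
  apply: (span_sub (T := fun y => y = 0)) => // [b x y -> ->|_ [b [z []]] //].
  by rewrite scaler0 addr0.
rewrite foldl_rcons seq_submod_rcons; split.
  move=> [x [u [hu ->]]]; exists (p x), (p u); split; first exact/IH.
  by rewrite linearD (linearZ_LR p).
move=> [y [v [hv e]]]; have [x hx] := op y.
exists x, (a - b *: x); split; last by rewrite addrC subrK.
by apply/IH; rewrite linearB (linearZ_LR p) hx e addrC addKr.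
Qed.

Lemma regular_reg_on s :
  (forall k m, (k < size s)%N ->
     @seq_submod R V (take k s) (s`_k *: m) -> seq_submod (take k s) m) -> reg_on U s.
Proof.
elim/last_ind: s => [//|s b IH] hs; apply/reg_on_rcons; split.
  apply: IH => k m ks; have := hs k m.
  by rewrite -cats1 size_cat nth_cat take_cat ks addn1 ltnS (ltnW ks); apply.
move=> x /foldl_extU_seq; rewrite (linearZ_LR p) => h; apply/foldl_extU_seq.
have := hs (size s) (p x); rewrite -cats1 size_cat nth_cat take_cat ltnn subnn take0 cats0 addn1.
by rewrite ltnSn; apply.
Qed.
End WeakRegularity.

Section ConormalQuotient.
Variables (R : comNzRingType) (I : idealr R).

Lemma ideal_closed : @subclosed R R^o (fun a => a \in (I : {pred R})).
Proof.
split=> [|a x y hx hy]; first exact: rpred0.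
by apply: rpredD => //; exact: idealMr.
Qed.

Lemma conormal_proj : exists p : {linear submod (ideal_mem I) -> conormal I},
  onto p /\ forall x, p x = 0 <-> ideal_exp (ideal_set I) 2 (val x).
Proof.
have [p hp] : exists p : {linear submod (ideal_mem I) -> conormal I},
    forall x, p x = \pi_(quotm (square_mem I)) x.
  by apply: ex_linear => a x y; rewrite quotm_piD -quotm_piZ.
exists p; split=> [|x].
  by elim/quotm_ind => a; exists a; rewrite hp.
rewrite hp; have {1}-> : 0 = \pi_(quotm (square_mem I)) 0 by rewrite /quotm piE.
split=> [/quotm_eqP|h]; first by rewrite subr0 => /asboolP.
by apply/quotm_eqP; rewrite subr0; apply/asboolP.
Qed.

Lemma conormal_cover (V : lmodType R) (f : {linear V -> R^o}) :
  (forall a, a \in (I : {pred R}) <-> exists v, a = f v) ->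
  exists p : {linear V -> conormal I}, onto p /\ forall v, p v = 0 <-> ideal_exp (ideal_set I) 2 (f v).
Proof.
move=> If; have [p [op kp]] := conormal_proj.
have [|g hg] := factor_inj (i := lval (ideal_mem I)) (f := f) val_inj.
  move=> v; have fI : (f v : R) \in (I : {pred R}) by apply/If; exists v.
  by exists (Submod (fI : (f v : R^o) \in submod_mem (ideal_mem I))).
exists (lcomp p g); split=> [y|v]; last by rewrite -[lcomp _ _ v]/(p (g v)) kp hg.
have [x <-] := op y; have /If [v hv] : val x \in (I : {pred R}) := valP x.
by exists v; congr (p _); apply: val_inj; rewrite [LHS]hg.
Qed.

Lemma ideal_sq_sub (S : R^o -> Prop) : subclosed S ->
  (forall a b, a \in (I : {pred R}) -> b \in (I : {pred R}) -> S (a * b)) ->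
  forall x, ideal_exp (ideal_set I) 2 x -> S x.
Proof.
move=> hS h; have [S0 SD] := hS; apply: ideal_gen_sub => // _ [a [b [Ia hb ->]]].
move: b hb; apply: (ideal_gen_sub (T := fun b => S (a * b))) => [|c x y hx hy|].
- by rewrite mulr0.
- by rewrite mulrDr mulrCA; apply: SD.
move=> _ [b [c [Ib _ ->]]]; rewrite mulrA mulrC; apply: (@subclosedZ R R^o S c) => //; exact: h.
Qed.

Lemma ideal_sq_mul a b : a \in (I : {pred R}) -> b \in (I : {pred R}) ->
  ideal_exp (ideal_set I) 2 (a * b).
Proof.
move=> Ia Ib; apply: ideal_gen_in; exists a, b; split=> //.
by apply: ideal_gen_in; exists b, 1; split; rewrite ?mulr1.
Qed.

Lemma fgm_onto (V W : lmodType R) (p : {linear V -> W}) : onto p -> fgm V -> fgm W.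
Proof.
move=> op [b [q oq]]; exists b, (lcomp p q) => y.
by have [x <-] := op y; have [u <-] := oq x; exists u.
Qed.

Lemma fgm_conormal : noeth R^o -> fgm (conormal I).
Proof.
move=> nR; have [|p [op _]] := conormal_cover (f := lval _ : {linear psub ideal_closed -> R^o}).
  move=> a; split=> [Ia|[v ->]]; last exact: (psubP v).
  by exists (mkpsub ideal_closed Ia).
exact: fgm_onto op (noeth_fgm _ nR).
Qed.
End ConormalQuotient.

Section MinorIdeals.
Variables (K : fieldType) (n : nat).
Local Notation R := {mpoly K[n.+1]}.

Lemma minor_ideal_closed p q (M : 'M[R]_(p, q)) k : @subclosed R R^o (minor_ideal M k).
Proof. by split; [exact: ideal_gen0|exact: ideal_genD]. Qed.

Lemma minor_ideal_omega t m (M : 'M[R]_(t, m)) a :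
  minor_ideal M t a <-> exists z, St t 0 z /\ a = omega M z.
Proof.
split; last first.
  move=> [z [hz ->]]; apply: (omega_ideal (minor_ideal_closed M t) _ hz) => g hg.
  by apply: ideal_gen_in; exists id, g; split.
apply: (ideal_gen_sub (T := fun a => exists z, St t 0 z /\ a = omega M z)).
- by exists 0; split; [exact: St0|rewrite linear0].
- move=> b x y [z [hz ->]] [w [hw ->]]; exists (b *: z + w); split; first exact: St_comb.
  by rewrite (linearP (omega M)).
move=> _ [f [g [hf hg ->]]]; have [w [hw e]] := omega_minor M g.
exists w; split=> //; rewrite e /max_minor; congr (\det _).
by apply/matrixP => i j; rewrite !mxE (homo_ord_id hf).
Qed.

Variables (t m : nat) (M : 'M[R]_(t.+2, m)).

(** An increasing choice of all rows but one misses a row [i], so the minor is [omegai i] of a basis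
    element up to the sign [(-1) ^+ i]. *)
Lemma minor_ideal_subminor (S : R^o -> Prop) : subclosed S ->
  (forall a, subminor M a -> S a) -> forall a, minor_ideal M t.+1 a -> S a.
Proof.
move=> hS h a; have [S0 SD] := hS; apply: ideal_gen_sub => // _ [f [g [hf hg ->]]].
have [i fi] := homo_ord_lift hf.
pose w : ext m {mpoly R[t.+2]} := basis R t.+2 m (fun b => val (g b)).
have hw : St t.+1 0 w by apply: St_basis => b; exact: ltn_ord.
have -> : \det (mxsub f g M) = (-1) ^+ i * omegai M i w.
  rewrite /omegai mulrA -exprD addnn -signr_odd odd_double expr0 mul1r.
  rewrite /w /basis ctf_wdf (linearZ_LR (@vc R _ m)) /= vc_vac mcoeffZ mcoeff1 eqxx mulr1.
  congr (\det _); rewrite -(dot_mxsub M f g); apply/matrixP => b c; rewrite !mxE.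
  by rewrite fi.
by apply: (@subclosedZ R R^o) => //; apply: h; exists i, w.
Qed.

Lemma minor_ideal_le a : minor_ideal M t.+2 a -> minor_ideal M t.+1 a.
Proof.
have hS := minor_ideal_closed M t.+1; have [S0 SD] := hS.
apply: (ideal_gen_sub S0 SD) => _ [f [g [hf hg ->]]].
rewrite (expand_det_row _ ord0); apply: (@subclosed_sum R R^o) => // j.
apply: (@subclosedZ R R^o) => //; rewrite /cofactor; apply: (@subclosedZ R R^o) => //.
apply: ideal_gen_in; exists (fun i => f (lift ord0 i)), (fun i => g (lift j i)).
have lm k (l : 'I_k.+1) : {homo lift l : i j / (i < j)%N} by move=> a' b' /=; rewrite /bump; lia.
split=> [a' b' ab|a' b' ab|]; [exact/hf/lm|exact/hg/lm|].
by congr (\det _); apply/matrixP => a' b'; rewrite !mxE.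
Qed.
End MinorIdeals.

(** * Vanishing for the conormal module of a determinantal ideal *)

Section Determinantal.
Variables (K : fieldType) (n t m c : nat).
Local Notation R := {mpoly K[n.+1]}.
Variables (M : 'M[R]_(t.+2, m)) (I : idealr R).
Hypothesis char0 : [pchar K] =i pred0.
Hypotheses (hI : homogeneous_ideal I) (cI : proj_codim I c) (hM : homogeneous_mx M).
Hypothesis IM : ideal_set I = minor_ideal M t.+2.
Hypotheses (c0 : (0 < c)%N) (mc : (m = t.+1 + c)%N).
Local Notation J := (minor_ideal M t.+1).

Lemma inv_nat k : exists r : R, k.+1%:R * r = 1.
Proof.
exists ((k.+1%:R : K)^-1)%:MP; rewrite -[k.+1%:R]/(k.+1%:R : R) -mpolyC_nat -mpolyCM mulfV ?mpolyC1 //.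
by rewrite (proj1 (pcharf0P K) char0).
Qed.

Lemma ideal_omega a : a \in (I : {pred R}) <-> exists z, St t.+2 0 z /\ a = omega M z.
Proof. by rewrite -minor_ideal_omega -IM. Qed.

Lemma regular_in_ideal : exists s : seq R, [/\ size s = c, forall a, a \in s -> hgen a,
  forall a, a \in s -> a \in (I : {pred R}) & @reg_on R R^o (fun x => x = 0) s].
Proof. by have := grade_codim hI cI (leqnn c). Qed.

Let tm : (t.+1 < m)%N. Proof. by rewrite mc; lia. Qed.
Let mt : (m - t.+1 = c)%N. Proof. by rewrite mc; lia. Qed.

Lemma extn_cyclic k : (c <= k)%N -> extn R^o k (cyclic_mod I).
Proof.
have [s [ss _ sI rs]] := regular_in_ideal; have [p [op kp]] := cyc_proj I.
rewrite -mt => ck; apply: (extn_A (M := M) op _ inv_nat rs _ _ tm) => //.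
- by move=> a; rewrite kp; exact: ideal_omega.
- by move=> a /sI /ideal_omega.
- by rewrite ss mt.
Qed.

Variable bs : seq R.
Hypothesis bsJ : forall a, a \in bs -> J a.
Hypothesis reg_bs : @reg_on R R^o (fun a => a \in (I : {pred R})) bs.

(** The regular sequence [s] in [I] is used twice: it makes the strands exact, and it is the start
    of the sequence in [J] that [grade_up] lengthens to [c + size bs]. *)
Lemma extn_conormal_codim q : (c <= q)%N -> (q.+4 < c + size bs)%N -> extn R^o q (conormal I).
Proof.
move=> cq qs; have [s [ss sh sI rs]] := regular_in_ideal.
have [p [op kp]] := cyc_proj I.
have so a : a \in s -> exists w, St t.+2 0 w /\ a = omega M w by move=> /sI /ideal_omega.
have hJ : hid J by apply: minor_ideal_hid.
have omJ z : St t.+2 0 z -> J (omega M z).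
  by move=> hz; apply: minor_ideal_le; apply/minor_ideal_omega; exists z.
have [js [sj jJ rj]] : exists js, [/\ size js = (m - t.+1 + size bs)%N, forall a, a \in js -> J a
    & @reg_on R R^o (fun x => x = 0) js].
  apply: (grade_up (as_ := s) inv_nat tm hJ omJ rs so _ bsJ _ sh _ rs); rewrite ?ss ?mt //.
  - by apply: reg_on_ext reg_bs => a; exact: ideal_omega.
  - by move=> a /so [w [hw ->]]; exact: omJ.
have [L [pL [opL kpL]]] := quot_ex (@bdry_closed R (strand M t.+1) 0).
have [|pN [opN kpN]] := conormal_cover (I := I)
    (f := lcomp (omega M) (lval _) : {linear sterm R t.+2 m t.+2 0 -> R^o}).
  move=> a; rewrite ideal_omega; split=> [[z [hz ->]]|[v ->]].
    by exists (mkpsub (@St_closed R t.+2 m t.+2 0) hz).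
  by exists (val v); split=> //; exact: psubP.
apply: (extn_conormal (pN := pN) (pL := pL) (pA := p) (I2 := ideal_exp (ideal_set I) 2) opN opL op
    kpN _ _ _ _ _ inv_nat rs so rj _ _ tm); rewrite ?mt ?ss ?sj //.
- by move=> z; rewrite kpL bdP.
- by move=> a; rewrite kp; exact: ideal_omega.
- by split; [exact: ideal_exp0|exact: ideal_expD].
- move=> z z' hz hz'; apply: ideal_sq_mul; apply/ideal_omega; first by exists z.
  by exists z'.
- move=> S hS h; apply: ideal_sq_sub => // a b /ideal_omega [z [hz ->]] /ideal_omega [z' [hz' ->]].
  exact: h.
- by move=> S hS h a /jJ; exact: minor_ideal_subminor.
- by rewrite mt.
Qed.
End Determinantal.

Lemma proj_dim_uniq (K : fieldType) n (I : idealr {mpoly K[n.+1]}) d d' :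
  proj_dim I d -> proj_dim I d' -> d = d'.
Proof.
have le a b : proj_dim I a -> proj_dim I b -> (a <= b)%N.
  move=> [[P [h1 h2]] _] [_ no]; rewrite leqNgt; apply/negP => ba; apply: no; exists P; split=> i ib.
    by apply: h1; apply: leq_trans ib ba.
  by apply: h2; apply: leq_trans ib ba.
by move=> h h'; apply/eqP; rewrite eqn_leq !le.
Qed.

Lemma zero_projective (R : comNzRingType) (N : lmodType R) : (forall x : N, x = 0) -> projective N.
Proof. by move=> N0 V C p f op; exists (lzero N V) => x; rewrite (N0 x) !linear0. Qed.

Lemma conormal_zero (R : comNzRingType) (I : idealr R) :
  (forall a, a \in (I : {pred R}) -> a = 0) -> forall x : conormal I, x = 0.
Proof.
move=> I0 x; have [p [op kp]] := conormal_proj I; have [y <-] := op x.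
suff -> : y = 0 by rewrite linear0.
by apply: val_inj; apply: I0; exact: (valP y).
Qed.

(** Covers codimension 0, where the matrix has fewer columns than rows and [I] is zero. *)
Lemma minor_ideal_wide (K : fieldType) n p q (M : 'M[{mpoly K[n.+1]}]_(p, q)) k a :
  (q < k)%N -> minor_ideal M k a -> a = 0.
Proof.
move=> qk; have [S0 SD] : @subclosed _ {mpoly K[n.+1]}^o (fun a => a = 0).
  by split=> // b x y -> ->; rewrite scaler0 addr0.
apply: (ideal_gen_sub (T := fun a => a = 0) S0 SD) => x [f [g [_ hg _]]].
have k0 : (0 < k)%N by apply: leq_ltn_trans qk.
by have [_] := homo_ord_bounds hg (Ordinal k0); rewrite /=; lia.
Qed.

Theorem corollary3p21 (K : closedFieldType) (n t c : nat)
    (M : 'M[{mpoly K[n.+1]}]_(t, t + c - 1)) (I : idealr {mpoly K[n.+1]})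
    (dimX depthJA i : nat) :
  [pchar K] =i pred0 ->
  (2 <= t)%N ->
  standard_determinantal I t c M ->
  proj_dim I dimX ->
  (1 <= i)%N ->
  is_depth (cyclic_mod I) (minor_ideal M t.-1) depthJA ->
  (4 + i <= depthJA)%N ->
  (forall (E : injective_resolution (conormal I)) (k : nat),
     (dimX < k + i)%N -> (k <= dimX)%N ->
     forall x : local_cohomology (@irrelevant_ideal K n) E k, x = 0) /\
  (forall j : nat, (1 <= j <= i)%N ->
     forall x : Ext j (conormal_quot I) (canonical_quot I c), x = 0).
Proof.
move=> char0; case: t M => [|[|t]] M // _ [hI _ cI hM IM] dX _ [bs [sb bsJ [rb _] _]] hb.
have nR := @noeth_mpoly K n.+1.
have [d dd cd] := cI; have {d dd} cd : (c + dimX = n)%N by rewrite (proj_dim_uniq dX dd).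
have mc : (t.+2 + c - 1 = t.+1 + c)%N by lia.
have [op [kp hp]] := cyc_proj I.
have rbs : @reg_on _ {mpoly K[n.+1]}^o (fun a => a \in (I : {pred {mpoly K[n.+1]}})) bs.
  by apply: regular_reg_on kp hp _ _ => k a ks; exact: rb.
have I0 : c = 0%N -> forall x : conormal I, x = 0.
  move=> c0; apply: conormal_zero => a Ia; apply: (minor_ideal_wide (M := M) (k := t.+2)); first by lia.
  by rewrite -IM.
have main q : (c <= q)%N -> (q < c + i)%N -> extn {mpoly K[n.+1]}^o q (conormal I).
  move=> cq qi; have [c0|c0] := posnP c; first by apply: extn_proj; apply: zero_projective; exact: I0.
  by apply: (extn_conormal_codim char0 hI cI hM IM c0 mc bsJ rbs cq); rewrite sb; lia.
split=> [E k k1 k2|[//|j] /andP [_ ji]].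
  (* The index is [q = n - k]. As [dimX = n - c], the given range of [k] is exactly
     [c <= q < c + i]. *)
  apply: local_cohomology_cv; have -> : k = (n - (n - k))%N by lia.
  apply: cv_ext; first exact: leq_subr.
    exact: fgm_conormal.
  by apply: main; lia.
apply: Ext_extn; have [c0|c0] := posnP c.
  by apply: extn_proj; apply: zero_projective; exact: I0.
have [s [ss _ sI rs]] := regular_in_ideal hI cI.
have extA k : (size s <= k)%N -> extn {mpoly K[n.+1]}^o k (cyclic_mod I).
  by rewrite ss => ck; apply: (extn_cyclic char0 hI cI IM c0 mc ck).
(* Degree [j.+1] over [A] becomes degree [c + j + 1] over [R], that is [extn] at [c + j], with
   [j < i]. *)
rewrite -ss; apply: (extn_canonical nR rs sI extA).
  by apply: fgm_descend; exact: fgm_conormal.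
by apply: extn_descend; apply: main; rewrite ss; lia.
Qed.
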